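(* Let $\omega\in\mathcal W$. Then $\rho_\tau(z,w)\approx\mathcal S(z,w)$ for $z,w\in\mathbb D$, i.e. there is a constant $C\ge1$ such that $C^{-1}\rho_\tau(z,w)\le\mathcal S(z,w)\le C\rho_\tau(z,w)$ for all $z,w\in\mathbb D$.
   Context: $\mathbb D$ is the unit disk, $dA$ normalized area measure. A weight is $\omega=e^{-\eta}$ with $\eta$ a radial $C^2$ function on $\mathbb D$, strictly increasing in $|z|$, $\Delta\eta>0$, $\omega$ integrable. $\omega\in\mathcal W$ if there is a differentiable radial $\tau>0$ with $\tau\asymp(\Delta\eta)^{-1/2}$ and $\tau(r)\to0$, $\tau'(r)\to0$ as $r\to1^-$; such $\tau$ is fixed. $A^2(\omega)$ is the Hilbert space of holomorphic $f$ with $\int|f|^2\omega^2dA<\infty$, inner product $\int f\bar g\,\omega^2dA$, reproducing kernel $K(z,w)=\overline{K_z(w)}$ ($f(z)=\langle f,K_z\rangle$). The Skwarczyński distance is $\mathcal S(z,w)=\left(1-\frac{|K(z,w)|}{\|K_z\|\|K_w\|}\right)^{1/2}$. $d_\tau(z,w)=\inf_\gamma\int_0^1|\gamma'(t)|/\tau(\gamma(t))\,dt$ over piecewise smooth curves in $\mathbb D$ from $z$ to $w$, and $\rho_\tau=1-e^{-d_\tau}$. *)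

(* Defs.v *)
(* MathComp + MathComp-Analysis (abstract R : realType),
   complex numbers R[i] from mathcomp-real-closed. *)
From mathcomp Require Import all_boot all_order all_algebra.
From mathcomp Require Import all_classical all_reals all_analysis.
From mathcomp Require Import complex.
Import Order.TTheory GRing.Theory Num.Theory.
Import numFieldNormedType.Exports.

Set Implicit Arguments.
Unset Strict Implicit.
Unset Printing Implicit Defensive.

Local Open Scope ring_scope.
Local Open Scope classical_set_scope.

(* ---------- The plane R^2 = C and the unit disk ---------- *)

(* Euclidean norm on the plane R*R (identified with C via p2c). *)
Definition enorm {R : realType} (p : R * R) : R :=
  Num.sqrt (p.1 ^+ 2 + p.2 ^+ 2).

(* The unit disk D. *)
Definition disk {R : realType} : set (R * R) := [set p | enorm p < 1].

(* The identification R*R -> C. *)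
Definition p2c {R : realType} (p : R * R) : R[i] := (p.1 +i* p.2)%C.

(* Squared modulus and modulus of a complex number (real valued). *)
Definition cnorm2 {R : realType} (z : R[i]) : R := complex.Re z ^+ 2 + complex.Im z ^+ 2.
Definition cabs {R : realType} (z : R[i]) : R := Num.sqrt (cnorm2 z).

(* Lebesgue measure on R^2 *)
Definition leb2 {R : realType} := ((@lebesgue_measure R) \x (@lebesgue_measure R))%E.

(* Integral over D against the normalized area measure dA = dx dy / pi. *)
Definition area_integral {R : realType} (g : R * R -> R) : \bar R :=
  ((pi^-1)%:E * \int[leb2]_(p in disk) (g p)%:E)%E.
Definition area_Rintegral {R : realType} (g : R * R -> R) : R :=
  pi^-1 * Rintegral leb2 disk g.

(* ---------- Weights ---------- *)

(* eta(z) = h(|z|) : a radial function with profile h *)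
Definition radial {R : realType} (h : R -> R) : R * R -> R :=
  fun p => h (enorm p).

(* omega = e^{-eta} *)
Definition omega {R : realType} (h : R -> R) (p : R * R) : R :=
  expR (- radial h p).

(* Laplacian  Delta g = g_xx + g_yy  *)
Definition laplacian {R : realType} (g : R * R -> R) (p : R * R) : R :=
  'D_(1, 0) ('D_(1, 0) g) p + 'D_(0, 1) ('D_(0, 1) g) p.

(* g is C^2 on D: differentiable, first partials differentiable,
   second partials continuous. *)
Definition C2_on_disk {R : realType} (g : R * R -> R) : Prop :=
  forall p, disk p ->
    [/\ differentiable g p,
        differentiable ('D_(1, 0) g) p,
        differentiable ('D_(0, 1) g) p &
        [/\ {for p, continuous ('D_(1, 0) ('D_(1, 0) g))},
            {for p, continuous ('D_(0, 1) ('D_(1, 0) g))},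
            {for p, continuous ('D_(1, 0) ('D_(0, 1) g))} &
            {for p, continuous ('D_(0, 1) ('D_(0, 1) g))}]].

(* omega = e^{-eta} belongs to the class W, with eta = radial h and
   the fixed function tau = radial t. *)
Definition in_W {R : realType} (h t : R -> R) : Prop :=
  [/\ C2_on_disk (radial h),
      (forall r s : R, 0 <= r -> r < s -> s < 1 -> h r < h s),
      (forall p, disk p -> 0 < laplacian (radial h) p),
      (area_integral (omega h) < +oo)%E &
      [/\ (forall p, disk p -> 0 < radial t p),
          (forall p, disk p -> differentiable (radial t) p),
          (exists c : R, 0 < c /\ forall p, disk p ->
              radial t p <= c * (Num.sqrt (laplacian (radial h) p))^-1 /\
              (Num.sqrt (laplacian (radial h) p))^-1 <= c * radial t p),
          t r @[r --> 1^'-] --> 0 &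
          t^`() r @[r --> 1^'-] --> 0]].

(* ---------- The weighted Bergman space A^2(omega) ---------- *)

(* holomorphic on D (complex differentiable at every point of D) *)
Definition holomorphic_on_disk {R : realType} (f : R[i] -> R[i]) : Prop :=
  forall p, disk p -> derivable (f : R[i]^o -> R[i]^o) (p2c p) 1.

Definition in_A2 {R : realType} (h : R -> R) (f : R[i] -> R[i]) : Prop :=
  holomorphic_on_disk f /\
  (area_integral (fun p => cnorm2 (f (p2c p)) * omega h p ^+ 2)%R < +oo)%E.

(* <f, g> = \int_D f conj(g) omega^2 dA  (real and imaginary parts) *)
Definition A2_inner {R : realType} (h : R -> R) (f g : R[i] -> R[i]) : R[i] :=
  ((area_Rintegral (fun p =>
      complex.Re (f (p2c p) * (g (p2c p))^*) * omega h p ^+ 2))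
   +i*
   (area_Rintegral (fun p =>
      complex.Im (f (p2c p) * (g (p2c p))^*) * omega h p ^+ 2)))%C.

Definition A2_norm {R : realType} (h : R -> R) (f : R[i] -> R[i]) : R :=
  Num.sqrt (area_Rintegral (fun p => cnorm2 (f (p2c p)) * omega h p ^+ 2)).

(* Kz is the reproducing kernel of A^2(omega): Kz z is the function K_z,
   K_z in A^2(omega) and f(z) = <f, K_z> for all f in A^2(omega). *)
Definition is_reproducing_kernel {R : realType} (h : R -> R)
    (Kz : R * R -> R[i] -> R[i]) : Prop :=
  forall z, disk z ->
    in_A2 h (Kz z) /\
    forall f, in_A2 h f -> f (p2c z) = A2_inner h f (Kz z).

(* K(z, w) = conj (K_z(w)) *)
Definition kernel {R : realType} (Kz : R * R -> R[i] -> R[i]) (z w : R * R) : R[i] :=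
  (Kz z (p2c w))^*.

(* Skwarczynski distance *)
Definition skw_dist {R : realType} (h : R -> R) (Kz : R * R -> R[i] -> R[i])
    (z w : R * R) : R :=
  Num.sqrt (1 - cabs (kernel Kz z w) / (A2_norm h (Kz z) * A2_norm h (Kz w))).

(* ---------- The distance d_tau ---------- *)

(* piecewise smooth (piecewise C^1) curve parametrized by [0,1] *)
Definition piecewise_smooth {R : realType} (g : R -> R * R) : Prop :=
  {within `[0, 1], continuous g} /\
  exists (n : nat) (s : nat -> R),
    [/\ s 0%N = 0, s n = 1,
        (forall i, (i < n)%N -> s i < s i.+1) &
        forall i, (i < n)%N -> exists g' : R -> R * R,
          {within `[s i, s i.+1], continuous g'} /\
          forall x, s i < x < s i.+1 -> derivable g x 1 /\ g^`() x = g' x].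

(* tau-length: \int_0^1 |g'(x)| / tau(g(x)) dx *)
Definition tau_length {R : realType} (t : R -> R) (g : R -> R * R) : R :=
  Rintegral (@lebesgue_measure R) `[0, 1]
    (fun x => enorm (g^`() x) / radial t (g x)).

Definition d_tau {R : realType} (t : R -> R) (z w : R * R) : R :=
  inf [set L | exists g : R -> R * R,
         [/\ piecewise_smooth g, g 0 = z, g 1 = w,
             (forall x, 0 <= x <= 1 -> disk (g x)) &
             L = tau_length t g]].

Definition rho_tau {R : realType} (t : R -> R) (z w : R * R) : R :=
  1 - expR (- d_tau t z w).

(* Main.v *)
(** Since the weight is radial, the monomials are orthogonal and complete in the
    Bergman space (rotation averages and Taylor expansion), so
    [K(z, w) = \sum_n c_n (conj z * w)^n] up to conjugation, with [1 / c_n] the squared norm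
    of the [n]-th monomial.  Lagrange's identity writes the Gram determinant
    [K(z, z) K(w, w) - |K(z, w)|^2] as a double sum of squares.  Integration by
    parts locates the ratios [c_n / c_(n+1)] near the critical radii of the monomials;
    because [Delta eta] is comparable with [tau^-2] and [tau] is nearly constant at its
    own scale, the weights [c_n |z|^(2 n)] carry a fixed proportion of their mass on a block of about
    [1 / tau(z)] indices, on which they are comparable, and have variance of order
    [tau(z)^-2].  Hence the Skwarczynski distance is comparable with
    [min(1, |z - w| / tau(z))].  The bound [tau(v) <= K (tau(z) + |v - z|)] gives the
    same two-sided estimate for [rho_tau]. *)
Require Import Defs.
From HB Require Import structures.
From mathcomp Require Import all_boot all_order all_algebra.
From mathcomp Require Import all_classical all_reals all_analysis.
From mathcomp Require Import complex.
From mathcomp Require Import measurable_realfun.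
From mathcomp Require Import ring lra zify.
Import Order.TTheory GRing.Theory Num.Theory.
Import numFieldNormedType.Exports.
Local Open Scope ring_scope.
Local Open Scope classical_set_scope.
Set Implicit Arguments.
Unset Strict Implicit.
Unset Printing Implicit Defensive.

(** * Modulus, polar form and first-order expansions in the complex plane *)

Section ComplexBasics.
Context {R : realType}.
Implicit Types z w : R[i].

(** Both distances are compared with [m = min(1, |z - w| / tau(z))] and never with each other. On
    the Skwarczynski side, if [x] is the normalised modulus of the kernel, then [1 - x] and
    [1 - x ^ 2] differ by a factor at most 2 on [[0, 1]], and [1 - x ^ 2] is the normalised Gram
    determinant. No asymptotics of [c_n] are used: everything comes from the monotone ratios
    [c_n / c_(n+1)], which are the means of [u] under the densities proportional to
    [u ^ n * omega ^ 2]. The variable [u = |z| ^ 2] makes the image of area a multiple of [du], and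
    turns half the Laplacian into the derivative of [r h'(r)], whose value at [u] is the index
    around which the weights [c_n u ^ n] concentrate. This analysis works only near the boundary,
    where [tau] varies slowly. The remaining pairs are treated separately, by two terms of
    Lagrange's identity for the lower bound and by a common larger radius for the upper one. A lower
    bound for [d_tau] must hold along every curve; it comes from a logarithmic potential whose
    gradient is at most a multiple of [1 / tau]. *)

Lemma cabsE z : (cabs z)%:C%C = `|z|.
Proof. by rewrite normc_def. Qed.

Lemma cabs_ge0 z : 0 <= cabs z.
Proof. exact: sqrtr_ge0. Qed.

Lemma cabsM z w : cabs (z * w) = cabs z * cabs w.
Proof. by apply: complexI; rewrite rmorphM/= !cabsE normrM. Qed.

Lemma cabsD z w : cabs (z + w) <= cabs z + cabs w.
Proof. by rewrite -lecR rmorphD/= !cabsE ler_normD. Qed.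

Lemma cabsN z : cabs (- z) = cabs z.
Proof. by apply: complexI; rewrite !cabsE normrN. Qed.

Lemma cabsB z w : cabs (z - w) = cabs (w - z).
Proof. by rewrite -cabsN opprB. Qed.

Lemma cabs0 : cabs (0 : R[i]) = 0.
Proof. by apply: complexI; rewrite cabsE normr0. Qed.

Lemma cabs1 : cabs (1 : R[i]) = 1.
Proof. by apply: complexI; rewrite cabsE normr1. Qed.

Lemma cabs_eq0 z : (cabs z == 0) = (z == 0).
Proof. by rewrite -(inj_eq (@complexI R)) cabsE normr_eq0. Qed.

Lemma cabs_gt0 z : (0 < cabs z) = (z != 0).
Proof. by rewrite lt_neqAle cabs_ge0 andbT eq_sym cabs_eq0. Qed.

Lemma cabsX z n : cabs (z ^+ n) = cabs z ^+ n.
Proof. by elim: n => [|n IH]; rewrite ?expr0 ?cabs1// !exprS cabsM IH. Qed.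

Lemma cabsV z : cabs (z^-1) = (cabs z)^-1.
Proof. by apply: complexI; rewrite fmorphV/= !cabsE normfV. Qed.

Lemma cabs_conj z : cabs (z^*) = cabs z.
Proof. by apply: complexI; rewrite !cabsE norm_conjC. Qed.

Lemma cabs_real (x : R) : cabs (x%:C%C) = `|x|.
Proof. by rewrite /cabs /cnorm2/= expr0n/= addr0 sqrtr_sqr. Qed.

Lemma cnorm2E z : cnorm2 z = cabs z ^+ 2.
Proof. by rewrite /cabs sqr_sqrtr// /cnorm2 addr_ge0 ?sqr_ge0. Qed.

Lemma cnorm2_ge0 z : 0 <= cnorm2 z.
Proof. by rewrite cnorm2E sqr_ge0. Qed.

Lemma cnorm2_conj z : (cnorm2 z)%:C%C = z * z^*.
Proof. by rewrite cnorm2E rmorphXn/= cabsE normCK. Qed.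

Lemma cabs_Re z : `|complex.Re z| <= cabs z.
Proof. by rewrite -sqrtr_sqr ler_wsqrtr// /cnorm2 lerDl sqr_ge0. Qed.

Lemma cabs_Im z : `|complex.Im z| <= cabs z.
Proof. by rewrite -sqrtr_sqr ler_wsqrtr// /cnorm2 lerDr sqr_ge0. Qed.

Lemma cabs_ReIm z : cabs z <= `|complex.Re z| + `|complex.Im z|.
Proof.
rewrite -[leRHS]ger0_norm ?addr_ge0// -sqrtr_sqr ler_wsqrtr// /cnorm2.
by rewrite sqrrD !real_normK ?num_real// addrAC lerDl mulrn_wge0// mulr_ge0.
Qed.

Lemma ReD z w : complex.Re (z + w) = complex.Re z + complex.Re w.
Proof. by case: z; case: w. Qed.

Lemma ImD z w : complex.Im (z + w) = complex.Im z + complex.Im w.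
Proof. by case: z; case: w. Qed.

Lemma ReN z : complex.Re (- z) = - complex.Re z.
Proof. by case: z. Qed.

Lemma ImN z : complex.Im (- z) = - complex.Im z.
Proof. by case: z. Qed.

Lemma ReM z w : complex.Re (z * w) =
  complex.Re z * complex.Re w - complex.Im z * complex.Im w.
Proof. by case: z; case: w. Qed.

Lemma ImM z w : complex.Im (z * w) =
  complex.Re z * complex.Im w + complex.Im z * complex.Re w.
Proof. by case: z; case: w. Qed.

Lemma Re_conj z : complex.Re (z^*) = complex.Re z.
Proof. by case: z. Qed.

Lemma Im_conj z : complex.Im (z^*) = - complex.Im z.
Proof. by case: z. Qed.

Lemma complex_ext z w :
  complex.Re z = complex.Re w -> complex.Im z = complex.Im w -> z = w.
Proof. by case: z w => [a b] [c d] /= -> ->. Qed.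

Lemma ler_cabs_sum (I : Type) (r : seq I) (P : pred I) (F : I -> R[i]) :
  cabs (\sum_(i <- r | P i) F i) <= \sum_(i <- r | P i) cabs (F i).
Proof.
elim/big_rec2: _ => [|i x y _ h]; first by rewrite cabs0.
by apply: le_trans (cabsD _ _) _; rewrite lerD2l.
Qed.

Definition cis (x : R) : R[i] := (cos x +i* sin x)%C.

Lemma cabs_cis x : cabs (cis x) = 1.
Proof. by rewrite /cabs /cnorm2/= cos2Dsin2 sqrtr1. Qed.

Lemma cisD x y : cis (x + y) = cis x * cis y.
Proof. by apply: complex_ext; rewrite /= ?cosD ?sinD//; ring. Qed.

Lemma cis0 : cis 0 = 1.
Proof. by rewrite /cis cos0 sin0. Qed.

Lemma cisN x : cis (- x) = (cis x)^*.
Proof. by rewrite /cis cosN sinN. Qed.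

Lemma cisX x n : cis x ^+ n = cis (n%:R * x).
Proof.
elim: n => [|n IH]; first by rewrite mul0r cis0.
by rewrite exprS IH -cisD -natr1 mulrDl mul1r addrC.
Qed.

Lemma cis2pi : cis (2 * pi) = 1.
Proof. by rewrite /cis mulr_natl cos2pi sin2pi. Qed.

Lemma enormE (p : R * R) : enorm p = cabs (p2c p).
Proof. by []. Qed.

Lemma p2cK z : p2c (complex.Re z, complex.Im z) = z.
Proof. by case: z. Qed.

(** [acos] reaches only the upper half-plane; below the axis the angle is [2 pi - acos a]. The range
    [[0, 2 pi]] is the one that [fcoef_rot] accepts. *)
Lemma polar_form z : exists2 x : R, 0 <= x <= 2 * pi & z = (cabs z)%:C%C * cis x.
Proof.
have [->|z0] := eqVneq z 0.
  by exists 0; rewrite ?cabs0 ?mul0r// lexx mulr_ge0// pi_ge0.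
have c0 : 0 < cabs z by rewrite cabs_gt0.
pose a := complex.Re z / cabs z; pose b := complex.Im z / cabs z.
have ab : a ^+ 2 + b ^+ 2 = 1.
  rewrite !expr_div_n -mulrDl -/(cnorm2 z) cnorm2E divff// expf_neq0//.
  by rewrite gt_eqF.
have a1 : -1 <= a <= 1.
  rewrite -ler_norml -(@ler_pXn2r _ 2)// ?nnegrE// expr1n real_normK ?num_real//.
  by rewrite -ab lerDl sqr_ge0.
have ss : sin (acos a) = `|b|.
  rewrite sin_acos//; rewrite -ab addrAC subrr add0r sqrtr_sqr //.
have pa := acos_ge0 a1; have ap := acos_lepi a1; have pi0 := @pi_ge0 R.
have [b0|b0] := leP 0 b.
- exists (acos a); first by apply/andP; split; lra.
  apply: complex_ext; rewrite /= ?acosK// ?ss ?ger0_norm//.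
  + by rewrite mul0r subr0 mulrCA divff ?mulr1 ?gt_eqF.
  + by rewrite mul0r addr0 mulrCA divff ?mulr1 ?gt_eqF.
- exists (2 * pi - acos a); first by apply/andP; split; lra.
  have -> : cis (2 * pi - acos a) = cis (- acos a) by rewrite cisD cis2pi mul1r.
  apply: complex_ext; rewrite /= ?cosN ?sinN ?acosK// ?ss ?ltr0_norm// ?opprK.
  + by rewrite mul0r subr0 mulrCA divff ?mulr1 ?gt_eqF.
  + by rewrite mul0r addr0 mulrCA divff ?mulr1 ?gt_eqF.
Qed.

(** The norm of [R[i]] takes its values in [R[i]], so radii of balls are complex numbers; this
    restates the derivative as a first-order expansion with real tolerances. *)
Lemma derivable_cabs (f : R[i] -> R[i]) z :
  derivable (f : R[i]^o -> R[i]^o) z 1 ->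
  exists l : R[i], forall e : R, 0 < e -> exists2 d : R, 0 < d &
    forall w, cabs (w - z) < d ->
      cabs (f w - f z - l * (w - z)) <= e * cabs (w - z).
Proof.
move=> /cvg_ex[l fl]; exists l => e e0.
have e0' : 0 < e%:C%C :> R[i] by rewrite ltcR.
move/cvgrPdist_le : fl => /(_ _ e0') [/= d d0 hd].
(* A positive element of [R[i]] has zero imaginary part, so the radius is real. *)
have dr : d = (complex.Re d)%:C%C.
  by apply: complex_ext => //=; move: d0; rewrite ltcE/= => /andP[/eqP->].
exists (complex.Re d); first by move: d0; rewrite {1}dr ltcR.
move=> w wd; have [->|wz] := eqVneq w z.
  by rewrite !subrr mulr0 subrr cabs0 mulr0.
have wz0 : w - z != 0 by rewrite subr_eq0.
have := hd (w - z); rewrite /ball_/= sub0r normrN -cabsE dr ltcR => /(_ wd wz0).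
rewrite /shift/= -cabsE lecR /GRing.scale/= mulr1 subrK => h.
have -> : f w - f z - l * (w - z) = - ((w - z) * (l - (w - z)^-1 * (f w - f z))).
  have -> : (w - z) * (l - (w - z)^-1 * (f w - f z)) = (w - z) * l - (f w - f z).
    by rewrite mulrBr; congr (_ - _); rewrite mulrA divff// mul1r.
  by rewrite opprB [l * _]mulrC.
by rewrite cabsN cabsM mulrC ler_wpM2r// cabs_ge0.
Qed.

Lemma holo_continuous (f : R[i] -> R[i]) z :
  derivable (f : R[i]^o -> R[i]^o) z 1 ->
  forall e : R, 0 < e -> exists2 d : R, 0 < d &
    forall w, cabs (w - z) < d -> cabs (f w - f z) < e.
Proof.
move=> /derivable_cabs[l hl] e e0; have [d d0 hd] := hl 1 ltr01.
have L0 : 0 < cabs l + 1 by rewrite ltr_wpDl ?cabs_ge0.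
exists (Num.min d (e / (cabs l + 1))); first by rewrite lt_min d0 divr_gt0.
move=> w; rewrite lt_min => /andP[wd we].
rewrite -[f w - f z](subrK (l * (w - z))); apply: le_lt_trans (cabsD _ _) _.
apply: le_lt_trans (lerD (hd _ wd) (lexx _)) _.
by rewrite cabsM -mulrDl addrC -ltr_pdivlMl// mulrC.
Qed.

End ComplexBasics.

(** * Lebesgue measure in the plane: rotations, dilations, radial integrals *)

Section Plane.
Context {R : realType}.
Local Notation leb := (@lebesgue_measure R).
Local Notation TR := (measurableTypeR R).
Local Notation T2 := (TR * TR)%type.

Lemma box_measurable (a b : R) (e : R) :
  measurable [set q : T2 | `|q.1 - a| < e /\ `|q.2 - b| < e].
Proof.
rewrite (_ : [set _ | _] = `]a - e, a + e[ `*` `]b - e, b + e[).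
  by apply: measurableX; exact: measurable_itv.
by apply/seteqP; split=> -[x y] /=; rewrite !in_itv/= !ltr_distl.
Qed.

Definition open2 (A : set T2) := forall p, A p -> exists2 e : R, 0 < e &
  forall q, `|q.1 - p.1| < e -> `|q.2 - p.2| < e -> A q.

Lemma open2_measurable (A : set T2) : open2 A -> measurable A.
Proof.
move=> oA.
pose box (a b e : rat) := [set q : R * R | `|q.1 - ratr a| < ratr e /\
   `|q.2 - ratr b| < ratr e].
pose F (a b e : rat) := if pselect (box a b e `<=` A) then box a b e else set0.
have -> : A = \bigcup_a \bigcup_b \bigcup_e F a b e.
  apply/seteqP; split=> [p Ap|p [a _ [b _ [e _]]]]; last first.
    by rewrite /F; case: pselect => // h /h.
  have [e e0 he] := oA _ Ap.
  (* A centre within [e / 3] of [p] and a radius in []e / 3, e / 2[] give a rational box that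
     contains [p] and stays within [e] of it. *)
  have e30 : 0 < e / 3 by rewrite divr_gt0.
  have [d] := @rat_in_itvoo R (e / 3) (e / 2) ltac:(lra).
  rewrite in_itv/= => /andP[d1 d2].
  have [a] := @rat_in_itvoo R (p.1 - e / 3) p.1 ltac:(lra).
  rewrite in_itv/= => /andP[a1 a2].
  have [b] := @rat_in_itvoo R (p.2 - e / 3) p.2 ltac:(lra).
  rewrite in_itv/= => /andP[b1 b2].
  exists a => //; exists b => //; exists d => //; rewrite /F; case: pselect => [h|[]].
    by rewrite /box/= !ltr_distl; split; apply/andP; split; lra.
  move=> q; rewrite /box/= !ltr_distl => -[/andP[q1 q2] /andP[q3 q4]].
  by apply: he; rewrite ltr_distl; apply/andP; split; lra.
apply: bigcupT_measurable_rat => a; apply: bigcupT_measurable_rat => b.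
apply: bigcupT_measurable_rat => e; rewrite /F; case: pselect => h.
  exact: box_measurable.
exact: measurable0.
Qed.

Lemma open2_measurable_fun (D : set T2) (f : T2 -> R) : open2 D ->
  (forall p, D p -> forall e, 0 < e -> exists2 d : R, 0 < d &
     forall q, D q -> `|q.1 - p.1| < d -> `|q.2 - p.2| < d -> `|f q - f p| < e) ->
  measurable_fun D f.
Proof.
move=> oD cf mD; apply: (measurability _ (RGenOInfty.measurableE R)) => //.
move=> _ [_ [x ->] <-]; apply: open2_measurable => p [Dp /=].
rewrite in_itv/= andbT => xp.
have [d1 d10 h1] := oD _ Dp; have [d2 d20 h2] := cf _ Dp (f p - x) ltac:(by rewrite subr_gt0).
exists (Num.min d1 d2); first by rewrite lt_min d10.
move=> q; rewrite !lt_min => /andP[q1 q2] /andP[q3 q4].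
have Dq := h1 q q1 q3; split=> //=; rewrite in_itv/= andbT.
by have := h2 q Dq q2 q4; rewrite ltr_distl => /andP[+ _]; rewrite subKr.
Qed.

Lemma measurable_fun_shift (c : R) : measurable_fun setT (fun x : TR => x + c : TR).
Proof. by apply: (@measurable_funD _ TR R) => //; exact: measurable_cst. Qed.

Lemma measurable_fun_scale (c : R) : measurable_fun setT (fun x : TR => c * x : TR).
Proof. by apply: (@measurable_funM _ TR R) => //; exact: measurable_cst. Qed.

Lemma lebesgue_measure_translate (c : R) (A : set TR) : measurable A ->
  leb ((fun x => x + c) @^-1` A) = leb A.
Proof.
move=> mA; have mf := measurable_fun_shift c.
pose m : {measure set TR -> \bar R} := pushforward leb (fun x : TR => x + c : TR).
apply/esym; apply: (@lebesgue_measure_unique R (m mf)) => //.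
move=> X [[a b] /= ab <-]; rewrite /m/= /pushforward.
have -> : (fun x => x + c) @^-1` `]a, b]%classic = `]a - c, b - c]%classic.
  by apply/seteqP; split=> x /=; rewrite !in_itv/=; lra.
rewrite !lebesgue_measure_itv/= !lte_fin ltrD2r; case: ifP => // _.
by rewrite -!EFinB; congr EFin; lra.
Qed.

Lemma lebesgue_measure_scale (c : R) (A : set TR) : 0 < c -> measurable A ->
  (leb ((fun x => c * x)%R @^-1` A) = c^-1%:E * leb A)%E.
Proof.
move=> c0 mA; have mf := measurable_fun_scale c.
pose k := NngNum (ltW c0).
pose m : {measure set TR -> \bar R} := pushforward leb (fun x : TR => c * x : TR).
have h : leb A = mscale k (m mf) A.
  apply: (@lebesgue_measure_unique R (mscale k (m mf))) => //.
  move=> X [[a b] /= ab <-]; rewrite /mscale/= /m/= /pushforward.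
  have -> : (fun x => c * x) @^-1` `]a, b]%classic = `]c^-1 * a, c^-1 * b]%classic.
    by apply/seteqP; split=> x /=; rewrite !in_itv/= ler_pdivlMl// ltr_pdivrMl.
  rewrite !lebesgue_measure_itv/= !lte_fin ltr_pM2l ?invr_gt0//.
  case: ifP => _; last by rewrite mule0.
  by rewrite -!EFinB -EFinM; congr EFin; rewrite -mulrBr mulrA mulfV ?mul1r ?gt_eqF.
by rewrite h /mscale/= muleA -EFinM mulVf ?gt_eqF// mul1e.
Qed.

(** [leb2] is defined through vertical sections; uniqueness of the product measure gives the
    horizontal ones, which the shear [shx] merely translates. *)
Lemma leb2_ysection (A : set T2) : measurable A ->
  leb2 A = (\int[leb]_y leb (ysection A y))%E.
Proof.
move=> mA; rewrite /leb2.
rewrite (@product_measure_unique _ _ _ _ R leb leb (leb \x^ leb)%E)//.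
by move=> B C mB mC; exact: product_measure2E.
Qed.

Definition shx (a : R) (p : T2) : T2 := (p.1 + a * p.2, p.2).
Definition shy (a : R) (p : T2) : T2 := (p.1, p.2 + a * p.1).

Lemma measurable_shx a : measurable_fun setT (shx a).
Proof.
apply: measurable_fun_pair => //; apply: (@measurable_funD _ T2 R) => //.
by apply: (@measurable_funM _ T2 R) => //; exact: measurable_cst.
Qed.

Lemma measurable_shy a : measurable_fun setT (shy a).
Proof.
apply: measurable_fun_pair => //; apply: (@measurable_funD _ T2 R) => //.
by apply: (@measurable_funM _ T2 R) => //; exact: measurable_cst.
Qed.

Lemma leb2_shx a (A : set T2) : measurable A -> leb2 (shx a @^-1` A) = leb2 A.
Proof.
move=> mA; have mf := measurable_shx a.
pose m : {measure set T2 -> \bar R} := pushforward leb2 (shx a).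
apply/esym; apply: (@product_measure_unique _ _ _ _ R leb leb (m mf)) => //.
move=> B C mB mC; rewrite /m/=.
change (leb2 (shx a @^-1` (B `*` C)) = leb B * leb C)%E.
have mS : measurable (shx a @^-1` (B `*` C)).
  by rewrite -[X in measurable X]setTI; apply: mf => //; exact: measurableX.
rewrite leb2_ysection//.
rewrite (eq_integral (fun y => leb B * (\1_C y)%:E)%E).
  by rewrite ge0_integralZl ?integral_indic ?setIT//; exact: measurableT_comp.
move=> y _; rewrite indicE; case: (boolP (y \in C)) => yC /=.
  rewrite mule1 -(lebesgue_measure_translate (a * y) mB); congr (leb _).
  apply/seteqP; split=> x /=.
    by move=> /ysectionP[].
  by move=> Bx; apply/ysectionP; split=> //=; exact: set_mem.
rewrite mule0 (_ : ysection _ _ = set0) ?measure0//.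
apply/seteqP; split=> x //= /ysectionP[/= _ Cy].
by move/negP: yC; apply; exact: mem_set.
Qed.

Lemma leb2_shy a (A : set T2) : measurable A -> leb2 (shy a @^-1` A) = leb2 A.
Proof.
move=> mA; have mf := measurable_shy a.
pose m : {measure set T2 -> \bar R} := pushforward leb2 (shy a).
apply/esym; apply: (@product_measure_unique _ _ _ _ R leb leb (m mf)) => //.
move=> B C mB mC; rewrite /m/= /pushforward.
have mS : measurable (shy a @^-1` (B `*` C)).
  by rewrite -[X in measurable X]setTI; apply: mf => //; exact: measurableX.
rewrite /leb2 /product_measure1/=.
rewrite (eq_integral (fun x => (\1_B x)%:E * leb C)%E).
  by rewrite ge0_integralZr ?integral_indic ?setIT//; exact: measurableT_comp.
move=> x _ /=; rewrite indicE; case: (boolP (x \in B)) => xB /=.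
  rewrite mul1e -(lebesgue_measure_translate (a * x) mC); congr (leb _).
  apply/seteqP; split=> y /=.
    by move=> /xsectionP[].
  by move=> Bx; apply/xsectionP; split=> //=; exact: set_mem.
rewrite mul0e (_ : xsection _ _ = set0) ?measure0//.
apply/seteqP; split=> y //= /xsectionP[/= Cy _].
by move/negP: xB; apply; exact: mem_set.
Qed.

Definition rot (x : R) (p : T2) : T2 :=
  (cos x * p.1 - sin x * p.2, sin x * p.1 + cos x * p.2).

Lemma measurable_rot x : measurable_fun setT (rot x).
Proof.
apply: measurable_fun_pair.
  by apply: (@measurable_funB _ T2 R); apply: (@measurable_funM _ T2 R) => //; exact: measurable_cst.
by apply: (@measurable_funD _ T2 R); apply: (@measurable_funM _ T2 R) => //; exact: measurable_cst.
Qed.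

Lemma measurable_preimage (f : T2 -> T2) (A : set T2) :
  measurable_fun setT f -> measurable A -> measurable (f @^-1` A).
Proof. by move=> mf mA; rewrite -[X in measurable X]setTI; exact: mf. Qed.

(* A rotation of angle not in pi Z is a product of three shears. *)
Lemma leb2_rot x (A : set T2) : measurable A -> leb2 (rot x @^-1` A) = leb2 A.
Proof.
have shear y (B : set T2) : sin y != 0 -> measurable B -> leb2 (rot y @^-1` B) = leb2 B.
  (* [a] is minus the tangent of the half angle [y / 2]. *)
  move=> s0 mB; pose a := (cos y - 1) / sin y.
  have mB1 := measurable_preimage (measurable_shx a) mB.
  have mB2 := measurable_preimage (measurable_shy (sin y)) mB1.
  rewrite -(leb2_shx a mB) -(leb2_shy (sin y) mB1) -(leb2_shx a mB2); congr leb2.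
  have E : rot y =1 shx a \o shy (sin y) \o shx a.
    move=> [u v]; rewrite /rot /shx /shy/=.
    have as_ : a * sin y = cos y - 1 by rewrite /a divfK.
    have ac : a * (1 + cos y) = - sin y.
      apply: (mulfI s0); rewrite mulrA [sin y * a]mulrC as_.
      by have := cos2Dsin2 y; lra.
    congr (_, _); last by ring: as_.
    have -> : u + a * v + a * (v + sin y * (u + a * v)) =
      u + (a * sin y) * u + a * (1 + (1 + a * sin y)) * v by ring.
    by rewrite as_ (_ : 1 + (cos y - 1) = cos y); [rewrite ac; ring | ring].
  by apply/seteqP; split=> p /=; rewrite E.
move=> mA; have [s0|s0] := eqVneq (sin x) 0; last exact: shear.
have c1 : cos x = 1 \/ cos x = -1.
  have := cos2Dsin2 x; rewrite s0 expr0n addr0 => /eqP.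
  by rewrite sqrf_eq1 => /orP[/eqP|/eqP]; [left|right].
case: c1 => c1.
  congr leb2; apply/seteqP; split=> -[u v] /=; rewrite /rot/= s0 c1.
    by rewrite !mul0r !mul1r subr0 add0r.
  by rewrite !mul0r !mul1r subr0 add0r.
(* The remaining rotation is the half-turn, the square of a quarter-turn to which [shear]
   applies. *)
have s1 : sin (pi / 2 : R) != 0 by rewrite sin_pihalf oner_neq0.
have mA1 := measurable_preimage (measurable_rot (pi / 2)) mA.
rewrite -(shear _ _ s1 mA) -(shear _ _ s1 mA1); congr leb2.
have E : rot x =1 rot (pi / 2) \o rot (pi / 2).
  by move=> [u v]; rewrite /rot/= s0 c1 sin_pihalf cos_pihalf; congr (_, _); ring.
by apply/seteqP; split=> p /=; rewrite E.
Qed.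

Definition dil (c : R) (p : T2) : T2 := (c * p.1, c * p.2).

Lemma measurable_dil c : measurable_fun setT (dil c).
Proof. by apply: measurable_fun_pair; apply: (@measurable_funM _ T2 R) => //; exact: measurable_cst. Qed.

Lemma leb2_dil c (A : set T2) : 0 < c -> measurable A ->
  (leb2 (dil c @^-1` A) = (c ^- 2)%:E * leb2 A)%E.
Proof.
move=> c0 mA; have mf := measurable_dil c.
have k0 : 0 <= c ^+ 2 by rewrite sqr_ge0.
pose k := NngNum k0.
pose m : {measure set T2 -> \bar R} := pushforward leb2 (dil c).
have h : leb2 A = mscale k (m mf) A.
  apply: (@product_measure_unique _ _ _ _ R leb leb (mscale k (m mf))) => //.
  move=> B C mB mC; rewrite /mscale/= /m/=.
  change ((c ^+ 2)%:E * leb2 (((fun x : TR => (c * x)%R : TR) @^-1` B) `*`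
    ((fun x : TR => (c * x)%R : TR) @^-1` C)) = leb B * leb C)%E.
  have mh := measurable_fun_scale c.
  rewrite /leb2 product_measure1E//; last 2 first.
    by rewrite -[X in measurable X]setTI; exact: mh.
    by rewrite -[X in measurable X]setTI; exact: mh.
  change ((c ^+ 2)%:E * (leb ((fun x : TR => (c * x)%R : TR) @^-1` B) *
    leb ((fun x : TR => (c * x)%R : TR) @^-1` C)) = leb B * leb C)%E.
  rewrite !lebesgue_measure_scale// muleACA muleA -!EFinM.
  rewrite !muleA -EFinM.
  by rewrite (_ : c ^+ 2 * (c^-1 / c) = 1) ?mul1e//; field; rewrite gt_eqF.
by rewrite h /mscale/= muleA -EFinM mulVf ?mul1e// expf_neq0// gt_eqF.
Qed.

Definition nrm2 (p : T2) : TR := p.1 * p.1 + p.2 * p.2.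

Lemma nrm2E p : nrm2 p = p.1 ^+ 2 + p.2 ^+ 2.
Proof. by rewrite !expr2. Qed.

Lemma nrm2_ge0 p : 0 <= nrm2 p.
Proof. by rewrite nrm2E addr_ge0 ?sqr_ge0. Qed.

Lemma measurable_nrm2 : measurable_fun setT nrm2.
Proof.
by apply: (@measurable_funD _ T2 R); apply: (@measurable_funM _ T2 R).
Qed.

Lemma disk_nrm2 p : disk p <-> nrm2 p < 1.
Proof.
rewrite /disk/= /enorm -nrm2E -[X in _ < X <-> _]sqrtr1.
by rewrite ltr_sqrt ?ltr01.
Qed.

Lemma disk_preimage : @disk R = nrm2 @^-1` `[0, 1[%classic.
Proof.
by apply/seteqP; split=> p; rewrite /= in_itv/= nrm2_ge0/= => /disk_nrm2.
Qed.

Lemma measurable_disk : measurable (@disk R : set T2).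
Proof.
rewrite disk_preimage -[X in measurable X]setTI; exact: measurable_nrm2.
Qed.

Definition cball (b : R) : set T2 := [set p | nrm2 p <= b].

Lemma measurable_cball b : measurable (cball b).
Proof.
rewrite (_ : cball b = setT `&` nrm2 @^-1` `]-oo, b]%classic).
  exact: measurable_nrm2.
by rewrite setTI; apply/seteqP; split=> p; rewrite /= in_itv/=.
Qed.

Lemma le_leb2 (A B : set T2) : measurable A -> measurable B -> A `<=` B ->
  (leb2 A <= leb2 B)%E.
Proof. by move=> mA mB AB; apply: (@le_measure _ _ _ (leb \x leb)%E); rewrite ?inE. Qed.

Lemma leb20 : leb2 (set0 : set T2) = 0%E.
Proof. exact: (@measure0 _ _ _ (leb \x leb)%E). Qed.

Lemma leb2D (A B : set T2) (a b : R) : measurable A -> measurable B -> B `<=` A ->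
  leb2 A = a%:E -> leb2 B = b%:E -> leb2 (A `\` B) = (a - b)%:E.
Proof.
move=> mA mB BA la lb.
change ((leb \x leb)%E (A `\` B) = (a - b)%:E).
rewrite measureD//; last by change (leb2 A < +oo)%E; rewrite la ltry.
rewrite (_ : A `&` B = B); last exact/setIidPr.
by change (leb2 A - leb2 B = (a - b)%:E)%E; rewrite la lb -EFinB.
Qed.

Lemma square_leb2 (a b : R) : a <= b ->
  leb2 (`[a, b]%classic `*` `[a, b]%classic : set T2) = ((b - a) ^+ 2)%:E.
Proof.
move=> ab; rewrite /leb2 product_measure1E; [|exact: measurable_itv..].
have h : leb (`[a, b]%classic : set TR) = (b - a)%:E.
  rewrite lebesgue_measure_itv/= lte_fin; case: ltP => [_|ba]; first by rewrite -EFinB.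
  by congr EFin; lra.
by change (leb (`[a, b]%classic : set TR) * leb (`[a, b]%classic : set TR) =
  ((b - a) ^+ 2)%:E)%E; rewrite h -EFinM expr2.
Qed.

Definition kap : R := fine (leb2 (cball 1)).

Lemma leb2_cball1 : leb2 (cball 1) = kap%:E.
Proof.
rewrite /kap fineK// ge0_fin_numE//.
apply: (@le_lt_trans _ _ (leb2 (`[-1, 1]%classic `*` `[-1, 1]%classic : set T2))).
  apply: le_leb2; [exact: measurable_cball|by apply: measurableX; exact: measurable_itv|].
  move=> [x y]; rewrite /cball/= /nrm2/= !in_itv/= => h.
  by split; apply/andP; split; nra.
by rewrite square_leb2 ?ltry//; lra.
Qed.

Lemma kap_gt0 : 0 < kap.
Proof.
rewrite -lte_fin -leb2_cball1.
apply: (@lt_le_trans _ _ (leb2 (`[0, 1 / 2]%classic `*` `[0, 1 / 2]%classic : set T2))).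
  by rewrite square_leb2 ?lte_fin ?exprn_gt0//; lra.
apply: le_leb2; [by apply: measurableX; exact: measurable_itv|exact: measurable_cball|].
move=> [x y] /=; rewrite /cball/= /nrm2/= !in_itv/= => -[/andP[x0 x1] /andP[y0 y1]].
by nra.
Qed.

Lemma leb2_cball b : 0 <= b -> leb2 (cball b) = (kap * b)%:E.
Proof.
rewrite le_eqVlt => /orP[/eqP<-|b0].
  rewrite mulr0 (_ : cball 0 = `[0, 0]%classic `*` `[0, 0]%classic).
    by rewrite square_leb2// subrr expr0n.
  apply/seteqP; split=> -[x y]; rewrite /cball/= nrm2E/= !in_itv/= -!eq_le.
    move=> h; have : x ^+ 2 + y ^+ 2 == 0.
      by rewrite eq_le h addr_ge0 ?sqr_ge0.
    by rewrite paddr_eq0 ?sqr_ge0// !sqrf_eq0 => /andP[/eqP-> /eqP->].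
  by move=> [/eqP<- /eqP<-]; rewrite expr0n/= addr0.
have c0 : 0 < (Num.sqrt b)^-1 by rewrite invr_gt0 sqrtr_gt0.
rewrite (_ : cball b = dil (Num.sqrt b)^-1 @^-1` cball 1).
  rewrite leb2_dil//; last exact: measurable_cball.
  by rewrite -exprVn invrK sqr_sqrtr ?ltW// leb2_cball1 -EFinM mulrC.
apply/seteqP; split=> p; rewrite /cball/= !nrm2E/= !exprMn -mulrDr exprVn.
  by rewrite sqr_sqrtr ?[0 <= b]ltW// ler_pdivrMl ?mulr1.
by rewrite sqr_sqrtr ?[0 <= b]ltW// ler_pdivrMl ?mulr1.
Qed.

Definition kapn := NngNum (ltW kap_gt0).

Lemma pushforward_nrm2_itv (a b : R) : a < b ->
  leb2 (nrm2 @^-1` `]a, b]) = (kap * (Num.max b 0 - Num.max a 0))%:E.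
Proof.
move=> ab.
have [b0|b0] := ltP b 0.
  rewrite (_ : _ @^-1` _ = set0).
    rewrite leb20 max_r; last by lra.
    by rewrite subrr mulr0.
  apply/seteqP; split=> p //=; rewrite in_itv/= => /andP[_ h].
  by have := nrm2_ge0 p; lra.
have [a0|a0] := ltP a 0.
  rewrite (_ : _ @^-1` _ = cball b) ?leb2_cball ?subr0//.
  apply/seteqP; split=> p; rewrite /cball/= in_itv/=; first by move=> /andP[].
  by move=> ->; rewrite andbT; apply: lt_le_trans (nrm2_ge0 p).
rewrite (_ : _ @^-1` _ = cball b `\` cball a).
  rewrite (@leb2D _ _ (kap * b) (kap * a)) ?leb2_cball//.
  - by rewrite mulrBr.
  - exact: measurable_cball.
  - exact: measurable_cball.
  - by move=> p; rewrite /cball/=; lra.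
apply/seteqP; split=> p; rewrite /cball/= in_itv/=.
  by move=> /andP[h1 h2]; split=> //; apply/negP; rewrite -ltNge.
by move=> [h1 /negP]; rewrite -ltNge => ->.
Qed.

Lemma measurable_ray : measurable (`[0, +oo[%classic : set TR).
Proof. exact: measurable_itv. Qed.

(** The area of a disc is linear in the square of its radius, so the image of area under [nrm2] is a
    multiple of length on the half-line. This takes the place of polar coordinates. *)
Lemma leb2_nrm2 (A : set TR) : measurable A ->
  (leb2 (nrm2 @^-1` A) = kap%:E * leb (A `&` (`[0%R, +oo[%classic : set TR)))%E.
Proof.
move=> mA; have mf := measurable_nrm2.
pose m : {measure set TR -> \bar R} := pushforward leb2 nrm2.
pose m2 := mscale kapn (mrestr leb measurable_ray).
suff : m mf A = m2 A by [].
apply: (@measure_unique _ R TR (@ocitv R) (fun k => `]- k%:R, k%:R]%classic)) => //.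
- exact: ocitvI.
- by move=> k; exists (- k%:R, k%:R).
- apply/seteqP; split=> // x _; exists (Num.bound `|x|) => //=.
  rewrite in_itv/=; have := Num.Theory.archi_boundP (normr_ge0 x).
  by rewrite ltr_norml => /andP[-> /ltW].
- move=> X [[a b] /= ab <-]; rewrite /m/= /m2 /mscale/= /mrestr.
  change (leb2 (nrm2 @^-1` `]a, b]) = kap%:E * leb (`]a, b]%classic `&` (`[0%R, +oo[%classic : set TR)))%E.
  have [ba|{}ab] := leP b a.
    rewrite set_itv_ge ?preimage_set0 ?set0I ?bnd_simp -?leNgt//.
    by rewrite leb20 measure0 mule0.
  rewrite pushforward_nrm2_itv// EFinM; congr (_ * _)%E.
  have [b0|b0] := ltP b 0.
    rewrite (_ : _ `&` _ = set0).
      rewrite measure0; congr EFin; rewrite max_r; last by lra.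
      by rewrite subrr.
    by apply/seteqP; split=> x //=; rewrite !in_itv/=; lra.
  have [a0|a0] := ltP a 0.
    rewrite (_ : _ `&` _ = `[0%R, b]%classic).
      rewrite lebesgue_measure_itv/= lte_fin; case: ltP => h; last first.
        by congr EFin; lra.
      by rewrite -EFinB.
    by apply/seteqP; split=> x /=; rewrite !in_itv/=; lra.
  rewrite (_ : _ `&` _ = `]a, b]%classic).
    by rewrite lebesgue_measure_itv/= lte_fin ab -EFinB.
  by apply/seteqP; split=> x /=; rewrite !in_itv/=; lra.
- move=> k; rewrite /m/=.
  change (leb2 (nrm2 @^-1` `](- k%:R)%R, k%:R%R]) < +oo)%E.
  case: k => [|k]; last first.
    rewrite pushforward_nrm2_itv ?ltry//.
    have k0 : 0 < k.+1%:R :> R by rewrite ltr0n.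
    by lra.
  rewrite set_itv_ge ?preimage_set0 ?leb20 ?ltry// bnd_simp -leNgt.
  by rewrite mulr0n oppr0.
Qed.

(* Only the homogeneity of the area matters, so [kap] is never identified with [pi]. *)
Lemma integral_radial (f : TR -> \bar R) : measurable_fun (`[0%R, 1%R[%classic : set TR) f ->
  (forall y, 0 <= y < 1 -> (0 <= f y)%E) ->
  (\int[leb2]_(p in disk) f (nrm2 p) = kap%:E * \int[leb]_(y in `[0%R, 1%R[) f y)%E.
Proof.
move=> mf f0; have mn := measurable_nrm2.
have mI : measurable (`[0%R, 1%R[%classic : set TR) by exact: measurable_itv.
have f0' : {in (`[0%R, 1%R[%classic : set TR), forall y, (0 <= f y)%E}.
  by move=> y; rewrite inE/= in_itv/=; exact: f0.
rewrite disk_preimage.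
rewrite -[LHS](@ge0_integral_pushforward _ _ T2 TR R nrm2 mn (leb \x leb)%E _ f mI mf f0').
pose m : {measure set TR -> \bar R} := pushforward (leb \x leb)%E nrm2.
rewrite -(@ge0_integral_mscale _ _ _ leb _ mI kapn f mf); last first.
  by move=> x xI; apply: f0'; rewrite inE.
apply: (@eq_measure_integral _ _ _ _ (mscale kapn leb) (m mn)) => A mA AI.
rewrite /m/= /mscale/=.
change (leb2 (nrm2 @^-1` A) = kap%:E * leb A)%E.
rewrite leb2_nrm2// (_ : A `&` _ = A)//.
by apply/seteqP; split=> x; [move=> []|move=> Ax; split=> //=; move: (AI _ Ax); rewrite /= !in_itv/= => /andP[->]].
Qed.

Lemma disk_rot x : rot x @^-1` disk = disk.
Proof.
have E p : nrm2 (rot x p) = nrm2 p.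
  transitivity ((cos x ^+ 2 + sin x ^+ 2) * nrm2 p); last by rewrite cos2Dsin2 mul1r.
  by rewrite /nrm2 /rot/=; ring.
by apply/seteqP; split=> p /= /disk_nrm2; [rewrite E|rewrite -(E p)] => /disk_nrm2.
Qed.

Lemma ge0_integral_rot x (f : T2 -> \bar R) : measurable_fun (disk : set T2) f ->
  (forall p, disk p -> (0 <= f p)%E) ->
  (\int[leb2]_(p in disk) f (rot x p) = \int[leb2]_(p in disk) f p)%E.
Proof.
move=> mf f0; have mr := measurable_rot x; have mD := measurable_disk.
have f0' : {in (disk : set T2), forall y, (0 <= f y)%E}.
  by move=> y; rewrite inE; exact: f0.
rewrite -{1}(disk_rot x).
rewrite -[LHS](@ge0_integral_pushforward _ _ T2 T2 R (rot x) mr (leb \x leb)%E _ f mD mf f0').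
pose m : {measure set T2 -> \bar R} := pushforward (leb \x leb)%E (rot x).
apply: (@eq_measure_integral _ _ _ _ (leb \x leb)%E (m mr)) => A mA AI.
exact: leb2_rot.
Qed.

End Plane.

(** * Goursat's theorem for closed forms on rectangles *)

Section Goursat.
Context {R : realType}.
Local Notation leb := (@lebesgue_measure R).
Implicit Types (f g : R -> R) (a b c d x y : R).

Definition cont_on f a b := forall x, a <= x <= b -> {for x, continuous f}.

Lemma cont_on_within f a b : cont_on f a b -> {within `[a, b], continuous f}.
Proof.
move=> cf; apply: continuous_in_subspaceT => x; rewrite inE/= in_itv/=; exact: cf.
Qed.

Lemma cont_on_integrable f a b : cont_on f a b -> leb.-integrable `[a, b] (EFin \o f).
Proof.
move=> cf; apply: continuous_compact_integrable; first exact: segment_compact.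
exact: cont_on_within.
Qed.

Lemma cont_onB f g a b : cont_on f a b -> cont_on g a b ->
  cont_on (fun x => f x - g x) a b.
Proof. by move=> cf cg x xx; apply: continuousB; [exact: cf|exact: cg]. Qed.

Definition cint1 f a b : R := \int[leb]_(x in `[a, b]) f x.

Lemma cint1_split f a b c : a <= c -> c <= b -> cont_on f a b ->
  cint1 f a b = cint1 f a c + cint1 f c b.
Proof.
move=> ac cb cf; have := cont_on_integrable cf => h.
have := @Rintegral_itvB R f (BLeft a) (BRight b) c h.
rewrite !bnd_simp => /(_ ac cb) e; apply/eqP; rewrite /cint1 addrC -subr_eq; apply/eqP.
rewrite e Rintegral_itv_obnd_cbnd//.
by apply: integrableS h => //; apply: subset_itvr; rewrite bnd_simp.
Qed.

Lemma cint1B f g a b : cont_on f a b -> cont_on g a b ->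
  cint1 (fun x => f x - g x) a b = cint1 f a b - cint1 g a b.
Proof. by move=> cf cg; rewrite /cint1 RintegralB//; exact: cont_on_integrable. Qed.

Lemma cint1_cst k a b : a <= b -> cint1 (fun=> k) a b = k * (b - a).
Proof.
move=> ab; transitivity (k * fine (leb (`[a, b]%classic : set R))).
  exact: Rintegral_cst.
rewrite lebesgue_measure_itv/= lte_fin.
by case: ltP => [_|ba]; rewrite -?EFinB//= (_ : b - a = 0)//; lra.
Qed.

Lemma cint1_bound f a b (M : R) : a <= b -> cont_on f a b ->
  (forall x, a <= x <= b -> `|f x| <= M) -> `|cint1 f a b| <= M * (b - a).
Proof.
move=> ab cf fM; have h := cont_on_integrable cf.
have cM k : leb.-integrable `[a, b] (EFin \o (fun=> k : R)).
  by apply: cont_on_integrable => x _; exact: cst_continuous.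
have Mx x : `[a, b]%classic x -> `|f x| <= M by rewrite /= in_itv/=; exact: fM.
rewrite ler_norml -mulNr -!(cint1_cst _ ab); apply/andP; split.
  by apply: le_Rintegral => // x /Mx; rewrite ler_norml => /andP[].
by apply: le_Rintegral => // x /Mx; rewrite ler_norml => /andP[].
Qed.

Variables P Q : R -> R -> R.

(** [P dx + Q dy] is totally differentiable at the point, and the same [ga] serving as [P_y] and as
    [Q_x] says that it is closed there. This pointwise condition is what complex differentiability
    provides. *)
Definition closed_form_at x0 y0 := exists be ga de : R, forall e, 0 < e ->
  exists2 eta : R, 0 < eta & forall x y, `|x - x0| < eta -> `|y - y0| < eta ->
  `|P x y - P x0 y0 - be * (x - x0) - ga * (y - y0)| <= e * (`|x - x0| + `|y - y0|) /\
  `|Q x y - Q x0 y0 - ga * (x - x0) - de * (y - y0)| <= e * (`|x - x0| + `|y - y0|).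

(** Counterclockwise circulation of [P dx + Q dy] around [[a, b] x [c, d]]. *)
Definition circ a b c d := cint1 (P^~ c) a b - cint1 (P^~ d) a b +
  cint1 (Q b) c d - cint1 (Q a) c d.

Lemma affine_small_continuous f x0 (s : R) :
  (forall e, 0 < e -> exists2 eta : R, 0 < eta & forall x, `|x - x0| < eta ->
     `|f x - f x0 - s * (x - x0)| <= e * `|x - x0|) -> {for x0, continuous f}.
Proof.
move=> h; apply/cvgrPdist_lt => e e0; have [eta eta0 he] := h 1 ltr01.
have S0 : 0 < `|s| + 1 by rewrite ltr_wpDl.
have es : 0 < e / (`|s| + 1) by exact: divr_gt0.
near=> x.
have xe : `|x - x0| < eta by rewrite distrC; near: x; apply: cvgr_dist_lt => //; exact: cvg_id.
have xd : `|x - x0| < e / (`|s| + 1).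
  by rewrite distrC; near: x; apply: cvgr_dist_lt => //; exact: cvg_id.
rewrite distrC -[f x - f x0](subrK (s * (x - x0))).
apply: le_lt_trans (ler_normD _ _) _.
apply: le_lt_trans (lerD (he _ xe) (lexx _)) _.
by rewrite normrM -mulrDl addrC -ltr_pdivlMl// mulrC.
Unshelve. all: by end_near. Qed.

Lemma closed_form_continuous x0 y0 : closed_form_at x0 y0 ->
  {for x0, continuous (P^~ y0)} /\ {for y0, continuous (Q x0)}.
Proof.
move=> [be [ga [de h]]]; split.
  apply: (@affine_small_continuous _ _ be) => e /h[eta eta0 he]; exists eta => // x xe.
  have [+ _] := he x y0 xe ltac:(by rewrite subrr normr0).
  by rewrite !subrr mulr0 subr0 normr0 addr0.
apply: (@affine_small_continuous _ _ de) => e /h[eta eta0 he]; exists eta => // y ye.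
have [_] := he x0 y ltac:(by rewrite subrr normr0) ye.
by rewrite !subrr mulr0 subr0 normr0 add0r.
Qed.

Definition closed_form_on a b c d :=
  forall x y, a <= x <= b -> c <= y <= d -> closed_form_at x y.

Lemma closed_form_contP a b c d y : closed_form_on a b c d -> c <= y <= d ->
  cont_on (P^~ y) a b.
Proof. by move=> h cyd x axb; have [] := closed_form_continuous (h x y axb cyd). Qed.

Lemma closed_form_contQ a b c d x : closed_form_on a b c d -> a <= x <= b ->
  cont_on (Q x) c d.
Proof. by move=> h axb y cyd; have [] := closed_form_continuous (h x y axb cyd). Qed.

Lemma circ_quarter a b c d m n : closed_form_on a b c d -> a <= m <= b -> c <= n <= d ->
  circ a b c d = circ a m c n + circ m b c n + circ a m n d + circ m b n d.
Proof.
move=> h amb cnd; have [am mb] := andP amb; have [cn nd] := andP cnd.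
have ab := le_trans am mb; have cd := le_trans cn nd.
rewrite /circ.
rewrite (cint1_split am mb (closed_form_contP h (y := c) _)) ?lexx//.
rewrite (cint1_split am mb (closed_form_contP h (y := d) _)) ?lexx ?cd//.
rewrite (cint1_split cn nd (closed_form_contQ h (x := b) _)) ?lexx ?ab//.
rewrite (cint1_split cn nd (closed_form_contQ h (x := a) _)) ?lexx//.
ring.
Qed.

(** The affine part of the form at the point is closed and has no circulation. What is left is at
    most [e] times the size of the rectangle, integrated over a perimeter of the same order. *)
Lemma circ_small a b c d x0 y0 : closed_form_on a b c d -> closed_form_at x0 y0 ->
  forall e, 0 < e -> exists2 eta : R, 0 < eta & forall a' b' c' d',
    a <= a' -> b' <= b -> c <= c' -> d' <= d -> a' <= x0 <= b' -> c' <= y0 <= d' ->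
    (b' - a') + (d' - c') < eta ->
    `|circ a' b' c' d'| <= e * ((b' - a') + (d' - c')) ^+ 2.
Proof.
move=> hD [be [ga [de h]]] e e0; have [eta eta0 he] := h (e / 2) (divr_gt0 e0 (ltr0Sn _ _)).
exists eta => // a' b' c' d' aa bb cc dd /andP[ax xb] /andP[cy yd].
set L := _ + _ => Leta.
have ab := le_trans ax xb; have cd := le_trans cy yd.
have Lw : b' - a' <= L by rewrite lerDl subr_ge0.
have Lh : d' - c' <= L by rewrite lerDr subr_ge0.
have c1 : c' <= c' <= d' by rewrite lexx.
have d1 : c' <= d' <= d' by rewrite lexx andbT.
have a1 : a' <= a' <= b' by rewrite lexx.
have b1 : a' <= b' <= b' by rewrite lexx andbT.
have hD' : closed_form_on a' b' c' d'.
  by move=> x y /andP[x1 x2] /andP[y1 y2]; apply: hD;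
    rewrite ?(le_trans aa x1) ?(le_trans x2 bb) ?(le_trans cc y1) ?(le_trans y2 dd).
have near x y : a' <= x <= b' -> c' <= y <= d' ->
  `|P x y - P x0 y0 - be * (x - x0) - ga * (y - y0)| <= e / 2 * L /\
  `|Q x y - Q x0 y0 - ga * (x - x0) - de * (y - y0)| <= e / 2 * L.
  move=> /andP[x1 x2] /andP[y1 y2].
  have hx : `|x - x0| <= b' - a' by rewrite ler_distl; clear - x1 x2 ax xb; lra.
  have hy : `|y - y0| <= d' - c' by rewrite ler_distl; clear - y1 y2 cy yd; lra.
  have [h1 h2] := he x y (le_lt_trans (le_trans hx Lw) Leta) (le_lt_trans (le_trans hy Lh) Leta).
  have hL : e / 2 * (`|x - x0| + `|y - y0|) <= e / 2 * L.
    by rewrite ler_wpM2l ?lerD// ltW// divr_gt0.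
  by split; [exact: le_trans h1 hL | exact: le_trans h2 hL].
have cPc := closed_form_contP hD' (y := c') c1.
have cPd := closed_form_contP hD' (y := d') d1.
have cQa := closed_form_contQ hD' (x := a') a1.
have cQb := closed_form_contQ hD' (x := b') b1.
have contk k u v : cont_on (fun=> k : R) u v by move=> x _; exact: cst_continuous.
(* The two terms in [ga] integrate to opposite multiples of the area and cancel: this is where
   closedness enters. *)
have -> : circ a' b' c' d' =
   cint1 (fun x => P x c' - P x d' - ga * (c' - d')) a' b' +
   cint1 (fun y => Q b' y - Q a' y - ga * (b' - a')) c' d'.
  rewrite !cint1B//; [|exact: cont_onB..].
  by rewrite /circ !cint1_cst//; ring.
have eL : e * L = e / 2 * L + e / 2 * L by field.
apply: le_trans (ler_normD _ _) _.
have -> : e * L ^+ 2 = e * L * (b' - a') + e * L * (d' - c') by rewrite /L; ring.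
apply: lerD; apply: cint1_bound => //.
- by apply: cont_onB => //; exact: cont_onB.
- move=> x xx; have [h1 _] := near x c' xx c1; have [h2 _] := near x d' xx d1.
  have -> : P x c' - P x d' - ga * (c' - d') =
    (P x c' - P x0 y0 - be * (x - x0) - ga * (c' - y0)) -
    (P x d' - P x0 y0 - be * (x - x0) - ga * (d' - y0)) by ring.
  by rewrite eL; apply: le_trans (ler_normB _ _) _; exact: lerD.
- by apply: cont_onB => //; exact: cont_onB.
- move=> y yy; have [_ h1] := near b' y b1 yy; have [_ h2] := near a' y a1 yy.
  have -> : Q b' y - Q a' y - ga * (b' - a') =
    (Q b' y - Q x0 y0 - ga * (b' - x0) - de * (y - y0)) -
    (Q a' y - Q x0 y0 - ga * (a' - x0) - de * (y - y0)) by ring.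
  by rewrite eL; apply: le_trans (ler_normB _ _) _; exact: lerD.
Qed.

(* Bisection: a quarter always carries at least a quarter of the circulation, whereas
   near a point of differentiability the circulation is [o(diameter^2)]. *)
Lemma goursat a b c d : a <= b -> c <= d -> closed_form_on a b c d -> circ a b c d = 0.
Proof.
move=> ab cd hD; apply/eqP; rewrite -normr_le0 leNgt; apply/negP => W0.
pose w k : R := (b - a) / 2 ^+ k; pose hh k : R := (d - c) / 2 ^+ k.
have wS k : w k = w k.+1 + w k.+1.
  by rewrite /w exprS; field; rewrite expf_neq0.
have hS k : hh k = hh k.+1 + hh k.+1.
  by rewrite /hh exprS; field; rewrite expf_neq0.
have w0 k : 0 <= w k by rewrite divr_ge0 ?subr_ge0// exprn_ge0.
have h0 k : 0 <= hh k by rewrite divr_ge0 ?subr_ge0// exprn_ge0.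
pose V k (p : R * R) := circ p.1 (p.1 + w k) p.2 (p.2 + hh k).
pose Bad k (p : R * R) := [/\ a <= p.1, p.1 + w k <= b, c <= p.2, p.2 + hh k <= d &
   `|circ a b c d| / 4 ^+ k <= `|V k p|].
pose Nxt k (p q : R * R) := [/\ Bad k.+1 q, p.1 <= q.1, q.1 + w k.+1 <= p.1 + w k,
   p.2 <= q.2 & q.2 + hh k.+1 <= p.2 + hh k].
have step k p : Bad k p -> exists q, Nxt k p q.
  move=> [p1 p2 p3 p4 p5].
  have ww := wS k; have hk := hS k; have wk := w0 k.+1; have hhk := h0 k.+1.
  have E : V k p = V k.+1 p + V k.+1 (p.1 + w k.+1, p.2) + V k.+1 (p.1, p.2 + hh k.+1) +
     V k.+1 (p.1 + w k.+1, p.2 + hh k.+1).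
    rewrite /V/= (_ : p.1 + w k.+1 + w k.+1 = p.1 + w k); last by lra.
    rewrite (_ : p.2 + hh k.+1 + hh k.+1 = p.2 + hh k); last by lra.
    apply: circ_quarter; [|lra|lra].
    by move=> x y x1 y1; apply: hD; lra.
  have [//|] : (exists q, Nxt k p q) \/ ~ (exists q, Nxt k p q) by exact: EM.
  move=> hn; exfalso.
  have small q : p.1 <= q.1 -> q.1 + w k.+1 <= p.1 + w k -> p.2 <= q.2 ->
     q.2 + hh k.+1 <= p.2 + hh k -> `|V k.+1 q| < `|circ a b c d| / 4 ^+ k.+1.
    move=> q1 q2 q3 q4; rewrite ltNge; apply/negP => hq; apply: hn; exists q.
    by split=> //; split=> //; [exact: le_trans p1 q1|exact: le_trans q2 p2|
      exact: le_trans p3 q3|exact: le_trans q4 p4].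
  have px : p.1 <= p.1 + w k.+1 by rewrite lerDl.
  have pw : p.1 + w k.+1 <= p.1 + w k by rewrite lerD2l ww lerDl.
  have pww : p.1 + w k.+1 + w k.+1 <= p.1 + w k by rewrite ww addrA.
  have py : p.2 <= p.2 + hh k.+1 by rewrite lerDl.
  have ph : p.2 + hh k.+1 <= p.2 + hh k by rewrite lerD2l hk lerDl.
  have phh : p.2 + hh k.+1 + hh k.+1 <= p.2 + hh k by rewrite hk addrA.
  have s1 := small p (lexx _) pw (lexx _) ph.
  have s2 := small (p.1 + w k.+1, p.2) px pww (lexx _) ph.
  have s3 := small (p.1, p.2 + hh k.+1) (lexx _) pw py phh.
  have s4 := small (p.1 + w k.+1, p.2 + hh k.+1) px pww py phh.
  have q4 : `|circ a b c d| / 4 ^+ k = 4 * (`|circ a b c d| / 4 ^+ k.+1).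
    by rewrite exprS; field; rewrite expf_neq0.
  have := le_trans p5 (eq_ind _ (fun v => `|v| <= _) (le_trans (ler_normD _ _)
     (lerD (le_trans (ler_normD _ _) (lerD (ler_normD _ _) (lexx _))) (lexx _))) _ (esym E)).
  by rewrite q4; clear - s1 s2 s3 s4; lra.
(* The default [s k'] of [xget] is never taken, since [step] provides a bad quarter. *)
pose s := fix s k : R * R := if k is k'.+1 then xget (s k') [set q | Nxt k' (s k') q] else (a, c).
have badN k : Bad k (s k) /\ Nxt k (s k) (s k.+1).
  have B k' : Bad k' (s k') -> Nxt k' (s k') (s k'.+1).
    by move=> hb; apply: (@xgetPex _ (s k') [set q | Nxt k' (s k') q]); exact: step.
  elim: k => [|k [_ [IH _ _ _ _]]]; last by split=> //; exact: B.
  have B0 : Bad 0%N (s 0%N).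
    have e1 : w 0%N = b - a by rewrite /w expr0 divr1.
    have e2 : hh 0%N = d - c by rewrite /hh expr0 divr1.
    split; rewrite /= ?e1 ?e2 ?expr0 ?divr1 ?lexx//; try lra.
    by rewrite /V/= e1 e2 (addrC a) subrK (addrC c) subrK.
  by split=> //; exact: B.
have mono j k : (j <= k)%N -> [/\ (s j).1 <= (s k).1, (s k).1 + w k <= (s j).1 + w j,
    (s j).2 <= (s k).2 & (s k).2 + hh k <= (s j).2 + hh j].
  move=> /subnK <-; elim: (k - j)%N => [|n [i1 i2 i3 i4]]; first by rewrite !lexx.
  have [_ [_ n1 n2 n3 n4]] := badN (n + j)%N.
  by rewrite addSn; split; [exact: le_trans i1 n1|exact: le_trans n2 i2|
    exact: le_trans i3 n3|exact: le_trans n4 i4].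
have cross j k : (s j).1 <= (s k).1 + w k /\ (s j).2 <= (s k).2 + hh k.
  have [/mono[m1 _ m3 _]|/ltnW /mono[_ m2 _ m4]] := leqP j k; split.
  - by apply: le_trans m1 _; rewrite lerDl.
  - by apply: le_trans m3 _; rewrite lerDl.
  - by apply: le_trans m2; rewrite lerDl.
  - by apply: le_trans m4; rewrite lerDl.
(* By [cross], every lower left corner is below every upper right corner, so the suprema of the
   former lie in all the rectangles. *)
pose x0 := sup (range (fun k => (s k).1)); pose y0 := sup (range (fun k => (s k).2)).
have xk k : (s k).1 <= x0 <= (s k).1 + w k.
  apply/andP; split.
    apply: ub_le_sup; last by exists k.
    by exists ((s 0%N).1 + w 0%N) => _ [j _ <-]; have [] := cross j 0%N.
  apply: ge_sup; first by exists (s 0%N).1; exists 0%N.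
  by move=> _ [j _ <-]; have [] := cross j k.
have yk k : (s k).2 <= y0 <= (s k).2 + hh k.
  apply/andP; split.
    apply: ub_le_sup; last by exists k.
    by exists ((s 0%N).2 + hh 0%N) => _ [j _ <-]; have [] := cross j 0%N.
  apply: ge_sup; first by exists (s 0%N).2; exists 0%N.
  by move=> _ [j _ <-]; have [] := cross j k.
have xy : closed_form_at x0 y0.
  have [[b1 b2 b3 b4 _] _] := badN 0%N.
  by apply: hD; [have := xk 0%N|have := yk 0%N]; lra.
pose L := (b - a) + (d - c).
have L0 : 0 <= L by rewrite addr_ge0 ?subr_ge0.
(* With this [e] the bound [e * L ^ 2] is smaller than the circulation, even for a degenerate
   rectangle. *)
have e0 : 0 < `|circ a b c d| / (2 * (L ^+ 2 + 1)).
  by rewrite divr_gt0// mulr_gt0// ltr_wpDl ?sqr_ge0.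
have [eta eta0 he] := circ_small hD xy e0.
have [k hk] : exists k, L / 2 ^+ k < eta.
  have [k hk] : exists k : nat, L / eta < k%:R.
    by exists (Num.bound (L / eta)); apply: Num.Theory.archi_boundP; rewrite divr_ge0// ltW.
  exists k; rewrite ltr_pdivrMr ?exprn_gt0// mulrC -ltr_pdivrMr//.
  apply: lt_le_trans hk _; rewrite -natrX ler_nat ltnW//; exact: ltn_expl.
have [[b1 b2 b3 b4 b5] _] := badN k.
have Lk : (s k).1 + w k - (s k).1 + ((s k).2 + hh k - (s k).2) = L / 2 ^+ k.
  by rewrite /w /hh /L; field; rewrite expf_neq0.
have := he _ _ _ _ b1 b2 b3 b4 (xk k) (yk k); rewrite Lk => /(_ hk).
move=> /(le_trans b5); rewrite expr_div_n -exprM mulnC exprM.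
have -> : (2 : R) ^+ 2 = 4 by ring.
rewrite mulrA ler_pM2r ?invr_gt0 ?exprn_gt0// => h.
have : `|circ a b c d| * (2 * (L ^+ 2 + 1)) <= `|circ a b c d| * L ^+ 2.
  by rewrite -ler_pdivlMr ?mulr_gt0 ?ltr_wpDl ?sqr_ge0// mulrAC.
rewrite ler_pM2l//; have := sqr_ge0 L; lra.
Qed.

End Goursat.

(** * Complex differentiability in two real variables; the exponential *)

Section CircleMeans.
Context {R : realType}.
Local Notation leb := (@lebesgue_measure R).

Lemma is_derive_small (f : R -> R) (x0 df : R) : is_derive x0 1 f df ->
  forall e, 0 < e -> exists2 d : R, 0 < d & forall x, `|x - x0| < d ->
    `|f x - f x0 - df * (x - x0)| <= e * `|x - x0|.
Proof.
move=> [dfx <-] e e0; move: (dfx).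
move=> /cvgrPdist_le /(_ _ e0) [/= d d0 hd].
exists d => // x xd; have [->|xx] := eqVneq x x0.
  by rewrite !subrr mulr0 subr0 normr0 mulr0.
have xx0 : x - x0 != 0 by rewrite subr_eq0.
have := hd (x - x0); rewrite /ball_/= sub0r normrN => /(_ xd xx0).
rewrite /shift/= [(x - x0)%:A]mulr1 subrK => h.
set l := 'D_1 f x0 in h *.
have -> : f x - f x0 - l * (x - x0) = - ((x - x0) * (l - (x - x0)^-1 *: (f x - f x0))).
  have -> : (x - x0) * (l - (x - x0)^-1 *: (f x - f x0)) = (x - x0) * l - (f x - f x0).
    by rewrite mulrBr; congr (_ - _); rewrite /GRing.scale/= mulrA divff// mul1r.
  by rewrite opprB [l * _]mulrC.
by rewrite normrN normrM mulrC ler_wpM2r.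
Qed.

(** Complex differentiability of [g] in [x + i y]: the linear part is multiplication by a complex
    number [l]. The two real variables are kept apart so that [goursat] can be applied to
    [f (z * exp (x + i y))]. *)
Definition cr_at (g : R -> R -> R[i]) (x0 y0 : R) := exists l : R[i], forall e : R,
  0 < e -> exists2 eta : R, 0 < eta & forall x y, `|x - x0| < eta -> `|y - y0| < eta ->
  cabs (g x y - g x0 y0 - l * ((x - x0) +i* (y - y0))%C) <= e * (`|x - x0| + `|y - y0|).

(** The forms here and in [cr_closed2] are the imaginary part and minus the real part of [g dz]; the
    Cauchy-Riemann equations make both closed. *)
Lemma cr_closed1 g x0 y0 : cr_at g x0 y0 ->
  closed_form_at (fun x y => complex.Im (g x y)) (fun x y => complex.Re (g x y)) x0 y0.
Proof.
move=> [l hl]; exists (complex.Im l), (complex.Re l), (- complex.Im l) => e /hl[eta eta0 h].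
exists eta => // x y xe ye; have := h x y xe ye; set D := g x y - _ - _ => hD; split.
  have -> : complex.Im (g x y) - complex.Im (g x0 y0) - complex.Im l * (x - x0) -
    complex.Re l * (y - y0) = complex.Im D by rewrite /D !ImD !ImN ImM/=; ring.
  exact: le_trans (cabs_Im _) hD.
have -> : complex.Re (g x y) - complex.Re (g x0 y0) - complex.Re l * (x - x0) -
    - complex.Im l * (y - y0) = complex.Re D by rewrite /D !ReD !ReN ReM/=; ring.
exact: le_trans (cabs_Re _) hD.
Qed.

Lemma cr_closed2 g x0 y0 : cr_at g x0 y0 ->
  closed_form_at (fun x y => - complex.Re (g x y)) (fun x y => complex.Im (g x y)) x0 y0.
Proof.
move=> [l hl]; exists (- complex.Re l), (complex.Im l), (complex.Re l) => e /hl[eta eta0 h].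
exists eta => // x y xe ye; have := h x y xe ye; set D := g x y - _ - _ => hD; split.
  have -> : - complex.Re (g x y) - - complex.Re (g x0 y0) - - complex.Re l * (x - x0) -
    complex.Im l * (y - y0) = - complex.Re D by rewrite /D !ReD !ReN ReM/=; ring.
  rewrite normrN; exact: le_trans (cabs_Re _) hD.
have -> : complex.Im (g x y) - complex.Im (g x0 y0) - complex.Im l * (x - x0) -
    complex.Re l * (y - y0) = complex.Im D by rewrite /D !ImD !ImN ImM/=; ring.
exact: le_trans (cabs_Im _) hD.
Qed.

Lemma cabs_dxdy (a b : R) : cabs (a +i* b)%C <= `|a| + `|b|.
Proof. exact: cabs_ReIm. Qed.

Lemma cr_lipschitz g x0 y0 : cr_at g x0 y0 -> exists2 M : R, 0 < M &
  exists2 eta : R, 0 < eta & forall x y, `|x - x0| < eta -> `|y - y0| < eta ->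
    cabs (g x y - g x0 y0) <= M * (`|x - x0| + `|y - y0|).
Proof.
move=> [l /(_ 1 ltr01)[eta eta0 h]]; exists (1 + cabs l); first by rewrite ltr_wpDr ?cabs_ge0.
exists eta => // x y xe ye.
rewrite -[g x y - _](subrK (l * ((x - x0) +i* (y - y0))%C)).
apply: le_trans (cabsD _ _) _; rewrite mulrDl; apply: lerD; first exact: h.
by rewrite cabsM ler_wpM2l ?cabs_ge0// cabs_dxdy.
Qed.

Lemma cr_mul g1 g2 x0 y0 : cr_at g1 x0 y0 -> cr_at g2 x0 y0 ->
  cr_at (fun x y => g1 x y * g2 x y) x0 y0.
Proof.
move=> h1 h2; have [M1 M10 [d1 d10 L1]] := cr_lipschitz h1.
have [M2 M20 [d2 d20 L2]] := cr_lipschitz h2.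
case: h1 => l1 h1; case: h2 => l2 h2.
exists (l1 * g2 x0 y0 + g1 x0 y0 * l2) => e e0.
pose B := cabs (g1 x0 y0) + cabs (g2 x0 y0) + 1.
have B0 : 0 < B by rewrite ltr_wpDl// addr_ge0 ?cabs_ge0.
have eB : 0 < e / (2 * B) by rewrite divr_gt0 ?mulr_gt0.
have [d3 d30 S1] := h1 _ eB; have [d4 d40 S2] := h2 _ eB.
have M120 : 0 < M1 * M2 by rewrite mulr_gt0.
(* Both increments are at most a Lipschitz constant times [N], and [N <= 2 * d5], so their product
   is at most [e / 2 * N]. *)
pose d5 := e / (4 * (M1 * M2)); have d50 : 0 < d5 by rewrite divr_gt0 ?mulr_gt0.
exists (Num.min d1 (Num.min d2 (Num.min d3 (Num.min d4 d5)))).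
  by rewrite !lt_min d10 d20 d30 d40 d50.
move=> x y; rewrite !lt_min => /and5P[x1 x2 x3 x4 x5] /and5P[y1 y2 y3 y4 y5].
set N := `|x - x0| + `|y - y0|; set dz := ((x - x0) +i* (y - y0))%C.
have N0 : 0 <= N by rewrite addr_ge0.
have -> : g1 x y * g2 x y - g1 x0 y0 * g2 x0 y0 - (l1 * g2 x0 y0 + g1 x0 y0 * l2) * dz =
  (g1 x y - g1 x0 y0) * (g2 x y - g2 x0 y0) +
  (g1 x y - g1 x0 y0 - l1 * dz) * g2 x0 y0 + g1 x0 y0 * (g2 x y - g2 x0 y0 - l2 * dz) by ring.
apply: le_trans (cabsD _ _) _.
have T1 : cabs ((g1 x y - g1 x0 y0) * (g2 x y - g2 x0 y0)) <= e / 2 * N.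
  rewrite cabsM; apply: (@le_trans _ _ (M1 * N * (M2 * N))).
    by apply: ler_pM; rewrite ?cabs_ge0 ?L1 ?L2.
  have N5 : N <= 2 * d5 by rewrite /N; lra.
  rewrite (_ : M1 * N * (M2 * N) = (M1 * M2) * N * N); last by ring.
  rewrite ler_wpM2r// (@le_trans _ _ (M1 * M2 * (2 * d5)))// ?ler_wpM2l ?(ltW M120)//.
  by rewrite /d5 le_eqVlt; apply/orP; left; apply/eqP; field; rewrite !gt_eqF.
have T2 : cabs ((g1 x y - g1 x0 y0 - l1 * dz) * g2 x0 y0) +
   cabs (g1 x0 y0 * (g2 x y - g2 x0 y0 - l2 * dz)) <= e / 2 * N.
  rewrite !cabsM.
  have S1' := S1 x y x3 y3; have S2' := S2 x y x4 y4.
  apply: (@le_trans _ _ (e / (2 * B) * N * cabs (g2 x0 y0) + cabs (g1 x0 y0) * (e / (2 * B) * N))).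
    by apply: lerD; [rewrite ler_wpM2r ?cabs_ge0|rewrite ler_wpM2l ?cabs_ge0].
  have -> : e / (2 * B) * N * cabs (g2 x0 y0) + cabs (g1 x0 y0) * (e / (2 * B) * N) =
     (e / (2 * B) * N) * (cabs (g1 x0 y0) + cabs (g2 x0 y0)) by ring.
  apply: (@le_trans _ _ ((e / (2 * B) * N) * B)).
    by apply: ler_wpM2l; [rewrite mulr_ge0 ?(ltW eB)|rewrite /B lerDl].
  by rewrite le_eqVlt; apply/orP; left; apply/eqP; field; rewrite gt_eqF.
apply: le_trans (lerD (cabsD _ _) (lexx _)) _.
by rewrite -addrA; apply: le_trans (lerD T1 T2) _; rewrite -mulrDl -splitr.
Qed.

Lemma cr_comp (f : R[i] -> R[i]) g x0 y0 :
  derivable (f : R[i]^o -> R[i]^o) (g x0 y0) 1 -> cr_at g x0 y0 ->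
  cr_at (fun x y => f (g x y)) x0 y0.
Proof.
move=> /derivable_cabs[l hl] hg; have [M M0 [d1 d10 L1]] := cr_lipschitz hg.
case: hg => m hm; exists (l * m) => e e0.
have eM : 0 < e / (2 * M) by rewrite divr_gt0 ?mulr_gt0.
have [d2 d20 h2] := hl _ eM.
have l1 : 0 < cabs l + 1 by rewrite ltr_wpDl ?cabs_ge0.
have el : 0 < e / (2 * (cabs l + 1)) by rewrite divr_gt0 ?mulr_gt0.
have [d3 d30 h3] := hm _ el.
pose d4 := d2 / (2 * M); have d40 : 0 < d4 by rewrite divr_gt0 ?mulr_gt0.
exists (Num.min d1 (Num.min d3 d4)); first by rewrite !lt_min d10 d30 d40.
move=> x y; rewrite !lt_min => /and3P[x1 x3 x4] /and3P[y1 y3 y4].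
set N := `|x - x0| + `|y - y0|; set dz := ((x - x0) +i* (y - y0))%C.
have N0 : 0 <= N by rewrite addr_ge0.
have LN := L1 x y x1 y1.
have small : cabs (g x y - g x0 y0) < d2.
  apply: le_lt_trans LN _; rewrite mulrC -ltr_pdivlMr//.
  have -> : d2 / M = 2 * d4 by rewrite /d4; field; rewrite gt_eqF.
  by lra.
have -> : f (g x y) - f (g x0 y0) - l * m * dz =
  (f (g x y) - f (g x0 y0) - l * (g x y - g x0 y0)) + l * (g x y - g x0 y0 - m * dz) by ring.
apply: le_trans (cabsD _ _) _.
rewrite [e in leRHS]splitr mulrDl; apply: lerD.
  apply: le_trans (h2 _ small) _.
  apply: (@le_trans _ _ (e / (2 * M) * (M * N))); first by rewrite ler_wpM2l ?(ltW eM).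
  by rewrite le_eqVlt; apply/orP; left; apply/eqP; field; rewrite gt_eqF.
rewrite cabsM; apply: (@le_trans _ _ ((cabs l + 1) * (e / (2 * (cabs l + 1)) * N))).
  by apply: ler_pM; rewrite ?cabs_ge0 ?lerDl// h3.
by rewrite le_eqVlt; apply/orP; left; apply/eqP; field; rewrite gt_eqF.
Qed.

(** The entire function [exp (s (x + i y))]. With [s = 1] it gives logarithmic polar coordinates,
    with [s = - k] the factor that extracts the frequency [k]. *)
Definition cexp (s x y : R) : R[i] := (expR (s * x))%:C%C * cis (s * y).

Lemma cexpD s x y a b : cexp s (x + a) (y + b) = cexp s x y * cexp s a b.
Proof. by rewrite /cexp !mulrDr expRD cisD rmorphM/=; ring. Qed.

Lemma cexp_cr0 s : cr_at (cexp s) 0 0.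
Proof.
exists (s%:C%C) => e e0.
have dE : is_derive (0 : R) 1 expR 1 by rewrite -[X in is_derive _ _ _ X](@expR0 R); exact: is_derive_expR.
have dC : is_derive (0 : R) 1 cos 0 by have := is_derive_cos (0 : R); rewrite sin0 oppr0.
have dS : is_derive (0 : R) 1 sin 1 by rewrite -[X in is_derive _ _ _ X](@cos0 R); exact: is_derive_sin.
have S0 : 0 < `|s| + 1 by rewrite ltr_wpDl.
(* The three remainders below add up to at most [5 * e' * (|X| + |Y|)], and [X], [Y] carry a factor
   [s]; dividing by [8 * (|s| + 1)] covers both. *)
pose e' := Num.min 1 (e / (8 * (`|s| + 1))).
have e'0 : 0 < e' by rewrite lt_min ltr01 divr_gt0 ?mulr_gt0.
have e'1 : e' <= 1 by rewrite ge_min lexx.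
have e's : 8 * e' * (`|s| + 1) <= e.
  have : e' <= e / (8 * (`|s| + 1)) by rewrite ge_min lexx orbT.
  by rewrite ler_pdivlMr ?mulr_gt0//; lra.
have [d1 d10 h1] := is_derive_small dE e'0.
have [d2 d20 h2] := is_derive_small dC e'0.
have [d3 d30 h3] := is_derive_small dS e'0.
have d40 : 0 < e' / 2 by rewrite divr_gt0.
pose d := Num.min d1 (Num.min d2 (Num.min d3 (e' / 2))) / (`|s| + 1).
exists d; first by rewrite divr_gt0// !lt_min d10 d20 d30 d40.
move=> x y; rewrite !subr0 => xd yd.
have sc t : `|t| < d -> [/\ `|s * t| < d1, `|s * t| < d2, `|s * t| < d3 & `|s * t| < e' / 2].
  rewrite /d ltr_pdivlMr// mulrDr mulr1 => ht.
  have : `|s * t| < Num.min d1 (Num.min d2 (Num.min d3 (e' / 2))).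
    by apply: le_lt_trans ht; rewrite normrM mulrC lerDl.
  by rewrite !lt_min => /and4P[].
have [sx1 _ _ sx4] := sc _ xd; have [_ sy2 sy3 sy4] := sc _ yd.
have := h1 (s * x); rewrite subr0 expR0 mul1r => /(_ sx1) E1.
have := h2 (s * y); rewrite subr0 cos0 mul0r subr0 => /(_ sy2) E2.
have := h3 (s * y); rewrite subr0 sin0 subr0 mul1r => /(_ sy3) E3.
set X := s * x in E1 sx4 *; set Y := s * y in E2 E3 sy4 *.
have -> : cexp s x y - cexp s 0 0 - s%:C%C * (x +i* y)%C =
  ((expR X - 1 - X) +i* 0)%C + ((expR X - 1) +i* 0)%C * ((cos Y - 1) +i* sin Y)%C +
  ((cos Y - 1) +i* (sin Y - Y))%C.
  rewrite /cexp -/X -/Y !mulr0 expR0 cis0.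
  by apply: complex_ext; rewrite /= /X /Y; ring.
have cx t : cabs (t +i* 0)%C = `|t| by exact: (cabs_real t).
apply: le_trans (cabsD _ _) _.
have b3 : cabs ((cos Y - 1) +i* (sin Y - Y))%C <= 2 * e' * `|Y|.
  by apply: le_trans (cabs_dxdy _ _) _; clear - E2 E3; clearbody e' Y; lra.
have b2 : cabs ((cos Y - 1) +i* sin Y)%C <= 3 * `|Y|.
  apply: le_trans (cabs_dxdy _ _) _.
  have : `|sin Y| <= `|sin Y - Y| + `|Y| by rewrite -{1}[sin Y](subrK Y); exact: ler_normD.
  have : e' * `|Y| <= `|Y| by rewrite ler_piMl.
  by clear - E2 E3; clearbody e' Y; lra.
have b1 : `|expR X - 1| <= e'.
  have : `|expR X - 1| <= `|expR X - 1 - X| + `|X| by rewrite -{1}[expR X - 1](subrK X); exact: ler_normD.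
  have : e' * `|X| <= `|X| by rewrite ler_piMl.
  by clear - E1 sx4; clearbody e' X; lra.
have T : cabs (((expR X - 1 - X) +i* 0)%C + ((expR X - 1) +i* 0)%C * ((cos Y - 1) +i* sin Y)%C)
   <= e' * `|X| + e' * (3 * `|Y|).
  apply: le_trans (cabsD _ _) _; rewrite cabsM !cx; apply: lerD => //.
  by apply: ler_pM => //; rewrite cabs_ge0.
apply: le_trans (lerD T b3) _.
apply: (@le_trans _ _ (8 * e' * (`|s| + 1) * (`|x| + `|y|))); last by rewrite ler_wpM2r ?addr_ge0.
rewrite /X /Y !normrM.
have : 0 <= e' * `|x| by rewrite mulr_ge0// ltW.
have : 0 <= e' * `|y| by rewrite mulr_ge0// ltW.
have : 0 <= e' * (`|s| * `|x|) by rewrite !mulr_ge0// ltW.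
have : 0 <= e' * (`|s| * `|y|) by rewrite !mulr_ge0// ltW.
by clear; clearbody e'; lra.
Qed.

(** The exponential is multiplicative, so its expansion at any point is the one at 0 times the value
    at that point. *)
Lemma cexp_cr s x0 y0 : cr_at (cexp s) x0 y0.
Proof.
have [l hl] := cexp_cr0 s; exists (cexp s x0 y0 * l) => e e0.
have C0 : 0 < cabs (cexp s x0 y0) + 1 by rewrite ltr_wpDl ?cabs_ge0.
have eC : 0 < e / (cabs (cexp s x0 y0) + 1) by rewrite divr_gt0.
have [d d0 hd] := hl _ eC; exists d => // x y xd yd.
have := hd (x - x0) (y - y0); rewrite !subr0 => /(_ xd yd) h.
have -> : cexp s x y - cexp s x0 y0 - cexp s x0 y0 * l * ((x - x0) +i* (y - y0))%C =
  cexp s x0 y0 * (cexp s (x - x0) (y - y0) - cexp s 0 0 - l * ((x - x0) +i* (y - y0))%C).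
  have e1 : cexp s x y = cexp s x0 y0 * cexp s (x - x0) (y - y0).
    by rewrite -cexpD !subrKC.
  have e2 : cexp s 0 0 = 1 by rewrite /cexp !mulr0 expR0 cis0 mul1r.
  by rewrite e1 e2; ring.
rewrite cabsM; apply: le_trans (ler_wpM2l (cabs_ge0 _) h) _.
set N := _ + _; rewrite mulrA; apply: ler_wpM2r; first by rewrite addr_ge0.
by rewrite mulrCA ler_piMr ?(ltW e0)// ler_pdivrMr// mul1r lerDl.
Qed.

End CircleMeans.

(** * Rules of conjugation *)

Section Conj.
Context {R : realType}.
Implicit Types z w : R[i].

Lemma cconjM z w : (z * w)^* = z^* * w^*.
Proof. by apply: complex_ext; rewrite ?(Re_conj, Im_conj, ReM, ImM); ring. Qed.

Lemma cconjB z w : (z - w)^* = z^* - w^*.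
Proof. by apply: complex_ext; rewrite ?(Re_conj, Im_conj, ReD, ImD, ReN, ImN); ring. Qed.

Lemma cconjK z : (z^* )^* = z.
Proof. by apply: complex_ext; rewrite ?(Re_conj, Im_conj) ?opprK. Qed.

Lemma cconjX z n : (z ^+ n)^* = z^* ^+ n.
Proof. by elim: n => [|n IH]; rewrite ?expr0 ?exprS ?cconjM ?IH//; apply: complex_ext; rewrite /= ?oppr0. Qed.
End Conj.

(** * Means and Fourier coefficients on the circle, Bessel's inequality *)

Section BoundedMeasurable.
Context {R : realType}.
Local Notation leb := (@lebesgue_measure R).
Local Notation tau := (2 * pi : R).
Local Notation I := (`[0%R, tau]%classic : set R).
Implicit Types (u v : R -> R[i]) (k : R).

(** Bounded measurable functions form an algebra that contains the Dini quotient, which need not be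
    continuous at the ends of the period. *)
Definition bm u := [/\ measurable_fun I (fun y => complex.Re (u y)),
  measurable_fun I (fun y => complex.Im (u y)) &
  exists M : R, forall y, I y -> cabs (u y) <= M].

Lemma tau_gt0 : 0 < tau.
Proof. by rewrite mulr_gt0// pi_gt0. Qed.

Lemma bm_integrable (h : R -> R) (M : R) : measurable_fun I h -> (forall y, I y -> `|h y| <= M) ->
  leb.-integrable I (EFin \o h).
Proof.
move=> mh bh; apply: measurable_bounded_integrable => //.
  change (leb (`[0%R, tau]%classic : set R) < +oo)%E.
  by rewrite lebesgue_measure_itv/= lte_fin tau_gt0 -EFinB ltry.
exists M; split; first exact: num_real.
by move=> K MK y Iy /=; apply: le_trans (ltW MK); exact: bh.
Qed.

Lemma bm_int u : bm u -> leb.-integrable I (EFin \o (fun y => complex.Re (u y))) /\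
  leb.-integrable I (EFin \o (fun y => complex.Im (u y))).
Proof.
move=> [mr mi [M hM]]; split; apply: (@bm_integrable _ M) => // y /hM.
  exact: le_trans (cabs_Re _).
exact: le_trans (cabs_Im _).
Qed.

Lemma bmD u v : bm u -> bm v -> bm (fun y => u y + v y).
Proof.
move=> [a1 a2 [M aM]] [b1 b2 [N bN]]; split.
- have -> : (fun y => complex.Re (u y + v y)) = (fun y => complex.Re (u y) + complex.Re (v y)).
    by apply/funext => y; rewrite ReD.
  exact: measurable_funD.
- have -> : (fun y => complex.Im (u y + v y)) = (fun y => complex.Im (u y) + complex.Im (v y)).
    by apply/funext => y; rewrite ImD.
  exact: measurable_funD.
- by exists (M + N) => y Iy; apply: le_trans (cabsD _ _) _; apply: lerD; [exact: aM|exact: bN].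
Qed.

Lemma bmM u v : bm u -> bm v -> bm (fun y => u y * v y).
Proof.
move=> [a1 a2 [M aM]] [b1 b2 [N bN]]; split.
- have -> : (fun y => complex.Re (u y * v y)) = (fun y => complex.Re (u y) * complex.Re (v y) -
      complex.Im (u y) * complex.Im (v y)) by apply/funext => y; rewrite ReM.
  by apply: measurable_funB; exact: measurable_funM.
- have -> : (fun y => complex.Im (u y * v y)) = (fun y => complex.Re (u y) * complex.Im (v y) +
      complex.Im (u y) * complex.Re (v y)) by apply/funext => y; rewrite ImM.
  by apply: measurable_funD; exact: measurable_funM.
- exists (M * N) => y Iy; rewrite cabsM.
  by apply: ler_pM; rewrite ?cabs_ge0//; [exact: aM|exact: bN].
Qed.

Lemma bm_conj u : bm u -> bm (fun y => (u y)^*).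
Proof.
move=> [a1 a2 [M aM]]; split.
- by have -> : (fun y => complex.Re (u y)^*) = (fun y => complex.Re (u y))
    by apply/funext => y; rewrite Re_conj.
- have -> : (fun y => complex.Im (u y)^*) = (fun y => - complex.Im (u y))
    by apply/funext => y; rewrite Im_conj.
  exact: measurableT_comp.
- by exists M => y Iy; rewrite cabs_conj; exact: aM.
Qed.

Lemma bm_cst (c : R[i]) : bm (fun=> c).
Proof. by split; [exact: measurable_cst..|exists (cabs c)]. Qed.

Lemma bm_cis k : bm (fun y => cis (k * y)).
Proof.
have cl : continuous (fun y : R => k * y) by move=> y; apply: cvgM; [exact: cvg_cst|exact: cvg_id].
split.
- apply: measurable_funTS; apply: continuous_measurable_fun => y.
  by apply: (@continuous_comp _ _ _ (fun y => k * y) cos); [exact: cl|exact: continuous_cos].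
- apply: measurable_funTS; apply: continuous_measurable_fun => y.
  by apply: (@continuous_comp _ _ _ (fun y => k * y) sin); [exact: cl|exact: continuous_sin].
- by exists 1 => y _; rewrite cabs_cis.
Qed.

Lemma bm_cont u : (forall y, I y -> {for y, continuous (fun y => complex.Re (u y))}) ->
  (forall y, I y -> {for y, continuous (fun y => complex.Im (u y))}) -> bm u.
Proof.
move=> cr ci.
have w1 : {within I, continuous (fun y => complex.Re (u y))}.
  by apply: continuous_in_subspaceT => y; rewrite inE => /cr.
have w2 : {within I, continuous (fun y => complex.Im (u y))}.
  by apply: continuous_in_subspaceT => y; rewrite inE => /ci.
have mI : measurable I by exact: measurable_itv.
have bd (h : R -> R) : {within I, continuous h} -> exists M : R, forall y, I y -> `|h y| <= M.
  move=> ch; have [c _ hc] := @EVT_max R h 0 tau (ltW tau_gt0) ch.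
  have [d _ hd] := @EVT_min R h 0 tau (ltW tau_gt0) ch.
  exists (`|h c| + `|h d|) => y Iy; have := hc y Iy; have := hd y Iy.
  rewrite ler_norml; have := ler_norm (h c); have := ler_norm (- h d); rewrite normrN.
  have := normr_ge0 (h c); have := normr_ge0 (h d); lra.
have [M1 h1] := bd _ w1; have [M2 h2] := bd _ w2.
split; [exact: subspace_continuous_measurable_fun..|].
exists (M1 + M2) => y Iy; apply: le_trans (cabs_ReIm _) _.
by apply: lerD; [exact: h1|exact: h2].
Qed.

Definition cmean u : R[i] := (tau^-1)%:C%C *
  (cint1 (fun y => complex.Re (u y)) 0 tau +i* cint1 (fun y => complex.Im (u y)) 0 tau)%C.

Lemma eq_cmean u v : (forall y, I y -> u y = v y) -> cmean u = cmean v.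
Proof.
move=> uv; rewrite /cmean; congr (_ * (_ +i* _)%C); apply: eq_Rintegral => y; rewrite inE => Iy.
  by rewrite uv.
by rewrite uv.
Qed.

Lemma cmeanD u v : bm u -> bm v -> cmean (fun y => u y + v y) = cmean u + cmean v.
Proof.
move=> hu hv; have [u1 u2] := bm_int hu; have [v1 v2] := bm_int hv.
rewrite /cmean -mulrDr; congr (_ * _); apply: complex_ext => /=.
  by rewrite /cint1; under eq_Rintegral do rewrite ReD; rewrite RintegralD.
by rewrite /cint1; under eq_Rintegral do rewrite ImD; rewrite RintegralD.
Qed.

Lemma cmeanZ (c : R[i]) u : bm u -> cmean (fun y => c * u y) = c * cmean u.
Proof.
move=> hu; have [u1 u2] := bm_int hu.
have iZ a (h : R -> R) : leb.-integrable I (EFin \o h) -> leb.-integrable I (EFin \o (fun y => a * h y)).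
  by move=> ih; apply: (@eq_integrable _ _ _ leb I _ (fun y => a%:E * (EFin \o h) y)%E) => //;
     exact: integrableZl.
rewrite /cmean mulrCA; congr (_ * _); apply: complex_ext => /=.
  rewrite /cint1; under eq_Rintegral do rewrite ReM.
  rewrite RintegralB; [|by []|exact: (iZ (complex.Re c) _ u1)|exact: (iZ (complex.Im c) _ u2)].
  by rewrite !RintegralZl// ReM.
rewrite /cint1; under eq_Rintegral do rewrite ImM.
rewrite RintegralD; [|by []|exact: (iZ (complex.Re c) _ u2)|exact: (iZ (complex.Im c) _ u1)].
by rewrite !RintegralZl// ImM.
Qed.

Lemma cmeanN u : bm u -> cmean (fun y => - u y) = - cmean u.
Proof. by move=> hu; rewrite -mulN1r -cmeanZ//; apply: eq_cmean => y _; rewrite mulN1r. Qed.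

Lemma bmN u : bm u -> bm (fun y => - u y).
Proof.
move=> hu; have := bmM (bm_cst (-1)) hu.
by congr bm; apply/funext => y; rewrite mulN1r.
Qed.

Lemma bmB u v : bm u -> bm v -> bm (fun y => u y - v y).
Proof. by move=> hu hv; apply: bmD => //; exact: bmN. Qed.

Lemma cmeanB u v : bm u -> bm v -> cmean (fun y => u y - v y) = cmean u - cmean v.
Proof. by move=> hu hv; rewrite cmeanD ?cmeanN//; exact: bmN. Qed.

Lemma cmean_conj u : bm u -> cmean (fun y => (u y)^*) = (cmean u)^*.
Proof.
move=> hu; have [u1 u2] := bm_int hu; rewrite /cmean rmorphM/=.
have -> : ((tau^-1)%:C%C)^* = (tau^-1)%:C%C :> R[i] by apply: complex_ext; rewrite /= ?oppr0.
congr (_ * _); apply: complex_ext => /=.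
  by rewrite /cint1; under eq_Rintegral do rewrite Re_conj.
rewrite /cint1; under eq_Rintegral do rewrite Im_conj -mulN1r.
by rewrite RintegralZl// mulN1r.
Qed.

Lemma cmean_cst c : cmean (fun=> c) = c.
Proof.
rewrite /cmean !cint1_cst ?(ltW tau_gt0)// subr0.
have t0 := tau_gt0.
by apply: complex_ext; rewrite ?ReM ?ImM/= ?mul0r ?subr0 ?addr0 mulrCA mulVf ?mulr1 ?(gt_eqF t0).
Qed.

Lemma cmean_Re_ge0 u : (forall y, I y -> 0 <= complex.Re (u y)) -> 0 <= complex.Re (cmean u).
Proof.
move=> h; rewrite /cmean/= mul0r subr0 mulr_ge0// ?invr_ge0 ?(ltW tau_gt0)//.
by apply: Rintegral_ge0 => y /h.
Qed.

(** Real and imaginary parts are estimated separately, whence the factor 2. *)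
Lemma cmean_bound u (M : R) : bm u -> (forall y, I y -> cabs (u y) <= M) ->
  cabs (cmean u) <= 2 * M.
Proof.
move=> hu hM; have [u1 u2] := bm_int hu.
rewrite /cmean cabsM cabs_real gtr0_norm ?invr_gt0 ?tau_gt0// ler_pdivrMl ?tau_gt0//.
apply: le_trans (cabs_ReIm _) _ => /=.
have iM : leb.-integrable I (EFin \o (fun=> M)).
  by apply: (@bm_integrable _ `|M|) => //; exact: measurable_cst.
have b (h : R -> R) : leb.-integrable I (EFin \o h) -> (forall y, I y -> `|h y| <= M) ->
   `|cint1 h 0 tau| <= tau * M.
  move=> ih hb; have iNM : leb.-integrable I (EFin \o (fun=> - M)).
    by apply: (@bm_integrable _ `|M|) => // y _; rewrite normrN.
  have E c : tau * c = cint1 (fun=> c) 0 tau.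
    by rewrite cint1_cst ?(ltW tau_gt0)// subr0 mulrC.
  rewrite ler_norml -mulrN !E; apply/andP; split.
    by apply: le_Rintegral => // y /hb; rewrite ler_norml => /andP[].
  by apply: le_Rintegral => // y /hb; rewrite ler_norml => /andP[].
have -> : tau * (2 * M) = tau * M + tau * M by ring.
apply: lerD; apply: b => // y /hM; [exact: le_trans (cabs_Re _)|exact: le_trans (cabs_Im _)].
Qed.

Lemma cis_per_conj k : cis (k * tau) = 1 -> cos (k * tau) = 1 /\ sin (k * tau) = 0.
Proof. by rewrite /cis => -[-> ->]. Qed.

Lemma cmean_cis k : k != 0 -> cis (k * tau) = 1 -> cmean (fun y => cis (k * y)) = 0.
Proof.
move=> k0 /cis_per_conj[ck sk].
have FTC (F h : R -> R) : (forall x : R, is_derive x (1 : R) F (h x)) -> continuous h ->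
   cint1 h 0 tau = F tau - F 0.
  move=> dF ch; rewrite /cint1 /Rintegral.
  have cF : continuous F by move=> x; apply: differentiable_continuous; apply/derivable1_diffP; case: (dF x).
  rewrite (@continuous_FTC2 R h F 0 tau tau_gt0)//=.
  - by apply: continuous_subspaceT.
  - split; first by move=> x _; case: (dF x).
      exact: cvg_at_right_filter (cF 0).
    exact: cvg_at_left_filter (cF tau).
  - by move=> x _; rewrite derive1E; case: (dF x).
have cl : continuous (fun y : R => k * y) by move=> y; apply: cvgM; [exact: cvg_cst|exact: cvg_id].
have cC : continuous (fun y : R => cos (k * y)).
  move=> y; apply: (@continuous_comp _ _ _ (fun y => k * y) cos); [exact: cl|exact: continuous_cos].
have cS : continuous (fun y : R => sin (k * y)).
  move=> y; apply: (@continuous_comp _ _ _ (fun y => k * y) sin); [exact: cl|exact: continuous_sin].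
have d1 (x : R) : is_derive x (1 : R) (fun y => k^-1 * sin (k * y)) (cos (k * x)).
  by apply: is_derive_eq; rewrite /GRing.scale/= !mulr1 ?mulr0 ?addr0 ?add0r; field.
have d2 (x : R) : is_derive x (1 : R) (fun y => - (k^-1 * cos (k * y))) (sin (k * x)).
  by apply: is_derive_eq; rewrite /GRing.scale/= !mulr1 ?mulr0 ?addr0 ?add0r; field.
have I1 : cint1 (fun y => cos (k * y)) 0 tau = 0.
  by rewrite (FTC _ _ d1 cC) mulr0 sin0 sk mulr0 subrr.
have I2 : cint1 (fun y => sin (k * y)) 0 tau = 0.
  by rewrite (FTC _ _ d2 cS) mulr0 cos0 ck subrr.
by rewrite /cmean I1 I2; apply: complex_ext; rewrite ?ReM ?ImM/= ?mulr0 ?subr0 ?addr0.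
Qed.

(** The frequency is a real number; its integrality is expressed by [cis (k * tau) = 1], which
    treats both signs alike. *)
Definition fhat u k := cmean (fun y => u y * cis (- (k * y))).

Lemma bm_fhat u k : bm u -> bm (fun y => u y * cis (- (k * y))).
Proof. by move=> hu; apply: bmM => //; under eq_fun do rewrite -mulNr; exact: bm_cis. Qed.

Lemma fhat_cis k j : cis (k * tau) = 1 -> cis (j * tau) = 1 ->
  fhat (fun y => cis (k * y)) j = (k == j)%:R.
Proof.
move=> hk hj; rewrite /fhat.
have -> : cmean (fun y => cis (k * y) * cis (- (j * y))) = cmean (fun y => cis ((k - j) * y)).
  by apply: eq_cmean => y _; rewrite -cisD mulrBl.
have [->|kj] := eqVneq k j.
  by rewrite subrr; under [X in cmean X]eq_fun do rewrite mul0r cis0; rewrite cmean_cst.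
rewrite cmean_cis ?subr_eq0//.
by rewrite mulrBl cisD hk mul1r cisN hj conjC1.
Qed.

Definition energy u := complex.Re (cmean (fun y => u y * (u y)^*)).

Lemma energy_ge0 u : 0 <= energy u.
Proof.
apply: cmean_Re_ge0 => y _; rewrite -cnorm2_conj/=; exact: cnorm2_ge0.
Qed.

Lemma energy_sub u k : bm u -> cis (k * tau) = 1 ->
  energy (fun y => u y - fhat u k * cis (k * y)) = energy u - cabs (fhat u k) ^+ 2.
Proof.
have alg (a c e : R[i]) : e * e^* = 1 -> (a - c * e) * (a - c * e)^* =
    a * a^* - c^* * (a * e^* ) - c * (a * e^* )^* + c * c^*.
  move=> ee; have -> : (a * e^* )^* = a^* * e by rewrite cconjM cconjK.
  have -> : (a - c * e)^* = a^* - c^* * e^* by rewrite cconjB cconjM.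
  rewrite -[c * c^* in RHS]mulr1 -ee; ring.
move=> hu hk; rewrite /energy; set c := fhat u k.
have hc := bm_cis k.
have h1 : bm (fun y => u y * (u y)^*) by apply: bmM => //; exact: bm_conj.
have h2 := bm_fhat k hu.
have h2' : bm (fun y => c^* * (u y * cis (- (k * y)))) by apply: bmM => //; exact: bm_cst.
have h3 : bm (fun y => c * (u y * cis (- (k * y)))^*).
  by apply: bmM; [exact: bm_cst|exact: bm_conj].
rewrite (@eq_cmean _ (fun y => u y * (u y)^* - c^* * (u y * cis (- (k * y))) -
   c * (u y * cis (- (k * y)))^* + c * c^*)); last first.
  move=> y _; rewrite cisN; apply: alg.
  by rewrite -cnorm2_conj cnorm2E cabs_cis expr1n.
rewrite cmeanD ?cmeanB//; last 3 first.
- exact: bmB.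
- by apply: bmB => //; exact: bmB.
- exact: bm_cst.
rewrite cmean_cst !cmeanZ//; last exact: bm_conj.
rewrite cmean_conj// -/(fhat u k) -/c.
have -> : c^* * c = c * c^* by rewrite mulrC.
by rewrite subrK ReD ReN -cnorm2_conj/= cnorm2E.
Qed.

(** Components are subtracted one by one: by [energy_sub] each lowers the energy by the square of
    its coefficient, by orthogonality it leaves the later coefficients unchanged, and the final
    energy is nonnegative. The steps [s = 1] and [s = -1] reach the two halves of the spectrum. *)
Lemma bessel u (s : R) : bm u -> cis (s * tau) = 1 -> s != 0 -> forall n,
  \sum_(j < n) cabs (fhat u (j%:R * s)) ^+ 2 <= energy u.
Proof.
move=> hu hs s0.
have per j : cis (j%:R * s * tau) = 1 by rewrite -mulrA -cisX hs expr1n.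
pose r := fix r n := if n is m.+1 then (fun y => r m y - fhat u (m%:R * s) * cis (m%:R * s * y))
   else u.
have hr n : bm (r n) /\ forall j, (n <= j)%N -> fhat (r n) (j%:R * s) = fhat u (j%:R * s).
  elim: n => [//|n [bn IH]].
  have b2 : bm (fun y => fhat u (n%:R * s) * cis (n%:R * s * y)).
    by apply: bmM; [exact: bm_cst|exact: bm_cis].
  split; first exact: bmB.
  move=> j nj; rewrite -(IH _ (ltnW nj)) /fhat/=.
  rewrite (@eq_cmean _ (fun y => r n y * cis (- (j%:R * s * y)) -
    fhat u (n%:R * s) * (cis (n%:R * s * y) * cis (- (j%:R * s * y))))); last first.
    by move=> y _; rewrite mulrBl mulrA.
  rewrite cmeanB; [|exact: bm_fhat|by apply: bmM; [exact: bm_cst|apply: bm_fhat; exact: bm_cis]].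
  rewrite cmeanZ; last by apply: bm_fhat; exact: bm_cis.
  rewrite -/(fhat (fun y => cis (n%:R * s * y)) (j%:R * s)) fhat_cis//.
  rewrite (inj_eq (mulIf s0)) eqr_nat ltn_eqF// mulr0 subr0//.
have E n : energy (r n) = energy u - \sum_(j < n) cabs (fhat u (j%:R * s)) ^+ 2.
  elim: n => [|n IH]; first by rewrite big_ord0 subr0.
  have [bn hn] := hr n; have := energy_sub bn (per n); rewrite (hn n (leqnn n)) => E1.
  by rewrite big_ord_recr/= opprD addrA -IH -E1.
by move=> n; have := energy_ge0 (r n); rewrite E subr_ge0.
Qed.

End BoundedMeasurable.

(** * Taylor expansion of holomorphic functions through Fourier series on circles *)

Section Taylor.
Context {R : realType}.
Local Notation leb := (@lebesgue_measure R).
Local Notation tau := (2 * pi : R).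
Local Notation I := (`[0%R, tau]%classic : set R).

Lemma cint1_shift (h : R -> R) (a b c : R) : a <= b -> continuous h ->
  cint1 (fun y => h (y + c)) a b = cint1 h (a + c) (b + c).
Proof.
move=> ab ch; rewrite /cint1 /Rintegral; congr fine.
have d1 (x : R) : is_derive x (1 : R) (fun y => y + c) 1.
  by apply: is_derive_eq; rewrite addr0.
have dE : (fun y : R => y + c)^`() = fun=> 1.
  by apply/funext => x; rewrite derive1E; case: (d1 x).
have cF : continuous (fun y : R => y + c) by move=> x; apply: cvgD; [exact: cvg_id|exact: cvg_cst].
rewrite (@integration_by_substitution_increasing R (fun y => y + c) h a b ab).
- by apply: eq_integral => x _ /=; rewrite dE /GRing.mul/= mulr1.
- by move=> x y _ _; rewrite ltrD2r.
- by rewrite dE => x _; exact: cst_continuous.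
- by rewrite dE; exact: is_cvg_cst.
- by rewrite dE; exact: is_cvg_cst.
- split; first by move=> x _; case: (d1 x).
    exact: cvg_at_right_filter (cF a).
  exact: cvg_at_left_filter (cF b).
- by apply: continuous_subspaceT.
Qed.

Lemma cint1_periodic (h : R -> R) (c : R) : 0 <= c <= tau -> continuous h ->
  (forall y, h (y + tau) = h y) -> cint1 (fun y => h (y + c)) 0 tau = cint1 h 0 tau.
Proof.
move=> /andP[c0 ct] ch per; have t0 := @tau_gt0 R.
have con a b : cont_on h a b by move=> x _; exact: ch.
rewrite cint1_shift ?(ltW t0)// add0r.
rewrite (cint1_split (c := tau) ct _ (con _ _)); last by rewrite lerDl.
rewrite (cint1_split (c := c) c0 ct (con _ _)) addrC; congr (_ + _).
have -> : cint1 h tau (tau + c) = cint1 h (0 + tau) (c + tau) by rewrite add0r addrC.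
rewrite -cint1_shift//; apply: eq_Rintegral => y _; exact: per.
Qed.

Variable f : R[i] -> R[i].
Hypothesis hf : forall z, cabs z < 1 -> derivable (f : R[i]^o -> R[i]^o) z 1.

Lemma cr_cst (w : R[i]) x0 y0 : cr_at (fun _ _ => w) x0 y0.
Proof.
exists 0 => e e0; exists 1 => // x y _ _.
by rewrite subrr mul0r subr0 cabs0 mulr_ge0 ?addr_ge0// ltW.
Qed.

Lemma cabs_cexp (s x y : R) : cabs (cexp s x y) = expR (s * x).
Proof. by rewrite cabsM cabs_cis mulr1 cabs_real ger0_norm// expR_ge0. Qed.

Lemma scale_lt1 (x : R) (z : R[i]) : x <= 0 -> cabs z < 1 -> cabs ((expR x)%:C%C * z) < 1.
Proof.
move=> x0; apply: le_lt_trans; rewrite cabsM cabs_real ger0_norm; last exact: expR_ge0.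
by apply: ler_piMl; [exact: cabs_ge0|rewrite -expR0 ler_expR].
Qed.

Lemma cr_holo (z : R[i]) x y : cabs z * expR x < 1 ->
  cr_at (fun x y => f (z * cexp 1 x y)) x y.
Proof.
move=> h; apply: cr_comp.
  by apply: hf; rewrite cabsM cabs_cexp mul1r.
by apply: cr_mul; [exact: cr_cst|exact: cexp_cr].
Qed.

Lemma cr_continuous (g : R -> R -> R[i]) (x0 y0 : R) : cr_at g x0 y0 ->
  {for y0, continuous (fun y => complex.Re (g x0 y))} /\
  {for y0, continuous (fun y => complex.Im (g x0 y))}.
Proof.
move=> hg; have [_ c1] := closed_form_continuous (cr_closed1 hg).
by have [_ c2] := closed_form_continuous (cr_closed2 hg).
Qed.

Lemma cexp1_0 y : cexp 1 0 y = cis y :> R[i].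
Proof. by rewrite /cexp mulr0 expR0 !mul1r. Qed.

Lemma circ_continuous (z : R[i]) : cabs z < 1 ->
  continuous (fun y => complex.Re (f (z * cis y))) /\
  continuous (fun y => complex.Im (f (z * cis y))).
Proof.
move=> z1; have h y : cr_at (fun x y => f (z * cexp 1 x y)) 0 y.
  by apply: cr_holo; rewrite expR0 mulr1.
split=> y; have [h1 h2] := cr_continuous (h y).
  by rewrite (_ : (fun y => _) = (fun y => complex.Re (f (z * cexp 1 0 y))))//; apply/funext => t; rewrite cexp1_0.
by rewrite (_ : (fun y => _) = (fun y => complex.Im (f (z * cexp 1 0 y))))//; apply/funext => t; rewrite cexp1_0.
Qed.

Lemma bm_circ (z : R[i]) : cabs z < 1 -> bm (fun y => f (z * cis y)).
Proof. by move=> /circ_continuous[c1 c2]; apply: bm_cont => y _; [exact: c1|exact: c2]. Qed.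

(** The circle is parametrised from [z], so that for [f] with Taylor coefficients [a_n] this is the
    whole term [a_n * z ^ n] when [k = n]. *)
Definition fcoef k (z : R[i]) := fhat (fun y => f (z * cis y)) k.

(** In logarithmic polar coordinates the annulus between the two circles is the rectangle [[x, 0] x
    [0, tau]]. Goursat's theorem is applied there to [f (z e^(a + i y)) e^(- k (a + i y))]. *)
Lemma fcoef_scale k x z : x <= 0 -> cabs z < 1 -> cis (k * tau) = 1 ->
  fcoef k ((expR x)%:C%C * z) = (expR (k * x))%:C%C * fcoef k z.
Proof.
move=> x0 z1 hk.
pose g (a y : R) := f (z * cexp 1 a y) * cexp (- k) a y.
have crg a y : a <= 0 -> cr_at g a y.
  move=> a0; apply: cr_mul; last exact: cexp_cr.
  apply: cr_holo; apply: le_lt_trans z1; rewrite ler_piMr ?cabs_ge0//.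
  by rewrite -expR0 ler_expR.
have per a : g a tau = g a 0.
  rewrite /g /cexp !mul1r !mulr0 cis0 cis2pi.
  by rewrite (mulNr k tau) cisN hk (_ : 1^* = 1 :> R[i])//; apply: complex_ext; rewrite /= ?oppr0.
have t0 := ltW (@tau_gt0 R).
have C1 : circ (fun a y => complex.Im (g a y)) (fun a y => complex.Re (g a y)) x 0 0 tau = 0.
  by apply: goursat => // a y /andP[_ a0] _; apply: cr_closed1; exact: crg.
have C2 : circ (fun a y => - complex.Re (g a y)) (fun a y => complex.Im (g a y)) x 0 0 tau = 0.
  by apply: goursat => // a y /andP[_ a0] _; apply: cr_closed2; exact: crg.
(* The horizontal sides cancel by periodicity; only the means over the vertical sides remain. *)
have E : cmean (g x) = cmean (g 0).
  have p1 : (fun a => complex.Im (g a 0)) = (fun a => complex.Im (g a tau)) by apply/funext => a; rewrite per.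
  have p2 : (fun a => - complex.Re (g a 0)) = (fun a => - complex.Re (g a tau)) by apply/funext => a; rewrite per.
  rewrite /circ p1 subrr add0r in C1; rewrite /circ p2 subrr add0r in C2.
  by rewrite /cmean -(subr0_eq C1) -(subr0_eq C2).
clear C1 C2; have ez := scale_lt1 x0 z1.
have E1 : cmean (g x) = (expR (- k * x))%:C%C * fcoef k ((expR x)%:C%C * z).
  rewrite /fcoef /fhat -cmeanZ; last by apply: bm_fhat; exact: bm_circ.
  apply: eq_cmean => y _; rewrite /g /cexp !mul1r (mulNr k y).
  have -> : z * ((expR x)%:C%C * cis y) = (expR x)%:C%C * z * cis y by ring.
  by ring.
have E2 : cmean (g 0) = fcoef k z.
  apply: eq_cmean => y _; rewrite /g cexp1_0 /cexp mulr0 expR0 mulNr.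
  rewrite (_ : 1%:C%C = 1 :> R[i]); last exact: erefl.
  by rewrite mul1r.
rewrite -E2 -E E1 mulrA -rmorphM/= -expRD mulNr subrr expR0.
rewrite (_ : 1%:C%C = 1 :> R[i]); last exact: erefl.
  by rewrite mul1r.
Qed.

(** When the circle shrinks to 0, [f] stays bounded on it while the factor of [fcoef_scale] blows up
    for negative [k]. *)
Lemma fcoef_neg k z : k < 0 -> cabs z < 1 -> cis (k * tau) = 1 -> fcoef k z = 0.
Proof.
move=> k0 z1 hk; apply/eqP; rewrite -cabs_eq0 eq_le cabs_ge0 andbT; apply/ler_addgt0Pr => e e0.
rewrite add0r.
have z0 : cabs (0 : R[i]) < 1 by rewrite cabs0 ltr01.
have [d d0 hd] := @holo_continuous R f 0 (hf z0) 1 ltr01.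
pose B := 2 * (cabs (f 0) + 1).
have B0 : 0 < B by rewrite mulr_gt0// ltr_wpDl ?cabs_ge0.
(* The first entry puts the circle of radius [e^(-t) |z|] in the region where [f] is within 1 of
   [f 0]; the second makes [B / (- k * t) <= e], through [expR (- s) <= s^-1]. *)
pose t := Num.max (d^-1) (B / e / - k).
have t0 : 0 < t by rewrite lt_max invr_gt0 d0.
have nk : 0 < - k by rewrite oppr_gt0.
have et (s : R) : 0 < s -> expR (- s) <= s^-1.
  move=> s0; rewrite expRN lef_pV2 ?posrE ?expR_gt0//.
  by apply: le_trans (expR_ge1Dx s); rewrite lerDr.
have S := @fcoef_scale k (- t) z ltac:(by rewrite oppr_le0 ltW) z1 hk.
have bz : cabs ((expR (- t))%:C%C * z) < d.
  rewrite cabsM cabs_real ger0_norm ?expR_ge0//.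
  apply: (@lt_le_trans _ _ (t^-1)).
    apply: le_lt_trans (ler_wpM2r (cabs_ge0 z) (et t t0)) _.
    by rewrite gtr_pMr ?invr_gt0.
  by rewrite invf_ple ?posrE// le_max lexx.
have ez : cabs ((expR (- t))%:C%C * z) < 1 by apply: scale_lt1 => //; rewrite oppr_le0 ltW.
have bF : cabs (fcoef k ((expR (- t))%:C%C * z)) <= B.
  apply: cmean_bound; first by apply: bm_fhat; exact: bm_circ.
  move=> y _; rewrite cabsM cabs_cis mulr1 addrC.
  set w := _ * _ * cis y; rewrite -[f w](subrK (f 0)).
  apply: le_trans (cabsD _ _) _; rewrite lerD2r ltW//; apply: hd.
  by rewrite subr0 /w cabsM cabs_cis mulr1.
have E : fcoef k z = (expR (- (- k * t)))%:C%C * fcoef k ((expR (- t))%:C%C * z).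
  rewrite S mulrA -rmorphM/= -expRD (_ : - (- k * t) + k * - t = 0) ?expR0; last by ring.
  rewrite (_ : 1%:C%C = 1 :> R[i]); last exact: erefl.
  by rewrite mul1r.
rewrite E cabsM cabs_real ger0_norm ?expR_ge0//.
have kt : 0 < - k * t by rewrite mulr_gt0.
apply: le_trans (ler_pM (expR_ge0 _) (cabs_ge0 _) (et _ kt) bF) _.
rewrite ler_pdivrMl// -ler_pdivrMr//.
have : B / e / - k <= t by rewrite le_max lexx orbT.
by move=> h; rewrite [leRHS]mulrC -ler_pdivrMr.
Qed.

(** At frequency 0 the coefficient does not depend on the radius, so the circle may shrink to the
    centre. *)
Lemma fcoef0 z : cabs z < 1 -> fcoef 0 z = f 0.
Proof.
move=> z1; apply/eqP; rewrite -subr_eq0 -cabs_eq0 eq_le cabs_ge0 andbT; apply/ler_addgt0Pr => e e0.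
rewrite add0r.
have z0 : cabs (0 : R[i]) < 1 by rewrite cabs0 ltr01.
have [d d0 hd] := @holo_continuous R f 0 (hf z0) (e / 2) (divr_gt0 e0 (ltr0Sn _ _)).
have t0 : - d^-1 <= 0 by rewrite oppr_le0 invr_ge0 ltW.
have hk : cis (0 * tau) = 1 by rewrite mul0r cis0.
have := fcoef_scale t0 z1 hk; rewrite mul0r expR0 (_ : 1%:C%C = 1 :> R[i])// mul1r => <-.
have ez := scale_lt1 t0 z1.
have bz : cabs ((expR (- d^-1))%:C%C * z) < d.
  rewrite cabsM cabs_real ger0_norm ?expR_ge0//.
  have h : expR (- d^-1) <= d.
    rewrite expRN invf_ple ?posrE ?expR_gt0//.
    by apply: le_trans (expR_ge1Dx _); rewrite lerDr.
  apply: (@le_lt_trans _ _ (d * cabs z)); first by rewrite ler_wpM2r ?cabs_ge0.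
  by rewrite gtr_pMr.
rewrite /fcoef /fhat -(cmean_cst (f 0)) -cmeanB; [|apply: bm_fhat; exact: bm_circ|exact: bm_cst].
have -> : e = 2 * (e / 2) by field.
apply: cmean_bound.
  by apply: bmB; [apply: bm_fhat; exact: bm_circ|exact: bm_cst].
move=> y _; rewrite mul0r oppr0 cis0 mulr1 ltW//; apply: hd.
by rewrite subr0 cabsM cabs_cis mulr1.
Qed.

(** Moving the base point shifts the angle, and a mean over a full period does not see the shift. *)
Lemma fcoef_rot k z c : 0 <= c <= tau -> cabs z < 1 -> cis (k * tau) = 1 ->
  fcoef k (z * cis c) = cis (k * c) * fcoef k z.
Proof.
move=> hc z1 hk; rewrite /fcoef /fhat.
have bz := bm_fhat k (bm_circ z1).
rewrite -cmeanZ//; pose u y := cis (k * c) * (f (z * cis y) * cis (- (k * y))).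
have pu y : u (y + tau) = u y.
  rewrite /u [cis (y + _)]cisD cis2pi mulr1 mulrDr opprD cisD [cis (- (k * tau))]cisN hk.
  by rewrite (_ : 1^* = 1 :> R[i]) ?mulr1//; apply: complex_ext; rewrite /= ?oppr0.
have [c1 c2] := circ_continuous z1.
have ck (a : R) : continuous (fun y : R => cos (a * y)) /\ continuous (fun y : R => sin (a * y)).
  have cl : continuous (fun y : R => a * y) by move=> y; apply: cvgM; [exact: cvg_cst|exact: cvg_id].
  split=> y.
    by apply: (@continuous_comp _ _ _ (fun y => a * y) cos); [exact: cl|exact: continuous_cos].
  by apply: (@continuous_comp _ _ _ (fun y => a * y) sin); [exact: cl|exact: continuous_sin].
have [e1 e2] := ck (- k).
pose v y := f (z * cis y) * cis (- k * y).
have uv : u = fun y => cis (k * c) * v y by apply/funext => y; rewrite /u /v mulNr.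
have cv1 : continuous (fun y => complex.Re (v y)).
  have -> : (fun y => complex.Re (v y)) = fun y => complex.Re (f (z * cis y)) * cos (- k * y) -
     complex.Im (f (z * cis y)) * sin (- k * y) by apply/funext => y; rewrite /v ReM.
  by move=> y; apply: cvgB; apply: cvgM; [exact: c1|exact: e1|exact: c2|exact: e2].
have cv2 : continuous (fun y => complex.Im (v y)).
  have -> : (fun y => complex.Im (v y)) = fun y => complex.Re (f (z * cis y)) * sin (- k * y) +
     complex.Im (f (z * cis y)) * cos (- k * y) by apply/funext => y; rewrite /v ImM.
  by move=> y; apply: cvgD; apply: cvgM; [exact: c1|exact: e2|exact: c2|exact: e1].
have cst (a : R) (y : R) : (fun=> a) @ y --> a by exact: cvg_cst.
have cu1 : continuous (fun y => complex.Re (u y)).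
  have -> : (fun y => complex.Re (u y)) = fun y => cos (k * c) * complex.Re (v y) -
     sin (k * c) * complex.Im (v y) by apply/funext => y; rewrite uv ReM.
  by move=> y; apply: cvgB; apply: cvgM; [exact: cst|exact: cv1|exact: cst|exact: cv2].
have cu2 : continuous (fun y => complex.Im (u y)).
  have -> : (fun y => complex.Im (u y)) = fun y => cos (k * c) * complex.Im (v y) +
     sin (k * c) * complex.Re (v y) by apply/funext => y; rewrite uv ImM.
  by move=> y; apply: cvgD; apply: cvgM; [exact: cst|exact: cv2|exact: cst|exact: cv1].
transitivity (cmean (fun y => u (y + c))).
  apply: eq_cmean => y _; rewrite /u [cis (y + c)]cisD.
  have -> : z * cis c * cis y = z * (cis y * cis c) by ring.
  have -> : cis (- (k * y)) = cis (k * c) * cis (- (k * (y + c))).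
    by rewrite -cisD; congr cis; ring.
  by ring.
rewrite /cmean; congr (_ * (_ +i* _)%C).
  by apply: (@cint1_periodic (fun y => complex.Re (u y))) => // y; rewrite pu.
by apply: (@cint1_periodic (fun y => complex.Im (u y))) => // y; rewrite pu.
Qed.

Lemma cinvE (w : R[i]) : w^-1 = w^* * ((cnorm2 w)^-1)%:C%C.
Proof.
have [->|w0] := eqVneq w 0.
  by rewrite invr0 (_ : 0^* = 0 :> R[i]) ?mul0r//; apply: complex_ext; rewrite /= ?oppr0.
apply: (mulfI w0); rewrite divff// mulrA -cnorm2_conj -rmorphM/= divff//.
by rewrite cnorm2E expf_neq0// cabs_eq0.
Qed.

(** The difference quotient of Dini's criterion; where [cis y = 1], division by zero gives it the
    value 0. *)
Definition dini (z : R[i]) (y : R) := (f (z * cis y) - f z) / (1 - cis y).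

(** Inside the period the chord does not vanish and its inverse is continuous; the two endpoints are
    split off as singletons. *)
Lemma measurable_inv_chord : measurable_fun I (fun y => (cnorm2 (1 - cis y))^-1).
Proof.
have E (y : R) : cnorm2 (1 - cis y) = 2 - 2 * cos y.
  by rewrite /cnorm2 !ReD !ImD !ReN !ImN/=; have := cos2Dsin2 y; nra.
have t0 := @tau_gt0 R.
have -> : I = `]0, tau[%classic `|` ([set 0] `|` [set tau]).
  apply/seteqP; split=> y; rewrite /= !in_itv/=.
    move=> /andP[]; rewrite le_eqVlt => /orP[/eqP<- _|y0]; first by right; left.
    by rewrite le_eqVlt => /orP[/eqP->|yt]; [right; right|left; rewrite y0].
  by case=> [/andP[/ltW-> /ltW->]|[->|->]]; rewrite ?lexx ?(ltW t0).
apply/measurable_funU => //; [exact: measurableU|split]; last first.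
  by apply/measurable_funU => //; split; exact: measurable_fun_set1.
apply: open_continuous_measurable_fun; first exact: interval_open.
move=> y; rewrite inE/= in_itv/= => /andP[y0 yt].
rewrite (_ : (fun y => _) = fun y => (2 - 2 * cos y)^-1); last by apply/funext => t; rewrite E.
apply: cvgV.
  have s0 : 0 < sin (y / 2) by apply: sin_gt0_pi; apply/andP; split; lra.
  have -> : cos y = cos (y / 2 + y / 2) by rewrite -splitr.
  by rewrite cosD gt_eqF//; have := cos2Dsin2 (y / 2); nra.
apply: cvgB; first exact: cvg_cst.
by apply: cvgM; [exact: cvg_cst|exact: continuous_cos].
Qed.

(** For [z cis y] close to [z], differentiability bounds the quotient by [|l| + 1], as the increment
    of the argument is at most the chord. Otherwise the chord is at least [d]. *)
Lemma bm_dini z : cabs z < 1 -> bm (dini z).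
Proof.
move=> z1; have bz := bm_circ z1.
have bN : bm (fun y => (f (z * cis y) - f z) * (1 - cis y)^* ).
  apply: bmM; first by apply: bmB => //; exact: bm_cst.
  apply: bm_conj; apply: bmB; first exact: bm_cst.
  by have := bm_cis (1 : R); under eq_fun do rewrite mul1r.
have E y : dini z y = (f (z * cis y) - f z) * (1 - cis y)^* * ((cnorm2 (1 - cis y))^-1)%:C%C.
  by rewrite /dini cinvE mulrA.
have mI := measurable_inv_chord.
case: bN => n1 n2 _; split.
- have -> : (fun y => complex.Re (dini z y)) = fun y => complex.Re ((f (z * cis y) - f z) * (1 - cis y)^* ) *
    (cnorm2 (1 - cis y))^-1 by apply/funext => y; rewrite E ReM/= mulr0 subr0.
  exact: measurable_funM.
- have -> : (fun y => complex.Im (dini z y)) = fun y => complex.Im ((f (z * cis y) - f z) * (1 - cis y)^* ) *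
    (cnorm2 (1 - cis y))^-1 by apply/funext => y; rewrite E ImM/= mulr0 add0r.
  exact: measurable_funM.
have [l hl] := @derivable_cabs R f z (hf z1); have [d d0 hd] := hl 1 ltr01.
have [_ _ [B hB]] := bz.
exists (cabs l + 1 + (B + cabs (f z)) / d) => y Iy.
have B0 : 0 <= B + cabs (f z) by rewrite addr_ge0 ?cabs_ge0// (le_trans (cabs_ge0 _) (hB y Iy)).
rewrite /dini cabsM cabsV; set D := cabs (1 - cis y).
have [D0|D0] := eqVneq D 0.
  by rewrite D0 invr0 mulr0 !addr_ge0 ?cabs_ge0// divr_ge0// ltW.
have Dp : 0 < D by rewrite lt_neqAle eq_sym D0 cabs_ge0.
have zD : cabs (z * cis y - z) = cabs z * D by rewrite -{2}[z]mulr1 -mulrBr cabsM cabsB.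
rewrite ler_pdivrMr//.
have [h|h] := ltP (cabs (z * cis y - z)) d.
  apply: (@le_trans _ _ ((cabs l + 1) * D)); last first.
    by rewrite ler_wpM2r ?(ltW Dp)// lerDl divr_ge0// ltW.
  rewrite -[f (z * cis y) - f z](subrK (l * (z * cis y - z))).
  apply: le_trans (cabsD _ _) _; rewrite addrC cabsM mulrDl.
  have zD' : cabs (z * cis y - z) <= D by rewrite zD ler_piMl ?(ltW Dp)// ltW.
  apply: lerD; first by rewrite ler_wpM2l ?cabs_ge0.
  by apply: le_trans (hd _ h) _; rewrite !mul1r.
apply: (@le_trans _ _ (B + cabs (f z))).
  by apply: le_trans (cabsD _ _) _; rewrite cabsN lerD2r; exact: hB.
apply: (@le_trans _ _ ((B + cabs (f z)) / d * D)); last first.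
  by rewrite ler_wpM2r ?(ltW Dp)// lerDr addr_ge0 ?cabs_ge0.
rewrite mulrAC ler_pdivlMr// ler_wpM2l//; apply: le_trans h _.
by rewrite zD ler_piMl ?(ltW Dp)// ltW.
Qed.

(** Multiplying by [1 - cis y] turns a Fourier coefficient into the difference of two consecutive
    ones. *)
Lemma dini_step z k : cabs z < 1 -> cis (k * tau) = 1 ->
  fhat (dini z) k - fhat (dini z) (k - 1) = fcoef k z - f z * (k == 0)%:R.
Proof.
move=> z1 hk; have bd := bm_dini z1; have bz := bm_circ z1.
rewrite /fcoef -[X in f z * (X == _)%:R]/k.
have -> : (k == 0)%:R = fhat (fun y => cis (0 * y)) k.
  by rewrite fhat_cis// ?mul0r ?cis0// eq_sym.
rewrite {3 4}/fhat -cmeanZ; last by apply: bm_fhat; exact: bm_cis.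
rewrite /fhat -!cmeanB; try exact: bm_fhat; last first.
  by apply: bmM; [exact: bm_cst|apply: bm_fhat; exact: bm_cis].
apply: eq_cmean => y _.
have E : dini z y * (1 - cis y) = f (z * cis y) - f z.
  rewrite /dini; have [h|h] := eqVneq (1 - cis y) 0; last by rewrite divfK.
  have c1 : cis y = 1 by move/eqP: h; rewrite subr_eq0 => /eqP.
  by rewrite h mulr0 c1 mulr1 subrr.
have -> : cis (- ((k - 1) * y)) = cis (- (k * y)) * cis y by rewrite -cisD; congr cis; ring.
rewrite mul0r cis0.
have -> : dini z y * cis (- (k * y)) - dini z y * (cis (- (k * y)) * cis y) =
  dini z y * (1 - cis y) * cis (- (k * y)) by ring.
by rewrite E; ring.
Qed.

Lemma cis_nat n : cis (n%:R * tau) = 1.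
Proof. by rewrite -cisX cis2pi expr1n. Qed.

Lemma cis_natN n : cis (- n%:R * tau) = 1.
Proof.
by rewrite mulNr cisN cis_nat; apply: complex_ext; rewrite /= ?oppr0.
Qed.

(** [w] is [z] rotated and contracted by [expR x] with [x <= 0], so [fcoef_scale] and [fcoef_rot]
    compare the two coefficients. Powers are cross-multiplied to avoid quotients. *)
Lemma fcoef_polar n z w : cabs z < 1 -> cabs w < 1 -> cabs w <= cabs z -> w != 0 ->
  fcoef n%:R w * z ^+ n = fcoef n%:R z * w ^+ n.
Proof.
move=> z1 w1 wz w0; have hn := cis_nat n.
have wp : 0 < cabs w by rewrite cabs_gt0.
have zp : 0 < cabs z by exact: lt_le_trans wz.
have z0 : z != 0 by rewrite -cabs_gt0.
have [c hc cE] := polar_form (w / z).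
pose x := ln (cabs w / cabs z).
have ex : expR x = cabs w / cabs z by rewrite lnK// posrE divr_gt0.
have x0 : x <= 0 by apply: ln_le0; rewrite ler_pdivrMr// mul1r.
have wE : w = (expR x)%:C%C * (z * cis c).
  transitivity (w / z * z); first by rewrite divfK.
  by rewrite cE ex cabsM cabsV; ring.
have zc : cabs (z * cis c) < 1 by rewrite cabsM cabs_cis mulr1.
rewrite wE fcoef_scale// fcoef_rot// exprMn exprMn -rmorphXn/= -expRM_natl cisX.
by rewrite [n%:R * x]mulrC; ring.
Qed.

Lemma fcoef_mono n z w : cabs z < 1 -> cabs w < 1 -> z != 0 ->
  fcoef n%:R w * z ^+ n = fcoef n%:R z * w ^+ n.
Proof.
move=> z1 w1 z0; have [->|w0] := eqVneq w 0; last first.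
  by have [wz|/ltW zw] := leP (cabs w) (cabs z); [|apply/esym]; exact: fcoef_polar.
case: n => [|n].
  by rewrite !expr0 !mulr1 mulr0n !fcoef0// cabs0.
rewrite expr0n/= mulr0 (_ : fcoef _ 0 = 0) ?mul0r//.
have -> : fcoef n.+1%:R 0 = f 0 * fhat (fun y => cis (0 * y)) n.+1%:R.
  rewrite /fcoef /fhat -cmeanZ; last by apply: bm_fhat; exact: bm_cis.
  by apply: eq_cmean => y _; rewrite !mul0r cis0 mul1r.
by rewrite fhat_cis ?cis_nat ?mul0r ?cis0// eq_sym pnatr_eq0 mulr0.
Qed.

(* Dini's criterion: the Fourier series on the circle through [z] converges at [z] because
   the difference quotient [dini z] is bounded, and its coefficients tend to 0 by Bessel. *)
Lemma taylor_cvg z : cabs z < 1 -> forall e : R, 0 < e -> exists N0, forall N, (N0 <= N)%N ->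
  cabs (\sum_(j < N) fcoef j%:R z - f z) < e.
Proof.
move=> z1 e e0; have bd := bm_dini z1.
have c1 : cis ((1 : R) * tau) = 1 by rewrite mul1r cis2pi.
have cm1 : cis ((-1 : R) * tau) = 1 by have := cis_natN 1.
(* At negative frequencies [fcoef] vanishes, so [dini_step] makes all the negative coefficients of
   [dini] equal; Bessel's inequality then forces their common value to be 0. *)
have neg n : fhat (dini z) (- n.+1%:R) = fhat (dini z) (-1).
  elim: n => [|n IH]; first by rewrite mulr1n.
  have hk := cis_natN n.+1.
  have := dini_step z1 hk; rewrite fcoef_neg// ?oppr_lt0 ?ltr0n//.
  have -> : (- n.+1%:R == 0 :> R) = false by rewrite oppr_eq0 pnatr_eq0.
  rewrite mulr0 subr0 => /eqP; rewrite subr_eq0 => /eqP e1.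
  by rewrite -IH e1; congr fhat; rewrite -[n.+2%:R]natr1; ring.
have k0 : fhat (dini z) (-1) = 0.
  apply/eqP; rewrite -cabs_eq0; apply/negPn/negP => kn0.
  have kp : 0 < cabs (fhat (dini z) (-1)) ^+ 2 by rewrite exprn_gt0// lt_neqAle eq_sym kn0 cabs_ge0.
  pose E := energy (dini z).
  pose n := Num.bound (E / cabs (fhat (dini z) (-1)) ^+ 2).
  have hn : E / cabs (fhat (dini z) (-1)) ^+ 2 < n%:R.
    by apply: Num.Theory.archi_boundP; rewrite divr_ge0 ?energy_ge0// ltW.
  have := bessel bd cm1 ltac:(by rewrite oppr_eq0 oner_eq0) n.+1.
  rewrite big_ord_recl/=.
  have -> : \sum_(i < n) cabs (fhat (dini z) ((bump 0 i)%:R * -1)) ^+ 2 =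
     n%:R * cabs (fhat (dini z) (-1)) ^+ 2.
    rewrite (eq_bigr (fun=> cabs (fhat (dini z) (-1)) ^+ 2)).
      by rewrite sumr_const card_ord mulr_natl.
    by move=> i _; rewrite /bump/= mulrN1 add1n neg.
  move: hn; rewrite ltr_pdivrMr// -/E => h1 h2.
  by have := sqr_ge0 (cabs (fhat (dini z) (0 * -1))); rewrite /E in h1; lra.
(* The recurrence telescopes: the error of a partial sum is a single Fourier coefficient of
   [dini]. *)
have S N : \sum_(j < N.+1) fcoef j%:R z - f z = fhat (dini z) N%:R.
  elim: N => [|N IH].
    rewrite big_ord_recl big_ord0 addr0/=.
    by have := dini_step z1 (cis_nat 0); rewrite mulr0n eqxx mulr1 sub0r k0 subr0 => ->.
  rewrite big_ord_recr/= addrAC IH.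
  have := dini_step z1 (cis_nat N.+1); rewrite pnatr_eq0/= mulr0 subr0 => <-.
  have -> : N.+1%:R - 1 = N%:R :> R by rewrite -natr1 addrK.
  by rewrite subrKC.
pose u j := cabs (fhat (dini z) j%:R) ^+ 2.
have bu n : \sum_(j < n) u j <= energy (dini z).
  have := bessel bd c1 (oner_neq0 _) n; apply: le_trans.
  by apply: ler_sum => j _; rewrite /u mulr1.
have cu : cvgn (series u).
  apply: nondecreasing_is_cvgn.
    apply/nondecreasing_seqP => n; rewrite /series/= big_nat_recr//= lerDl; exact: sqr_ge0.
  by exists (energy (dini z)) => _ [n _ <-]; rewrite /series/= big_mkord.
have := cvg_series_cvg_0 cu => /cvgrPdist_lt /(_ (e ^+ 2)) []; first by rewrite exprn_gt0.
move=> N0 _ hN0; exists N0.+1 => -[//|N] hN; rewrite S.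
have := hN0 N hN; rewrite /u/= sub0r normrN ger0_norm ?sqr_ge0//.
by rewrite ltr_pXn2r// ?nnegrE ?cabs_ge0// ltW.
Qed.

End Taylor.

(** * Averaging plane integrals over rotations *)

Section RotAverage.
Context {R : realType}.
Local Notation leb := (@lebesgue_measure R).
Local Notation TR := (measurableTypeR R).
Local Notation T2 := (TR * TR)%type.
Local Notation tau := (2 * pi : R).
Local Notation I := (`[0%R, tau]%classic : set TR).
Local Notation mu2 := (leb \x leb)%E.

(** The product measure bundled as a sigma-finite one, the form in which Fubini's theorem takes
    it. *)
Definition plane_measure : {sigma_finite_measure set T2 -> \bar R} := HB.pack mu2
  (lebesgue_integral_fubini.measure_function_Measure_isSigmaFinite__to__measure_function_isSFinite leb leb)
  (lebesgue_integral_fubini.measure_function_Measure_isSigmaFinite__to__measure_function_isSigmaFinite leb leb).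

Lemma leb_I : leb I = tau%:E.
Proof. by rewrite lebesgue_measure_itv/= lte_fin tau_gt0 -EFinB subr0. Qed.

Lemma integral_indic_I : (\int[leb]_x (\1_I x)%:E = tau%:E)%E.
Proof.
by rewrite integral_indic// setIT; exact: leb_I.
Qed.

Lemma measurable_rot2 : measurable_fun setT (fun tp : TR * T2 => rot tp.1 tp.2).
Proof.
have mcos : @measurable_fun _ _ TR R setT cos.
  by have := continuous_measurable_fun (@continuous_cos R).
have msin : @measurable_fun _ _ TR R setT sin.
  by have := continuous_measurable_fun (@continuous_sin R).
have mf : @measurable_fun _ _ (TR * T2)%type TR setT fst by exact: measurable_fst.
have mc := measurableT_comp mcos mf.
have ms := measurableT_comp msin mf.
have m2 : @measurable_fun _ _ (TR * T2)%type T2 setT snd by exact: measurable_snd.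
have m21 : @measurable_fun _ _ (TR * T2)%type R setT (fun tp => tp.2.1).
  exact: (@measurableT_comp _ _ _ (TR * T2)%type T2 TR fst setT snd measurable_fst m2).
have m22 : @measurable_fun _ _ (TR * T2)%type R setT (fun tp => tp.2.2).
  exact: (@measurableT_comp _ _ _ (TR * T2)%type T2 TR snd setT snd measurable_snd m2).
apply: measurable_fun_pair.
  by apply: (@measurable_funB _ _ R); exact: (@measurable_funM _ _ R).
by apply: (@measurable_funD _ _ R); exact: (@measurable_funM _ _ R).
Qed.

Lemma nrm2_rot x (p : T2) : nrm2 (rot x p) = nrm2 p.
Proof.
transitivity ((cos x ^+ 2 + sin x ^+ 2) * nrm2 p); last by rewrite cos2Dsin2 mul1r.
by rewrite /nrm2 /rot/=; ring.
Qed.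

Lemma disk_rotE x (p : T2) : disk (rot x p) <-> disk p.
Proof. by split=> /disk_nrm2; rewrite ?nrm2_rot => h; apply/disk_nrm2; rewrite ?nrm2_rot. Qed.

Lemma integral_rot x (H : T2 -> R) : mu2.-integrable (disk : set T2) (EFin \o H) ->
  (\int[leb2]_(p in disk) (H (rot x p))%:E = \int[leb2]_(p in disk) (H p)%:E)%E.
Proof.
move=> iH; have mH := measurable_int _ iH.
rewrite integralE [RHS]integralE; congr (_ - _)%E.
  transitivity (\int[leb2]_(p in disk) ((EFin \o H)^\+ (rot x p)))%E.
    by apply: eq_integral => p _; rewrite -[LHS]/(((EFin \o H) \o rot x)^\+ p)%E funepos_comp.
  apply: ge0_integral_rot; first exact: measurable_funepos.
  by move=> p _; exact: funepos_ge0.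
transitivity (\int[leb2]_(p in disk) ((EFin \o H)^\- (rot x p)))%E.
  by apply: eq_integral => p _; rewrite -[LHS]/(((EFin \o H) \o rot x)^\- p)%E funeneg_comp.
apply: ge0_integral_rot; first exact: measurable_funeneg.
by move=> p _; exact: funeneg_ge0.
Qed.

(** Every rotation preserves the integral over the disk, so integrating in the angle multiplies it
    by [tau]; Fubini's theorem then moves the angular integral inside. *)
Lemma rot_average (H : T2 -> R) : mu2.-integrable (disk : set T2) (EFin \o H) ->
  (forall p, disk p -> leb.-integrable I (EFin \o (fun x => H (rot x p)))) ->
  tau * Rintegral leb2 disk H = Rintegral leb2 disk (fun p => cint1 (fun x => H (rot x p)) 0 tau).
Proof.
move=> iH iX; have mD := @measurable_disk R; have mH := measurable_int _ iH.
have mI : measurable I by exact: measurable_itv.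
pose D := I `*` (disk : set T2).
have mDD : measurable D by exact: measurableX.
(* Extension by zero: as the disk is invariant, [G (rot x p)] vanishes outside it for every angle,
   and Fubini's theorem applies on the full product. *)
pose G := (fun p => (H p)%:E) \_ (disk : set T2).
have mG : measurable_fun setT G by apply/(measurable_restrictT _ mD).
pose F (tp : TR * T2) : \bar R := ((\1_I tp.1)%:E * G (rot tp.1 tp.2))%E.
have mF : measurable_fun setT F.
  apply: emeasurable_funM.
    apply/measurable_EFinP.
    have m1 : @measurable_fun _ _ TR R setT (\1_I) by exact: measurable_indic.
    have mf : @measurable_fun _ _ (TR * T2)%type TR setT fst by exact: measurable_fst.
    exact: (measurableT_comp m1 mf).
  exact: (measurableT_comp mG measurable_rot2).
have GD p x : disk p -> G (rot x p) = (H (rot x p))%:E.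
  by move=> dp; rewrite /G patchE mem_set//; apply/disk_rotE.
have GnD p x : ~ disk p -> G (rot x p) = 0%E.
  by move=> dp; rewrite /G patchE memNset// => /disk_rotE.
have Gint x : (\int[mu2]_p G (rot x p) = \int[mu2]_(p in disk) (H p)%:E)%E.
  rewrite -(integral_rot x iH) [RHS]integral_mkcond; apply: eq_integral => p _.
  rewrite [in RHS]patchE; case: ifPn; first by rewrite inE => /GD ->.
  by rewrite notin_setE => /GnD ->.
have Gabs x : (\int[mu2]_p `|G (rot x p)| = \int[mu2]_(p in disk) `|(H p)%:E|)%E.
  transitivity (\int[leb2]_(p in disk) ((abse \o (EFin \o H)) (rot x p)))%E.
    rewrite [RHS]integral_mkcond; apply: eq_integral => p _.
    rewrite [in RHS]patchE; case: ifPn; first by rewrite inE => /GD ->.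
    by rewrite notin_setE => /GnD ->; rewrite abse0.
  apply: (@ge0_integral_rot R x (abse \o (EFin \o H))); last by move=> p _; exact: abse_ge0.
  exact: (measurableT_comp (@abse_measurable R setT) mH).
have FF := @Fubini _ _ TR T2 R leb plane_measure F.
have iF : ltac:(lazymatch type of FF with ?P -> _ => exact P end).
  apply/integrableP; split=> //.
  have mAF : measurable_fun setT (fun z => `|F z|%E).
    exact: (measurableT_comp (@abse_measurable R setT) mF).
  have T := @fubini_tonelli1 _ _ TR T2 R leb plane_measure (fun z => `|F z|%E) mAF (fun z => abse_ge0 (F z)).
  refine (eq_ind_r (fun v => (v < +oo)%E) _ T).
  rewrite (eq_integral (fun x => (\1_I x)%:E * \int[mu2]_(p in disk) `|(H p)%:E|))%E; last first.
    move=> x _; rewrite /fubini_F/= -(Gabs x) -ge0_integralZl//=; last first.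
      by apply: measurableT_comp => //; exact: (measurableT_comp mG (@measurable_rot R x)).
    by apply: eq_integral => p _; rewrite /F/= abseM gee0_abs// lee_fin.
  move/integrableP : iH => [_ iH].
  rewrite ge0_integralZr//=; [|by apply/measurable_EFinP|exact: integral_ge0].
  rewrite integral_indic_I lte_mul_pinfty//.
  by rewrite lee_fin ltW ?tau_gt0.
have E1 : (\int[leb]_x fubini_F mu2 F x = tau%:E * \int[mu2]_(p in disk) (H p)%:E)%E.
  rewrite (eq_integral (fun x => (\1_I x)%:E * \int[mu2]_(p in disk) (H p)%:E))%E; last first.
    move=> x _; rewrite /fubini_F/= -(Gint x).
    rewrite /F/= indicE; case: (x \in I) => /=.
      by rewrite mul1e; apply: eq_integral => p _; rewrite mul1e.
    by rewrite mul0e; apply: integral0_eq => p _; rewrite mul0e.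
  have fin : (\int[mu2]_(p in disk) (H p)%:E)%E \is a fin_num by exact: integrable_fin_num.
  rewrite -(fineK fin).
  rewrite integralZr//=; last first.
    apply/integrableP; split; first exact/measurable_EFinP.
    rewrite (eq_integral (fun x => (\1_I x)%:E)); last by move=> x _; rewrite gee0_abs ?lee_fin.
    by rewrite integral_indic_I ltry.
  by rewrite integral_indic_I.
pose c (p : T2) := cint1 (fun x => H (rot x p)) 0 tau.
have GE : fubini_G leb F = (fun p => (c p)%:E) \_ (disk : set T2).
  apply/funext => p; rewrite /fubini_G patchE.
  case: ifPn => [|/negP dp]; last first.
    apply: integral0_eq => x _; rewrite /F/= GnD ?mule0// => h; apply: dp; exact: mem_set.
  rewrite inE => dp; have ip := iX _ dp.
  rewrite /c /cint1 /Rintegral fineK; last exact: (@integrable_fin_num _ _ _ leb I mI _ ip).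
  rewrite [RHS]integral_mkcond; apply: eq_integral => x _.
  rewrite /F/= GD// indicE patchE; case: (x \in _) => /=; first by rewrite mul1e.
  by rewrite mul0e.
have E2 : (\int[mu2]_p fubini_G leb F p = \int[mu2]_(p in disk) (c p)%:E)%E.
  by rewrite [RHS]integral_mkcond GE.
have := FF iF; rewrite E1 E2 => E.
rewrite /Rintegral -/c.
have -> : (\int[leb2]_(p in disk) (c p)%:E = tau%:E * \int[mu2]_(p in disk) (H p)%:E)%E by rewrite E.
by rewrite -(fineK (integrable_fin_num mD iH)) -EFinM/=.
Qed.

End RotAverage.

(** * The Bergman space, its monomials and the expansion of the kernel *)

Section Bergman.
Context {R : realType}.
Local Notation leb := (@lebesgue_measure R).
Local Notation TR := (measurableTypeR R).
Local Notation T2 := (TR * TR)%type.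
Local Notation tau := (2 * pi : R).
Local Notation I := (`[0%R, tau]%classic : set TR).
Local Notation mu2 := (leb \x leb)%E.

Lemma continuous_box (g : R * R -> R) (p : R * R) : {for p, continuous g} ->
  forall e : R, 0 < e -> exists2 d : R, 0 < d &
    forall q, `|q.1 - p.1| < d -> `|q.2 - p.2| < d -> `|g q - g p| < e.
Proof.
move=> cg e e0; move/cvgrPdist_lt: cg => /(_ _ e0) /nbhs_ballP[d /= d0 hd].
exists d => // q q1 q2; rewrite distrC; apply: hd.
by split; rewrite /ball/= distrC.
Qed.

Lemma open2_disk : open2 (@disk R : set T2).
Proof.
move=> p /disk_nrm2 p1.
have c : {for (p : R * R), continuous (fun q : R * R => q.1 * q.1 + q.2 * q.2)}.
  by apply: cvgD; apply: cvgM; (exact: cvg_fst || exact: cvg_snd).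
have e0 : 0 < 1 - nrm2 p by rewrite subr_gt0.
have [d d0 hd] := continuous_box c e0; exists d => // q q1 q2.
apply/disk_nrm2; have := hd q q1 q2; rewrite ltr_distl => /andP[_].
by rewrite /nrm2; lra.
Qed.

Lemma p2c_lt1 (p : R * R) : disk p <-> cabs (p2c p) < 1.
Proof. by []. Qed.

Lemma p2c_dist (p q : R * R) : cabs (p2c q - p2c p) <= `|q.1 - p.1| + `|q.2 - p.2|.
Proof. exact: le_trans (cabs_ReIm _) _. Qed.

Lemma p2c_rot (x : R) (p : R * R) : p2c (rot x p) = p2c p * cis x.
Proof. by rewrite /p2c /rot; apply: complex_ext; rewrite ?ReM ?ImM/=; ring. Qed.

Lemma holo_measurable (f : R[i] -> R[i]) : holomorphic_on_disk f ->
  measurable_fun (disk : set T2) (fun p => complex.Re (f (p2c p))) /\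
  measurable_fun (disk : set T2) (fun p => complex.Im (f (p2c p))).
Proof.
move=> hf; have key p : disk p -> forall e, 0 < e -> exists2 d : R, 0 < d &
   forall q, disk q -> `|q.1 - p.1| < d -> `|q.2 - p.2| < d -> cabs (f (p2c q) - f (p2c p)) < e.
  move=> dp e e0; have [d d0 hd] := @holo_continuous R f (p2c p) (hf p dp) e e0.
  exists (d / 2); first by rewrite divr_gt0.
  move=> q _ q1 q2; apply: hd; apply: le_lt_trans (p2c_dist _ _) _; lra.
split; apply: open2_measurable_fun; [exact: open2_disk| |exact: open2_disk|].
  move=> p dp e /(key p dp)[d d0 hd]; exists d => // q dq q1 q2.
  by apply: le_lt_trans (hd q dq q1 q2); rewrite -ReN -ReD cabs_Re.
move=> p dp e /(key p dp)[d d0 hd]; exists d => // q dq q1 q2.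
by apply: le_lt_trans (hd q dq q1 q2); rewrite -ImN -ImD cabs_Im.
Qed.

Lemma mono_holo n : holomorphic_on_disk (fun w : R[i] => w ^+ n).
Proof. by move=> p _; exact: exprn_derivable. Qed.

Lemma area_integral_lty (g : T2 -> R) : (forall p, disk p -> 0 <= g p) ->
  measurable_fun (disk : set T2) g -> (area_integral g < +oo)%E ->
  mu2.-integrable (disk : set T2) (EFin \o g).
Proof.
move=> g0 mg; rewrite /area_integral => h; apply/integrableP; split; first exact/measurable_EFinP.
rewrite (eq_integral (fun p => (g p)%:E)); last first.
  by move=> p; rewrite inE => dp /=; rewrite ger0_norm// g0.
have I0 : (0 <= \int[leb2]_(p in disk) (g p)%:E)%E.
  by apply: integral_ge0 => p dp; rewrite lee_fin g0.
suff : (\int[leb2]_(p in disk) (g p)%:E < +oo)%E by [].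
move: h I0; case: (\int[leb2]_(x in disk) (g x)%:E)%E => [r| |]; [by move=> _ _; rewrite ltry| |by []].
by rewrite mulry gtr0_sg ?invr_gt0 ?pi_gt0// mul1e.
Qed.

Variables h t : R -> R.
Hypothesis hW : in_W h t.

Local Notation W := (fun p : T2 => omega h p ^+ 2).

Lemma W_ge0 p : 0 <= W p. Proof. exact: sqr_ge0. Qed.

Lemma radial_continuous p : disk p -> {for p, continuous (radial h)}.
Proof. by case: hW => C _ _ _ _ /C[d _ _ _]; exact: differentiable_continuous. Qed.

Lemma measurable_omega : measurable_fun (disk : set T2) (omega h).
Proof.
have mr : measurable_fun (disk : set T2) (radial h).
  apply: open2_measurable_fun; first exact: open2_disk.
  move=> p dp e e0; have [d d0 hd] := continuous_box (radial_continuous dp) e0.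
  by exists d => // q _; exact: hd.
have me : @measurable_fun _ _ R R setT expR by exact: measurable_expR.
apply: (measurableT_comp me); apply: measurableT_comp => //.
Qed.

Lemma measurable_W : measurable_fun (disk : set T2) W.
Proof. by under eq_fun do rewrite expr2; apply: measurable_funM; exact: measurable_omega. Qed.

Lemma omega_le p : disk p -> omega h p <= expR (- h 0).
Proof.
case: hW => _ inc _ _ _ dp; rewrite /omega ler_expR lerN2 /radial.
have e0 : 0 <= enorm p by exact: sqrtr_ge0.
move: e0; rewrite le_eqVlt => /orP[/eqP <-//|e0].
by apply: ltW; apply: inc.
Qed.

Lemma integrable_omega : mu2.-integrable (disk : set T2) (EFin \o omega h).
Proof.
case: hW => _ _ _ i _; apply: area_integral_lty => //.
  by move=> p _; exact: expR_ge0.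
exact: measurable_omega.
Qed.

Lemma integrable_dom (g k : T2 -> R) : measurable_fun (disk : set T2) g ->
  mu2.-integrable (disk : set T2) (EFin \o k) ->
  (forall p, disk p -> `|g p| <= k p) -> mu2.-integrable (disk : set T2) (EFin \o g).
Proof.
move=> mg ik gk; apply: (le_integrable (@measurable_disk R) _ _ ik); first exact/measurable_EFinP.
move=> p dp /=; rewrite lee_fin; apply: le_trans (gk _ dp) _; exact: ler_norm.
Qed.

(** The profile increases, so [omega] is largest at the centre, and [omega ^ 2] is dominated by a
    multiple of the integrable [omega]. *)
Lemma integrable_W : mu2.-integrable (disk : set T2) (EFin \o W).
Proof.
apply: (@integrable_dom _ (fun p => expR (- h 0) * omega h p)); first exact: measurable_W.
  by apply: (@eq_integrable _ _ _ mu2 _ (@measurable_disk R) (fun p => (expR (- h 0))%:E * (EFin \o omega h) p)%E) => //;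
    apply: integrableZl; [exact: measurable_disk|exact: integrable_omega].
move=> p dp; rewrite ger0_norm ?sqr_ge0// expr2 ler_wpM2r ?omega_le//; exact: expR_ge0.
Qed.

Lemma A2_integrable f : in_A2 h f ->
  mu2.-integrable (disk : set T2) (EFin \o (fun p => cnorm2 (f (p2c p)) * W p)).
Proof.
move=> [hf ff]; have [m1 m2] := holo_measurable hf.
apply: area_integral_lty => //; first by move=> p _; rewrite mulr_ge0 ?cnorm2_ge0 ?sqr_ge0.
apply: measurable_funM; last exact: measurable_W.
by apply: measurable_funD; under eq_fun do rewrite expr2; exact: measurable_funM.
Qed.

Lemma A2_inner_integrable f g : in_A2 h f -> in_A2 h g ->
  mu2.-integrable (disk : set T2) (EFin \o (fun p => complex.Re (f (p2c p) * (g (p2c p))^* ) * W p)) /\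
  mu2.-integrable (disk : set T2) (EFin \o (fun p => complex.Im (f (p2c p) * (g (p2c p))^* ) * W p)).
Proof.
move=> Af Ag; have [f1 f2] := holo_measurable (proj1 Af); have [g1 g2] := holo_measurable (proj1 Ag).
have mR : measurable_fun (disk : set T2) (fun p => complex.Re (f (p2c p) * (g (p2c p))^* ) * W p).
  apply: measurable_funM; last exact: measurable_W.
  rewrite (_ : (fun p => _) = (fun p => complex.Re (f (p2c p)) * complex.Re (g (p2c p)) +
    complex.Im (f (p2c p)) * complex.Im (g (p2c p)))); last first.
    by apply/funext => p; rewrite ReM Re_conj Im_conj mulrN opprK.
  by apply: measurable_funD; exact: measurable_funM.
have mI : measurable_fun (disk : set T2) (fun p => complex.Im (f (p2c p) * (g (p2c p))^* ) * W p).
  apply: measurable_funM; last exact: measurable_W.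
  rewrite (_ : (fun p => _) = (fun p => complex.Im (f (p2c p)) * complex.Re (g (p2c p)) -
    complex.Re (f (p2c p)) * complex.Im (g (p2c p)))); last first.
    by apply/funext => p; rewrite ImM Re_conj Im_conj mulrN addrC.
  by apply: measurable_funB; exact: measurable_funM.
pose k (p : T2) := cnorm2 (f (p2c p)) * W p + cnorm2 (g (p2c p)) * W p.
have ik : mu2.-integrable (disk : set T2) (EFin \o k).
  have := integrableD (@measurable_disk R) (A2_integrable Af) (A2_integrable Ag).
  by apply: eq_integrable; [exact: measurable_disk|move=> p _ /=; rewrite /k EFinD].
have bd p : cabs (f (p2c p) * (g (p2c p))^* ) <= cnorm2 (f (p2c p)) + cnorm2 (g (p2c p)).
  rewrite cabsM cabs_conj !cnorm2E.
  have := sqr_ge0 (cabs (f (p2c p)) - cabs (g (p2c p))).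
  have := mulr_ge0 (cabs_ge0 (f (p2c p))) (cabs_ge0 (g (p2c p))); nra.
split; apply: (@integrable_dom _ k) => // p _.
  rewrite normrM (ger0_norm (W_ge0 p)) /k -mulrDl ler_wpM2r ?W_ge0//.
  exact: le_trans (cabs_Re _) (bd p).
rewrite normrM (ger0_norm (W_ge0 p)) /k -mulrDl ler_wpM2r ?W_ge0//.
exact: le_trans (cabs_Im _) (bd p).
Qed.

Lemma mono_A2 n : in_A2 h (fun w : R[i] => w ^+ n).
Proof.
split; first exact: mono_holo.
rewrite /area_integral.
have iW : mu2.-integrable (disk : set T2) (EFin \o (fun p => cnorm2 ((p2c p) ^+ n) * W p)).
  apply: (@integrable_dom _ W); [|exact: integrable_W|].
    apply: measurable_funM; last exact: measurable_W.
    have [m1 m2] := holo_measurable (@mono_holo n).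
    by apply: measurable_funD; under eq_fun do rewrite expr2; exact: measurable_funM.
  move=> p /p2c_lt1 dp; rewrite normrM (ger0_norm (W_ge0 p)) ger0_norm ?cnorm2_ge0//.
  rewrite ler_piMl ?W_ge0// cnorm2E cabsX -exprM exprn_ile1 ?cabs_ge0//; exact: ltW.
have := integrable_fin_num (@measurable_disk R) iW.
rewrite fin_numElt => /andP[_ lt].
apply: (@le_lt_trans _ _ ((pi^-1)%:E * (fine (\int[mu2]_(x in disk) (cnorm2 ((p2c x) ^+ n) * W x)%:E))%:E)%E).
  by rewrite fineK//; exact: (integrable_fin_num (@measurable_disk R) iW).
by rewrite -EFinM ltry.
Qed.

Definition mnorm n : R := area_Rintegral (fun p => cnorm2 ((p2c p) ^+ n) * W p).

Lemma p2c_nrm2 (p : T2) : cnorm2 (p2c p) = nrm2 p.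
Proof. by rewrite nrm2E. Qed.

Lemma W_rot x p : W (rot x p) = W p.
Proof.
by rewrite /omega /radial !enormE p2c_rot cabsM cabs_cis mulr1.
Qed.

(** On a small square inside the disk and away from 0 the integrand has a positive lower bound. *)
Lemma mnorm_gt0 n : 0 < mnorm n.
Proof.
pose F (p : T2) := cnorm2 ((p2c p) ^+ n) * W p.
have iF : mu2.-integrable (disk : set T2) (EFin \o F) by exact: (A2_integrable (mono_A2 n)).
have F0 p : 0 <= F p by rewrite mulr_ge0 ?cnorm2_ge0 ?W_ge0.
pose S : set T2 := `[1 / 4, 1 / 2]%classic `*` `[1 / 4, 1 / 2]%classic.
have mS : measurable S by apply: measurableX; exact: measurable_itv.
have nS p : S p -> 1 / 8 <= nrm2 p <= 1 / 2.
  move=> [/=]; rewrite !in_itv/= => /andP[x1 x2] /andP[y1 y2].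
  by rewrite /nrm2; apply/andP; split; nra.
have SD : S `<=` (disk : set T2) by move=> p /nS /andP[_ h2]; apply/disk_nrm2; lra.
pose c := (1 / 8) ^+ n * expR (- h (Num.sqrt (1 / 2))) ^+ 2.
have c0 : 0 < c by rewrite mulr_gt0 ?exprn_gt0 ?expR_gt0//; lra.
have cF p : S p -> c <= F p.
  move=> Sp; have /andP[n1 n2] := nS _ Sp.
  apply: ler_pM; [by rewrite exprn_ge0//; lra|by rewrite exprn_ge0 ?expR_ge0| |].
    rewrite cnorm2E cabsX -exprM mulnC exprM -cnorm2E p2c_nrm2.
    by rewrite lerXn2r// ?nnegrE ?nrm2_ge0//; lra.
  rewrite lerXn2r// ?nnegrE ?expR_ge0// ler_expR lerN2 /radial.
  have -> : enorm p = Num.sqrt (nrm2 p) by rewrite nrm2E.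
  case: hW => _ inc _ _ _; move: n2; rewrite le_eqVlt => /orP[/eqP->//|n2].
  apply: ltW; apply: inc; [exact: sqrtr_ge0|by rewrite ltr_sqrt//; lra|].
  by rewrite -[ltRHS]sqrtr1 ltr_sqrt//; lra.
rewrite /mnorm /area_Rintegral mulr_gt0// ?invr_gt0 ?pi_gt0//.
have lSF : ((c * ((1 / 2 - 1 / 4) ^+ 2))%:E <= \int[mu2]_(p in disk) (F p)%:E)%E.
  apply: (@le_trans _ _ (\int[mu2]_(p in S) (F p)%:E)%E); last first.
    apply: ge0_subset_integral => //; [exact: measurable_disk|exact: measurable_int iF|].
    by move=> p _; rewrite lee_fin.
  apply: (@le_trans _ _ (\int[mu2]_(p in S) (cst c%:E) p)%E).
    rewrite integral_cst// EFinM.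
    have /= := @square_leb2 R (1 / 4) (1 / 2) ltac:(lra) => <-.
    exact: le_refl.
  apply: ge0_le_integral => //.
  - by move=> p _; rewrite lee_fin ltW.
  - by apply: (measurable_funS (@measurable_disk R) SD); exact: measurable_int iF.
have fin := integrable_fin_num (@measurable_disk R) iF.
rewrite -lte_fin /Rintegral.
have -> : (fine (\int[leb2]_(x in disk) (cnorm2 (p2c x ^+ n) * W x)%:E))%:E = (\int[mu2]_(p in disk) (F p)%:E)%E.
  by rewrite fineK.
by apply: lt_le_trans lSF; rewrite lte_fin mulr_gt0// exprn_gt0//; lra.
Qed.

Lemma inner_conj f g : in_A2 h f -> in_A2 h g -> A2_inner h f g = (A2_inner h g f)^*.
Proof.
move=> Af Ag; have [_ iI] := A2_inner_integrable Ag Af.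
rewrite /A2_inner; apply: complex_ext; rewrite ?Re_conj ?Im_conj /=.
  rewrite /area_Rintegral; congr (_ * _); apply: eq_Rintegral => p _.
  by rewrite !ReM !Re_conj !Im_conj; congr (_ * _); ring.
rewrite /area_Rintegral -mulrN; congr (_ * _).
rewrite -[RHS]mulN1r -[RHS](RintegralZl (-1) (@measurable_disk R) iI).
apply: eq_Rintegral => p _.
by rewrite !ImM !Re_conj !Im_conj; ring.
Qed.

(** Averaging over rotations replaces [f] on each circle by its [n]-th Fourier coefficient, which
    [fcoef_mono] identifies with one constant [A] times the monomial, on all circles at once. *)
Lemma inner_mono f n z : in_A2 h f -> cabs z < 1 -> z != 0 ->
  A2_inner h f (fun w => w ^+ n) * z ^+ n = fcoef f n%:R z * (mnorm n)%:C%C.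
Proof.
move=> Af z1 z0; have Am := mono_A2 n.
have hf w : cabs w < 1 -> derivable (f : R[i]^o -> R[i]^o) w 1.
  by move=> w1; have := (proj1 Af) (complex.Re w, complex.Im w); rewrite p2cK; apply.
have [iR iI] := A2_inner_integrable Af Am.
have zn : z ^+ n != 0 by rewrite expf_neq0.
pose A := fcoef f n%:R z / z ^+ n; pose N (p : T2) := cnorm2 (p2c p ^+ n).
have mean p : disk p -> (fcoef f n%:R (p2c p)) * (p2c p ^+ n)^* = A * (N p)%:C%C.
  move=> dp; have := @fcoef_mono R f hf n z (p2c p) z1 dp z0 => E.
  apply: (mulIf zn); rewrite mulrAC E /A /N cnorm2_conj; field.
  exact: zn.
pose u (p : T2) x := f (p2c p * cis x) * cis (- (n%:R * x)).
have bu p : disk p -> bm (u p) by move=> dp; apply: bm_fhat; exact: bm_circ.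
pose v (p : T2) x := (W p)%:C%C * ((p2c p ^+ n)^* * u p x).
have bv p : disk p -> bm (v p).
  by move=> dp; apply: bmM; [exact: bm_cst|apply: bmM; [exact: bm_cst|exact: bu]].
have rotE p x : f (p2c (rot x p)) * (p2c (rot x p) ^+ n)^* = (p2c p ^+ n)^* * u p x.
  rewrite /u p2c_rot exprMn cconjM cisX -cisN; ring.
have cm p : disk p -> cmean (v p) = A * (N p * W p)%:C%C.
  move=> dp; rewrite cmeanZ; last by apply: bmM; [exact: bm_cst|exact: bu].
  rewrite cmeanZ; last exact: bu.
  have := mean _ dp; rewrite /fcoef /fhat -/(u p) mulrC => ->.
  by rewrite rmorphM/=; ring.
have t0 := @tau_gt0 R.
have tn : tau != 0 by rewrite gt_eqF.
have cR p : disk p -> cint1 (fun x => complex.Re (v p x)) 0 tau = tau * (complex.Re A * (N p * W p)).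
  move=> dp; have := congr1 (fun z => tau * complex.Re z) (cm _ dp).
  by rewrite /cmean !ReM/= !mul0r !mulr0 !subr0 mulrA mulfV// mul1r.
have cI p : disk p -> cint1 (fun x => complex.Im (v p x)) 0 tau = tau * (complex.Im A * (N p * W p)).
  move=> dp; have := congr1 (fun z => tau * complex.Im z) (cm _ dp).
  by rewrite /cmean !ImM/= !mul0r !mulr0 ?addr0 ?add0r mulrA mulfV// mul1r.
pose HR (p : T2) := complex.Re (f (p2c p) * (p2c p ^+ n)^* ) * W p.
pose HI (p : T2) := complex.Im (f (p2c p) * (p2c p ^+ n)^* ) * W p.
have vR p x : HR (rot x p) = complex.Re (v p x).
  by rewrite /HR rotE W_rot /v [in RHS]ReM/= mul0r subr0 mulrC.
have vI p x : HI (rot x p) = complex.Im (v p x).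
  by rewrite /HI rotE W_rot /v [in RHS]ImM/= mul0r addr0 mulrC.
have iNW : mu2.-integrable (disk : set T2) (EFin \o (fun p => N p * W p)) by exact: (A2_integrable Am).
have RA : Rintegral leb2 disk HR = complex.Re A * Rintegral leb2 disk (fun p => N p * W p).
  apply: (mulfI tn); rewrite rot_average//; last first.
    move=> p dp; have [i1 _] := bm_int (bv _ dp).
    by have -> : (fun x => HR (rot x p)) = fun x => complex.Re (v p x) by apply/funext => x; rewrite vR.
  transitivity (Rintegral leb2 disk (fun p => (tau * complex.Re A) * (N p * W p))).
    apply: eq_Rintegral => p; rewrite inE => dp; rewrite -mulrA -cR//; apply: eq_Rintegral => x _; exact: vR.
  by rewrite (RintegralZl _ (@measurable_disk R) iNW) mulrA.
have IA : Rintegral leb2 disk HI = complex.Im A * Rintegral leb2 disk (fun p => N p * W p).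
  apply: (mulfI tn); rewrite rot_average//; last first.
    move=> p dp; have [_ i1] := bm_int (bv _ dp).
    by have -> : (fun x => HI (rot x p)) = fun x => complex.Im (v p x) by apply/funext => x; rewrite vI.
  transitivity (Rintegral leb2 disk (fun p => (tau * complex.Im A) * (N p * W p))).
    apply: eq_Rintegral => p; rewrite inE => dp; rewrite -mulrA -cI//; apply: eq_Rintegral => x _; exact: vI.
  by rewrite (RintegralZl _ (@measurable_disk R) iNW) mulrA.
have E : A2_inner h f (fun w => w ^+ n) = A * (mnorm n)%:C%C.
  rewrite /A2_inner /mnorm; apply: complex_ext.
    by rewrite ReM/= mulr0 subr0 /area_Rintegral RA mulrCA.
  by rewrite ImM/= mulr0 add0r /area_Rintegral IA mulrCA.
by rewrite E /A mulrAC divfK.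
Qed.

Variable Kz : R * R -> R[i] -> R[i].
Hypothesis hK : is_reproducing_kernel h Kz.

Lemma kernel_holo p : disk p -> forall w, cabs w < 1 -> derivable (Kz p : R[i]^o -> R[i]^o) w 1.
Proof.
move=> /hK[[hf _] _] w w1.
by have := hf (complex.Re w, complex.Im w); rewrite p2cK; apply.
Qed.

(** The reproducing property tested on [w ^ n] gives the inner product of [Kz p] with the monomial,
    and [inner_mono] turns it into a coefficient. *)
Lemma kernel_fcoef n p z : disk p -> cabs z < 1 ->
  fcoef (Kz p) n%:R z = ((mnorm n)^-1)%:C%C * ((p2c p)^* * z) ^+ n.
Proof.
move=> dp z1; have [Ap rep] := hK dp.
have m0 := mnorm_gt0 n.
have mC : (mnorm n)%:C%C != 0 :> R[i] by rewrite fmorph_eq0 gt_eqF.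
have key w : cabs w < 1 -> w != 0 -> fcoef (Kz p) n%:R w * (mnorm n)%:C%C = ((p2c p)^* * w) ^+ n.
  move=> w1 w0; rewrite -(inner_mono n Ap w1 w0) (inner_conj Ap (mono_A2 n)).
  by rewrite -(rep _ (mono_A2 n)) cconjX exprMn.
(* [inner_mono] excludes the point 0, so every [z] is reached from [1 / 2] through [fcoef_mono]. *)
have z'0 : (2^-1)%:C%C != 0 :> R[i] by rewrite fmorph_eq0 invr_eq0 pnatr_eq0.
have z'1 : cabs (2^-1)%:C%C < 1 :> R.
  by rewrite cabs_real ger0_norm ?invr_ge0// invf_lt1// ltr1n.
have := @fcoef_mono R (Kz p) (kernel_holo dp) n _ z z'1 z1 z'0.
move=> /(congr1 (fun v => v * (mnorm n)%:C%C)); rewrite mulrAC [RHS]mulrAC (key _ z'1 z'0) exprMn => E.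
apply: (mulIf mC); apply: (mulIf (expf_neq0 n z'0)); rewrite E.
rewrite exprMn fmorphV/=; field; exact: mC.
Qed.

Lemma kernel_cvg p z : disk p -> cabs z < 1 -> forall e : R, 0 < e ->
  exists N0, forall N, (N0 <= N)%N ->
  cabs (\sum_(j < N) ((mnorm j)^-1)%:C%C * ((p2c p)^* * z) ^+ j - Kz p z) < e.
Proof.
move=> dp z1 e e0; have [N0 hN] := taylor_cvg (kernel_holo dp) z1 e0.
exists N0 => N /hN; congr (cabs (_ - _) < _); apply: eq_bigr => j _.
exact: kernel_fcoef.
Qed.

Lemma kernel_norm p : disk p -> A2_norm h (Kz p) = Num.sqrt (complex.Re (Kz p (p2c p))).
Proof.
move=> dp; have [Ap rep] := hK dp; rewrite /A2_norm; congr Num.sqrt.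
rewrite (rep _ Ap) /A2_inner/= /area_Rintegral; congr (_ * _); apply: eq_Rintegral => q _.
by rewrite -cnorm2_conj.
Qed.

End Bergman.

(** * Slow variation and growth of tau *)

Section Profile.
Context {R : realType}.

Lemma near_is_derive (f g : R -> R) (x df e : R) : 0 < e ->
  (forall y, `|y - x| < e -> f y = g y) -> is_derive x 1 f df -> is_derive x 1 g df.
Proof.
move=> e0 fg [d <-]; have E : {near x, f =1 g}.
  by apply/nbhs_ballP; exists e => // y; rewrite /ball/= distrC; exact: fg.
split; first by apply: near_eq_derivable d; rewrite ?oner_eq0.
by rewrite (near_eq_derive _ E)// oner_eq0.
Qed.

Lemma is_derive_row (g : R * R -> R) (x y : R) : derivable g (x, y) (1, 0) ->
  is_derive x 1 (fun s => g (s, y)) ('D_(1, 0) g (x, y)).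
Proof.
have E : (fun k : R => k^-1 *: (((fun s => g (s, y)) \o shift x) k%:A - g (x, y))) =
         (fun k : R => k^-1 *: ((g \o shift (x, y)) (k *: (1, 0)) - g (x, y))).
  apply/funext => k /=; congr (_ *: (g _ - _)).
  by rewrite [RHS](_ : _ = (k * 1 + x, k * 0 + y))// mulr0 add0r.
by move=> d; split; [rewrite /derivable E|rewrite /derive E].
Qed.

Lemma is_derive_col (g : R * R -> R) (x y : R) : derivable g (x, y) (0, 1) ->
  is_derive y 1 (fun s => g (x, s)) ('D_(0, 1) g (x, y)).
Proof.
have E : (fun k : R => k^-1 *: (((fun s => g (x, s)) \o shift y) k%:A - g (x, y))) =
         (fun k : R => k^-1 *: ((g \o shift (x, y)) (k *: (0, 1)) - g (x, y))).
  apply/funext => k /=; congr (_ *: (g _ - _)).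
  by rewrite [RHS](_ : _ = (k * 0 + x, k * 1 + y))// mulr0 add0r.
by move=> d; split; [rewrite /derivable E|rewrite /derive E].
Qed.

Lemma enorm_axis (x : R) : enorm (x, 0) = `|x|.
Proof. by rewrite /enorm/= expr0n addr0 sqrtr_sqr. Qed.

Lemma disk_axis (x : R) : `|x| < 1 -> disk (x, 0 : R).
Proof. by rewrite /disk/= enorm_axis. Qed.

Variables h t : R -> R.
Hypothesis hW : in_W h t.

Lemma t_gt0 r : 0 <= r < 1 -> 0 < t r.
Proof.
move=> /andP[r0 r1]; case: hW => _ _ _ _ [t0 _ _ _ _].
have := t0 (r, 0); rewrite /radial enorm_axis ger0_norm//; apply.
by apply: disk_axis; rewrite ger0_norm.
Qed.

Lemma t_continuous (r : R) : 0 <= r < 1 -> {for r, continuous (fun x : R => t `|x|)}.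
Proof.
move=> /andP[r0 r1]; case: hW => _ _ _ _ [_ d _ _ _].
have dr : disk (r, 0 : R) by apply: disk_axis; rewrite ger0_norm.
have : derivable (radial t) (r, 0) (1, 0) by apply: diff_derivable; exact: d.
move=> /is_derive_row[dd _]; have := dd => /derivable1_diffP/differentiable_continuous.
by congr (continuous_at r _); apply/funext => s; rewrite /radial enorm_axis.
Qed.

Lemma t_derivable r : 0 < r < 1 -> derivable t r 1.
Proof.
move=> /andP[r0 r1]; case: hW => _ _ _ _ [_ d _ _ _].
have dr : disk (r, 0 : R) by apply: disk_axis; rewrite ger0_norm ?ltW.
have : derivable (radial t) (r, 0) (1, 0) by apply: diff_derivable; exact: d.
move=> /is_derive_row dd.
suff: is_derive r 1 t ('D_(1, 0) (radial t) (r, 0)) by case.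
apply: near_is_derive r0 _ dd.
move=> y; rewrite ltr_norml /radial enorm_axis => /andP[y1 _].
by rewrite ger0_norm//; lra.
Qed.

(** The mean value theorem, with [t'] tending to 0 at the boundary. *)
Lemma t_lip e : 0 < e -> exists2 r1 : R, 0 < r1 < 1 &
  forall r s, r1 <= r < 1 -> r1 <= s < 1 -> `|t r - t s| <= e * `|r - s|.
Proof.
move=> e0; case: hW => _ _ _ _ [_ _ _ _ /cvgrPdist_le /(_ _ e0)].
move=> [d /= d0 hd]; pose r1 := Num.max (1 / 2) (1 - d / 2).
have r1d : 1 - d / 2 <= r1 by rewrite le_max lexx orbT.
have r12 : 1 / 2 <= r1 by rewrite le_max lexx.
have r11 : r1 < 1 by rewrite gt_max; lra.
have main r s : r1 <= r -> r < s -> s < 1 -> `|t r - t s| <= e * `|r - s|.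
  move=> hr rs s1; have [|x|c] := @MVT R t (t^`()) r s rs.
  - move=> x; rewrite in_itv/= => /andP[x1 x2].
    have dx : derivable t x 1 by apply: t_derivable; lra.
    by split=> //; rewrite derive1E.
  - move: x; apply: derivable_within_continuous => x; rewrite in_itv/= => xx.
    by apply: t_derivable; lra.
  rewrite in_itv/= => /andP[c1 c2] E; rewrite distrC E normrM (distrC r s) ler_wpM2r//.
  have := hd c; rewrite /ball_/= sub0r normrN; apply; last by lra.
  by rewrite ger0_norm; lra.
exists r1; first by lra.
move=> r s /andP[hr r1'] /andP[hs s1]; case: (ltgtP r s) => [rs|sr|->]; first exact: main.
  by rewrite distrC (distrC r); exact: main.
by rewrite !subrr normr0 mulr0.
Qed.

(** Let [s] tend to 1 in [t_lip]: there [t s] tends to 0. *)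
Lemma t_le e : 0 < e -> exists2 r1 : R, 0 < r1 < 1 &
  forall r, r1 <= r < 1 -> t r <= e * (1 - r).
Proof.
move=> e0; have [r1 r11 lip] := t_lip e0; exists r1 => // r hr.
case: hW => _ _ _ _ [_ _ _ /cvgrPdist_le t0 _].
apply/ler_addgt0Pr => d d0; have [k /= k0 hk] := t0 _ d0.
pose s := Num.max r (1 - k / 2).
have s1 : r <= s by rewrite le_max lexx.
have s2 : 1 - k / 2 <= s by rewrite le_max lexx orbT.
have s3 : s < 1 by rewrite gt_max; lra.
have := hk s; rewrite /ball_/= sub0r normrN.
have ks : `|1 - s| < k by rewrite ger0_norm; lra.
move=> /(_ ks s3) ts; have := lip r s hr; rewrite s3 andbT.
have r1s : r1 <= s by lra.
move=> /(_ r1s); rewrite (distrC r s) (@ger0_norm _ (s - r)); last by lra.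
have := ler_norm (t s); have := ler_norm (t r - t s).
have : e * (s - r) <= e * (1 - r) by rewrite ler_wpM2l//; lra.
lra.
Qed.

Lemma t_sv e : 0 < e -> exists2 r1 : R, 0 < r1 < 1 & forall r, r1 <= r < 1 -> t r <= e * (1 - r) /\
  forall s, r1 <= s < 1 -> `|t r - t s| <= e * `|r - s|.
Proof.
move=> e0; have [r1 r11 lip] := t_lip e0; have [r2 r21 le] := t_le e0.
have m1 : r1 <= Num.max r1 r2 by rewrite le_max lexx.
have m2 : r2 <= Num.max r1 r2 by rewrite le_max lexx orbT.
exists (Num.max r1 r2); first by rewrite lt_max gt_max; lra.
move=> r hr; split; first by apply: le; lra.
by move=> s hs; apply: lip; lra.
Qed.

Lemma t_bounds (b : R) : 0 <= b < 1 -> exists2 mM : R * R, 0 < mM.1 &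
  forall r, 0 <= r <= b -> mM.1 <= t r <= mM.2.
Proof.
move=> /andP[b0 b1].
have cw : {within `[0, b], continuous (fun x : R => t `|x|)}.
  apply: continuous_in_subspaceT => x; rewrite inE/= in_itv/= => xb.
  by apply: t_continuous; lra.
have [c cb hc] := EVT_min b0 cw; have [d db hd] := EVT_max b0 cw.
exists (t c, t d) => /=; first by apply: t_gt0; move: cb; rewrite in_itv/=; lra.
move=> r rb; have ri : r \in `[0, b]%R by rewrite in_itv.
have := hc _ ri; have := hd _ ri; move: cb db; rewrite !in_itv/= => /andP[c0 _] /andP[d0 _].
by move: rb => /andP[r0 _]; rewrite !ger0_norm// => -> ->.
Qed.

(** Close to the boundary [t] is 1-Lipschitz by [t_sv]. If [z] is in the core, [tau] is bounded
    below at [z]; if [z] is beyond [r2] and [p] within [r1], the two points are at distance at least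
    [(1 - r1) / 2]. *)
Lemma tau_growth : exists2 K : R, 1 <= K & forall p z, disk p -> disk z ->
  radial t p <= K * (radial t z + enorm (p - z)).
Proof.
have [r1 r11 sv] := @t_sv 1 ltr01.
pose r2 := (1 + r1) / 2; have r2b : 0 <= r2 < 1 by rewrite /r2; lra.
have [[m M] /= m0 hm] := t_bounds r2b.
have hM0 := hm 0; have M0 : m <= M by have := hM0 ltac:(lra); lra.
(* The summands serve in turn the pairs close to the boundary, the pairs with [z] in the core and
   the pairs across the gap. [M + 1] bounds [t] everywhere, as [t a <= 1 - a] beyond [r1]. *)
pose K := 1 + (M + 1) / m + 2 * M / (1 - r1).
have i0 : 0 < 1 - r1 by lra.
have k1 : 0 <= (M + 1) / m by rewrite divr_ge0//; lra.
have k2 : 0 <= 2 * M / (1 - r1) by rewrite divr_ge0//; lra.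
exists K; first by rewrite /K; lra.
move=> p z dp dz; rewrite /radial.
have tri : `|enorm p - enorm z| <= enorm (p - z).
  have -> : enorm p = cabs (p2c p) by []. have -> : enorm z = cabs (p2c z) by [].
  have -> : enorm (p - z) = cabs (p2c p - p2c z) by [].
  rewrite ler_distl; apply/andP; split.
    have := cabsD (p2c p - p2c z) (p2c z); have := cabsD (p2c z - p2c p) (p2c p).
    by rewrite !subrK (cabsB (p2c z)); lra.
  by have := cabsD (p2c p - p2c z) (p2c z); rewrite subrK; lra.
have p0 : 0 <= enorm p by exact: sqrtr_ge0.
have z0 : 0 <= enorm z by exact: sqrtr_ge0.
have p1 : enorm p < 1 by [].
have z1 : enorm z < 1 by [].
have tp0 := @t_gt0 (enorm p) ltac:(lra); have tz0 := @t_gt0 (enorm z) ltac:(lra).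
have n0 : 0 <= enorm (p - z) by exact: sqrtr_ge0.
move: (enorm p) (enorm z) (enorm (p - z)) tri p0 z0 p1 z1 tp0 tz0 n0 => a b x tri p0 z0 p1 z1 tp0 tz0 n0.
have K1 : 1 * (t b + x) <= K * (t b + x) by apply: ler_wpM2r; rewrite /K; lra.
have [zr2|zr2] := leP b r2.
  have tb : m <= t b by have := hm b; lra.
  have ta : t a <= M + 1.
    have [ar2|ar2] := leP a r2; first by have := hm a; lra.
    have [] := sv a; first by rewrite /r2 in ar2; lra.
    by move=> ? _; lra.
  apply: (@le_trans _ _ ((M + 1) / m * (t b + x))).
    apply: (@le_trans _ _ ((M + 1) / m * m)); first by rewrite divfK// gt_eqF.
    by apply: ler_wpM2l => //; lra.
  by apply: ler_wpM2r; rewrite /K; lra.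
have [ar1|ar1] := ltP a r1.
  have ta : t a <= M by have := hm a; rewrite /r2 in zr2 *; lra.
  have xb : (1 - r1) / 2 <= x.
    by move: tri; rewrite ler_distl /r2 in zr2 *; lra.
  apply: (@le_trans _ _ (2 * M / (1 - r1) * (t b + x))); last by apply: ler_wpM2r; rewrite /K; lra.
  apply: (@le_trans _ _ (2 * M / (1 - r1) * ((1 - r1) / 2))); last by apply: ler_wpM2l => //; lra.
  by rewrite [leRHS](_ : _ = M)//; field; rewrite gt_eqF.
have := (sv a _).2 b; rewrite /r2 in zr2 => /(_ ltac:(lra) ltac:(lra)).
by rewrite ler_distl; lra.
Qed.

End Profile.

(** * Derivatives of the radial weight in the variable [u = |z| ^ 2] *)

Section RadialDerivatives.
Context {R : realType}.

Lemma is_derive_chain (f g : R -> R) (x y a b : R) : g x = y -> is_derive y 1 f a ->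
  is_derive x 1 g b -> is_derive x 1 (fun s => f (g s)) (a * b).
Proof. by move=> <- df dg; exact: is_derive1_comp. Qed.

Variables h t : R -> R.
Hypothesis hW : in_W h t.

Local Notation eta := (radial h).
Definition hD (x : R) : R := 'D_(1, 0) (radial h) (x, 0).
Definition lapl (u : R) : R := laplacian (radial h) (Num.sqrt u, 0).
(** This is [r h'(r)] at [r = sqrt u]. By [wt_derive], the derivative of [u ^ n * wt u] has the sign
    of [n - mm u], so [mm u = n] says that [u] is critical for the [n]-th monomial. *)
Definition mm (u : R) : R := Num.sqrt u * hD (Num.sqrt u).
Definition wt (u : R) : R := expR (- h (Num.sqrt u)) ^+ 2.

Lemma sqrtr_itv (u : R) : 0 < u < 1 -> 0 < Num.sqrt u < 1.
Proof.
by move=> /andP[u0 u1]; rewrite sqrtr_gt0 u0/= -[ltRHS]sqrtr1 ltr_sqrt ?ltr01.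
Qed.

Lemma eta_derive (x : R) : `|x| < 1 -> is_derive x 1 (fun s => h `|s|) (hD x).
Proof.
move=> x1; case: hW => C _ _ _ _; have [d _ _ _] := C _ (disk_axis x1).
have := is_derive_row (diff_derivable d).
by congr (is_derive _ _ _ _); apply/funext => s; rewrite /radial enorm_axis.
Qed.

Lemma h_derive (x : R) : 0 < x < 1 -> is_derive x 1 h (hD x).
Proof.
move=> /andP[x0 x1]; have x1' : `|x| < 1 by rewrite gtr0_norm.
apply: near_is_derive x0 _ (eta_derive x1') => y; rewrite ltr_norml => /andP[y1 _].
by rewrite ger0_norm//; lra.
Qed.

Lemma hD_derive (x : R) : `|x| < 1 ->
  is_derive x 1 hD ('D_(1, 0) ('D_(1, 0) (radial h)) (x, 0)).
Proof.
move=> x1; case: hW => C _ _ _ _; have [_ d _ _] := C _ (disk_axis x1).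
exact: is_derive_row (diff_derivable d).
Qed.

Lemma hD_ge0 (x : R) : 0 < x < 1 -> 0 <= hD x.
Proof.
move=> /andP[x0 x1]; rewrite leNgt; apply/negP => n0; case: hW => _ inc _ _ _.
have e0 : 0 < - hD x / 2 by lra.
have xi : 0 < x < 1 by rewrite x0.
have [d d0 hd] := is_derive_small (h_derive xi) e0.
pose y := Num.min (d / 2) ((1 - x) / 2).
have y0 : 0 < y by rewrite lt_min; lra.
have yd : y <= d / 2 by rewrite ge_min lexx.
have y1 : y <= (1 - x) / 2 by rewrite ge_min lexx orbT.
have := hd (x + y); rewrite addrAC subrr add0r gtr0_norm// => /(_ ltac:(lra)).
rewrite ler_norml => /andP[_]; have := inc x (x + y) ltac:(lra) ltac:(lra) ltac:(lra).
have := mulr_gt0 e0 y0; nra.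
Qed.

Lemma is_derive_hyp (x y : R) : 0 < x ->
  is_derive y 1 (fun s => Num.sqrt (x ^+ 2 + s ^+ 2)) (y / Num.sqrt (x ^+ 2 + y ^+ 2)).
Proof.
move=> x0; have p : 0 < x ^+ 2 + y ^+ 2 by rewrite ltr_wpDr ?sqr_ge0 ?exprn_gt0.
have d1 := is_derive1_sqrt p.
have d2 : is_derive y 1 (fun s : R => x ^+ 2 + s ^+ 2) (2 * y).
  apply: (is_derive_eq (is_deriveD (is_derive_cst (x ^+ 2) y (1 : R)) (is_deriveX 2 (is_derive_id y (1 : R))))).
  by rewrite add0r /GRing.scale/= mulr1 expr1.
apply: (is_derive_eq (@is_derive_chain Num.sqrt (fun s => x ^+ 2 + s ^+ 2) _ _ _ _ erefl d1 d2)).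
have q : Num.sqrt (x ^+ 2 + y ^+ 2) != 0 by rewrite gt_eqF// sqrtr_gt0.
by field.
Qed.

Lemma hyp_axis (x : R) : 0 < x -> Num.sqrt (x ^+ 2 + 0 ^+ 2) = x.
Proof. by move=> x0; rewrite expr0n addr0 sqrtr_sqr gtr0_norm. Qed.

Lemma eta_col (x y : R) : 0 < x -> disk (x, y) ->
  'D_(0, 1) (radial h) (x, y) = y * (hD (Num.sqrt (x ^+ 2 + y ^+ 2)) / Num.sqrt (x ^+ 2 + y ^+ 2)).
Proof.
move=> x0 dxy; case: hW => C _ _ _ _; have [d _ _ _] := C _ dxy.
have [_ <-] := is_derive_col (diff_derivable d).
have p : 0 < Num.sqrt (x ^+ 2 + y ^+ 2) < 1.
  by rewrite sqrtr_gt0 ltr_wpDr ?sqr_ge0 ?exprn_gt0//=; exact: dxy.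
have [_ E] := @is_derive_chain h (fun s => Num.sqrt (x ^+ 2 + s ^+ 2)) _ _ _ _ erefl (h_derive p) (is_derive_hyp y x0).
by rewrite mulrCA -E.
Qed.

(** Off the axis the vertical derivative is [s * k s] with [k = h' / r] at the point [(x, s)]; its
    derivative at [s = 0] is [k 0]. *)
Lemma laplacian_axis (x : R) : 0 < x < 1 -> laplacian (radial h) (x, 0) =
  'D_(1, 0) ('D_(1, 0) (radial h)) (x, 0) + hD x / x.
Proof.
move=> /andP[x0 x1]; rewrite /laplacian; congr (_ + _).
have x1' : `|x| < 1 by rewrite gtr0_norm.
case: hW => C _ _ _ _; have [_ _ d _] := C _ (disk_axis x1').
have [_ <-] := is_derive_col (diff_derivable d).
pose k s := hD (Num.sqrt (x ^+ 2 + s ^+ 2)) / Num.sqrt (x ^+ 2 + s ^+ 2).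
have dh := is_derive_hyp 0 x0; rewrite hyp_axis// mul0r in dh.
have d1 := @is_derive_chain hD (fun s => Num.sqrt (x ^+ 2 + s ^+ 2)) _ _ _ _ (hyp_axis x0) (hD_derive x1') dh.
pose S (s : R) : R := Num.sqrt (x ^+ 2 + s ^+ 2).
have q : S 0 != 0 by rewrite /S hyp_axis// gt_eqF.
have d2 := is_deriveV (f := S) q dh.
have d3 := is_deriveM (is_derive_id 0 (1 : R)) (is_deriveM d1 d2).
have [e e0 he] : exists2 e : R, 0 < e & forall y : R, `|y| < e -> disk (x, y).
  have x2 : x ^+ 2 < 1 by rewrite expr2; nra.
  exists (1 - x ^+ 2); first by lra.
  move=> y; rewrite ltr_norml => /andP[y1 y2]; rewrite /disk/= /enorm/= -[ltRHS]sqrtr1 ltr_sqrt//.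
  have := sqr_ge0 x; nra.
suff: is_derive (0 : R) (1 : R) (fun s : R => 'D_(0, 1) eta (x, s)) (hD x / x) by case.
apply: (@near_is_derive _ (fun s => s * k s) _ _ _ _ e0).
  by move=> y; rewrite subr0 => /he dy; rewrite eta_col.
apply: (is_derive_eq d3).
rewrite scale0r add0r.
by change (hD (S 0) / S 0 * 1 = hD x / x); rewrite mulr1 /S hyp_axis.
Qed.

(** With [u = r ^ 2] one has [d/du = (1 / 2 r) d/dr], and [(r h')' / r] is the radial Laplacian. *)
Lemma mm_derive (u : R) : 0 < u < 1 -> is_derive u 1 mm (lapl u / 2).
Proof.
move=> ui; have si := sqrtr_itv ui; move: (ui) (si) => /andP[u0 u1] /andP[s0 s1].
have d0 := is_derive1_sqrt u0.
have s1' : `|Num.sqrt u| < 1 by rewrite gtr0_norm.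
have d1 := is_derive1_comp (hD_derive s1') d0.
apply: (is_derive_eq (is_deriveM d0 d1)).
rewrite /lapl laplacian_axis//= /GRing.scale/=.
by field; rewrite gt_eqF.
Qed.

Lemma wt_derive (u : R) : 0 < u < 1 -> is_derive u 1 wt (- (mm u / u) * wt u).
Proof.
move=> ui; have si := sqrtr_itv ui; move: (ui) (si) => /andP[u0 u1] /andP[s0 s1].
have d0 := is_derive1_sqrt u0.
have d1 := is_deriveN (is_derive1_comp (h_derive si) d0).
have d2 := is_derive1_comp (is_derive_expR _) d1.
apply: (is_derive_eq (is_deriveX 2 d2)).
have -> : (- (h \o Num.sqrt)) u = - h (Num.sqrt u) by [].
have -> : mm u / u = hD (Num.sqrt u) / Num.sqrt u.
  by rewrite /mm -[X in _ / X](sqr_sqrtr (ltW u0)); field; rewrite gt_eqF.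
rewrite /wt /= /GRing.scale/=.
by field; rewrite gt_eqF.
Qed.

Lemma wt_gt0 u : 0 < wt u.
Proof. by rewrite exprn_gt0// expR_gt0. Qed.

Lemma sqrtr_lt1 (u : R) : u < 1 -> `|Num.sqrt u| < 1.
Proof. by move=> u1; rewrite ger0_norm ?sqrtr_ge0// -[ltRHS]sqrtr1 ltr_sqrt ?ltr01. Qed.

Lemma wt_continuous (u : R) : u < 1 -> {for u, continuous wt}.
Proof.
move=> /sqrtr_lt1 u1; have [/derivable1_diffP/differentiable_continuous c _] := eta_derive u1.
have E : wt = fun u => expR (- h `|Num.sqrt u|) * expR (- h `|Num.sqrt u|).
  by apply/funext => s; rewrite /wt expr2 ger0_norm// sqrtr_ge0.
have c1 : {for u, continuous (fun u => expR (- h `|Num.sqrt u|))}.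
  apply: (@continuous_comp _ _ _ (fun u => - h `|Num.sqrt u|) expR); last exact: continuous_expR.
  apply: (@cvgN _ _ _ _ _ (fun u : R => h `|Num.sqrt u|)).
  apply: (@continuous_comp _ _ _ (@Num.sqrt R) (fun s => h `|s|)); [exact: sqrt_continuous|exact: c].
by rewrite E; apply: continuousM.
Qed.

Lemma mm_continuous (u : R) : u < 1 -> {for u, continuous mm}.
Proof.
move=> /sqrtr_lt1 u1; have [/derivable1_diffP/differentiable_continuous c _] := hD_derive u1.
apply: continuousM; first exact: sqrt_continuous.
by apply: (@continuous_comp _ _ _ (@Num.sqrt R) hD); [exact: sqrt_continuous|exact: c].
Qed.

Lemma mm_ge0 u : 0 < u < 1 -> 0 <= mm u.
Proof. by move=> /sqrtr_itv si; rewrite mulr_ge0 ?sqrtr_ge0 ?hD_ge0. Qed.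

Lemma lapl_bounds : exists2 c : R, 1 <= c & forall u, 0 <= u < 1 ->
  (c * t (Num.sqrt u) ^+ 2)^-1 <= lapl u / 2 <= c / t (Num.sqrt u) ^+ 2.
Proof.
case: (hW) => _ _ L0 _ [_ _ [c [c0 hc]] _ _].
exists (2 * c ^+ 2 + 1); first by have := sqr_ge0 c; lra.
move=> u /andP[u0 u1]; have s1 := sqrtr_lt1 u1; have ds := disk_axis s1.
have t0 : 0 < t (Num.sqrt u).
  by apply: (t_gt0 hW); rewrite sqrtr_ge0 -[Num.sqrt u]ger0_norm ?sqrtr_ge0.
have [] := hc _ ds; have := L0 _ ds; rewrite -/(lapl u) /radial enorm_axis ger0_norm ?sqrtr_ge0//.
move: (t _) t0 (lapl u) => {}t0 tp L Lp; set q := Num.sqrt L.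
have q0 : 0 < q by rewrite sqrtr_gt0.
have Lq : L = q ^+ 2 by rewrite sqr_sqrtr// ltW.
rewrite ler_pdivlMr// => h1; rewrite -div1r ler_pdivrMr// => h2; rewrite Lq.
have tt : 0 < t0 ^+ 2 by rewrite exprn_gt0.
have h1' : (t0 * q) ^+ 2 <= c ^+ 2 by rewrite lerXn2r// ?nnegrE ?mulr_ge0 ?ltW.
have h2' : 1 <= (c * t0 * q) ^+ 2 by rewrite exprn_ege1.
have cc := sqr_ge0 c.
have pp : 0 < 2 * c ^+ 2 + 1 by lra.
apply/andP; split.
  rewrite -div1r ler_pdivrMr ?mulr_gt0// !exprMn in h2' *.
  have := mulr_ge0 (sqr_ge0 q) (ltW tt); nra.
by rewrite ler_pdivlMr// exprMn in h1' *; nra.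
Qed.

Lemma mm_mvt u v : 0 < u -> u < v -> v < 1 ->
  exists2 x, u < x < v & mm v - mm u = lapl x / 2 * (v - u).
Proof.
move=> u0 uv v1; have [x|x|x xi E] := @MVT R mm (fun x => lapl x / 2) u v uv.
- by rewrite in_itv/= => xi; apply: mm_derive; lra.
- move: x; apply: continuous_in_subspaceT => x; rewrite inE/= in_itv/= => xi.
  by apply: mm_continuous; lra.
by exists x => //; rewrite in_itv/= in xi.
Qed.

End RadialDerivatives.

(** * Moments of the weight and the location of their ratios *)

Section Moments.
Context {R : realType}.
Local Notation leb := (@lebesgue_measure R).
Local Notation TR := (measurableTypeR R).
Local Notation T2 := (TR * TR)%type.
Local Notation J := (`[0%R, 1%R[%classic : set TR).
Local Notation mu2 := (leb \x leb)%E.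

Lemma integrable_scale (D : set TR) (g : R -> R) (c : R) : measurable D ->
  leb.-integrable D (EFin \o g) -> leb.-integrable D (EFin \o (fun u => c * g u)).
Proof.
move=> mD ig; apply: (@eq_integrable _ _ _ leb _ mD (fun u => c%:E * (EFin \o g) u)%E) => //.
exact: integrableZl.
Qed.

Lemma integrable_sub (D : set TR) (f g : R -> R) : measurable D ->
  leb.-integrable D (EFin \o f) -> leb.-integrable D (EFin \o g) ->
  leb.-integrable D (EFin \o (fun u => f u - g u)).
Proof.
move=> mD if_ ig; apply: (@eq_integrable _ _ _ leb _ mD (fun u => (EFin \o f) u - (EFin \o g) u)%E) => //.
exact: integrableB.
Qed.

Variables h t : R -> R.
Hypothesis hW : in_W h t.

Lemma measurable_J : measurable J. Proof. exact: measurable_itv. Qed.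

(** Functions of [Num.sqrt u] extend continuously to negative [u], where the root is 0, so an open
    ray can stand in for the half-open interval. *)
Lemma measurable_ltr1 (g : R -> R) : (forall u, u < 1 -> {for u, continuous g}) ->
  measurable_fun J g.
Proof.
move=> cg; apply: (@measurable_funS _ _ _ _ (`]-oo, 1[%classic : set TR)).
- exact: measurable_itv.
- by move=> x /=; rewrite !in_itv/= => /andP[].
apply: open_continuous_measurable_fun; first exact: interval_open.
by move=> x; rewrite inE/= in_itv/=; exact: cg.
Qed.

Lemma Xwt_continuous (n : nat) (u : R) : u < 1 -> {for u, continuous (fun u : R => u ^+ n * wt h u)}.
Proof. by move=> u1; apply: continuousM; [exact: exprn_continuous|exact: (wt_continuous hW)]. Qed.

Lemma wt_nrm2 (p : T2) : wt h (nrm2 p) = omega h p ^+ 2.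
Proof. by rewrite /wt /omega /radial /enorm nrm2E. Qed.

Lemma Xwt_ge0 n u : 0 <= u -> 0 <= u ^+ n * wt h u.
Proof. by move=> u0; rewrite mulr_ge0 ?exprn_ge0// ltW// wt_gt0. Qed.

Definition mom n : R := Rintegral leb J (fun u => u ^+ n * wt h u).

Lemma mono_radial n : (\int[leb2]_(p in disk) (cnorm2 ((p2c p) ^+ n) * omega h p ^+ 2)%:E =
  (@kap R)%:E * \int[leb]_(u in J) (u ^+ n * wt h u)%:E)%E.
Proof.
rewrite -(@integral_radial R (fun u => (u ^+ n * wt h u)%:E)); last 2 first.
- by apply/measurable_EFinP; apply: measurable_ltr1 => u u1; exact: Xwt_continuous.
- by move=> y /andP[y0 _]; rewrite lee_fin Xwt_ge0.
apply: eq_integral => p _; rewrite wt_nrm2 cnorm2E cabsX -exprM mulnC exprM -cnorm2E.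
by rewrite p2c_nrm2.
Qed.

Lemma mom_fin n : (\int[leb]_(u in J) (u ^+ n * wt h u)%:E)%E \is a fin_num.
Proof.
have := integrable_fin_num (@measurable_disk R) (A2_integrable hW (mono_A2 hW n)).
rewrite [X in X \is a fin_num -> _](_ : _ = (\int[leb2]_(p in disk) (cnorm2 ((p2c p) ^+ n) * omega h p ^+ 2)%:E)%E)//.
rewrite mono_radial; have k0 := @kap_gt0 R.
have : (0 <= \int[leb]_(u in J) (u ^+ n * wt h u)%:E)%E.
  by apply: integral_ge0 => u /=; rewrite in_itv/= => /andP[u0 _]; rewrite lee_fin Xwt_ge0.
case: (integral _ _ _) => [r| |]//.
by rewrite mulry gtr0_sg// mul1e.
Qed.

Lemma mom_integrable n : leb.-integrable J (EFin \o (fun u => u ^+ n * wt h u)).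
Proof.
apply/integrableP; split.
  by apply/measurable_EFinP; apply: measurable_ltr1 => u u1; exact: Xwt_continuous.
rewrite (eq_integral (fun u : TR => ((u : R) ^+ n * wt h u)%:E)).
  by have := mom_fin n; rewrite fin_numElt => /andP[].
move=> u; rewrite inE/= in_itv/= => /andP[u0 _].
by rewrite ger0_norm// Xwt_ge0.
Qed.

Lemma mnorm_mom n : mnorm h n = (pi^-1 * @kap R) * mom n.
Proof.
rewrite /mnorm /area_Rintegral -mulrA; congr (_ * _).
rewrite {1}/Rintegral mono_radial fineM//; exact: mom_fin.
Qed.

Lemma mom_gt0 n : 0 < mom n.
Proof.
have := mnorm_gt0 hW n; rewrite mnorm_mom.
by rewrite pmulr_rgt0// mulr_gt0 ?kap_gt0// invr_gt0 pi_gt0.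
Qed.

(** Cauchy-Schwarz: [(u - l) ^ 2] is integrated against [u ^ n * wt], with the [l] that minimises
    the result. *)
Lemma mom_convex n : mom n.+1 ^+ 2 <= mom n * mom n.+2.
Proof.
have m0 := mom_gt0 n; pose l := mom n.+1 / mom n.
have key : 0 <= mom n.+2 - 2 * l * mom n.+1 + l ^+ 2 * mom n.
  have E : mom n.+2 - 2 * l * mom n.+1 + l ^+ 2 * mom n =
    Rintegral leb J (fun u => u ^+ n * wt h u * (u - l) ^+ 2).
    rewrite /mom -(RintegralZl (2 * l) measurable_J (mom_integrable n.+1)).
    rewrite -(RintegralZl (l ^+ 2) measurable_J (mom_integrable n)).
    have i1 : leb.-integrable J (EFin \o (fun u => 2 * l * (u ^+ n.+1 * wt h u))).
      exact: (integrable_scale _ measurable_J (mom_integrable n.+1)).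
    have i2 : leb.-integrable J (EFin \o (fun u => l ^+ 2 * (u ^+ n * wt h u))).
      exact: (integrable_scale _ measurable_J (mom_integrable n)).
    have i3 : leb.-integrable J (EFin \o (fun u => u ^+ n.+2 * wt h u - 2 * l * (u ^+ n.+1 * wt h u))).
      by apply: (integrable_sub measurable_J) => //; exact: (mom_integrable n.+2).
    rewrite -RintegralB//; last exact: (mom_integrable n.+2).
    rewrite -RintegralD//; apply: eq_Rintegral => u _; rewrite !exprS; ring.
  rewrite E; apply: Rintegral_ge0 => u /=; rewrite in_itv/= => /andP[u0 _].
  by rewrite mulr_ge0 ?sqr_ge0 ?Xwt_ge0.
have e : mom n.+1 = l * mom n by rewrite /l divfK// gt_eqF.
have := mulr_ge0 (ltW m0) key; rewrite e; nra.
Qed.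

(** As [mnorm] is a fixed multiple of [mom], this is [c_n / c_(n+1)]; it is also the mean of [u]
    under the density proportional to [u ^ n * wt]. *)
Definition brat n : R := mom n.+1 / mom n.

Lemma brat_le n m : (n <= m)%N -> brat n <= brat m.
Proof.
elim: m => [|m IH]; first by rewrite leqn0 => /eqP ->.
rewrite leq_eqVlt => /orP[/eqP -> //|/IH h1]; apply: le_trans h1 _.
by rewrite /brat ler_pdivrMr ?mom_gt0// mulrAC ler_pdivlMr ?mom_gt0// -expr2 mulrC mom_convex.
Qed.

(** Monotone convergence along [[0, 1 - 1 / (n + 1)]]; it allows integration by parts to stay away
    from the boundary. The first interval is a point and is handled apart. *)
Lemma Rintegral_le_lim (f : R -> R) (M : R) : (forall u, u < 1 -> {for u, continuous f}) ->
  (forall u, 0 <= u < 1 -> 0 <= f u) -> leb.-integrable J (EFin \o f) ->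
  (forall a, 0 < a < 1 -> Rintegral leb `[0, a] f <= M) -> Rintegral leb J f <= M.
Proof.
move=> cf f0 fi hM; have mf := measurable_ltr1 cf.
pose F (n : nat) : set TR := [set` Interval (BLeft (0 : R)) (BRight (1 - n.+1%:R^-1))].
have nF n : 0 <= (n.+1%:R : R)^-1 by rewrite invr_ge0.
have FJ n : F n `<=` J.
  move=> x; rewrite /F /= !in_itv/= => /andP[-> h1].
  by apply: le_lt_trans h1 _; rewrite ltrBlDr ltrDl invr_gt0.
have EJ : J = \bigcup_n F n by rewrite -itv_bnd_open_bigcup.
have M0 : 0 <= M.
  apply: le_trans (hM (1 / 2) ltac:(lra)); apply: Rintegral_ge0 => x /=; rewrite in_itv/= => xi.
  by apply: f0; lra.
rewrite -lee_fin /Rintegral fineK; last exact: integrable_fin_num fi.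
rewrite {1}EJ; apply: cvge_le; last first.
  apply: ge0_nondecreasing_set_cvg_integral.
  - apply/nondecreasing_seqP => n; rewrite subsetEset => x; rewrite /F /= !in_itv/= => /andP[-> h1] /=.
    by apply: le_trans h1 _; rewrite lerD2l lerN2 lef_pV2 ?posrE ?ltr0n// ler_nat.
  - by move=> i; exact: measurable_itv.
  - move=> i; apply/measurable_EFinP; apply: (measurable_funS measurable_J (@FJ i) mf).
  - by move=> i x /FJ /=; rewrite in_itv/= => xi; rewrite lee_fin f0.
apply: nearW => -[|n].
  rewrite /F invr1 subrr set_itv1 integral_set1 lee_fin//.
have fin : (\int[leb]_(x in F n.+1) (f x)%:E)%E \is a fin_num.
  apply: integrable_fin_num; first exact: measurable_itv.
  by apply: (@integrableS _ _ _ leb J) fi => //; exact: measurable_itv.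
rewrite -(fineK fin) lee_fin; apply: hM.
rewrite subr_gt0 invf_lt1 ?ltr0n// ltr1n/= ltrBlDr ltrDl invr_gt0 ltr0n//.
exact: eventually_filter.
Qed.

(** Integrate the derivative of [F = u^(n+1) * wt * (u - u0)] over [[0, c]]. [F] vanishes at 0 and
    is nonnegative at [c > u0], so the boundary term has the good sign whatever the behaviour of the
    weight at 1. The outcome is that the mean of [a * |u - u0|] is at most [1 + b], the 1 bounding
    [u]. *)
Lemma moment_location n (u0 a b : R) : 0 < u0 < 1 -> 0 < a -> 0 <= b ->
  (forall u, 0 <= u < 1 -> a * `|u - u0| - b <= (mm h u - n.+1%:R) * (u - u0)) ->
  `|brat n - u0| <= (1 + b) / a.
Proof.
move=> /andP[u00 u01] a0 b0 hp.
pose F (u : R) := u ^+ n.+1 * wt h u * (u - u0).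
pose k (u : R) := u ^+ n * wt h u * ((n.+1%:R - mm h u) * (u - u0) + u).
have dF (u : R) : 0 < u < 1 -> is_derive u 1 F (k u).
  move=> ui; have u0' : u != 0 by rewrite gt_eqF//; case/andP: ui.
  have dX : is_derive u 1 (fun v : R => v ^+ n.+1) (n.+1%:R * u ^+ n).
    have -> : (fun v : R => v ^+ n.+1) = (id : R -> R) ^+ n.+1 by rewrite exprfctE.
    by apply: (is_derive_eq (is_deriveX n.+1 (is_derive_id u (1 : R)))); rewrite /GRing.scale/= mulr1.
  have dB : is_derive u 1 (fun v : R => v - u0) 1.
    by apply: (is_derive_eq (is_deriveB (is_derive_id u (1 : R)) (is_derive_cst u0 u (1 : R)))); rewrite subr0.
  have d := is_deriveM (is_deriveM dX (wt_derive hW ui)) dB.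
  apply: (is_derive_eq d).
  change (u ^+ n.+1 * wt h u * 1 + (u - u0) * (u ^+ n.+1 * (- (mm h u / u) * wt h u) + wt h u * (n.+1%:R * u ^+ n)) = k u).
  rewrite /k exprS.
  by field.
have cB (c : R) : {for c, continuous (fun u : R => u - u0)}.
  by apply: cvgB; [exact: cvg_id|exact: cvg_cst].
have cF (u : R) : u < 1 -> {for u, continuous F}.
  by move=> u1; apply: continuousM; [exact: Xwt_continuous|exact: cB].
have ck (u : R) : u < 1 -> {for u, continuous k}.
  move=> u1; apply: continuousM; first exact: Xwt_continuous.
  apply: continuousD; last exact: cvg_id.
  apply: continuousM; last exact: cB.
  by apply: cvgB; [exact: cvg_cst|exact: (mm_continuous hW)].
have cN (u : R) : u < 1 -> {for u, continuous (fun u : R => u ^+ n * wt h u * `|u - u0|)}.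
  move=> u1; apply: continuousM; first exact: Xwt_continuous.
  by apply: (@continuous_comp _ _ _ (fun u => u - u0) (fun v : R => `|v|)); [exact: cB|exact: norm_continuous].
have iN : leb.-integrable J (EFin \o (fun u : R => u ^+ n * wt h u * `|u - u0|)).
  apply: (le_integrable measurable_J _ _ (mom_integrable n)).
    by apply/measurable_EFinP; exact: measurable_ltr1.
  move=> u /=; rewrite in_itv/= => /andP[v0 v1]; rewrite lee_fin normrM ler_piMr//.
  by rewrite normr_id ler_norml; lra.
have iI (g : R -> R) (c : R) : c < 1 -> (forall u, u < 1 -> {for u, continuous g}) ->
    leb.-integrable `[0, c] (EFin \o g).
  move=> c1 cg; apply: continuous_compact_integrable; first exact: segment_compact.
  by apply: continuous_in_subspaceT => u; rewrite inE/= in_itv/= => ui; apply: cg; lra.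
have main c : 0 < c < 1 -> u0 < c -> a * Rintegral leb `[0, c] (fun u : R => u ^+ n * wt h u * `|u - u0|) <=
    (1 + b) * mom n.
  move=> /andP[c0 c1] u0c.
  have Ek : Rintegral leb `[0, c] k = F c.
    rewrite /Rintegral (@continuous_FTC2 _ k F 0 c c0).
    - by rewrite -EFinB/= /F expr0n/= !mul0r subr0.
    - by apply: continuous_in_subspaceT => u; rewrite inE/= in_itv/= => ui; apply: ck; lra.
    - split.
      + by move=> u; rewrite in_itv/= => ui; have [] := dF u ltac:(lra).
      + by apply: cvg_at_right_filter; apply: cF.
      + by apply: cvg_at_left_filter; apply: cF.
    - by move=> u; rewrite in_itv/= => ui; rewrite derive1E; have [_ ->] := dF u ltac:(lra).
  have Fc : 0 <= F c by rewrite mulr_ge0 ?Xwt_ge0//; lra.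
  have mc : measurable (`[0, c]%classic : set TR) by exact: measurable_itv.
  have i1 := iI _ _ c1 ck.
  have i2 := iI _ _ c1 (@Xwt_continuous n).
  have i3 := iI _ _ c1 cN.
  have i4 : leb.-integrable `[0, c] (EFin \o (fun u => (1 + b) * (u ^+ n * wt h u))).
    exact: (integrable_scale _ mc i2).
  have i5 : leb.-integrable `[0, c] (EFin \o (fun u => a * (u ^+ n * wt h u * `|u - u0|))).
    exact: (integrable_scale _ mc i3).
  have i6 : leb.-integrable `[0, c] (EFin \o (fun u => (1 + b) * (u ^+ n * wt h u) - a * (u ^+ n * wt h u * `|u - u0|))).
    exact: (integrable_sub mc).
  have := le_Rintegral mc i1 i6; rewrite Ek RintegralB// !RintegralZl//.
  have le1 : Rintegral leb `[0, c] (fun u => u ^+ n * wt h u) <= mom n.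
    rewrite /mom /Rintegral fine_le//; [exact: integrable_fin_num i2|exact: mom_fin|].
    apply: ge0_subset_integral => //.
    - by apply: measurable_int (mom_integrable n).
    - by move=> u /=; rewrite in_itv/= => /andP[v0 _]; rewrite lee_fin Xwt_ge0.
    - by move=> u /=; rewrite !in_itv/=; lra.
  have := ler_wpM2l (ltac:(lra) : 0 <= 1 + b) le1 => h1 h2.
  suff : F c <= (1 + b) * Rintegral leb `[0, c] (fun u => u ^+ n * wt h u) -
    a * Rintegral leb `[0, c] (fun u : R => u ^+ n * wt h u * `|u - u0|) by lra.
  apply: h2 => u /=; rewrite in_itv/= => /andP[v0 vc].
  have := hp u ltac:(lra); have X0 := Xwt_ge0 n v0.
  rewrite /k => hu.
  have -> : (1 + b) * (u ^+ n * wt h u) - a * (u ^+ n * wt h u * `|u - u0|) =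
    u ^+ n * wt h u * (1 + b - a * `|u - u0|) by ring.
  by rewrite ler_wpM2l//; lra.
have fin : a * Rintegral leb J (fun u : R => u ^+ n * wt h u * `|u - u0|) <= (1 + b) * mom n.
  rewrite mulrC -ler_pdivlMr//; apply: Rintegral_le_lim => //.
    by move=> u /andP[v0 _]; rewrite mulr_ge0 ?Xwt_ge0.
  move=> c /andP[c0 c1]; rewrite ler_pdivlMr// mulrC.
  (* [c] is enlarged beyond [u0], where [F] is nonnegative. *)
  pose c' := Num.max c ((1 + u0) / 2).
  have c1' : c' < 1 by rewrite gt_max c1; lra.
  have cc : c <= c' by rewrite le_max lexx.
  have uc : u0 < c' by rewrite lt_max; apply/orP; right; lra.
  apply: le_trans (main c' ltac:(lra) uc); rewrite ler_pM2l//.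
  rewrite /Rintegral fine_le//; [exact: integrable_fin_num (iI _ _ c1 cN)|exact: integrable_fin_num (iI _ _ c1' cN)|].
  apply: ge0_subset_integral => //.
  - exact: measurable_int (iI _ _ c1' cN).
  - by move=> u /=; rewrite in_itv/= => /andP[v0 _]; rewrite lee_fin mulr_ge0 ?Xwt_ge0.
  - by move=> u /=; rewrite !in_itv/=; lra.
have m0 := mom_gt0 n.
have -> : brat n - u0 = (mom n.+1 - u0 * mom n) / mom n by rewrite /brat; field; rewrite gt_eqF.
have Ed : mom n.+1 - u0 * mom n = Rintegral leb J (fun u => u ^+ n * wt h u * (u - u0)).
  rewrite /mom -(RintegralZl u0 measurable_J (mom_integrable n)) -RintegralB//.
  - by apply: eq_Rintegral => u _; rewrite exprS; ring.
  - exact: mom_integrable n.+1.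
  - exact: (integrable_scale _ measurable_J (mom_integrable n)).
rewrite normrM normfV (gtr0_norm m0) ler_pdivrMr// mulrAC ler_pdivlMr// mulrC.
apply: le_trans fin; rewrite ler_pM2l// Ed.
have iD : leb.-integrable J (EFin \o (fun u : R => u ^+ n * wt h u * (u - u0))).
  apply: (le_integrable measurable_J _ _ iN).
    apply/measurable_EFinP; apply: measurable_ltr1 => u u1.
    by apply: continuousM; [exact: Xwt_continuous|exact: cB].
  by move=> u /= _; rewrite lee_fin !normrM normr_id.
apply: le_trans (le_normr_Rintegral measurable_J iD) _.
rewrite le_eqVlt; apply/orP; left; apply/eqP; apply: eq_Rintegral => u; rewrite inE/= in_itv/= => /andP[v0 _].
by rewrite normrM ger0_norm// Xwt_ge0.
Qed.

End Moments.

(** * Positive sequences with geometric tails around a flat block *)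

Section Spread.
Context {R : realType}.
Implicit Types (p : nat -> R) (s K : R).

(** Truncated subtraction makes one of the summands vanish, so this is [|k - m|]. *)
Definition ndist (k m : nat) : nat := (k - m + (m - k))%N.

Lemma ndist_sqr k m : (k%:R - m%:R) ^+ 2 = (ndist k m)%:R ^+ 2 :> R.
Proof.
rewrite /ndist; case: (leqP m k) => h.
  by rewrite (eqP (_ : m - k == 0)%N) ?addn0 ?natrB// subn_eq0.
have -> : (k - m + (m - k) = m - k)%N by lia.
rewrite natrB; last exact: ltnW.
by rewrite -sqrrN opprB.
Qed.

Lemma ndist_ge k m : (m <= k)%N -> ndist k m = (k - m)%N.
Proof. by rewrite /ndist; lia. Qed.

Lemma ndist_le k m : (k <= m)%N -> ndist k m = (m - k)%N.
Proof. by rewrite /ndist; lia. Qed.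

Lemma subn_mid k l m : (k <= l)%N -> (l <= m)%N -> (m - k = (l - k) + (m - l))%N.
Proof. by lia. Qed.

Lemma geometric_two_sided (q : R) m N : 0 < q < 1 ->
  \sum_(k < N) q ^+ ndist k m <= 2 / (1 - q).
Proof.
move=> /andP[q0 q1]; have d0 : 0 < 1 - q by lra.
have left n : (n <= m)%N -> \sum_(k < n) q ^+ ndist k m <= q ^+ (m - n) / (1 - q).
  elim: n => [_|n IH nm]; first by rewrite big_ord0 divr_ge0 ?exprn_ge0 ?ltW.
  rewrite big_ord_recr/=; apply: le_trans (lerD (IH (ltnW nm)) (lexx _)) _.
  have -> : ndist n m = (m - n)%N by rewrite /ndist; lia.
  have -> : (m - n = (m - n.+1).+1)%N by lia.
  rewrite exprS -mulrA; set x := _ / _.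
  have -> : q ^+ (m - n.+1) = x * (1 - q) by rewrite /x divfK// gt_eqF.
  have x0 : 0 <= x by rewrite /x divr_ge0 ?exprn_ge0 ?ltW.
  have := mulr_ge0 x0 (sqr_ge0 (1 - q)); nra.
have right j : \sum_(k < m + j) q ^+ ndist k m <= (2 - q ^+ j) / (1 - q).
  elim: j => [|j IH].
    rewrite addn0 expr0; apply: le_trans (left m (leqnn m)) _.
    by rewrite subnn expr0; rewrite ler_pM2r ?invr_gt0//; lra.
  rewrite addnS big_ord_recr/=; apply: le_trans (lerD IH (lexx _)) _.
  have -> : ndist (m + j) m = j by rewrite /ndist; lia.
  by rewrite exprS le_eqVlt; apply/orP; left; apply/eqP; field; rewrite gt_eqF.
have [Nm|mN] := leqP N m.
  apply: le_trans (left N Nm) _; rewrite ler_pM2r ?invr_gt0//.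
  by apply: (@le_trans _ _ 1); [rewrite exprn_ile1// ltW|lra].
have -> : N = (m + (N - m))%N by lia.
apply: le_trans (right _) _; rewrite ler_pM2r ?invr_gt0//.
by have := exprn_ge0 (N - m) (ltW q0); lra.
Qed.

Lemma bernoulli (y : R) j : 0 <= y -> 1 + j%:R * y <= (1 + y) ^+ j.
Proof.
move=> y0; elim: j => [|j IH]; first by rewrite mul0r addr0 expr0.
rewrite exprS -natr1; have := ler_wpM2l (ltac:(lra) : 0 <= 1 + y) IH.
have := mulr_ge0 (mulr_ge0 (ler0n R j) y0) y0; nra.
Qed.

(** Half of the decay rate is given up to absorb the square: Bernoulli's inequality gives
    [(s j)^2 <= 36 (1 + s / 6)^(2 j)], then [(1 + s / 6)^2 <= 1 + s / 2] and
    [(1 + s / 2)(1 - s) <= 1 - s / 2]. *)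
Lemma geometric_sqr s j : 0 <= s <= 1 -> (s * j%:R) ^+ 2 * (1 - s) ^+ j <= 36 * (1 - s / 2) ^+ j.
Proof.
move=> /andP[s0 s1].
have b : (s * j%:R) ^+ 2 <= 36 * (1 + s / 2) ^+ j.
  have y0 : 0 <= s / 6 by lra.
  have h1 := @bernoulli (s / 6) j y0.
  have h2 : (1 + s / 6) ^+ j * (1 + s / 6) ^+ j <= (1 + s / 2) ^+ j.
    by rewrite -exprMn lerXn2r// ?nnegrE; nra.
  have js := mulr_ge0 (ler0n R j) y0.
  have h3 : (1 + j%:R * (s / 6)) * (1 + j%:R * (s / 6)) <= (1 + s / 6) ^+ j * (1 + s / 6) ^+ j.
    by apply: ler_pM => //; lra.
  apply: (@le_trans _ _ (36 * ((1 + j%:R * (s / 6)) * (1 + j%:R * (s / 6))))).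
    have -> : s * j%:R = 6 * (j%:R * (s / 6)) by field.
    by move: (j%:R * _) js => x x0; nra.
  by rewrite ler_pM2l//; apply: le_trans h3 h2.
have q0 : 0 <= (1 - s) ^+ j by rewrite exprn_ge0//; lra.
apply: le_trans (ler_wpM2r q0 b) _; rewrite -mulrA ler_pM2l// -exprMn lerXn2r// ?nnegrE; nra.
Qed.

Lemma expR_subr (x : R) : 0 <= x <= 1 / 2 -> 1 <= expR (2 * x) * (1 - x).
Proof.
move=> /andP[x0 x1]; have := expR_ge1Dx (2 * x) => h.
apply: le_trans (ler_wpM2r _ h); nra.
Qed.

Lemma expR_subrX (x : R) k : 0 <= x <= 1 / 2 -> 1 <= expR (2 * x * k%:R) * (1 - x) ^+ k.
Proof.
by move=> hx; rewrite mulrC -[_ * k%:R]mulrC expRM_natl mulrC -exprMn exprn_ege1// expR_subr.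
Qed.

(** A block has at most [K / s] indices. By [expR_subrX], crossing it at the rate [1 - K * s] costs
    at most [expR (2 * K ^ 2)], and at the rate [1 - s] at most [expR (2 * K)]. *)
Definition spread_const K : R := expR (2 * K ^+ 2 + 2 * K).

Section Weights.
(** A model of the kernel weights at a fixed radius, with [s] of the order of tau: geometric growth
    up to [nm], geometric decay from [np] on, ratios within [K * s] of 1 in between, and a block of
    about [1 / s] indices. *)
Variables (p : nat -> R) (s K : R) (nm np : nat).
Hypotheses (p0 : forall n, 0 < p n) (s0 : 0 < s) (K1 : 1 <= K) (Ks : K * s <= 1 / 2).
Hypothesis mp : (nm <= np)%N.
Hypothesis p_right : forall n, (np <= n)%N -> p n.+1 <= (1 - s) * p n.
Hypothesis p_left : forall n, (n < nm)%N -> p n <= (1 - s) * p n.+1.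
Hypothesis p_up : forall n, (nm <= n < np)%N -> (1 - K * s) * p n <= p n.+1.
Hypothesis p_down : forall n, (nm <= n < np)%N -> (1 - K * s) * p n.+1 <= p n.
Hypothesis len_ge : 1 <= K * s * (np - nm)%:R.
Hypothesis len_le : s * (np - nm)%:R <= K.

Let s1 : s <= 1 / 2. Proof. by have Ks' := Ks; have := ler_wpM2r (ltW s0) K1; rewrite mul1r; lra. Qed.
Let E := expR (2 * K ^+ 2).

Lemma block_pow k : (k <= np - nm)%N -> 1 <= E * (1 - K * s) ^+ k.
Proof.
have [s0' K1' Ks' s1'] : [/\ 0 < s, 1 <= K, K * s <= 1 / 2 & s <= 1 / 2] by [].
move=> kl; have ks0 : 0 <= K * s by rewrite mulr_ge0//; lra.
have h := @expR_subrX (K * s) k; apply: le_trans (h _) _; first by rewrite ks0.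
apply: ler_wpM2r; first by rewrite exprn_ge0//; lra.
rewrite ler_expR; have kr : k%:R <= (np - nm)%:R :> R by rewrite ler_nat.
have := ler_wpM2l (ltW s0) kr => h1.
have := ler_wpM2l (ltac:(lra) : 0 <= K) (le_trans h1 len_le); rewrite expr2; nra.
Qed.

Lemma block_comparable i j : (nm <= i <= np)%N -> (nm <= j <= np)%N -> p i <= E * p j.
Proof.
have [s0' K1' Ks' s1'] : [/\ 0 < s, 1 <= K, K * s <= 1 / 2 & s <= 1 / 2] by [].
have q0 : 0 <= 1 - K * s by lra.
have up i' k : (nm <= i')%N -> (i' + k <= np)%N -> (1 - K * s) ^+ k * p i' <= p (i' + k)%N.
  move=> hi; elim: k => [|k IH] hk; first by rewrite addn0 expr0 mul1r.
  rewrite addnS; apply: le_trans (p_up (n := (i' + k)%N) _); last by lia.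
  by rewrite exprS -mulrA ler_wpM2l// IH//; lia.
have down i' k : (nm <= i')%N -> (i' + k <= np)%N -> (1 - K * s) ^+ k * p (i' + k)%N <= p i'.
  move=> hi; elim: k => [|k IH] hk; first by rewrite addn0 expr0 mul1r.
  apply: le_trans (IH _); last by lia.
  rewrite addnS exprSr -mulrA ler_wpM2l ?exprn_ge0//; apply: p_down; lia.
have main k x y : (k <= np - nm)%N -> 0 < x -> (1 - K * s) ^+ k * x <= y -> x <= E * y.
  move=> hk x0 h; have E0 : 0 <= E by exact: expR_ge0.
  apply: le_trans (ler_wpM2l E0 h); rewrite mulrA ler_peMl ?(ltW x0)//; exact: block_pow.
move=> /andP[i1 i2] /andP[j1 j2]; have [ij|ji] := leqP i j.
  apply: (main (j - i)%N) => //; first by lia.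
  by have := up i (j - i)%N i1; rewrite subnKC//; apply.
apply: (main (i - j)%N) => //; first by lia.
by have := down j (i - j)%N j1; rewrite subnKC ?(ltnW ji)//; apply.
Qed.

(** Outside the block the decay is assumed. Inside it the weights are comparable and [(1 - s) ^ j]
    stays bounded below, so the same geometric bound centred at [np] holds at the price of a
    constant. *)
Lemma weight_decay k : p k <= spread_const K * p np * (1 - s) ^+ ndist k np.
Proof.
have [s0' K1' Ks' s1'] : [/\ 0 < s, 1 <= K, K * s <= 1 / 2 & s <= 1 / 2] by [].
have q0 : 0 <= 1 - s by lra.
have e1 : 1 <= expR (2 * K) :> R by apply: le_trans (expR_ge1Dx _); lra.
have E1 : 1 <= E by apply: le_trans (expR_ge1Dx _); have := sqr_ge0 K; lra.
have SE : spread_const K = E * expR (2 * K) by rewrite /spread_const expRD.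
have pn0 := p0 np.
have lb j : (j <= np - nm)%N -> 1 <= expR (2 * K) * (1 - s) ^+ j.
  move=> hj; apply: le_trans (@expR_subrX s j _) _; first by rewrite ltW.
  apply: ler_wpM2r; first by rewrite exprn_ge0.
  rewrite ler_expR -mulrA ler_pM2l//; apply: le_trans len_le.
  by rewrite ler_pM2l// ler_nat.
have hnp : (nm <= np <= np)%N by rewrite mp leqnn.
have block j : (nm <= j <= np)%N -> p j <= E * p np * (expR (2 * K) * (1 - s) ^+ (np - j)).
  move=> /[dup] hj /andP[h1 h2]; apply: le_trans (block_comparable hj hnp) _.
  by rewrite ler_peMr ?mulr_ge0 ?expR_ge0 ?(ltW pn0)// lb// leq_sub2l.
have [kn|nk] := leqP np k.
  rewrite ndist_ge//.
  have S1 : 1 <= spread_const K by rewrite SE mulr_ege1.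
  have h j : p (np + j)%N <= p np * (1 - s) ^+ j.
    elim: j => [|j IH]; first by rewrite addn0 mulr1.
    rewrite addnS; apply: le_trans (p_right (leq_addr _ _)) _.
    by rewrite exprS mulrCA ler_wpM2l.
  have := h (k - np)%N; rewrite subnKC// => h'; apply: le_trans h' _.
  by rewrite -mulrA ler_peMl// mulr_ge0 ?exprn_ge0 ?(ltW pn0).
rewrite (ndist_le (ltnW nk)).
have -> : spread_const K * p np * (1 - s) ^+ (np - k) = E * p np * (expR (2 * K) * (1 - s) ^+ (np - k)).
  by rewrite SE; ring.
have [nmk|knm] := leqP nm k; first by apply: block; rewrite nmk ltnW.
have h j : (j <= nm)%N -> p (nm - j)%N <= (1 - s) ^+ j * p nm.
  elim: j => [|j IH] hj; first by rewrite subn0 mul1r.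
  have nm0 : (nm - j.+1 < nm)%N by rewrite ltn_subrL (leq_ltn_trans (leq0n j) hj).
  apply: le_trans (p_left nm0) _.
  rewrite exprS -mulrA ler_wpM2l//; rewrite subnSK//.
  by apply: IH; exact: ltnW.
have := h (nm - k)%N (leq_subr _ _); rewrite (subKn (ltnW knm)).
move=> h'; apply: le_trans h' _.
rewrite (subn_mid (ltnW knm) mp).
rewrite exprD [expR _ * _]mulrCA [E * _ * _]mulrCA ler_wpM2l ?exprn_ge0//.
by apply: block; rewrite leqnn.
Qed.

(** The block alone contributes at least [1 / (K * s)] weights comparable with [p np]. *)
Lemma sum_weights_ge N : (np <= N)%N -> p np <= K * E * s * \sum_(k < N) p k.
Proof.
have [s0' K1' Ks' s1'] : [/\ 0 < s, 1 <= K, K * s <= 1 / 2 & s <= 1 / 2] by [].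
move=> hN; have E0 : 0 < E by exact: expR_gt0.
have h : (np - nm)%:R * p np <= E * \sum_(k < N) p k.
  rewrite mulr_sumr -(big_mkord predT (fun k => E * p k)).
  have pE k : 0 <= E * p k by rewrite mulr_ge0 ?ltW.
  rewrite (@big_cat_nat _ _ _ nm) //=; last by lia.
  rewrite (@big_cat_nat _ _ _ np nm) //=.
  have -> : (np - nm)%:R * p np = \sum_(nm <= k < np) p np by rewrite sumr_const_nat mulr_natl.
  have h1 : \sum_(nm <= k < np) p np <= \sum_(nm <= k < np) E * p k.
    by rewrite big_nat_cond [leRHS]big_nat_cond; apply: ler_sum => k /andP[hk _]; apply: block_comparable; lia.
  have h2 : 0 <= \sum_(0 <= k < nm) E * p k by apply: sumr_ge0.
  have h3 : 0 <= \sum_(np <= k < N) E * p k by apply: sumr_ge0.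
  lra.
have ks0 : 0 <= K * s by rewrite mulr_ge0//; lra.
have := ler_wpM2l ks0 h; have := ler_wpM2r (ltW (p0 np)) len_ge; rewrite mul1r; nra.
Qed.

Lemma block_weight n N : (nm <= n <= np)%N ->
  s * \sum_(k < N) p k <= 2 * spread_const K * E * p n.
Proof.
have [s0' K1' Ks' s1'] : [/\ 0 < s, 1 <= K, K * s <= 1 / 2 & s <= 1 / 2] by [].
move=> hn; have S0 : 0 <= spread_const K by exact: expR_ge0.
have h : \sum_(k < N) p k <= spread_const K * p np * (2 / s).
  apply: (@le_trans _ _ (\sum_(k < N) spread_const K * p np * (1 - s) ^+ ndist k np)).
    by apply: ler_sum => k _; exact: weight_decay.
  rewrite -mulr_sumr ler_wpM2l ?mulr_ge0 ?(ltW (p0 _))//.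
  have := @geometric_two_sided (1 - s) np N; rewrite opprB addrCA subrr addr0; apply; lra.
have -> : 2 * spread_const K * E * p n = 2 * spread_const K * (E * p n) by ring.
apply: (@le_trans _ _ (2 * spread_const K * p np)).
  apply: le_trans (ler_wpM2l (ltW s0) h) _.
  by rewrite le_eqVlt; apply/orP; left; apply/eqP; field; rewrite gt_eqF.
by rewrite ler_wpM2l ?mulr_ge0//; apply: block_comparable => //; lia.
Qed.

Lemma second_moment N : (np <= N)%N ->
  s ^+ 2 * \sum_(k < N) p k * (k%:R - np%:R) ^+ 2 <=
  144 * spread_const K * K * E * \sum_(k < N) p k.
Proof.
have [s0' K1' Ks' s1'] : [/\ 0 < s, 1 <= K, K * s <= 1 / 2 & s <= 1 / 2] by [].
move=> hN; have S0 : 0 <= spread_const K by exact: expR_ge0.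
(* [geometric_sqr] costs 36 and halves the rate; the two-sided series then sums to [2 / (s / 2)].
   Hence [144 = 36 * 4]. *)
have h : s ^+ 2 * \sum_(k < N) p k * (k%:R - np%:R) ^+ 2 <= 36 * (spread_const K * p np) * (2 / (s / 2)).
  rewrite mulr_sumr; apply: (@le_trans _ _ (\sum_(k < N) 36 * (spread_const K * p np) * (1 - s / 2) ^+ ndist k np)).
    apply: ler_sum => k _; rewrite ndist_sqr mulrCA -exprMn.
    apply: le_trans (ler_wpM2r (sqr_ge0 _) (weight_decay k)) _.
    rewrite [leLHS](_ : _ = spread_const K * p np * ((s * (ndist k np)%:R) ^+ 2 * (1 - s) ^+ ndist k np)); last by ring.
    rewrite [leRHS](_ : _ = spread_const K * p np * (36 * (1 - s / 2) ^+ ndist k np)); last by ring.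
    rewrite ler_wpM2l ?mulr_ge0 ?(ltW (p0 _))//; apply: geometric_sqr; lra.
  rewrite -mulr_sumr ler_wpM2l ?mulr_ge0 ?(ltW (p0 _))//.
  have := @geometric_two_sided (1 - s / 2) np N; rewrite opprB addrCA subrr addr0; apply; lra.
apply: le_trans h _.
rewrite [leLHS](_ : _ = 144 * spread_const K / s * p np); last by field; rewrite gt_eqF.
have c0 : 0 <= 144 * spread_const K / s by rewrite divr_ge0 ?(ltW s0)// mulr_ge0.
apply: le_trans (ler_wpM2l c0 (sum_weights_ge hN)) _.
by rewrite le_eqVlt; apply/orP; left; apply/eqP; field; rewrite gt_eqF.
Qed.

End Weights.
End Spread.

(** * Increments of [mm] at the scale of tau, and the location of [brat] *)

Section Location.
Context {R : realType}.
Variables h t : R -> R.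
Hypothesis hW : in_W h t.

Local Notation T u := (t (Num.sqrt u)).

Lemma T_gt0 u : 0 <= u < 1 -> 0 < T u.
Proof.
move=> /andP[u0 u1]; apply: (t_gt0 hW); rewrite sqrtr_ge0/=.
by have := sqrtr_lt1 u1; rewrite ger0_norm ?sqrtr_ge0.
Qed.

Lemma sqrtr_dist (u v : R) : 1 / 4 <= u -> 1 / 4 <= v -> `|Num.sqrt u - Num.sqrt v| <= `|u - v|.
Proof.
move=> hu hv; have q (x : R) : 1 / 4 <= x -> 1 / 2 <= Num.sqrt x.
  move=> hx; rewrite -[1 / 2]ger0_norm; last by lra.
  by rewrite -sqrtr_sqr ler_wsqrtr//; nra.
have e : u - v = (Num.sqrt u - Num.sqrt v) * (Num.sqrt u + Num.sqrt v).
  by rewrite -subr_sqr !sqr_sqrtr//; lra.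
rewrite e normrM ler_peMr// ger0_norm; have := q _ hu; have := q _ hv; lra.
Qed.

(** With slope [1 / (4 A)] in [t_sv], the radius [A * T v] is at most a quarter of [1 - v], so the
    interval around [v] stays near the boundary, and [T] varies on it by at most a quarter of
    [T v]. *)
Lemma local_T (A w : R) : 1 <= A -> w < 1 -> exists2 v1 : R, 1 / 2 <= v1 < 1 & forall v, v1 <= v < 1 ->
  [/\ w <= v, A * T v <= 1 & forall u, `|u - v| <= A * T v -> 1 / 2 <= u < 1 /\ w <= u /\ T v / 2 <= T u <= 2 * T v].
Proof.
move=> A1 w1; have e0 : 0 < (4 * A)^-1 by rewrite invr_gt0; lra.
have [r1 /andP[r10 r11] sv] := t_sv hW e0.
pose w' := Num.max (Num.max w (1 / 2)) (r1 ^+ 2).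
have w'w : w <= w' by rewrite !le_max lexx.
have w'2 : 1 / 2 <= w' by rewrite !le_max lexx orbT.
have w'r : r1 ^+ 2 <= w' by rewrite !le_max lexx orbT.
have w'1 : w' < 1 by rewrite !gt_max w1 expr_lt1 ?ltW//; lra.
have S u : w' <= u < 1 -> r1 <= Num.sqrt u < 1.
  move=> /andP[hu u1]; apply/andP; split.
    have -> : r1 = Num.sqrt (r1 ^+ 2) by rewrite sqrtr_sqr gtr0_norm.
    by rewrite ler_wsqrtr//; lra.
  by have := sqrtr_lt1 u1; rewrite ger0_norm ?sqrtr_ge0.
have T1 v : w' <= v < 1 -> 4 * A * T v <= 1 - v.
  move=> hv; have [h1 _] := sv _ (S _ hv); move: h1; rewrite ler_pdivlMl; last by lra.
  have v0 : 0 <= v by lra.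
  have := sqr_sqrtr v0; have := S _ hv => /andP[s0 s1]; rewrite expr2.
  by have := @sqrtr_ge0 R v; nra.
have T2 u v : w' <= u < 1 -> w' <= v < 1 -> 4 * A * `|T v - T u| <= `|u - v|.
  move=> hu hv; have [_ h1] := sv _ (S _ hv); move: (h1 _ (S _ hu)).
  rewrite ler_pdivlMl; last by lra.
  by move=> h2; apply: le_trans h2 _; rewrite (distrC u v); apply: sqrtr_dist; lra.
exists ((1 + w') / 2); first by lra.
move=> v /andP[hv v1]; have hv' : w' <= v < 1 by lra.
have Tv := @T_gt0 v ltac:(lra).
have t1 := T1 _ hv'; have AT : 0 <= A * T v by rewrite mulr_ge0 ?ltW//; lra.
have {}t1 : A * T v <= (1 - v) / 4 by rewrite -mulrA in t1; lra.
split; [lra|lra|] => u hu; have : `|u - v| <= (1 - v) / 4 by lra.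
rewrite ler_distl => uv; have hu' : w' <= u < 1 by lra.
have := T2 _ _ hu' hv' => h2.
have {}h2 : `|T v - T u| <= T v / 4.
  have A0 : 0 < A by lra.
  by rewrite -(ler_pM2l A0); move: h2; rewrite -mulrA; lra.
by move: h2; rewrite ler_distl; split; [lra|split; lra].
Qed.

Lemma lapl_gt0 u : 0 <= u < 1 -> 0 < lapl h u.
Proof.
move=> /andP[u0 u1]; case: hW => _ _ L0 _ _; apply: L0.
by apply: disk_axis; exact: sqrtr_lt1.
Qed.

Lemma mm_mono u v : 0 <= u -> u <= v -> v < 1 -> mm h u <= mm h v.
Proof.
rewrite le_eqVlt => /orP[/eqP<-|u0].
  rewrite le_eqVlt => /orP[/eqP<-//|v0 v1]; rewrite {1}/mm sqrtr0 mul0r (mm_ge0 hW)//.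
  by rewrite v0.
rewrite le_eqVlt => /orP[/eqP<-//|uv v1].
have [x xi E] := mm_mvt hW u0 uv v1; rewrite -subr_ge0 E.
have x1 : 0 <= x < 1 by lra.
by rewrite mulr_ge0//; [have := lapl_gt0 x1; lra|lra].
Qed.

(* Increments of [mm] at the scale of [T], where [mm' = lapl / 2] is comparable with [T^-2]. *)
Lemma mm_local (c : R) (A v u : R) : 1 <= c -> 1 <= A -> 0 < v < 1 ->
  (forall u, 0 <= u < 1 -> (c * T u ^+ 2)^-1 <= lapl h u / 2 <= c / T u ^+ 2) ->
  (forall u, `|u - v| <= A * T v -> 1 / 2 <= u < 1 /\ T v / 2 <= T u <= 2 * T v) ->
  `|u - v| <= A * T v ->
  (u - v) ^+ 2 / (4 * c * T v ^+ 2) <= (mm h u - mm h v) * (u - v) /\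
  `|mm h u - mm h v| <= 4 * c * `|u - v| / T v ^+ 2.
Proof.
move=> c1 A1 vi lb loc hu; have [ui _] := loc u hu.
have Tv : 0 < T v by apply: T_gt0; lra.
have T2 : 0 < T v ^+ 2 by rewrite exprn_gt0.
have key x : `|x - v| <= A * T v -> 1 / (4 * c * T v ^+ 2) <= lapl h x / 2 <= 4 * c / T v ^+ 2.
  move=> hx; have [xi /andP[t1 t2]] := loc x hx; have /andP[l1 l2] := lb x ltac:(lra).
  have Tx : 0 < T x by lra.
  have Tx2 : 0 < T x ^+ 2 by rewrite exprn_gt0.
  have cp : 0 < c by lra.
  have q1 : T x ^+ 2 <= 4 * T v ^+ 2 by rewrite !expr2; nra.
  have q2 : T v ^+ 2 <= 4 * T x ^+ 2 by rewrite !expr2; nra.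
  apply/andP; split.
    apply: le_trans l1; rewrite div1r lef_pV2 ?posrE ?mulr_gt0//.
    by rewrite [4 * c]mulrC -mulrA ler_pM2l.
  apply: le_trans l2 _; rewrite ler_pdivrMr// mulrAC ler_pdivlMr//.
  by rewrite [4 * c]mulrC -[leRHS]mulrA ler_pM2l.
have q0 : 0 <= 1 / (4 * c * T v ^+ 2).
  by rewrite divr_ge0// mulr_ge0 ?(ltW T2)//; clear - c1 hW; lra.
have [uv|vu|->] := ltgtP u v; last first.
- by split; rewrite !subrr ?normr0 ?mulr0 ?expr0n/= ?mul0r.
- have v0 : 0 < v by case/andP: vi.
  have [x xi E] := mm_mvt hW v0 vu ltac:(lra).
  have hx : `|x - v| <= A * T v by move: hu; rewrite !ler_distl; clear - xi hW; lra.
  have /andP[k1 k2] := key x hx; rewrite E normrM (@ger0_norm _ (u - v)); last by rewrite subr_ge0 ltW.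
  have d0 : 0 <= u - v by rewrite subr_ge0 ltW.
  split; first by rewrite -[leRHS]mulrA -expr2 [leRHS]mulrC ler_wpM2l ?sqr_ge0// -div1r.
  rewrite ger0_norm; last exact: le_trans q0 k1.
  by rewrite [leRHS]mulrAC ler_wpM2r.
have u0 : 0 < u by lra.
have [x xi E] := mm_mvt hW u0 uv ltac:(lra).
have hx : `|x - v| <= A * T v by move: hu; rewrite !ler_distl; clear - xi hW; lra.
have /andP[k1 k2] := key x hx; rewrite (distrC u v).
have -> : mm h u - mm h v = - (lapl h x / 2 * (v - u)) by rewrite -E opprB.
have -> : u - v = - (v - u) by rewrite opprB.
rewrite mulrNN sqrrN normrN normrM.
have d0 : 0 <= v - u by rewrite subr_ge0 ltW.
rewrite (@ger0_norm _ (v - u))//.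
split; first by rewrite -[leRHS]mulrA -expr2 [leRHS]mulrC ler_wpM2l ?sqr_ge0// -div1r.
rewrite ger0_norm; last exact: le_trans q0 k1.
by rewrite [leRHS]mulrAC ler_wpM2r.
Qed.

(** Within [T v] of [v], [mm_local] gives a quadratic bound. Farther away [mm] is monotone, so its
    increment is at least the one at distance [T v] and the product grows at least linearly. *)
Lemma mm_coercive (c v u : R) : 1 <= c -> 0 < v < 1 -> 0 <= u < 1 ->
  (forall u, 0 <= u < 1 -> (c * T u ^+ 2)^-1 <= lapl h u / 2 <= c / T u ^+ 2) ->
  (forall u, `|u - v| <= 1 * T v -> 1 / 2 <= u < 1 /\ T v / 2 <= T u <= 2 * T v) ->
  (`|u - v| / T v - 1) / (4 * c) <= (mm h u - mm h v) * (u - v).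
Proof.
move=> c1 vi ui lb loc.
have Tv : 0 < T v by apply: T_gt0; lra.
have c0 : 0 < 4 * c by lra.
have far x : `|x - v| = T v -> 1 / (4 * c) <= (mm h x - mm h v) * (x - v).
  move=> hx; have [] := @mm_local c 1 v x c1 (lexx _) vi lb loc; first by rewrite hx mul1r.
  move=> + _; rewrite -(real_normK (num_real (x - v))) hx => h1; apply: le_trans h1.
  by rewrite le_eqVlt; apply/orP; left; apply/eqP; field; rewrite !gt_eqF//; lra.
have ab x : 1 / (4 * c) <= x * T v -> forall y d, x <= y -> T v <= d -> (d / T v - 1) / (4 * c) <= y * d.
  move=> hx y d xy Td; have d0 : 0 < d by lra.
  rewrite -ler_pdivrMr// in hx; have xp : 0 < x by apply: lt_le_trans hx; rewrite !divr_gt0.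
  apply: (@le_trans _ _ (d / T v / (4 * c))); first by rewrite ler_pM2r ?invr_gt0//; lra.
  have -> : d / T v / (4 * c) = (1 / (4 * c) / T v) * d by field; rewrite !gt_eqF//; lra.
  by rewrite ler_pM2r//; apply: le_trans xy.
have [near|] := leP `|u - v| (T v).
  have [] := @mm_local c 1 v u c1 (lexx _) vi lb loc; first by rewrite mul1r.
  move=> h1 _; apply: le_trans h1.
  rewrite -(real_normK (num_real (u - v))).
  have -> : `|u - v| ^+ 2 / (4 * c * T v ^+ 2) = (`|u - v| / T v) ^+ 2 / (4 * c) by field; rewrite !gt_eqF//; lra.
  rewrite ler_pM2r ?invr_gt0//; have : 0 <= `|u - v| / T v by rewrite divr_ge0// ltW.
  by move: (_ / T v) => y y0; have := sqr_ge0 (y - 1); rewrite !expr2; nra.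
rewrite ltr_normr => /orP[hu|hu].
  have := far (v + T v); rewrite addrAC subrr add0r gtr0_norm// => /(_ erefl) hx.
  have le : mm h (v + T v) - mm h v <= mm h u - mm h v by rewrite lerD2r mm_mono//; clear - vi ui hu Tv hW; lra.
  by rewrite ger0_norm; [exact: (ab _ hx _ _ le (ltW hu))|exact: le_trans (ltW Tv) (ltW hu)].
have [vT _] := loc (v - T v) ltac:(by rewrite addrAC subrr add0r normrN gtr0_norm// mul1r).
have := far (v - T v); rewrite addrAC subrr add0r normrN gtr0_norm// mulrN -mulNr opprB => /(_ erefl) hx.
have le : mm h v - mm h (v - T v) <= mm h v - mm h u by rewrite lerD2l lerN2 mm_mono//; clear - vi ui vT hu Tv hW; lra.
have hu' : T v <= v - u by move: hu; rewrite opprB => /ltW.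
rewrite -normrN opprB ger0_norm; last exact: le_trans (ltW Tv) hu'.
by rewrite -[leRHS]mulrNN !opprB; exact: (ab _ hx _ _ le hu').
Qed.

Lemma brat_location : exists2 c : R, 1 <= c & 
  (forall u, 0 <= u < 1 -> (c * T u ^+ 2)^-1 <= lapl h u / 2 <= c / T u ^+ 2) /\
  exists2 w : R, 1 / 2 <= w < 1 & forall v, w <= v < 1 -> 1 <= mm h v /\
    forall n, `|n.+1%:R - mm h v| <= 1 -> `|brat h n - v| <= 16 * c * T v.
Proof.
have [c c1 lb] := lapl_bounds hW; exists c => //; split=> //.
have [w w1 loc] := @local_T (8 * c) 0 ltac:(lra) ltr01; exists w => // v /andP[hv v1].
have [_ Ts loc'] := loc v ltac:(lra).
have vi : 0 < v < 1 by lra.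
have Tv : 0 < T v by apply: T_gt0; lra.
have loc1 u : `|u - v| <= 1 * T v -> 1 / 2 <= u < 1 /\ T v / 2 <= T u <= 2 * T v.
  move=> hu; have [] := loc' u; last by move=> ? [_ ?].
  by apply: le_trans hu _; rewrite ler_pM2r//; lra.
have co u ui := @mm_coercive c v u c1 vi ui lb loc1.
have xT u : `|u - v| <= `|u - v| / T v / (8 * c).
  rewrite -mulrA -invfM ler_peMr// invf_ge1; first by rewrite mulrC.
  by rewrite mulr_gt0//; lra.
split.
  (* Over a step of length [T v] the function [mm] grows by at least [1 / (4 * c * T v)], which is
     at least 2 because [8 * c * T v <= 1]. *)
  have [vT _] := loc1 (v - T v) ltac:(by rewrite addrAC subrr add0r normrN gtr0_norm// mul1r).
  have [h1 _] := @mm_local c 1 v (v - T v) c1 (lexx _) vi lb loc1 ltac:(by rewrite addrAC subrr add0r normrN gtr0_norm// mul1r).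
  have m0 : 0 <= mm h (v - T v) by apply: (mm_ge0 hW); lra.
  move: h1; rewrite addrAC subrr add0r sqrrN mulrN -mulNr opprB.
  have -> : T v ^+ 2 / (4 * c * T v ^+ 2) = 1 / (4 * c) by field; rewrite !gt_eqF//; lra.
  rewrite ler_pdivrMr; last by lra.
  move=> h2; have : 4 * c * T v <= 1 / 2 by lra.
  move=> h3; have h4 : 1 <= (mm h v - mm h (v - T v)) * (1 / 2).
    have d0 : 0 <= mm h v - mm h (v - T v) by rewrite subr_ge0 mm_mono//; clear - vi vT Tv hW; lra.
    by apply: le_trans h2 _; rewrite -mulrA ler_wpM2l//; clear - h3 hW; lra.
  clear - h4 m0 hW; lra.
move=> n hn.
(* [moment_location] is used with [a = 1 / (8 * c * T v)] and [b = 1]. Coercivity supplies twice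
   this slope; replacing [mm h v] by the integer [n + 1] costs [|u - v|], at most half of it. *)
have -> : 16 * c * T v = (1 + 1) / (8 * c * T v)^-1 by rewrite invrK; ring.
apply: (moment_location hW vi) => //; first by rewrite invr_gt0 mulr_gt0//; lra.
move=> u ui; have h1 := co u ui; have h2 := xT u.
have h3 : - `|u - v| <= (mm h v - n.+1%:R) * (u - v).
  rewrite lerNl -mulNr opprB; apply: le_trans (ler_norm _) _.
  by rewrite normrM ler_piMl.
have cp : 0 < c by clear - c1 hW; lra.
have e1 : (8 * c * T v)^-1 * `|u - v| = `|u - v| / T v / (8 * c) by field; rewrite !gt_eqF.
have e2 : (`|u - v| / T v - 1) / (4 * c) = 2 * (`|u - v| / T v / (8 * c)) - 1 / (4 * c) by field; rewrite !gt_eqF.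
have e3 : 1 / (4 * c) <= 1 by rewrite ler_pdivrMr; clear - c1 hW; lra.
rewrite e1; rewrite e2 in h1; clear - h1 h2 h3 e3 hW; lra.
Qed.

End Location.

(** * The block of dominant kernel weights at a given radius *)

Section KernelSpread.
Context {R : realType}.
Variables h t : R -> R.
Hypothesis hW : in_W h t.

Local Notation T u := (t (Num.sqrt u)).

Definition kw (u : R) (n : nat) : R := u ^+ n / mnorm h n.

Lemma nat_near (x : R) : 1 <= x -> exists n, `|n.+1%:R - x| <= 1.
Proof.
move=> x1; have x0 : 0 <= x by lra.
have /andP[h1 h2] := truncn_itv x0; exists (Num.truncn x).-1.
have n0 : (0 < Num.truncn x)%N.
  by rewrite lt0n; apply/eqP => e; move: h2; rewrite e => h2; lra.
by rewrite prednK// ler_distl; move: h2; rewrite -natr1; lra.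
Qed.

Lemma kw_gt0 u n : 0 < u -> 0 < kw u n.
Proof. by move=> u0; rewrite divr_gt0 ?exprn_gt0//; exact: (mnorm_gt0 hW). Qed.

(** Consecutive weights have ratio [u / brat n]; since [brat] is nondecreasing, they rise while
    [brat n < u] and fall afterwards. *)
Lemma kw_ratio u n : kw u n.+1 * brat h n = u * kw u n.
Proof.
have m1 := mom_gt0 hW n.+1; have m0 := mom_gt0 hW n; have k0 := @kap_gt0 R; have p0 := @pi_gt0 R.
have q0 : 0 < pi^-1 * @kap R by rewrite mulr_gt0// invr_gt0.
rewrite /kw /brat !(mnorm_mom hW) exprS.
move: (pi^-1 * @kap R) q0 (mom h n) (mom h n.+1) m0 m1 (u ^+ n) => q q0 a b a0 b0 v.
by field; rewrite !gt_eqF.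
Qed.

Lemma brat_gt0 n : 0 < brat h n.
Proof. by rewrite divr_gt0 ?(mom_gt0 hW). Qed.

(** [u / (u + T0) <= 1 - T0 / 2] because [u + T0 <= 2]: this is the origin of the rate
    [s = T0 / 2]. *)
Lemma ratio_right (T0 s u b p p' : R) : s = T0 / 2 -> 0 < T0 <= 1 -> 0 < u < 1 -> 0 < p ->
  0 < b -> p' * b = u * p -> u + T0 <= b -> p' <= (1 - s) * p.
Proof.
move=> -> T1 ui p0 b0 e hb; rewrite -(ler_pM2r b0) e mulrAC ler_pM2r//.
apply: (@le_trans _ _ ((1 - T0 / 2) * (u + T0))); first by nra.
by rewrite ler_wpM2l//; lra.
Qed.

Lemma ratio_left (T0 s u b p p' : R) : s = T0 / 2 -> 0 < T0 <= 1 -> 0 < u < 1 -> 0 < p' ->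
  p' * b = u * p -> b <= u - T0 -> p <= (1 - s) * p'.
Proof.
move=> -> T1 ui p0 e hb; have u0 : 0 < u by lra.
rewrite -(ler_pM2l u0) -e mulrCA [u * _]mulrC mulrA [_ * p']mulrC -mulrA ler_pM2l//; nra.
Qed.

Lemma ratio_up (d q u b p p' : R) : 1 / 2 <= u < 1 -> 0 < p -> 0 < b -> 0 <= q <= 1 -> 2 * d <= q ->
  p' * b = u * p -> b <= u + d -> (1 - q) * p <= p'.
Proof.
move=> ui p0 b0 q0 dq e hb; rewrite -(ler_pM2r b0) e mulrAC ler_pM2r//.
by have [bu|ub] := leP b u; nra.
Qed.

Lemma ratio_down (d q u b p p' : R) : 1 / 2 <= u < 1 -> 0 < p' -> 0 <= q <= 1 -> 2 * d <= q ->
  p' * b = u * p -> u - d <= b -> (1 - q) * p' <= p.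
Proof.
move=> ui p0 q0 dq e hb; have u0 : 0 < u by lra.
rewrite -(ler_pM2l u0) -e mulrA mulrC ler_pM2l//; nra.
Qed.

Lemma loc_double (c T0 T1 x : R) : 1 <= c -> T1 <= 2 * T0 -> x <= 16 * c * T1 -> x <= 32 * c * T0.
Proof. by move=> c1 h1 h2; nra. Qed.

Lemma loc_far (c T0 x : R) : 1 <= c -> 0 < T0 -> (32 * c + 1) / (4 * c * T0) <= x -> 8 <= T0 * x.
Proof.
move=> c1 T00; rewrite ler_pdivrMr; last by rewrite !mulr_gt0//; lra.
have c0 : 0 < 4 * c by lra.
move=> h1; rewrite -(ler_pM2l c0).
have -> : 4 * c * (T0 * x) = x * (4 * c * T0) by ring.
lra.
Qed.

Lemma loc_close (c T0 x : R) : 1 <= c -> 0 < T0 -> x <= 4 * c * ((32 * c + 1) * T0) / T0 ^+ 2 ->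
  T0 * x <= 132 * c ^+ 2.
Proof.
move=> c1 T00; rewrite ler_pdivlMr ?exprn_gt0// => h1.
rewrite -(ler_pM2r T00); have -> : T0 * x * T0 = x * T0 ^+ 2 by ring.
by apply: le_trans h1 _; rewrite mulrA ler_pM2r// expr2; nra.
Qed.

(** Rounding [mm] to an integer costs at most 1 at each end, and [T0 <= 1]: hence 14 from
    [8 + 8 - 2], 270 as room for [132 + 132 + 2], and 134 from the additional shift by one index. *)
Lemma loc_count (c T0 np nm mp ml m : R) : 1 <= c -> 0 < T0 <= 1 ->
  `|np + 1 - mp| <= 1 -> `|nm + 1 - ml| <= 1 -> 8 <= T0 * (mp - m) -> 8 <= T0 * (m - ml) ->
  T0 * `|mp - m| <= 132 * c ^+ 2 -> T0 * `|ml - m| <= 132 * c ^+ 2 ->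
  [/\ 14 <= T0 * (np - nm), T0 * (np - nm) <= 270 * c ^+ 2 & T0 * `|np - m| <= 134 * c ^+ 2].
Proof.
move=> c1 /andP[T00 T1] enp enm k1 k2 k3 k4.
have cc : 1 <= c ^+ 2 by rewrite expr_ge1//; lra.
have small x : `|x| <= 1 -> -1 <= T0 * x <= 1.
  move=> hx; rewrite -ler_norml normrM (gtr0_norm T00).
  by rewrite -[leRHS]mulr1; apply: ler_pM => //; exact: ltW.
have /andP[f1 f2] := small _ enp; have /andP[g1 g2] := small _ enm.
have k3' : T0 * (mp - m) <= 132 * c ^+ 2 by apply: le_trans k3; rewrite ler_pM2l// ler_norm.
have k4' : T0 * (m - ml) <= 132 * c ^+ 2.
  by apply: le_trans k4; rewrite ler_pM2l// -normrN opprB ler_norm.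
have e : T0 * (np - nm) = T0 * (np + 1 - mp) - T0 * (nm + 1 - ml) + T0 * (mp - m) + T0 * (m - ml) by ring.
clear k3 k4 enm small; rewrite e; split; [lra|lra|].
have -> : np - m = (np + 1 - mp) + (mp - m) - 1 by ring.
have -> : T0 * `|np + 1 - mp + (mp - m) - 1| = `|T0 * (np + 1 - mp) + T0 * (mp - m) - T0|.
  by rewrite -[X in X * `|_|](gtr0_norm T00) -normrM; congr `|_|; ring.
by rewrite ler_norml; lra.
Qed.

(** The ends of the block are the integers nearest in the sense of [nat_near] to [mm] at the points
    [u - a * T u] and [u + a * T u]; [brat_location] applies at both, and [mm_local] counts the
    indices between them. *)
Lemma block_location : exists2 c : R, 1 <= c & exists2 w : R, 1 / 2 <= w < 1 &
  forall u, w <= u < 1 -> 300 * c ^+ 2 * T u <= 1 /\ exists nm np : nat,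
  [/\ brat h nm <= u - T u, u + T u <= brat h np, u - 65 * c * T u <= brat h nm,
      brat h np <= u + 65 * c * T u &
  [/\ 14 <= T u * (np%:R - nm%:R), T u * (np%:R - nm%:R) <= 270 * c ^+ 2 &
      T u * `|np%:R - mm h u| <= 134 * c ^+ 2]].
Proof.
have [c c1 [lb [w0 w01 loc]]] := brat_location hW; exists c => //.
have c2 : c <= c ^+ 2 by rewrite expr2; nra.
pose A := 300 * c ^+ 2; have A1 : 1 <= A by rewrite /A; lra.
have [w w1 lT] := @local_T _ h t hW A w0 A1 (proj2 (andP w01)).
exists w; first exact: w1.
move=> u hu; have [wu AT lu] := lT u hu; split; first exact: AT.
have ui : 0 < u < 1 by clear - hu w1; lra.
have T0 : 0 < T u by apply: (T_gt0 hW); clear - ui; lra.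
(* [T] at most doubles on the interval, so [brat] is known up to [32 * c * T u] at both points; the
   extra 1 leaves the margin [T u] that makes the weights decay outside the block. *)
pose a := 32 * c + 1.
have aA : a * T u <= A * T u by rewrite ler_pM2r// /A /a; clear - c1 c2; lra.
have aT : 0 < a * T u by rewrite mulr_gt0// /a; clear - c1; lra.
have lu' v : `|v - u| <= A * T u -> 1 / 2 <= v < 1 /\ T u / 2 <= T v <= 2 * T u.
  by move=> /lu[h1 [_ h2]].
have hp : `|u + a * T u - u| <= A * T u by rewrite addrAC subrr add0r gtr0_norm.
have hm : `|u - a * T u - u| <= A * T u by rewrite addrAC subrr add0r normrN gtr0_norm.
have [/andP[_ p1] [p2 /andP[_ p3]]] := lu _ hp; have [/andP[_ m1] [m2 /andP[_ m3]]] := lu _ hm.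
have [q1 q2] := loc (u + a * T u) (introT andP (conj p2 p1)).
have [r1 r2] := loc (u - a * T u) (introT andP (conj m2 m1)).
have [np enp] := nat_near q1; have [nm enm] := nat_near r1.
have bp := loc_double c1 p3 (q2 _ enp); have bm := loc_double c1 m3 (r2 _ enm).
have [i1 i2] := mm_local hW c1 A1 ui lb lu' hp.
have [j1 j2] := mm_local hW c1 A1 ui lb lu' hm.
have e1 : u + a * T u - u = a * T u by ring.
have e2 : u - a * T u - u = - (a * T u) by ring.
have e3 : (a * T u) ^+ 2 / (4 * c * T u ^+ 2) = a / (4 * c * T u) * (a * T u).
  by field; rewrite !gt_eqF//; clear - c1; lra.
rewrite e1 e3 (gtr0_norm aT) in i1 i2; rewrite e2 sqrrN normrN e3 (gtr0_norm aT) in j1 j2.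
rewrite mulrN -mulNr opprB ler_pM2r// in j1; rewrite ler_pM2r// in i1.
rewrite -natr1 in enp; rewrite -natr1 in enm.
exists nm, np.
have T1 : T u <= 1.
  by apply: le_trans AT; rewrite ler_peMl// ltW.
have ctT : T u <= c * T u by rewrite ler_peMl// ltW.
have aE : a * T u = 32 * c * T u + T u by rewrite /a; ring.
move: bp bm; rewrite !ler_distl aE => /andP[bp1 bp2] /andP[bm1 bm2].
have [] := loc_count c1 _ enp enm (loc_far c1 T0 i1) (loc_far c1 T0 j1) (loc_close c1 T0 i2) (loc_close c1 T0 j2).
  by rewrite T0.
by split; [clear - bm2; lra|clear - bp1; lra|clear - bm1 ctT; lra|clear - bp2 ctT; lra|split].
Qed.

Lemma kernel_spread : exists2 C : R, 1 <= C & exists2 w : R, 1 / 2 <= w < 1 &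
  forall u, w <= u < 1 -> T u <= 1 /\ exists nm np : nat,
  [/\ (nm <= np)%N, 14 <= T u * (np - nm)%:R,
   forall n N, (nm <= n <= np)%N -> T u * \sum_(k < N) kw u k <= C * kw u n &
   forall N, (np <= N)%N ->
     T u ^+ 2 * \sum_(k < N) kw u k * (k%:R - mm h u) ^+ 2 <= C * \sum_(k < N) kw u k].
Proof.
have [c c1 [w w1 loc]] := block_location.
have cc : 1 <= c ^+ 2 by rewrite expr_ge1//; lra.
pose K := 300 * c ^+ 2; pose E := expR (2 * K ^+ 2); pose S := spread_const K.
have K1 : 1 <= K by rewrite /K; lra.
have S0 : 0 < S by exact: expR_gt0.
have E0 : 0 < E by exact: expR_gt0.
have SE0 : 0 < S * E by rewrite mulr_gt0.
pose C1 := 144 * S * K * E.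
have C10 : 0 <= C1.
  by apply: mulr_ge0 (ltW E0); apply: mulr_ge0 (le_trans ler01 K1); apply: mulr_ge0 (ltW S0).
(* [4 * (S * E)] pays for the block estimate, [8 * C1] for the second moment about [np], and the
   last summand for moving the centre from [np] to [mm h u]. *)
pose C := 1 + 4 * (S * E) + 8 * C1 + 2 * (134 * c ^+ 2) ^+ 2.
have sq0 : 0 <= (134 * c ^+ 2) ^+ 2 by exact: sqr_ge0.
exists C; first by rewrite /C; lra.
exists w => // u hu; have [KT [nm [np [b1 b2 b3 b4 [l1 l2 l3]]]]] := loc u hu.
have ui : 0 < u < 1 by clear - hu w1; lra.
have T0 : 0 < T u by apply: (T_gt0 hW); clear - ui; lra.
have T1 : T u <= 1 by apply: le_trans KT; rewrite ler_peMl// ltW.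
split=> //; exists nm, np.
have mp : (nm <= np)%N.
  by rewrite leqNgt; apply/negP => /ltnW /(brat_le hW); clear - b1 b2 T0; lra.
have cT : c * T u <= c ^+ 2 * T u by rewrite ler_pM2r// expr2 ler_peMl//; clear - c1; lra.
pose s := T u / 2; have s0 : 0 < s by rewrite /s; clear - T0; lra.
have Ks : K * s <= 1 / 2 by rewrite /K /s mulrA; clear - KT; lra.
have q0 : 0 <= K * s <= 1 by rewrite mulr_ge0 ?(ltW s0)//=; clear - Ks K1; lra.
have cT0 : 0 <= c * T u by rewrite mulr_ge0 ?(ltW T0)//; clear - c1; lra.
have dq : 2 * (65 * c * T u) <= K * s by rewrite /K /s; clear - cT cT0; lra.
have u0 : 0 < u by clear - ui; lra.
have uh : 1 / 2 <= u < 1 by clear - hu w1; lra.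
have kp n := kw_gt0 n u0.
have Ti : 0 < T u <= 1 by rewrite T0.
have pr n : (np <= n)%N -> kw u n.+1 <= (1 - s) * kw u n.
  move=> hn; apply: (ratio_right (erefl : s = T u / 2) Ti ui (kp n) (brat_gt0 n) (kw_ratio u n)).
  exact: le_trans b2 (brat_le hW hn).
have pl n : (n < nm)%N -> kw u n <= (1 - s) * kw u n.+1.
  move=> hn; apply: (ratio_left (erefl : s = T u / 2) Ti ui (kp n.+1) (kw_ratio u n)).
  exact: le_trans (brat_le hW (ltnW hn)) b1.
have pu n : (nm <= n < np)%N -> (1 - K * s) * kw u n <= kw u n.+1.
  move=> /andP[h1 h2]; apply: (ratio_up uh (kp n) (brat_gt0 n) q0 dq (kw_ratio u n)).
  exact: le_trans (brat_le hW (ltnW h2)) b4.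
have pd n : (nm <= n < np)%N -> (1 - K * s) * kw u n.+1 <= kw u n.
  move=> /andP[h1 h2]; apply: (ratio_down uh (kp n.+1) q0 dq (kw_ratio u n)).
  exact: le_trans b3 (brat_le hW h1).
rewrite -natrB// in l1 l2.
have lg : 1 <= K * s * (np - nm)%:R.
  have h1 : 7 <= s * (np - nm)%:R by rewrite /s; clear - l1; lra.
  by rewrite -mulrA -[leLHS]mulr1; apply: ler_pM => //; clear - h1; lra.
have ll : s * (np - nm)%:R <= K by rewrite /s /K; clear - l2 cc; lra.
split=> //.
  move=> n N hn; have := block_weight kp s0 K1 Ks mp pr pl pu pd lg ll N hn.
  rewrite -/S -/E /s => h1; have kn := kp n.
  have : 0 <= (1 + 8 * C1 + 2 * (134 * c ^+ 2) ^+ 2) * kw u n by rewrite mulr_ge0 ?(ltW kn)//; clear - C10 sq0; lra.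
  have eC : C * kw u n = (1 + 8 * C1 + 2 * (134 * c ^+ 2) ^+ 2) * kw u n + 2 * (2 * S * E * kw u n) by rewrite /C; ring.
  rewrite eC => m0; apply: ler_wpDl m0 _; set Y := \sum_(k < N) kw u k in h1 *.
  have -> : T u * Y = 2 * (T u / 2 * Y) by field.
  by rewrite ler_pM2l.
move=> N hN; have := second_moment kp s0 K1 Ks mp pr pl pu pd lg ll hN.
rewrite -/S -/E -/C1; set X := \sum_(k < N) kw u k; set Y := \sum_(k < N) kw u k * (k%:R - np%:R) ^+ 2 => h1.
have X0 : 0 <= X by apply: sumr_ge0 => k _; exact: ltW.
have h2 : \sum_(k < N) kw u k * (k%:R - mm h u) ^+ 2 <= 2 * Y + 2 * (np%:R - mm h u) ^+ 2 * X.
  rewrite /Y /X !mulr_sumr -big_split/=; apply: ler_sum => k _.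
  have -> : k%:R - mm h u = (k%:R - np%:R) + (np%:R - mm h u) by ring.
  have kk := ltW (kp k); move: (k%:R - np%:R) (np%:R - mm h u) (kw u k) kk => x y v v0.
  by have hh := mulr_ge0 v0 (sqr_ge0 (x - y)); rewrite !expr2 in hh *; clear - hh; lra.
have h3 : (T u * `|np%:R - mm h u|) ^+ 2 <= (134 * c ^+ 2) ^+ 2.
  by rewrite lerXn2r// nnegrE mulr_ge0// ltW//; clear - cc; lra.
have := ler_wpM2l (sqr_ge0 (T u)) h2; rewrite mulrDr => h4.
have e1 : T u ^+ 2 * (2 * Y) = 8 * (s ^+ 2 * Y) by rewrite /s; field.
have e2 : T u ^+ 2 * (2 * (np%:R - mm h u) ^+ 2 * X) = 2 * (T u * `|np%:R - mm h u|) ^+ 2 * X.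
  by rewrite exprMn real_normK ?num_real//; ring.
have h5 := ler_wpM2r X0 h3.
have : 0 <= (1 + 4 * (S * E)) * X by rewrite mulr_ge0//; clear - SE0; lra.
have -> : C * X = (1 + 4 * (S * E)) * X + 8 * (C1 * X) + 2 * ((134 * c ^+ 2) ^+ 2 * X) by rewrite /C; ring.
rewrite e1 e2 -[2 * _ * X]mulrA in h4; move: h1 h4 h5.
move: ((1 + _) * X) (C1 * X) (s ^+ 2 * Y) (_ ^+ 2 * X) (_ ^+ 2 * X) (T u ^+ 2 * _) => a1 a2 a3 a4 a5 a6.
by move=> k1 k2 k3 k4; clear - k1 k2 k3 k4; lra.
Qed.

End KernelSpread.

(** * Lagrange's identity and its consequences for Gram determinants *)

Section Lagrange.
Context {R : realType}.
Implicit Types (z w : R[i]) (c : nat -> R).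

(** Here and in [csum] the kernel series is truncated. The Gram estimates are made for finite [N]
    and then passed to the limit. *)
Definition rsum c N (x : R) : R := \sum_(k < N) c k * x ^+ k.
Definition csum c N z : R[i] := \sum_(k < N) (c k)%:C%C * z ^+ k.

Lemma Re_sum (I : Type) (r : seq I) (P : pred I) (F : I -> R[i]) :
  complex.Re (\sum_(i <- r | P i) F i) = \sum_(i <- r | P i) complex.Re (F i).
Proof. by elim/big_rec2: _ => // i x y _ <-; rewrite ReD. Qed.

Lemma Im_sum (I : Type) (r : seq I) (P : pred I) (F : I -> R[i]) :
  complex.Im (\sum_(i <- r | P i) F i) = \sum_(i <- r | P i) complex.Im (F i).
Proof. by elim/big_rec2: _ => // i x y _ <-; rewrite ImD. Qed.

Lemma lagrange_id c N z w :
  2 * (rsum c N (cnorm2 z) * rsum c N (cnorm2 w) - cnorm2 (csum c N (z^* * w))) =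
  \sum_(n < N) \sum_(m < N) c n * c m * cnorm2 (z ^+ n * w ^+ m - z ^+ m * w ^+ n).
Proof.
pose a n := (c n)%:C%C * (z^* * w) ^+ n : R[i].
have E1 : cnorm2 (csum c N (z^* * w)) =
    \sum_(n < N) \sum_(m < N) (complex.Re (a n) * complex.Re (a m) + complex.Im (a n) * complex.Im (a m)).
  rewrite /cnorm2 /csum Re_sum Im_sum !expr2 !big_distrlr/= -big_split/=.
  by apply: eq_bigr => n _; rewrite -big_split.
have E2 : rsum c N (cnorm2 z) * rsum c N (cnorm2 w) =
    \sum_(n < N) \sum_(m < N) c n * c m * (cnorm2 (z ^+ n) * cnorm2 (w ^+ m)).
  rewrite /rsum big_distrlr/=; apply: eq_bigr => n _; apply: eq_bigr => m _.
  by rewrite !cnorm2E !cabsX -!exprM ![(_ * 2)%N]mulnC !exprM; ring.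
have E3 : rsum c N (cnorm2 z) * rsum c N (cnorm2 w) =
    \sum_(n < N) \sum_(m < N) c n * c m * (cnorm2 (z ^+ m) * cnorm2 (w ^+ n)).
  rewrite E2 exchange_big/=; apply: eq_bigr => n _; apply: eq_bigr => m _; ring.
rewrite mulrBr mulr_natl [X in X - _]mulr2n {1}E2 E3 E1 mulr_sumr -big_split -sumrB/=.
apply: eq_bigr => n _; rewrite mulr_sumr -big_split -sumrB/=; apply: eq_bigr => m _.
rewrite /a !exprMn -!cconjX /cnorm2.
by case: (z ^+ n) (z ^+ m) (w ^+ n) (w ^+ m) => [z1 z2] [z3 z4] [w1 w2] [w3 w4] /=; ring.
Qed.

Lemma cabs_subX z w (r : R) k : cabs z <= r -> cabs w <= r ->
  r * cabs (z ^+ k - w ^+ k) <= k%:R * cabs (z - w) * r ^+ k.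
Proof.
move=> zr wr; have r0 : 0 <= r by apply: le_trans zr; exact: cabs_ge0.
case: k => [|k]; first by rewrite !expr0 subrr cabs0 mulr0 !mul0r.
rewrite subrXX cabsM mulrCA -mulrA [leRHS]mulrCA ler_wpM2l ?cabs_ge0//.
rewrite exprS mulrCA ler_wpM2l//; apply: le_trans (ler_cabs_sum _ _ _) _.
apply: (@le_trans _ _ (\sum_(i < k.+1) r ^+ k)); last by rewrite sumr_const card_ord mulr_natl.
apply: ler_sum => i _; rewrite cabsM !cabsX/=.
have -> : r ^+ k = r ^+ (k - i) * r ^+ i by rewrite -exprD subnK// -ltnS.
by apply: ler_pM; rewrite ?exprn_ge0 ?cabs_ge0// lerXn2r// nnegrE ?cabs_ge0.
Qed.

(** The common power [(z w)^m] factors out and [cabs_subX] bounds what is left; the factor [r ^ 2]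
    on the left avoids a division by the radius. *)
Lemma cross_le z w (r s : R) n m : cabs z <= r -> cabs w <= s -> s <= r -> (m <= n)%N ->
  r ^+ 2 * cnorm2 (z ^+ n * w ^+ m - z ^+ m * w ^+ n) <=
  cnorm2 (z - w) * (n%:R - m%:R) ^+ 2 * ((r ^+ 2) ^+ n * (s ^+ 2) ^+ m).
Proof.
move=> zr ws sr mn; have s0 : 0 <= s by apply: le_trans ws; exact: cabs_ge0.
have r0 : 0 <= r by lra.
have -> : z ^+ n * w ^+ m - z ^+ m * w ^+ n = (z * w) ^+ m * (z ^+ (n - m) - w ^+ (n - m)).
  by rewrite mulrBr !exprMn mulrAC -exprD subnKC// -[X in _ = _ - X]mulrA -exprD subnKC.
rewrite !cnorm2E cabsM cabsX cabsM -natrB//.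
have h1 := cabs_subX (n - m) zr (le_trans ws sr).
have h2 : (cabs z * cabs w) ^+ m <= (r * s) ^+ m.
  by rewrite lerXn2r// ?nnegrE ?mulr_ge0 ?cabs_ge0//; apply: ler_pM; rewrite ?cabs_ge0.
have -> : (r ^+ 2) ^+ n * (s ^+ 2) ^+ m = ((r * s) ^+ m * r ^+ (n - m)) ^+ 2.
  rewrite !(exprAC _ 2) -{1}(subnKC mn) exprD !exprMn; ring.
rewrite -!exprMn lerXn2r// ?nnegrE ?mulr_ge0 ?exprn_ge0 ?cabs_ge0// ?mulr_ge0 ?cabs_ge0//.
have h3 := ler_pM _ _ h2 h1; apply: le_trans (_ : _ <= (cabs z * cabs w) ^+ m * (r * cabs (z ^+ (n - m) - w ^+ (n - m)))) _.
  by rewrite le_eqVlt; apply/orP; left; apply/eqP; ring.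
apply: le_trans (h3 _ _) _; [by rewrite exprn_ge0// mulr_ge0 ?cabs_ge0|by rewrite mulr_ge0 ?cabs_ge0|].
by rewrite le_eqVlt; apply/orP; left; apply/eqP; ring.
Qed.

(** [cross_le] asks for [m <= n]. Adding the weight with exchanged indices gives a bound for all
    pairs, and the two resulting double sums [V] and [V'] are equal. *)
Lemma gram_upper c N z w (r s : R) : (forall n, 0 <= c n) -> cabs z <= r -> cabs w <= s -> s <= r ->
  r ^+ 2 * (rsum c N (cnorm2 z) * rsum c N (cnorm2 w) - cnorm2 (csum c N (z^* * w))) <=
  cnorm2 (z - w) * \sum_(n < N) \sum_(m < N) c n * c m * (n%:R - m%:R) ^+ 2 * ((r ^+ 2) ^+ n * (s ^+ 2) ^+ m).
Proof.
move=> c0 zr ws sr.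
pose V := \sum_(n < N) \sum_(m < N) c n * c m * (n%:R - m%:R) ^+ 2 * ((r ^+ 2) ^+ n * (s ^+ 2) ^+ m).
have V' : V = \sum_(n < N) \sum_(m < N) c n * c m * (n%:R - m%:R) ^+ 2 * ((r ^+ 2) ^+ m * (s ^+ 2) ^+ n).
  by rewrite /V exchange_big/=; apply: eq_bigr => n _; apply: eq_bigr => m _; ring.
have rs0 n m : 0 <= (r ^+ 2) ^+ n * (s ^+ 2) ^+ m :> R by rewrite mulr_ge0// exprn_ge0// sqr_ge0.
have key n m : r ^+ 2 * cnorm2 (z ^+ n * w ^+ m - z ^+ m * w ^+ n) <=
    cnorm2 (z - w) * (n%:R - m%:R) ^+ 2 * ((r ^+ 2) ^+ n * (s ^+ 2) ^+ m + (r ^+ 2) ^+ m * (s ^+ 2) ^+ n).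
  have d0 : 0 <= cnorm2 (z - w) * (n%:R - m%:R) ^+ 2 by rewrite mulr_ge0 ?cnorm2_ge0 ?sqr_ge0.
  have [mn|/ltnW nm] := leqP m n.
    by apply: le_trans (cross_le zr ws sr mn) _; rewrite ler_wpM2l// lerDl.
  have := cross_le zr ws sr nm.
  have -> : cnorm2 (z ^+ m * w ^+ n - z ^+ n * w ^+ m) = cnorm2 (z ^+ n * w ^+ m - z ^+ m * w ^+ n).
    by rewrite !cnorm2E cabsB.
  have -> : (m%:R - n%:R) ^+ 2 = (n%:R - m%:R) ^+ 2 :> R by rewrite -sqrrN opprB.
  by move=> h; apply: le_trans h _; rewrite ler_wpM2l// lerDr.
rewrite -/V -(ler_pM2l (ltr0Sn R 1)) mulrCA lagrange_id.
have -> : 2 * (cnorm2 (z - w) * V) = cnorm2 (z - w) * (V + V) by ring.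
rewrite {2}V' -big_split/= !mulr_sumr; apply: ler_sum => n _.
rewrite -big_split/= !mulr_sumr; apply: ler_sum => m _.
have := ler_wpM2l (mulr_ge0 (c0 n) (c0 m)) (key n m) => h.
by apply: le_trans (_ : _ <= c n * c m * (r ^+ 2 * cnorm2 (z ^+ n * w ^+ m - z ^+ m * w ^+ n))) _;
  [rewrite mulrCA|apply: le_trans h _; rewrite le_eqVlt; apply/orP; left; apply/eqP; ring].
Qed.

(** Write [n - m = (n - a) + (a - b) - (m - b)]: the double sum is controlled by the two second
    moments and the distance of the centres. *)
Lemma moment_split N (p q : nat -> R) (a b : R) : (forall n, 0 <= p n) -> (forall n, 0 <= q n) ->
  \sum_(n < N) \sum_(m < N) p n * q m * (n%:R - m%:R) ^+ 2 <=
  3 * ((\sum_(n < N) p n * (n%:R - a) ^+ 2) * (\sum_(m < N) q m) +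
       (a - b) ^+ 2 * ((\sum_(n < N) p n) * (\sum_(m < N) q m)) +
       (\sum_(n < N) p n) * (\sum_(m < N) q m * (m%:R - b) ^+ 2)).
Proof.
move=> p0 q0; rewrite !big_distrlr/= !mulr_sumr -!big_split/= mulr_sumr; apply: ler_sum => n _.
rewrite !mulr_sumr -!big_split/= mulr_sumr; apply: ler_sum => m _.
have pq := mulr_ge0 (p0 n) (q0 m).
have -> : 3 * (p n * (n%:R - a) ^+ 2 * q m + (a - b) ^+ 2 * (p n * q m) + p n * (q m * (m%:R - b) ^+ 2)) =
  p n * q m * (3 * ((n%:R - a) ^+ 2 + (a - b) ^+ 2 + (m%:R - b) ^+ 2)) by ring.
rewrite ler_wpM2l//; have -> : n%:R - m%:R = (n%:R - a) + (a - b) - (m%:R - b) :> R by ring.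
move: (n%:R - a) (a - b) (m%:R - b) => x y v.
by have := sqr_ge0 (x - y); have := sqr_ge0 (y + v); have := sqr_ge0 (x + v); rewrite !expr2; lra.
Qed.

(** The inequality [|x^k - y^k| >= k |x - y| (x y)^((k - 1) / 2)], squared and multiplied by [x y]
    to avoid half-integer powers. The induction runs on the square roots [a], [b]. *)
Lemma powdiff_ge (x y : R) k : 0 <= x -> 0 <= y ->
  k%:R ^+ 2 * (x - y) ^+ 2 * (x * y) ^+ k <= x * y * (x ^+ k - y ^+ k) ^+ 2.
Proof.
wlog yx : x y / y <= x => [hw|] x0 y0.
  have [|/ltW xy] := leP y x; first by move=> yx; exact: hw.
  have := hw y x xy y0 x0; rewrite [y * x]mulrC -[(y - x) ^+ 2]sqrrN opprB.
  by rewrite -[(y ^+ k - x ^+ k) ^+ 2]sqrrN opprB.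
pose a := Num.sqrt x; pose b := Num.sqrt y.
have a0 : 0 <= a by exact: sqrtr_ge0. have b0 : 0 <= b by exact: sqrtr_ge0.
have xa : x = a ^+ 2 by rewrite sqr_sqrtr. have yb : y = b ^+ 2 by rewrite sqr_sqrtr.
have ba : b <= a by exact: ler_wsqrtr.
have ab0 : 0 <= a * b by rewrite mulr_ge0.
have key : k%:R * (x - y) * (a * b) ^+ k <= a * b * (x ^+ k - y ^+ k).
  elim: k => [|k IH]; first by rewrite !mul0r expr0 subrr mulr0.
  have ord : (a ^+ 2 - b ^+ 2) * (a * b) ^+ k <= (a - b) * (a ^+ k.+1 * a ^+ k + b ^+ k.+1 * b ^+ k).
    have h1 : b ^+ k <= a ^+ k by rewrite lerXn2r.
    have h2 : b ^+ k.+1 <= a ^+ k.+1 by rewrite lerXn2r.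
    have -> : (a ^+ 2 - b ^+ 2) * (a * b) ^+ k = (a - b) * (a ^+ k.+1 * b ^+ k + b ^+ k.+1 * a ^+ k).
      by rewrite exprMn !exprS; ring.
    by rewrite ler_wpM2l ?subr_ge0//; nra.
  have -> : x ^+ k.+1 - y ^+ k.+1 = a * b * (x ^+ k - y ^+ k) + (a - b) * (a ^+ k.+1 * a ^+ k + b ^+ k.+1 * b ^+ k).
    by rewrite xa yb -!exprM ![(2 * _)%N]mulnC !exprM !exprS; ring.
  have e : x - y = a ^+ 2 - b ^+ 2 by rewrite -xa -yb.
  rewrite -natr1 exprS [a * b * (_ + _)]mulrDr.
  have := ler_wpM2l ab0 IH; have := ler_wpM2l ab0 ord; rewrite e.
  clear; lra.
have l0 : 0 <= k%:R * (x - y) * (a * b) ^+ k by rewrite !mulr_ge0 ?exprn_ge0 ?subr_ge0.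
have := lerXn2r 2 _ _ key; rewrite !nnegrE => /(_ l0 (le_trans l0 key)).
by rewrite xa yb !exprMn -!exprM ![(_ * 2)%N]mulnC !exprM !exprMn.
Qed.

Lemma csum_real c N (x : R) : csum c N x%:C%C = (rsum c N x)%:C%C.
Proof.
rewrite /csum /rsum raddf_sum/=; apply: eq_bigr => k _.
by rewrite rmorphM/= rmorphXn.
Qed.

Lemma cnorm2_real (x : R) : cnorm2 x%:C%C = x ^+ 2.
Proof. by rewrite /cnorm2/= expr0n addr0. Qed.

(** [powdiff_ge] extracts [(n - m) ^ 2] and leaves weights at the geometric mean [x * y], the same
    weights as in [gram_angular]. *)
Lemma gram_radial c N (x y : R) : (forall n, 0 <= c n) -> 0 < x < 1 -> 0 < y < 1 ->
  (x - y) ^+ 2 / 2 * \sum_(n < N) \sum_(m < N) (c n * (x * y) ^+ n) * (c m * (x * y) ^+ m) * (n%:R - m%:R) ^+ 2 <=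
  rsum c N (x ^+ 2) * rsum c N (y ^+ 2) - rsum c N (x * y) ^+ 2.
Proof.
move=> c0 /andP[x0 x1] /andP[y0 y1].
have q0 : 0 < x * y by rewrite mulr_gt0.
have q1 : x * y <= 1 by rewrite mulr_ile1// ltW.
have key n m : (x - y) ^+ 2 * (n%:R - m%:R) ^+ 2 * ((x * y) ^+ n * (x * y) ^+ m) <=
    (x ^+ n * y ^+ m - x ^+ m * y ^+ n) ^+ 2.
  wlog mn : n m / (m <= n)%N => [hw|].
    have [|/ltnW nm] := leqP m n; first exact: hw.
    have := hw m n nm; rewrite -[(m%:R - n%:R) ^+ 2]sqrrN opprB [(x * y) ^+ m * _]mulrC.
    by rewrite -[X in _ <= X]sqrrN opprB.
  have -> : x ^+ n * y ^+ m - x ^+ m * y ^+ n = (x * y) ^+ m * (x ^+ (n - m) - y ^+ (n - m)).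
    by rewrite mulrBr !exprMn mulrAC -exprD subnKC// -[X in _ = _ - X]mulrA -exprD subnKC.
  have h := powdiff_ge (n - m) (ltW x0) (ltW y0).
  rewrite -natrB// -[X in (x * y) ^+ X * _](subnKC mn) exprD.
  set k := (n - m)%N in h *; set q := (x * y) ^+ m.
  have qq : 0 <= q ^+ 2 by exact: sqr_ge0.
  have h' : k%:R ^+ 2 * (x - y) ^+ 2 * (x * y) ^+ k <= (x ^+ k - y ^+ k) ^+ 2.
    by apply: le_trans h _; rewrite ler_piMl ?sqr_ge0.
  rewrite [leRHS]exprMn; apply: le_trans (ler_wpM2l qq h'); rewrite le_eqVlt; apply/orP; left; apply/eqP; ring.
have := lagrange_id c N x%:C%C y%:C%C; rewrite !cnorm2_real.
have -> : (x%:C%C)^* = x%:C%C :> R[i] by apply: complex_ext; rewrite ?Re_conj ?Im_conj//= oppr0.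
rewrite -rmorphM/= csum_real cnorm2_real => E.
rewrite -(ler_pM2l (ltr0Sn R 1)) E mulrA [2 * (_ / 2)]mulrC divfK ?pnatr_eq0// mulr_sumr.
apply: ler_sum => n _; rewrite mulr_sumr; apply: ler_sum => m _.
rewrite -!rmorphXn -!rmorphM -rmorphB/= cnorm2_real.
have := ler_wpM2l (mulr_ge0 (c0 n) (c0 m)) (key n m) => h; apply: le_trans h.
by rewrite le_eqVlt; apply/orP; left; apply/eqP; ring.
Qed.

(** Lagrange's identity for the two points [sqrt q] and [sqrt q * z] of equal modulus. *)
Lemma gram_angular c N (q : R) z : 0 <= q -> cabs z = 1 ->
  2 * (rsum c N q ^+ 2 - cnorm2 (csum c N (q%:C%C * z))) =
  \sum_(n < N) \sum_(m < N) (c n * q ^+ n) * (c m * q ^+ m) * cnorm2 (z ^+ n - z ^+ m).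
Proof.
move=> q0 z1; pose a := (Num.sqrt q)%:C%C : R[i].
have a2 : cnorm2 a = q by rewrite cnorm2_real sqr_sqrtr.
have aa : a^* = a by apply: complex_ext; rewrite ?Re_conj ?Im_conj//= oppr0.
have aq : a * a = q%:C%C by rewrite -rmorphM/= -expr2 sqr_sqrtr.
have := lagrange_id c N a (a * z).
have -> : cnorm2 (a * z) = q by rewrite cnorm2E cabsM z1 mulr1 -cnorm2E.
rewrite aa mulrA aq a2 -expr2 => ->; apply: eq_bigr => n _; apply: eq_bigr => m _.
have -> : a ^+ n * (a * z) ^+ m - a ^+ m * (a * z) ^+ n = (a ^+ n * a ^+ m) * (z ^+ m - z ^+ n).
  by rewrite !exprMn; ring.
have qX k : cabs (a ^+ k) ^+ 2 = q ^+ k by rewrite cabsX -exprM mulnC exprM -cnorm2E a2.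
by rewrite !cnorm2E !cabsM !exprMn !qX (cabsB (z ^+ m)); ring.
Qed.

End Lagrange.

(** * Double sums over blocks of indices and powers of a unit number *)

Section Blocks.
Context {R : realType}.
Implicit Types (p : nat -> R) (F : nat -> nat -> R) (z : R[i]).

Lemma block_sum1 (G : nat -> R) a M N : (forall n, 0 <= G n) -> (a + M <= N)%N ->
  \sum_(i < M) G (a + i)%N <= \sum_(n < N) G n.
Proof.
move=> G0 h; rewrite -(big_mkord predT G) -(big_mkord predT (fun i => G (a + i)%N)).
rewrite [leRHS](@big_cat_nat _ _ _ a) //=; last exact: leq_trans (leq_addr _ _) h.
rewrite [X in _ <= _ + X](@big_cat_nat _ _ _ (a + M)%N a) //=; last exact: leq_addr.
have -> : \sum_(0 <= i < M) G (a + i)%N = \sum_(a <= i < a + M) G i.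
  rewrite [RHS](_ : _ = \sum_(0 + a <= i < a + M) G i)// big_addn addKn.
  by apply: eq_bigr => i _; rewrite addnC.
have h1 : 0 <= \sum_(0 <= i < a) G i by exact: sumr_ge0.
have h2 : 0 <= \sum_(a + M <= i < N) G i by exact: sumr_ge0.
lra.
Qed.

Lemma block_sum p F (b : R) a M N : (forall n, 0 <= p n) -> (forall n m, 0 <= F n m) -> 0 <= b ->
  (forall i, (i < M)%N -> b <= p (a + i)%N) -> (a + M <= N)%N ->
  b ^+ 2 * \sum_(i < M) \sum_(j < M) F (a + i)%N (a + j)%N <=
  \sum_(n < N) \sum_(m < N) p n * p m * F n m.
Proof.
move=> p0 F0 b0 hb h.
apply: le_trans (block_sum1 (a := a) (M := M) (G := fun n => \sum_(m < N) p n * p m * F n m) _ h); last first.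
  by move=> n; apply: sumr_ge0 => m _; rewrite !mulr_ge0.
rewrite mulr_sumr; apply: ler_sum => i _.
apply: le_trans (block_sum1 (a := a) (M := M) (G := fun m => p (a + i)%N * p m * F (a + i)%N m) _ h); last first.
  by move=> n; rewrite !mulr_ge0.
rewrite mulr_sumr; apply: ler_sum => j _; rewrite ler_wpM2r// expr2.
by apply: ler_pM => //; exact: hb.
Qed.

Lemma sum_quadratic (A B D : R) M :
  6 * \sum_(j < M) (A * j%:R ^+ 2 + B * j%:R + D) =
  A * (M%:R * (M%:R - 1) * (2 * M%:R - 1)) + 3 * B * (M%:R * (M%:R - 1)) + 6 * D * M%:R.
Proof.
elim: M => [|M IH]; first by rewrite big_ord0; ring.
by rewrite big_ord_recr/= mulrDr IH -natr1; ring.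
Qed.

Lemma var_sum M : 6 * \sum_(i < M) \sum_(j < M) (i%:R - j%:R) ^+ 2 = M%:R ^+ 2 * (M%:R ^+ 2 - 1) :> R.
Proof.
set x := M%:R : R.
have inner (i : 'I_M) : \sum_(j < M) (i%:R - j%:R) ^+ 2 =
    x * i%:R ^+ 2 + (- (x * (x - 1))) * i%:R + x * (x - 1) * (2 * x - 1) / 6 :> R.
  have -> : \sum_(j < M) (i%:R - j%:R) ^+ 2 = \sum_(j < M) (1 * j%:R ^+ 2 + (- (2 * i%:R)) * j%:R + i%:R ^+ 2) :> R.
    by apply: eq_bigr => j _; ring.
  have s6 : (6 : R) != 0 by rewrite pnatr_eq0.
  by apply: (mulfI s6); rewrite sum_quadratic -/x; field.
rewrite (eq_bigr _ (fun i _ => inner i)) sum_quadratic -/x.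
by field.
Qed.

Lemma var_sum_ge M : (2 <= M)%N -> M%:R ^+ 4 / 8 <= \sum_(i < M) \sum_(j < M) (i%:R - j%:R) ^+ 2 :> R.
Proof.
move=> M2; have x2 : 2 <= M%:R :> R by rewrite ler_nat.
rewrite -(ler_pM2l (ltr0Sn R 5)) var_sum (exprM _ 2 2); set y := M%:R ^+ 2.
have y4 : 4 <= y by rewrite /y expr2; nra.
nra.
Qed.

Lemma csum_geometric z M : (z - 1) * csum (fun=> 1 : R) M z = z ^+ M - 1.
Proof. by rewrite subrX1; congr (_ * _); apply: eq_bigr => k _; rewrite mul1r. Qed.

Lemma unit_powers z M :
  cabs z = 1 -> \sum_(n < M) \sum_(m < M) cnorm2 (z ^+ n - z ^+ m) =
  2 * (M%:R ^+ 2 - cnorm2 (csum (fun=> 1 : R) M z)).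
Proof.
move=> z1; have := gram_angular (fun=> 1 : R) M ler01 z1; rewrite mul1r.
have -> : rsum (fun=> 1 : R) M 1 = M%:R.
  by rewrite /rsum (eq_bigr (fun=> 1)) ?sumr_const ?card_ord// => k _; rewrite expr1n mulr1.
by move=> ->; apply: eq_bigr => n _; apply: eq_bigr => m _; rewrite !expr1n !mul1r.
Qed.

(** The geometric sum is at most [2 / |z - 1| <= M / 2], so at least [2 (M^2 - M^2 / 4)] remains. *)
Lemma unit_powers_far z M : cabs z = 1 -> 4 <= M%:R * cabs (z - 1) ->
  3 / 2 * M%:R ^+ 2 <= \sum_(n < M) \sum_(m < M) cnorm2 (z ^+ n - z ^+ m).
Proof.
move=> z1 h; rewrite unit_powers// cnorm2E.
have := congr1 cabs (csum_geometric z M); rewrite cabsM.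
have : cabs (z ^+ M - 1) <= 2.
  by apply: le_trans (cabsD _ _) _; rewrite cabsN cabsX z1 expr1n cabs1; lra.
move=> h1 e; rewrite -e in h1; move: h h1 (cabs_ge0 (z - 1)) (cabs_ge0 (csum (fun=> 1) M z)) (ler0n R M).
move: (cabs (z - 1)) (cabs (csum _ _ _)) (M%:R) => d D m; clear => h1 h2 d0 D0 m0.
have dp : 0 < d by rewrite lt_neqAle d0 andbT; apply/eqP => e; rewrite -e mulr0 in h1; lra.
have : 2 * D <= m by rewrite -(ler_pM2l dp); nra.
by rewrite !expr2; nra.
Qed.

(** [z^k - 1] is [z - 1] times a sum of [k] powers, each within [j |z - 1|] of 1; the sum thus stays
    within [k / 2] of [k]. *)
Lemma unit_powers_close z k : cabs z = 1 -> k%:R * cabs (z - 1) <= 1 ->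
  k%:R * cabs (z - 1) / 2 <= cabs (z ^+ k - 1).
Proof.
move=> z1 h; have d0 := cabs_ge0 (z - 1).
rewrite -csum_geometric cabsM [_ * cabs (z - 1)]mulrC -mulrA ler_wpM2l//.
have h1 j : cabs (z ^+ j - 1) <= j%:R * cabs (z - 1).
  have := @cabs_subX R z 1 1 j; rewrite z1 cabs1 !expr1n mul1r mulr1; exact.
have h2 : cabs (k%:R - csum (fun=> 1 : R) k z) <= k%:R / 2.
  have -> : k%:R - csum (fun=> 1 : R) k z = \sum_(j < k) (1 - z ^+ j).
    by rewrite sumrB sumr_const card_ord; congr (_ - _); apply: eq_bigr => j _; rewrite mul1r.
  apply: le_trans (ler_cabs_sum _ _ _) _.
  apply: (@le_trans _ _ (\sum_(j < k) (0 * j%:R ^+ 2 + cabs (z - 1) * j%:R + 0))).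
    by apply: ler_sum => j _; rewrite cabsB mul0r add0r addr0 mulrC.
  rewrite -(ler_pM2l (ltr0Sn R 5)) sum_quadratic; have := ler0n R k; move: (k%:R : R) h => x; clear - d0; nra.
have := cabsD (k%:R - csum (fun=> 1 : R) k z) (csum (fun=> 1 : R) k z); rewrite subrK.
have -> : cabs (k%:R : R[i]) = k%:R.
  by rewrite -(rmorph_nat (real_complex R)) cabs_real ger0_norm.
by move=> h3; clear - h2 h3; lra.
Qed.

Lemma unit_powers_var z L : cabs z = 1 -> L%:R * cabs (z - 1) <= 1 ->
  cabs (z - 1) ^+ 2 / 4 * \sum_(i < L) \sum_(j < L) (i%:R - j%:R) ^+ 2 <=
  \sum_(n < L) \sum_(m < L) cnorm2 (z ^+ n - z ^+ m).
Proof.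
move=> z1 h; have d0 := cabs_ge0 (z - 1).
have key n m : (n < L)%N -> (m <= n)%N -> cabs (z - 1) ^+ 2 / 4 * (n%:R - m%:R) ^+ 2 <= cnorm2 (z ^+ n - z ^+ m).
  move=> nL mn; have -> : z ^+ n - z ^+ m = z ^+ m * (z ^+ (n - m) - 1).
    by rewrite mulrBr mulr1 -exprD subnKC.
  rewrite cnorm2E cabsM cabsX z1 expr1n mul1r -natrB//.
  have hk : (n - m)%:R * cabs (z - 1) <= 1.
    by apply: le_trans h; rewrite ler_wpM2r// ler_nat (leq_trans (leq_subr _ _)) ?(ltnW nL).
  have := unit_powers_close z1 hk => h1.
  have -> : cabs (z - 1) ^+ 2 / 4 * (n - m)%:R ^+ 2 = ((n - m)%:R * cabs (z - 1) / 2) ^+ 2 by field.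
  by rewrite lerXn2r// nnegrE ?cabs_ge0// divr_ge0 ?mulr_ge0.
rewrite mulr_sumr; apply: ler_sum => n _; rewrite mulr_sumr; apply: ler_sum => m _.
have [mn|/ltnW nm] := leqP m n; first exact: key.
have := key m n (ltn_ord m) nm.
by rewrite -[(m%:R - n%:R) ^+ 2]sqrrN opprB !cnorm2E (cabsB (z ^+ m)).
Qed.

End Blocks.

(** * Lower bounds for Gram determinants near the boundary *)

Section GramLower.
Context {R : realType}.
Variables h t : R -> R.
Hypothesis hW : in_W h t.

Local Notation T u := (t (Num.sqrt u)).
Definition kc (n : nat) : R := (mnorm h n)^-1.

Lemma kc_gt0 n : 0 < kc n.
Proof. by rewrite invr_gt0 (mnorm_gt0 hW). Qed.

(** The change of modulus and the change of argument are measured separately, with the quantity at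
    the geometric mean radius as intermediate. Both are then governed by the weights at [x * y] and
    by the block that [kernel_spread] gives there. *)
Lemma gram_lower : exists2 k0 : R, 0 < k0 <= 1 & exists2 w : R, 1 / 2 <= w < 1 &
  forall (x y : R) (z : R[i]), 0 < x < 1 -> 0 < y < 1 -> w <= x * y -> cabs z = 1 ->
  exists N0, forall N, (N0 <= N)%N ->
    k0 * ((x - y) / T (x * y)) ^+ 2 * rsum kc N (x * y) ^+ 2 <=
      rsum kc N (x ^+ 2) * rsum kc N (y ^+ 2) - rsum kc N (x * y) ^+ 2 /\
    k0 * Num.min 1 ((cabs (z - 1) / T (x * y)) ^+ 2) * rsum kc N (x * y) ^+ 2 <=
      rsum kc N (x * y) ^+ 2 - cnorm2 (csum kc N ((x * y)%:C%C * z)).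
Proof.
have [C C1 [w w1 sp]] := kernel_spread hW.
have C0 : 0 < C by lra.
have CC : 1 <= C ^+ 2 by rewrite expr_ge1//; exact: ltW.
have k00 : 0 <= (64 * C ^+ 2)^-1 by rewrite invr_ge0 mulr_ge0// sqr_ge0.
(* [64 = 8 * 4 * 2] is dictated by the case of a small rotation: 8 from [var_sum_ge], 4 from
   [unit_powers_var], 2 from [gram_angular]. *)
exists (64 * C ^+ 2)^-1.
  by rewrite invr_gt0 mulr_gt0 ?exprn_gt0//= invf_le1 ?mulr_gt0 ?exprn_gt0//; lra.
exists w => // x y z xi yi wxy z1; set u := x * y in wxy *.
have u1 : u < 1 by rewrite /u; case/andP: xi yi => x0 x1 /andP[y0 y1]; rewrite mulr_ilt1// ltW.
have [T1 [nm [np [mp len blk _]]]] := sp u (introT andP (conj wxy u1)).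
have u0 : 0 < u by lra.
have T0 : 0 < T u by apply: (T_gt0 hW); rewrite (ltW u0).
set a := T u in T1 len blk T0 *.
(* [L] lies between [1 / a] and [2 / a], so four such lengths fit into a block of at least [14 / a]
   indices. *)
pose L := (Num.truncn a^-1).+1.
have a1 : 1 <= a^-1 by rewrite invf_ge1.
have /andP[tr1 tr2] := truncn_itv (le_trans ler01 a1).
have L1 : a^-1 <= L%:R by exact: ltW.
have L2 : (2 <= L)%N.
  by rewrite -(ltr_nat R) (le_lt_trans a1).
have L4 : (4 * L <= np - nm)%N.
  rewrite -(ler_nat R) natrM; have : 14 / a <= (np - nm)%:R by rewrite ler_pdivrMr// mulrC.
  have : L%:R <= a^-1 + 1 by rewrite /L -natr1 lerD2r.
  by move: (np - nm)%:R (L%:R) => A B; clear - a1; lra.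
have aL : 1 <= a * L%:R by rewrite mulrC -ler_pdivrMr// div1r.
exists np.+1 => N hN; set X := rsum kc N u.
pose p n := kc n * u ^+ n.
have p0 n : 0 <= p n by rewrite mulr_ge0 ?exprn_ge0 ?(ltW u0)// ltW// kc_gt0.
have XE : X = \sum_(k < N) kw h u k by apply: eq_bigr => k _; rewrite mulrC.
have X0 : 0 <= X by apply: sumr_ge0 => k _; exact: p0.
have b0 : 0 <= a * X / C by rewrite divr_ge0 ?mulr_ge0// ltW.
have hb M i : (M <= 4 * L)%N -> (i < M)%N -> a * X / C <= p (nm + i)%N.
  move=> ML iM; have -> : p (nm + i)%N = kw h u (nm + i) by rewrite /p mulrC.
  rewrite ler_pdivrMr// XE [leRHS]mulrC; apply: blk.
  by rewrite leq_addr /= -(subnKC mp) leq_add2l (leq_trans (ltnW iM)) ?(leq_trans ML).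
have fit M : (M <= 4 * L)%N -> (nm + M <= N)%N.
  move=> ML; apply: leq_trans (ltnW hN); rewrite -{1}(subnKC mp) leq_add2l.
  exact: leq_trans ML L4.
have LL : (L <= 4 * L)%N by rewrite leq_pmull.
have gain (G : R) : 0 <= G -> (a * X / C) ^+ 2 * (L%:R ^+ 2 * G) >= X ^+ 2 / C ^+ 2 * G.
  move=> G0; have -> : (a * X / C) ^+ 2 * (L%:R ^+ 2 * G) = (a * L%:R) ^+ 2 * (X ^+ 2 / C ^+ 2 * G).
    by field; rewrite gt_eqF.
  by rewrite ler_peMl ?exprn_ege1// mulr_ge0 ?divr_ge0 ?sqr_ge0.
have L2a : a ^- 2 <= L%:R ^+ 2 by rewrite -exprVn lerXn2r// nnegrE ?invr_ge0// ltW.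
have gain4 : (a * X / C) ^+ 2 * (L%:R ^+ 4 / 8) >= X ^+ 2 / C ^+ 2 * (a ^- 2 / 8).
  have -> : L%:R ^+ 4 / 8 = L%:R ^+ 2 * (L%:R ^+ 2 / 8) :> R by rewrite (exprM _ 2 2) expr2 mulrA.
  apply: le_trans (gain _ _); last by rewrite divr_ge0// sqr_ge0.
  by rewrite ler_wpM2l ?divr_ge0 ?sqr_ge0// ler_pM2r.
split.
  apply: le_trans (gram_radial N _ xi yi); last by move=> n; rewrite ltW// kc_gt0.
  have d0 : 0 <= (x - y) ^+ 2 / 2 by rewrite divr_ge0// sqr_ge0.
  have := block_sum (F := fun n m => (n%:R - m%:R) ^+ 2) p0 (fun n m => sqr_ge0 _) b0
    (fun i => @hb L i LL) (fit L LL).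
  have -> : \sum_(i < L) \sum_(j < L) ((nm + i)%:R - (nm + j)%:R) ^+ 2 =
            \sum_(i < L) \sum_(j < L) (i%:R - j%:R) ^+ 2 :> R.
    by apply: eq_bigr => i _; apply: eq_bigr => j _; rewrite !natrD; ring.
  move=> h1; apply: le_trans (ler_wpM2l d0 h1).
  apply: le_trans (ler_wpM2l d0 (ler_wpM2l (sqr_ge0 _) (var_sum_ge L2))).
  apply: le_trans (ler_wpM2l d0 gain4).
  have -> : (x - y) ^+ 2 / 2 * (X ^+ 2 / C ^+ 2 * (a ^- 2 / 8)) = 4 * ((64 * C ^+ 2)^-1 * ((x - y) / a) ^+ 2 * X ^+ 2).
    by field; rewrite !gt_eqF.
  have v0 : 0 <= (64 * C ^+ 2)^-1 * ((x - y) / a) ^+ 2 * X ^+ 2.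
    by apply: mulr_ge0; [apply: mulr_ge0 => //; exact: sqr_ge0|exact: sqr_ge0].
  by rewrite ler_peMl// ler1n.
have q0 := ltW u0.
have s2 : (0 : R) < 2 by [].
rewrite -(ler_pM2r s2) [leRHS]mulrC (gram_angular kc N q0 z1).
have shift M : \sum_(i < M) \sum_(j < M) cnorm2 (z ^+ (nm + i) - z ^+ (nm + j)) =
            \sum_(i < M) \sum_(j < M) cnorm2 (z ^+ i - z ^+ j).
  apply: eq_bigr => i _; apply: eq_bigr => j _.
  by rewrite !exprD -mulrBr cnorm2E cabsM cabsX z1 expr1n mul1r -cnorm2E.
have blkM M : (M <= 4 * L)%N -> (a * X / C) ^+ 2 * \sum_(i < M) \sum_(j < M) cnorm2 (z ^+ i - z ^+ j) <=
    \sum_(n < N) \sum_(m < N) p n * p m * cnorm2 (z ^+ n - z ^+ m).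
  move=> ML; rewrite -shift.
  exact: (block_sum (F := fun n m => cnorm2 (z ^+ n - z ^+ m)) p0 (fun n m => cnorm2_ge0 _) b0
    (fun i => @hb M i ML) (fit M ML)).
have XC : 0 <= X ^+ 2 / C ^+ 2 by rewrite divr_ge0 ?sqr_ge0.
have k0X : 0 <= (64 * C ^+ 2)^-1 * X ^+ 2 by rewrite mulr_ge0 ?sqr_ge0.
have k64 : X ^+ 2 / C ^+ 2 = 64 * ((64 * C ^+ 2)^-1 * X ^+ 2) by field; rewrite gt_eqF.
(* If the powers of [z] turn slowly over [L] indices, their differences are of first order in
   [|z - 1|]; otherwise [4 * L] indices suffice for cancellation in the geometric sum. *)
have [near|far] := leP (L%:R * cabs (z - 1)) 1.
  apply: le_trans (blkM L LL).
  apply: le_trans (ler_wpM2l (sqr_ge0 _) (unit_powers_var z1 near)).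
  have d0 : 0 <= cabs (z - 1) ^+ 2 / 4 by rewrite divr_ge0// sqr_ge0.
  apply: le_trans (ler_wpM2l (sqr_ge0 _) (ler_wpM2l d0 (var_sum_ge L2))).
  rewrite [leRHS]mulrCA; apply: le_trans (ler_wpM2l d0 gain4).
  have -> : cabs (z - 1) ^+ 2 / 4 * (X ^+ 2 / C ^+ 2 * (a ^- 2 / 8)) =
      (64 * C ^+ 2)^-1 * (cabs (z - 1) / a) ^+ 2 * X ^+ 2 * 2 by field; rewrite !gt_eqF.
  by rewrite ler_pM2r// ler_wpM2r ?sqr_ge0// ler_wpM2l// ge_min lexx orbT.
apply: le_trans (blkM _ (leqnn _)).
have far4 : 4 <= (4 * L)%:R * cabs (z - 1) by rewrite natrM -mulrA; clear - far; lra.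
apply: le_trans (ler_wpM2l (sqr_ge0 _) (unit_powers_far z1 far4)).
have -> : 3 / 2 * (4 * L)%:R ^+ 2 = L%:R ^+ 2 * 24 :> R by rewrite natrM; field.
apply: le_trans (gain _ _); last by [].
rewrite k64; set Y := (64 * C ^+ 2)^-1 * X ^+ 2 in k0X *.
have m1 : Num.min 1 ((cabs (z - 1) / a) ^+ 2) <= 1 by rewrite ge_min lexx.
have -> : (64 * C ^+ 2)^-1 * Num.min 1 ((cabs (z - 1) / a) ^+ 2) * X ^+ 2 =
  Y * Num.min 1 ((cabs (z - 1) / a) ^+ 2) by rewrite /Y mulrAC.
by have h1 := ler_wpM2l k0X m1; rewrite mulr1 in h1; clear - h1 k0X; lra.
Qed.

End GramLower.

(** * From Gram determinants to the Skwarczynski distance *)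

Section SkwBounds.
Context {R : realType}.
Variables h t : R -> R.
Hypothesis hW : in_W h t.
Variable Kz : R * R -> R[i] -> R[i].
Hypothesis hK : is_reproducing_kernel h Kz.

Local Notation c := (@kc R h).
Local Notation Kd p := (complex.Re (Kz p (p2c p))).

Let c0 n : 0 <= c n. Proof. by rewrite ltW// (kc_gt0 hW). Qed.

Lemma csum_cvg p q : disk p -> disk q -> forall e : R, 0 < e -> exists N0, forall N, (N0 <= N)%N ->
  cabs (csum c N ((p2c p)^* * p2c q) - Kz p (p2c q)) < e.
Proof.
move=> dp dq e e0; have dq' : cabs (p2c q) < 1 by [].
have [N0 hN] := kernel_cvg hW hK dp dq' e0; exists N0 => N /hN.
by rewrite /csum /kc.
Qed.

Lemma rsum_cvg p : disk p -> (fun N => rsum c N (cnorm2 (p2c p))) @ \oo --> Kd p.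
Proof.
move=> dp; apply/cvgrPdist_lt => e e0; have [N0 hN] := csum_cvg dp dp e0.
exists N0 => // N /= NN; have := hN N NN.
rewrite mulrC -cnorm2_conj csum_real; apply: le_lt_trans.
have -> : Kd p - rsum c N (cnorm2 (p2c p)) = - complex.Re ((rsum c N (cnorm2 (p2c p)))%:C%C - Kz p (p2c p)).
  by rewrite ReD ReN/= opprB.
by rewrite normrN; exact: cabs_Re.
Qed.

Lemma cnorm_cvg p q : disk p -> disk q ->
  (fun N => cnorm2 (csum c N ((p2c p)^* * p2c q))) @ \oo --> cabs (Kz p (p2c q)) ^+ 2.
Proof.
move=> dp dq.
have h1 : (fun N => cabs (csum c N ((p2c p)^* * p2c q))) @ \oo --> cabs (Kz p (p2c q)).
  apply/cvgrPdist_lt => e e0; have [N0 hN] := csum_cvg dp dq e0.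
  exists N0 => // N /= NN; apply: le_lt_trans (hN N NN).
  set a := csum _ _ _; set b := Kz _ _.
  rewrite ler_distl; apply/andP; split.
    by have := cabsD (a - b) b; rewrite subrK; lra.
  by have := cabsD (b - a) a; rewrite subrK (cabsB b); lra.
rewrite expr2 (_ : (fun N => _) = (fun N => cabs (csum c N ((p2c p)^* * p2c q)) * cabs (csum c N ((p2c p)^* * p2c q)))).
  by apply: cvgM; exact: h1.
by apply/funext => N; rewrite cnorm2E expr2.
Qed.

Lemma rsum_mono N M (x : R) : 0 <= x -> (N <= M)%N -> rsum c N x <= rsum c M x.
Proof.
move=> x0 NM; rewrite /rsum -(subnKC NM) big_split_ord/= lerDl; apply: sumr_ge0 => k _.
by rewrite mulr_ge0 ?exprn_ge0.
Qed.

Lemma rsum_le p N : disk p -> rsum c N (cnorm2 (p2c p)) <= Kd p.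
Proof.
move=> dp; apply: (ler_cvg_to (cvg_cst _) (rsum_cvg dp)).
by exists N => // M /= NM; apply: rsum_mono => //; exact: cnorm2_ge0.
Qed.

Lemma rsum_ge0 N (x : R) : 0 <= x -> 0 <= rsum c N x.
Proof. by move=> x0; apply: sumr_ge0 => k _; rewrite mulr_ge0 ?exprn_ge0. Qed.

Lemma Kd_ge p : disk p -> c 0 <= Kd p.
Proof.
move=> dp; apply: le_trans (rsum_le 1 dp); rewrite /rsum big_ord1 expr0 mulr1//.
Qed.

Lemma gram_ge0 N z w : 0 <= rsum c N (cnorm2 z) * rsum c N (cnorm2 w) - cnorm2 (csum c N (z^* * w)).
Proof.
rewrite -(pmulr_rge0 _ (ltr0Sn R 1)) lagrange_id; apply: sumr_ge0 => n _; apply: sumr_ge0 => m _.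
by rewrite mulr_ge0 ?cnorm2_ge0// mulr_ge0.
Qed.

Lemma cvg_scale (l a : R) (u : nat -> R) : u @ \oo --> a -> (fun N => l * u N) @ \oo --> l * a.
Proof. by move=> ua; apply: cvgM => //; exact: cvg_cst. Qed.

Lemma gram_diag_cvg p q : disk p -> disk q ->
  (fun N => rsum c N (cnorm2 (p2c p)) * rsum c N (cnorm2 (p2c q))) @ \oo --> Kd p * Kd q.
Proof. by move=> dp dq; apply: cvgM; exact: rsum_cvg. Qed.

Lemma gram_limit_ge p q (l : R) N0 : disk p -> disk q ->
  (forall N, (N0 <= N)%N -> l * (rsum c N (cnorm2 (p2c p)) * rsum c N (cnorm2 (p2c q))) <=
    rsum c N (cnorm2 (p2c p)) * rsum c N (cnorm2 (p2c q)) - cnorm2 (csum c N ((p2c p)^* * p2c q))) ->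
  l * (Kd p * Kd q) <= Kd p * Kd q - cabs (Kz p (p2c q)) ^+ 2.
Proof.
move=> dp dq H; have P := gram_diag_cvg dp dq.
have PL := @cvg_scale l _ _ P; have PB : (fun N => rsum c N (cnorm2 (p2c p)) * rsum c N (cnorm2 (p2c q)) -
    cnorm2 (csum c N ((p2c p)^* * p2c q))) @ \oo --> Kd p * Kd q - cabs (Kz p (p2c q)) ^+ 2.
  by apply: cvgB; [exact: P|exact: cnorm_cvg].
apply: (ler_cvg_to PL PB).
by exists N0 => // N /= /H.
Qed.

Lemma gram_limit_le p q (l : R) N0 : disk p -> disk q ->
  (forall N, (N0 <= N)%N -> rsum c N (cnorm2 (p2c p)) * rsum c N (cnorm2 (p2c q)) - cnorm2 (csum c N ((p2c p)^* * p2c q))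
    <= l * (rsum c N (cnorm2 (p2c p)) * rsum c N (cnorm2 (p2c q)))) ->
  Kd p * Kd q - cabs (Kz p (p2c q)) ^+ 2 <= l * (Kd p * Kd q).
Proof.
move=> dp dq H; have P := gram_diag_cvg dp dq.
have PL := @cvg_scale l _ _ P; have PB : (fun N => rsum c N (cnorm2 (p2c p)) * rsum c N (cnorm2 (p2c q)) -
    cnorm2 (csum c N ((p2c p)^* * p2c q))) @ \oo --> Kd p * Kd q - cabs (Kz p (p2c q)) ^+ 2.
  by apply: cvgB; [exact: P|exact: cnorm_cvg].
apply: (ler_cvg_to PB PL).
by exists N0 => // N /= /H.
Qed.

Lemma skwE p q : disk p -> disk q -> exists2 x : R, 0 <= x <= 1 &
  skw_dist h Kz p q = Num.sqrt (1 - x) /\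
  Kd p * Kd q - cabs (Kz p (p2c q)) ^+ 2 = (1 - x ^+ 2) * (Kd p * Kd q).
Proof.
move=> dp dq.
have A0 : 0 < Kd p by apply: lt_le_trans (Kd_ge dp); exact: (kc_gt0 hW).
have B0 : 0 < Kd q by apply: lt_le_trans (Kd_ge dq); exact: (kc_gt0 hW).
(* With [l = 0] the limit of the nonnegative truncated determinants is the Cauchy-Schwarz inequality
   for the kernel. *)
have cs := @gram_limit_ge p q 0 0 dp dq; rewrite mul0r in cs.
have {}cs := cs (fun N _ => le_trans (eq_ind_r (fun v => v <= 0) (lexx 0) (mul0r _)) (gram_ge0 N _ _)).
rewrite /skw_dist /kernel cabs_conj (kernel_norm hK dp) (kernel_norm hK dq).
set Y := cabs _ in cs *; have Y0 : 0 <= Y by exact: cabs_ge0.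
move: (Kd p) (Kd q) A0 B0 cs => A B A0 B0 cs.
pose a : R := Num.sqrt A; pose b : R := Num.sqrt B.
have a0 : 0 < a by rewrite sqrtr_gt0. have b0 : 0 < b by rewrite sqrtr_gt0.
have EA : A = a ^+ 2 by rewrite sqr_sqrtr// ltW. have EB : B = b ^+ 2 by rewrite sqr_sqrtr// ltW.
exists (Y / (a * b)).
  have ab0 : 0 < a * b by rewrite mulr_gt0.
  rewrite divr_ge0 ?(ltW ab0)//= ler_pdivrMr// mul1r.
  rewrite -(@ler_pXn2r _ 2)// ?nnegrE ?(ltW ab0)// exprMn -EA -EB.
  by clear - cs; lra.
split=> //; rewrite EA EB; field; rewrite !gt_eqF//.
Qed.

(** On [[0, 1]] one has [1 - x ^ 2 <= 2 * (1 - x)], whence [l / 2]; the converse bound [skw_le]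
    rests on [1 - x <= 1 - x ^ 2]. *)
Lemma skw_ge p q (l : R) : disk p -> disk q -> 0 <= l ->
  l * (Kd p * Kd q) <= Kd p * Kd q - cabs (Kz p (p2c q)) ^+ 2 ->
  Num.sqrt (l / 2) <= skw_dist h Kz p q.
Proof.
move=> dp dq l0; have [x x1 [-> ->]] := skwE dp dq.
rewrite ler_pM2r; last first.
  by rewrite mulr_gt0//; [apply: lt_le_trans (Kd_ge dp)|apply: lt_le_trans (Kd_ge dq)]; exact: (kc_gt0 hW).
by move=> h1; rewrite ler_wsqrtr//; rewrite expr2 in h1; nra.
Qed.

Lemma skw_le p q (l : R) : disk p -> disk q ->
  Kd p * Kd q - cabs (Kz p (p2c q)) ^+ 2 <= l * (Kd p * Kd q) ->
  skw_dist h Kz p q <= Num.sqrt l.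
Proof.
move=> dp dq; have [x x1 [-> ->]] := skwE dp dq.
rewrite ler_pM2r; last first.
  by rewrite mulr_gt0//; [apply: lt_le_trans (Kd_ge dp)|apply: lt_le_trans (Kd_ge dq)]; exact: (kc_gt0 hW).
by move=> h1; rewrite ler_wsqrtr//; rewrite expr2 in h1; nra.
Qed.

Lemma skw_le1 p q : disk p -> disk q -> skw_dist h Kz p q <= 1.
Proof.
move=> dp dq; have [x x1 [-> _]] := skwE dp dq.
by rewrite -[leRHS]sqrtr1 ler_wsqrtr//; lra.
Qed.

End SkwBounds.

(** * Two-sided estimates of the distance [d_tau] *)

Section TauDistance.
Context {R : realType}.
Local Notation leb := (@lebesgue_measure R).
Local Notation TR := (measurableTypeR R).

Lemma telescope_le (x y z a b : R) : y - x <= a -> z - y <= b -> z - x <= a + b.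
Proof. by lra. Qed.

Lemma cauchy2 (x1 x2 y1 y2 : R) :
  (x1 * y1 + x2 * y2) ^+ 2 <= (x1 ^+ 2 + x2 ^+ 2) * (y1 ^+ 2 + y2 ^+ 2).
Proof. by have h1 := sqr_ge0 (x1 * y2 - x2 * y1); rewrite !expr2 in h1 *; lra. Qed.

Variables h t : R -> R.
Hypothesis hW : in_W h t.

Lemma is_derive_pair (g : R -> R * R) (x : R) : derivable g x 1 ->
  is_derive x 1 (fun s => (g s).1) (g^`() x).1 /\ is_derive x 1 (fun s => (g s).2) (g^`() x).2.
Proof.
rewrite derive1E => d.
have c : (fun k : R => k^-1 *: ((g \o shift x) k%:A - g x)) @ 0^' --> 'D_1 g x by exact: d.
have c1 : (fun k : R => (k^-1 *: ((g \o shift x) k%:A - g x)).1) @ 0^' --> ('D_1 g x).1.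
  by apply: (cvg_comp _ _ c); exact: cvg_fst.
have c2 : (fun k : R => (k^-1 *: ((g \o shift x) k%:A - g x)).2) @ 0^' --> ('D_1 g x).2.
  by apply: (cvg_comp _ _ c); exact: cvg_snd.
by split; split; [exact: (cvgP _ c1)|exact: (cvg_lim _ c1)|exact: (cvgP _ c2)|exact: (cvg_lim _ c2)].
Qed.

Lemma is_derive_line (p v : R * R) (x : R) : derivable (fun s : R => p + s *: v) x 1 /\
  (fun s : R => p + s *: v)^`() x = v.
Proof.
have c : (fun k : R => k^-1 *: (((fun s : R => p + s *: v) \o shift x) k%:A - (p + x *: v))) @ 0^' --> v.
  apply/cvgrPdist_lt => e e0; near=> k.
  have k0 : k != 0 by near: k; exact: nbhs_dnbhs_neq.
  rewrite /= [k%:A]mulr1 scalerDl opprD addrACA subrr add0r addrK scalerA mulVf// scale1r subrr.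
  by rewrite normr0.
by split; [exact: (cvgP _ c)|rewrite derive1E; exact: (cvg_lim _ c)].
Unshelve. all: by end_near. Qed.

Lemma radial_t_continuous p : disk p -> {for p, continuous (radial t)}.
Proof. by case: hW => _ _ _ _ [_ d _ _ _] dp; apply: differentiable_continuous; exact: d. Qed.

Lemma radial_t_gt0 p : disk p -> 0 < radial t p.
Proof. by case: hW => _ _ _ _ [h0 _ _ _ _]; exact: h0. Qed.

Lemma disk_line p q (s : R) : disk p -> disk q -> 0 <= s <= 1 -> disk (p + s *: (q - p)).
Proof.
move=> dp dq /andP[s0 s1]; rewrite /disk/= enormE.
have -> : p2c (p + s *: (q - p)) = (1 - s)%:C%C * p2c p + s%:C%C * p2c q.
  by apply: complex_ext; rewrite ?ReD ?ImD ?ReM ?ImM/= ?mul0r ?subr0 ?addr0 /GRing.scale/=; ring.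
apply: le_lt_trans (cabsD _ _) _; rewrite !cabsM !cabs_real !ger0_norm//; last by lra.
have p1 : cabs (p2c p) < 1 by []. have q1 : cabs (p2c q) < 1 by [].
have [->|sn] := eqVneq s 0; first by rewrite mul0r addr0 subr0 mul1r.
have sp : 0 < s by rewrite lt_neqAle eq_sym sn.
move: (cabs (p2c p)) (cabs (p2c q)) p1 q1 (cabs_ge0 (p2c p)) => a b p1 q1 a0.
apply: (@le_lt_trans _ _ ((1 - s) * 1 + s * b)); first by rewrite lerD2r ler_wpM2l//; lra.
have : s * b < s * 1 by rewrite ltr_pM2l.
lra.
Qed.

Section Potential.
Variables (p : R * R) (e : R).
Hypotheses (dp : disk p) (e0 : 0 < e).
Let t0 := radial t p.

(** [pot] is the function [ln (tau p + |v - p|)] with the corner at [p] smoothed by [e]. Its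
    gradient is at most [1 / (tau p + |v - p|)], so by the growth of tau its increment along a curve
    is at most [K] times the tau-length. *)
Definition potN (v : R * R) : R := Num.sqrt ((v.1 - p.1) ^+ 2 + (v.2 - p.2) ^+ 2 + e ^+ 2).
Definition pot (v : R * R) : R := ln (t0 + potN v).
Definition dpot (v d : R * R) : R :=
  ((v.1 - p.1) * d.1 + (v.2 - p.2) * d.2) / (potN v * (t0 + potN v)).

Let t00 : 0 < t0. Proof. exact: radial_t_gt0. Qed.

Lemma potN_gt0 v : 0 < potN v.
Proof. by rewrite sqrtr_gt0 ltr_wpDl ?exprn_gt0// addr_ge0 ?sqr_ge0. Qed.

Lemma pot_derive (g : R -> R * R) (x : R) : derivable g x 1 ->
  is_derive x 1 (fun s => pot (g s)) (dpot (g x) (g^`() x)).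
Proof.
move=> /is_derive_pair[d1 d2]; have N0 := potN_gt0 (g x).
have dS (f : R -> R) (a df : R) : is_derive x 1 f df -> is_derive x 1 (fun s => (f s - a) ^+ 2) (2 * (f x - a) * df).
  move=> df1; have dB : is_derive x 1 (fun s => f s - a) df.
    by apply: (is_derive_eq (is_deriveB df1 (is_derive_cst a x (1 : R)))); rewrite subr0.
  apply: (is_derive_eq (is_deriveM dB dB)); rewrite /GRing.scale/=; ring.
pose q s := ((g s).1 - p.1) ^+ 2 + ((g s).2 - p.2) ^+ 2 + e ^+ 2.
have dq : is_derive x 1 q (2 * ((g x).1 - p.1) * (g^`() x).1 + 2 * ((g x).2 - p.2) * (g^`() x).2).
  apply: (is_derive_eq (is_deriveD (is_deriveD (dS _ p.1 _ d1) (dS _ p.2 _ d2)) (is_derive_cst (e ^+ 2) x (1 : R)))).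
  by rewrite addr0.
have q0 : 0 < q x by rewrite -sqrtr_gt0.
have dN := @is_derive_chain _ Num.sqrt q x _ _ _ erefl (is_derive1_sqrt q0) dq.
have dT : is_derive x 1 (fun s => t0 + potN (g s)) ((2 * Num.sqrt (q x))^-1 *
    (2 * ((g x).1 - p.1) * (g^`() x).1 + 2 * ((g x).2 - p.2) * (g^`() x).2)).
  by apply: (is_derive_eq (is_deriveD (is_derive_cst t0 x (1 : R)) dN)); rewrite add0r.
have T0 : 0 < t0 + potN (g x) by rewrite addr_gt0.
apply: (is_derive_eq (@is_derive_chain _ (@ln R) (fun s => t0 + potN (g s)) x _ _ _ erefl (is_derive1_ln T0) dT)).
have -> : Num.sqrt (q x) = potN (g x) by [].
by rewrite /dpot; field; rewrite !gt_eqF.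
Qed.

Lemma dpot_le v d : dpot v d <= enorm d / (t0 + enorm (v - p)).
Proof.
have N0 := potN_gt0 v; have T0 : 0 < t0 + potN v by rewrite addr_gt0.
have vN : enorm (v - p) <= potN v by rewrite ler_wsqrtr// lerDl sqr_ge0.
have v0 : 0 <= enorm (v - p) by exact: sqrtr_ge0.
have d0 : 0 <= enorm d by exact: sqrtr_ge0.
have cs : (v.1 - p.1) * d.1 + (v.2 - p.2) * d.2 <= enorm (v - p) * enorm d.
  have -> : enorm (v - p) = Num.sqrt ((v.1 - p.1) ^+ 2 + (v.2 - p.2) ^+ 2) by [].
  apply: le_trans (ler_norm _) _; rewrite /enorm -sqrtr_sqr -sqrtrM; last by rewrite addr_ge0 ?sqr_ge0.
  by apply: ler_wsqrtr; exact: cauchy2.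
apply: (@le_trans _ _ (potN v * enorm d / (potN v * (t0 + potN v)))).
  by rewrite ler_pM2r ?invr_gt0 ?mulr_gt0//; apply: le_trans cs _; rewrite ler_wpM2r.
have -> : potN v * enorm d / (potN v * (t0 + potN v)) = enorm d / (t0 + potN v) by field; rewrite !gt_eqF.
have T1 : 0 < t0 + enorm (v - p) by rewrite ltr_wpDr.
by rewrite ler_wpM2l// lef_pV2 ?posrE// lerD2l.
Qed.

End Potential.

Section Length.
Variables (K : R) (p q : R * R) (e : R).
Hypotheses (K1 : 1 <= K) (dp : disk p) (e0 : 0 < e).
Hypothesis gr : forall v z : R * R, disk v -> disk z -> radial t v <= K * (radial t z + enorm (v - z)).

Lemma dpot_growth v d : disk v -> dpot p e v d <= K * (enorm d / radial t v).
Proof.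
move=> dv; apply: le_trans (dpot_le dp e0 v d) _.
have tv := radial_t_gt0 dv; have tp := radial_t_gt0 dp.
have d0 : 0 <= enorm d by exact: sqrtr_ge0.
have v0 : 0 <= enorm (v - p) by exact: sqrtr_ge0.
have s0 : 0 < radial t p + enorm (v - p) by rewrite ltr_wpDr.
have K0 : 0 < K by exact: lt_le_trans ltr01 K1.
rewrite mulrCA ler_wpM2l// -ler_pdivrMl//.
by rewrite -invfM lef_pV2 ?posrE ?mulr_gt0//; exact: gr.
Qed.

Local Notation F g := (fun x : R => enorm (g^`() x) / radial t (g x)).

(** The derivative of the curve is prescribed only in the interior, so lengths are taken over []a,
    b[]; there the integrand agrees with [G], continuous on [[a, b]], and the fundamental theorem of
    calculus applies to [pot]. *)
Lemma piece_length (g g' : R -> R * R) (a b : R) : a < b ->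
  {within `[a, b], continuous g} -> {within `[a, b], continuous g'} ->
  (forall x, a < x < b -> derivable g x 1 /\ g^`() x = g' x) ->
  (forall x, a <= x <= b -> disk (g x)) ->
  [/\ measurable_fun (`]a, b[%classic : set TR) (F g),
      (\int[leb]_(x in `]a, b[) (F g x)%:E)%E \is a fin_num &
      pot p e (g b) - pot p e (g a) <= K * fine (\int[leb]_(x in `]a, b[) (F g x)%:E)%E].
Proof.
move=> ab cg cg' dg dk.
have c1 : {within `[a, b], continuous (fun x => (g x).1)}.
  by move=> x; apply: (cvg_comp _ _ (cg x)); exact: cvg_fst.
have c2 : {within `[a, b], continuous (fun x => (g x).2)}.
  by move=> x; apply: (cvg_comp _ _ (cg x)); exact: cvg_snd.
have c1' : {within `[a, b], continuous (fun x => (g' x).1)}.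
  by move=> x; apply: (cvg_comp _ _ (cg' x)); exact: cvg_fst.
have c2' : {within `[a, b], continuous (fun x => (g' x).2)}.
  by move=> x; apply: (cvg_comp _ _ (cg' x)); exact: cvg_snd.
have csq (f1 f2 : R -> R) (A B C : R) : {within `[a, b], continuous f1} -> {within `[a, b], continuous f2} ->
    {within `[a, b], continuous (fun x => Num.sqrt ((f1 x - A) ^+ 2 + (f2 x - B) ^+ 2 + C))}.
  move=> k1 k2.
  have kS (f : R -> R) (D : R) : {within `[a, b], continuous f} -> {within `[a, b], continuous (fun x => (f x - D) ^+ 2)}.
    move=> k x; rewrite (_ : (fun x => _) = (fun x => (f x - D) * (f x - D))); last by apply/funext => y; rewrite expr2.
    by apply: cvgM; apply: cvgB; [exact: k|exact: cvg_cst|exact: k|exact: cvg_cst].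
  have kk : {within `[a, b], continuous (fun x => (f1 x - A) ^+ 2 + (f2 x - B) ^+ 2 + C)}.
    move=> x; apply: cvgD; last exact: cvg_cst.
    by apply: cvgD; [exact: (kS _ _ k1)|exact: (kS _ _ k2)].
  by move=> x; apply: (cvg_comp _ (@Num.sqrt R) (kk x)); exact: sqrt_continuous.
have cN : {within `[a, b], continuous (fun x => potN p e (g x))} by exact: csq.
have cTN : {within `[a, b], continuous (fun x => radial t p + potN p e (g x))}.
  by move=> x; apply: cvgD; [exact: cvg_cst|exact: cN].
have T0 x : 0 < radial t p + potN p e (g x) by rewrite addr_gt0 ?radial_t_gt0 ?potN_gt0.
have cP : {within `[a, b], continuous (fun x => pot p e (g x))}.
  by move=> x; apply: (cvg_comp _ (@ln R) (cTN x)); exact: continuous_ln.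
have cD : {within `[a, b], continuous (fun x => dpot p e (g x) (g' x))}.
  move=> x; apply: cvgM.
    by apply: cvgD; apply: cvgM; [apply: cvgB; [exact: c1|exact: cvg_cst]|exact: c1'|
                                  apply: cvgB; [exact: c2|exact: cvg_cst]|exact: c2'].
  apply: cvgV; first by rewrite gt_eqF// mulr_gt0 ?potN_gt0.
  by apply: cvgM; [exact: cN|exact: cTN].
pose G x := enorm (g' x) / radial t (g x).
have cG : {within `[a, b], continuous G}.
  have cr : {within `[a, b], continuous (fun x => radial t (g x))}.
    apply/subspace_continuousP => x Ax; have gx := (subspace_continuousP _ _).1 cg x Ax.
    apply: (cvg_comp _ (radial t) gx); apply: radial_t_continuous; apply: dk.
    by move: Ax; rewrite /= in_itv.
  have ce : {within `[a, b], continuous (fun x => enorm (g' x))}.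
    have -> : (fun x => enorm (g' x)) = fun x => Num.sqrt (((g' x).1 - 0) ^+ 2 + ((g' x).2 - 0) ^+ 2 + 0).
      by apply/funext => x; rewrite !subr0 addr0.
    exact: csq.
  apply/subspace_continuousP => x Ax; apply: cvgM; first exact: (subspace_continuousP _ _).1 ce x Ax.
  apply: cvgV; last exact: (subspace_continuousP _ _).1 cr x Ax.
  have dx : disk (g x) by apply: dk; move: Ax; rewrite /= in_itv.
  by rewrite gt_eqF// radial_t_gt0.
have iG : leb.-integrable `[a, b] (EFin \o G).
  by apply: continuous_compact_integrable => //; exact: segment_compact.
have iD : leb.-integrable `[a, b] (EFin \o (fun x => dpot p e (g x) (g' x))).
  by apply: continuous_compact_integrable => //; exact: segment_compact.
have mc : measurable (`[a, b]%classic : set TR) by exact: measurable_itv.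
have mo : measurable (`]a, b[%classic : set TR) by exact: measurable_itv.
have sub : (`]a, b[%classic : set TR) `<=` `[a, b]%classic.
  by move=> x /=; rewrite !in_itv/= => /andP[x1 x2]; rewrite !ltW.
have FG x : (`]a, b[%classic : set TR) x -> F g x = G x.
  by move=> /=; rewrite in_itv/= => /dg[_ ->].
have mGo : measurable_fun (`]a, b[%classic : set TR) (EFin \o G).
  by apply: (measurable_funS mc sub); exact: measurable_int iG.
have EFG : (\int[leb]_(x in `]a, b[) (F g x)%:E = \int[leb]_(x in `[a, b]) (G x)%:E)%E.
  rewrite (@integral_itv_bndoo _ a b (EFin \o G) true false mGo); apply: eq_integral => x.
  by rewrite inE => /FG /= ->.
have fin := integrable_fin_num mc iG.
split; [|by rewrite EFG|].
  apply: (@eq_measurable_fun _ _ _ _ _ G).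
    by move=> x; rewrite inE => /FG ->.
  by apply/measurable_EFinP.
rewrite EFG -/(Rintegral leb `[a, b] G).
have iKG := integrable_scale K mc iG.
have <- : Rintegral leb `[a, b] (fun x => dpot p e (g x) (g' x)) = pot p e (g b) - pot p e (g a).
  rewrite /Rintegral (@continuous_FTC2 _ _ (fun x => pot p e (g x)) a b ab cD)//.
    have /(continuous_within_itvP _ ab)[_ l r] := cP; split=> // x; rewrite in_itv/= => xi.
    by have [d _] := dg x xi; have [] := pot_derive dp e0 d.
  move=> x; rewrite in_itv/= => xi; have [d <-] := dg x xi; rewrite derive1E.
  by have [_ ->] := pot_derive dp e0 d.
rewrite -(RintegralZl K mc iG); apply: (le_Rintegral mc iD iKG) => x /=; rewrite in_itv/= => xi.
by apply: dpot_growth; exact: dk.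
Qed.

(** Pieces are glued over the half-open intervals []0, s i]]. Measurability of the integrand is
    carried through the induction, as its values at the break points are arbitrary. *)
Lemma curve_length (g : R -> R * R) : piecewise_smooth g -> g 0 = p -> g 1 = q ->
  (forall x, 0 <= x <= 1 -> disk (g x)) -> pot p e q - pot p e p <= K * tau_length t g.
Proof.
move=> [cg [n [s [s0 sn inc pc]]]] g0 g1 dk.
have smon i j : (i <= j)%N -> (j <= n)%N -> s i <= s j.
  elim: j => [|j IH]; first by rewrite leqn0 => /eqP->.
  rewrite leq_eqVlt => /orP[/eqP->//|ij] jn.
  by apply: le_trans (IH ij (ltnW jn)) _; rewrite ltW// inc.
have s01 i : (i <= n)%N -> 0 <= s i <= 1.
  by move=> hi; rewrite -s0 -sn !smon.
have main i : (i <= n)%N -> [/\ measurable_fun (`]0, s i]%classic : set TR) (F g),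
    (\int[leb]_(x in `]0%R, s i]) (F g x)%:E)%E \is a fin_num &
    pot p e (g (s i)) - pot p e (g 0) <= K * fine (\int[leb]_(x in `]0%R, s i]) (F g x)%:E)%E].
  elim: i => [_|i IH hi].
    rewrite s0 set_itv_ge ?bnd_simp ?ltxx//.
    by split; [exact: measurable_fun_set0|rewrite integral_set0|rewrite integral_set0 subrr mulr0].
  have [m1 f1 l1] := IH (ltnW hi); have [g' [cg' dg]] := pc i hi.
  have /andP[a0 a1] := s01 i (ltnW hi); have /andP[b0 b1] := s01 i.+1 hi.
  have cgi : {within `[s i, s i.+1], continuous g}.
    apply: (continuous_subspaceW _ cg) => x /=; rewrite !in_itv/= => /andP[x1 x2].
    by rewrite (le_trans a0 x1) (le_trans x2 b1).
  have dki x : s i <= x <= s i.+1 -> disk (g x).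
    by move=> /andP[x1 x2]; apply: dk; rewrite (le_trans a0 x1) (le_trans x2 b1).
  have [m2 f2 l2] := piece_length (inc i hi) cgi cg' dg dki.
  have mA : measurable (`]0, s i]%classic : set TR) by exact: measurable_itv.
  have mB : measurable (`]s i, s i.+1]%classic : set TR) by exact: measurable_itv.
  have mo : measurable (`]s i, s i.+1[%classic : set TR) by exact: measurable_itv.
  have EU : `]0, s i.+1]%classic = `]0, s i]%classic `|` `]s i, s i.+1]%classic :> set TR.
    by rewrite -itv_bndbnd_setU// bnd_simp// ltW// inc.
  have mF2 : measurable_fun (`]s i, s i.+1]%classic : set TR) (F g).
    rewrite -(@setUitv1 _ _ (BRight (s i)) (s i.+1) true) ?bnd_simp ?inc//; apply/measurable_funU => //.
    by split=> //; exact: measurable_fun_set1.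
  have E2 : (\int[leb]_(x in `]s i, s i.+1]) (F g x)%:E = \int[leb]_(x in `]s i, s i.+1[) (F g x)%:E)%E.
    by rewrite (@integral_itv_bndoo _ (s i) (s i.+1) (fun x => (F g x)%:E) false false)//; exact/measurable_EFinP.
  have mU : measurable_fun (`]0, s i.+1]%classic : set TR) (F g).
    by rewrite EU; apply/measurable_funU.
  have E3 : (\int[leb]_(x in `]0%R, s i.+1]) (F g x)%:E = \int[leb]_(x in `]0%R, s i]) (F g x)%:E +
      \int[leb]_(x in `]s i, s i.+1[) (F g x)%:E)%E.
    rewrite -E2 EU ge0_integral_setU//.
    - by apply/measurable_EFinP; rewrite -EU.
    - move=> x; rewrite -EU /= in_itv/= => /andP[x1 x2]; rewrite lee_fin divr_ge0 ?sqrtr_ge0// ltW//.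
      by apply: radial_t_gt0; apply: dk; rewrite (ltW x1) (le_trans x2).
    - apply/disj_setPS => x [] /=; rewrite !in_itv/= => /andP[_ x1] /andP[x2 _].
      by have := le_lt_trans x1 x2; rewrite ltxx.
  split=> //; first by rewrite E3 fin_numD f1.
  by rewrite E3 fineD// mulrDr; exact: telescope_le l1 l2.
have [m _] := main n (leqnn n); rewrite sn g0 g1 /tau_length /Rintegral.
have mo : measurable_fun (`]0, 1[%classic : set TR) (fun x => (F g x)%:E).
  apply/measurable_EFinP; rewrite sn in m; apply: (measurable_funS _ _ m); first exact: measurable_itv.
  by move=> x /=; rewrite !in_itv/= => /andP[-> /ltW].
by rewrite (@integral_itv_bndoo _ 0 1 (fun x => (F g x)%:E) false false mo) (@integral_itv_bndoo _ 0 1 (fun x => (F g x)%:E) true false mo).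
Qed.

End Length.

Lemma ln1D_ge (y : R) : 0 <= y <= 1 -> y / 2 <= ln (1 + y).
Proof.
move=> /andP[y0 y1]; rewrite -[leLHS]expRK ler_ln ?posrE ?expR_gt0//; last by lra.
have h1 := expR_ge1Dx (- (y / 2)); rewrite expRN in h1.
have E0 := expR_gt0 (y / 2); move: (expR (y / 2)) E0 h1 => E E0.
rewrite -(ler_pM2r E0) mulVf ?gt_eqF// => h1; nra.
Qed.

Lemma d_tau_lower : exists2 k : R, 0 < k & forall p q, disk p -> disk q ->
  k * Num.min 1 (enorm (q - p) / radial t p) <= d_tau t p q.
Proof.
have [K K1 gr] := tau_growth hW; have K0 : 0 < K by lra.
exists (6 * K)^-1; first by rewrite invr_gt0 mulr_gt0.
move=> p q dp dq; have tp := radial_t_gt0 dp.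
have d0 : 0 <= enorm (q - p) by exact: sqrtr_ge0.
pose line s := p + s *: (q - p).
(* The segment makes the set of lengths nonempty, so that its infimum is bounded below by any lower
   bound of the lengths. *)
have lineS : piecewise_smooth line /\ line 0 = p /\ line 1 = q.
  split; last by rewrite /line scale0r addr0 scale1r addrCA subrr addr0.
  have cl (x : R) : {for x, continuous line}.
    by have [/derivable1_diffP/differentiable_continuous] := is_derive_line p (q - p) x.
  split; first by apply: continuous_subspaceT => x; exact: cl.
  exists 1%N, (fun i => i%:R); split=> // [[|//] _|[|//] _]; first by rewrite ltr01.
  exists (fun=> q - p); split; first by apply: continuous_subspaceT => x; exact: cvg_cst.
  by move=> x _; exact: is_derive_line.
apply: lb_le_inf.
  exists (tau_length t line); exists line; case: lineS => ? [? ?]; split=> //.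
  by move=> x; exact: disk_line.
move=> L [g [gs g0 g1 dk ->]].
have L0 : 0 <= tau_length t g.
  apply: Rintegral_ge0 => x /=; rewrite in_itv/= => xi; rewrite divr_ge0 ?sqrtr_ge0// ltW//.
  by apply: radial_t_gt0; exact: dk.
have [dz|dz] := eqVneq (enorm (q - p)) 0.
  by rewrite dz mul0r min_r ?ler01// mulr0.
have dpos : 0 < enorm (q - p) by rewrite lt_neqAle eq_sym dz.
set d := enorm (q - p) in d0 dz dpos *.
(* With this smoothing the potential rises by at least [ln ((tau + d) / (tau + d / 2))]. [ln1D_ge]
   costs a factor 2 and the comparison with [min(1, d / tau)] a factor 3: hence [6 * K]. *)
have e0 : 0 < d / 2 by rewrite divr_gt0.
have len := curve_length K1 dp e0 gr gs g0 g1 dk.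
rewrite ler_pdivrMl ?mulr_gt0// [6 * K]mulrC -mulrA.
suff pd : Num.min 1 (d / radial t p) <= 6 * (pot p (d / 2) q - pot p (d / 2) p).
  apply: le_trans pd _; rewrite [leRHS]mulrCA ler_pM2l//.
have Np : potN p (d / 2) p = d / 2.
  by rewrite /potN !subrr expr0n/= !add0r sqrtr_sqr gtr0_norm.
have Nq : d <= potN p (d / 2) q by apply: ler_wsqrtr; rewrite lerDl sqr_ge0.
rewrite /pot Np; set tau := radial t p in tp *; set N := potN p (d / 2) q in Nq *.
have Y0 : 0 < 2 * tau + d by clear - tp dpos; lra.
have y1 : 0 <= d / (2 * tau + d) <= 1 by rewrite divr_ge0 ?(ltW Y0)//= ler_pdivrMr// mul1r; clear - tp; lra.
have lnY := ln1D_ge y1.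
have td : 0 < tau + d / 2 by clear - tp e0; lra.
have h1 : ln (1 + d / (2 * tau + d)) <= ln (tau + N) - ln (tau + d / 2).
  have tN : 0 < tau + N by clear - tp Nq dpos; lra.
  rewrite -ln_div ?posrE// ler_ln ?posrE ?divr_gt0//; last by clear - y1; lra.
  rewrite ler_pdivlMr//.
  have -> : (1 + d / (2 * tau + d)) * (tau + d / 2) = tau + d by field; rewrite gt_eqF.
  by rewrite lerD2l.
have h2 : Num.min 1 (d / tau) <= 3 * (d / (2 * tau + d)).
  have [dt|td'] := leP d tau.
    apply: (@le_trans _ _ (d / tau)); first by rewrite ge_min lexx orbT.
    rewrite mulrCA ler_pM2l// ler_pdivlMr// mulrC ler_pdivrMr//; clear - dt tp; lra.
  apply: (@le_trans _ _ 1); first by rewrite ge_min lexx.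
  by rewrite mulrA ler_pdivlMr//; clear - td' tp; lra.
by clear - h1 h2 lnY; lra.
Qed.

(** Along a segment of length at most [tau p / (2 K)], the growth of tau keeps tau at least
    [tau p / (2 K)]. *)
Lemma d_tau_upper : exists2 C : R, 1 <= C & forall p q, disk p -> disk q ->
  enorm (q - p) <= radial t p / C -> d_tau t p q <= C * (enorm (q - p) / radial t p).
Proof.
have [K K1 gr] := tau_growth hW; have K0 : 0 < K by lra.
exists (2 * K); first by lra.
move=> p q dp dq hd; have tp := radial_t_gt0 dp.
have d0 : 0 <= enorm (q - p) by exact: sqrtr_ge0.
pose line s := p + s *: (q - p).
have cl (x : R) : {for x, continuous line}.
  by have [/derivable1_diffP/differentiable_continuous] := is_derive_line p (q - p) x.
apply: (@le_trans _ _ (tau_length t line)).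
  apply: ge_inf.
    exists 0 => L [g [_ _ _ dk ->]]; apply: Rintegral_ge0 => x /=; rewrite in_itv/= => xi.
    by rewrite divr_ge0 ?sqrtr_ge0// ltW//; apply: radial_t_gt0; exact: dk.
  exists line; split=> //.
  - split; first by apply: continuous_subspaceT => x; exact: cl.
    exists 1%N, (fun i => i%:R); split=> // [[|//] _|[|//] _]; first by rewrite ltr01.
    exists (fun=> q - p); split; first by apply: continuous_subspaceT => x; exact: cvg_cst.
    by move=> x _; exact: is_derive_line.
  - by rewrite /line scale0r addr0.
  - by rewrite /line scale1r addrCA subrr addr0.
  - by move=> x; exact: disk_line.
have key x : 0 <= x <= 1 -> enorm (line^`() x) / radial t (line x) <= 2 * K * (enorm (q - p) / radial t p).
  move=> xi; have [_ ->] := is_derive_line p (q - p) x.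
  have dl : disk (line x) by exact: disk_line.
  have tl := radial_t_gt0 dl.
  have g1 := gr p (line x) dp dl.
  have el : enorm (p - line x) <= enorm (q - p).
    have -> : p - line x = - (x *: (q - p)) by rewrite /line opprD addrA subrr add0r.
    have -> : enorm (- (x *: (q - p))) = x * enorm (q - p).
      rewrite /enorm/= [X in Num.sqrt X](_ : _ = x ^+ 2 * ((q - p).1 ^+ 2 + (q - p).2 ^+ 2)); last first.
        by rewrite /GRing.scale/=; ring.
      by rewrite sqrtrM ?sqr_ge0// sqrtr_sqr ger0_norm//; case/andP: xi.
    by rewrite ler_piMl//; case/andP: xi.
  rewrite mulrCA ler_wpM2l// -ler_pdivrMl; last by rewrite mulr_gt0.
  rewrite -invfM lef_pV2 ?posrE ?mulr_gt0//.
  have : K * enorm (p - line x) <= radial t p / 2.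
    apply: le_trans (ler_wpM2l (ltW K0) (le_trans el hd)) _.
    rewrite le_eqVlt; apply/orP; left; apply/eqP; field; rewrite gt_eqF//.
  by move=> g2; rewrite mulrDr in g1; rewrite -mulrA; clear - g1 g2; lra.
have cF : {within `[0, 1], continuous (fun x => enorm (line^`() x) / radial t (line x))}.
  rewrite (_ : (fun x => _) = (fun x => enorm (q - p) / radial t (line x))); last first.
    by apply/funext => x; have [_ ->] := is_derive_line p (q - p) x.
  apply: continuous_in_subspaceT => x; rewrite inE/= in_itv/= => xi; apply: cvgM; first exact: cvg_cst.
  have dl : disk (line x) by exact: disk_line.
  apply: cvgV; first by rewrite gt_eqF// radial_t_gt0.
  by apply: (cvg_comp _ (radial t) (cl x)); exact: radial_t_continuous.
have m01 : measurable (`[0%R, 1%R]%classic : set TR) by exact: measurable_itv.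
have iF : leb.-integrable `[0, 1] (EFin \o (fun x => enorm (line^`() x) / radial t (line x))).
  by apply: continuous_compact_integrable => //; exact: segment_compact.
set M := 2 * K * _.
have iM : leb.-integrable `[0, 1] (EFin \o (fun _ : R => M)).
  apply: continuous_compact_integrable; first exact: segment_compact.
  by apply: continuous_subspaceT => x; exact: cvg_cst.
apply: le_trans (le_Rintegral m01 iF iM _) _.
  by move=> x /=; rewrite in_itv/=; exact: key.
rewrite Rintegral_cst//; change (M * fine (leb (`[0%R, 1%R]%classic : set TR)) <= M).
by rewrite lebesgue_measure_itv/= lte_fin ltr01 -EFinB/= subr0 mulr1.
Qed.

End TauDistance.

(** * The Skwarczynski distance against [min(1, |z - w| / tau(z))] *)

Section Comparison.
Context {R : realType}.

Lemma gram_sym (c : nat -> R) N (z w : R[i]) : cnorm2 (csum c N (w^* * z)) = cnorm2 (csum c N (z^* * w)).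
Proof.
have h1 := lagrange_id c N z w; have h2 := lagrange_id c N w z.
have E : \sum_(n < N) \sum_(m < N) c n * c m * cnorm2 (w ^+ n * z ^+ m - w ^+ m * z ^+ n) =
         \sum_(n < N) \sum_(m < N) c n * c m * cnorm2 (z ^+ n * w ^+ m - z ^+ m * w ^+ n).
  rewrite exchange_big/=; apply: eq_bigr => n _; apply: eq_bigr => m _.
  by rewrite [c m * c n]mulrC [w ^+ m * _]mulrC [w ^+ n * _]mulrC.
rewrite E -h1 [rsum c N (cnorm2 w) * _]mulrC in h2; clear h1 E; lra.
Qed.

Lemma sqrt_scale (k m : R) : 0 <= k -> 0 <= m -> Num.sqrt k * m = Num.sqrt (2 * k * m ^+ 2 / 2).
Proof.
move=> k0 m0; have -> : 2 * k * m ^+ 2 / 2 = k * m ^+ 2 by field.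
by rewrite [RHS]sqrtrM// sqrtr_sqr ger0_norm.
Qed.

(** The hypotheses give [(1 + a) X <= A] and [Y <= (1 - b) X], hence
    [A - Y >= (a + b) / (1 + a) * A]; the minimum takes care of large [a]. *)
Lemma gram_combine (A X Y a b : R) : 0 <= A -> 0 <= X -> 0 <= a -> 0 <= b <= 1 ->
  a * X <= A - X -> b * X <= X - Y -> Num.min 1 (a + b) / 2 * A <= A - Y.
Proof.
move=> A0 X0 a0 /andP[b0 b1] h1 h2.
have key : (a + b) * A <= (1 + a) * (A - Y).
  have h3 : (1 + a) * Y <= (1 + a) * ((1 - b) * X) by rewrite ler_wpM2l; lra.
  have h4 : (1 - b) * ((1 + a) * X) <= (1 - b) * A by rewrite ler_wpM2l; lra.
  have -> : (a + b) * A = (1 + a) * A - (1 - b) * A by ring.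
  have e : (1 + a) * ((1 - b) * X) = (1 - b) * ((1 + a) * X) by ring.
  by rewrite mulrBr lerD2l lerN2; apply: le_trans h3 _; rewrite e.
have [a1|a1] := leP a 1.
  have D0 : 0 <= A - Y by rewrite -(pmulr_rge0 _ (_ : 0 < 1 + a)); [apply: le_trans key; rewrite mulr_ge0//; lra|lra].
  have m1 : Num.min 1 (a + b) <= a + b by rewrite ge_min lexx orbT.
  have := ler_wpM2r A0 m1; nra.
have m1 : Num.min 1 (a + b) <= 1 by rewrite ge_min lexx.
have := ler_wpM2r A0 m1; nra.
Qed.

(** The diagonal term [A] has no upper bound here, but [Y] has: if [A] is large the difference
    [A - Y] is comparable with [A], and otherwise [f] suffices. *)
Lemma far_combine (A Y f G e : R) : 0 <= f <= e -> f <= A - Y -> 0 <= Y -> Y <= G ->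
  f * A <= (A - Y) * (G + e).
Proof.
move=> /andP[f0 fe] fA Y0 YG.
have h1 : 0 <= (A - Y - f) * G by rewrite mulr_ge0//; lra.
have h2 : 0 <= f * (G - Y) by rewrite mulr_ge0//; lra.
have h3 : 0 <= (A - Y) * (e - f) by rewrite mulr_ge0//; lra.
lra.
Qed.

Lemma half_le (w P : R) : 1 / 2 <= w -> 0 <= P -> P / 2 <= w * P.
Proof. by move=> hw P0; have := ler_wpM2r P0 hw; lra. Qed.

Lemma min_combine (a b d k : R) : 0 <= a -> 0 <= b -> 0 <= d <= a + b -> 0 < k <= 1 ->
  k / 2 * Num.min 1 d ^+ 2 <= Num.min 1 (k * a ^+ 2 + k * Num.min 1 (b ^+ 2)).
Proof.
move=> a0 b0 /andP[d0 dab] /andP[k0 k1].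
set m := Num.min 1 d.
have m0 : 0 <= m by rewrite le_min ler01.
have m1 : m <= 1 by rewrite ge_min lexx. have md : m <= d by rewrite ge_min lexx orbT.
have mm1 : m ^+ 2 <= 1 by rewrite expr_le1.
rewrite le_min; apply/andP; split; first by nra.
rewrite -mulrDr -mulrA ler_pM2l//.
have a2 := sqr_ge0 a.
have [b1|b1] := leP 1 (b ^+ 2); first by rewrite mulrC; lra.
have : m ^+ 2 <= (a + b) ^+ 2 by rewrite lerXn2r// ?nnegrE; lra.
have := sqr_ge0 (a - b); rewrite !expr2; lra.
Qed.

Lemma min_growth (d s T K : R) : 0 <= d -> 0 < s -> 0 < T -> 1 <= K -> T <= K * (s + d) ->
  Num.min 1 (d / s) / (2 * K) <= Num.min 1 (d / T).
Proof.
move=> d0 s0 T0 K1 TK; set m := Num.min 1 (d / s).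
have m1 : m <= 1 by rewrite ge_min lexx.
have m0 : 0 <= m by rewrite le_min ler01/= divr_ge0// ltW.
have md : m * s <= d by rewrite -ler_pdivlMr// ge_min lexx orbT.
have K0 : 0 < 2 * K by lra.
rewrite le_min; apply/andP; split; first by rewrite ler_pdivrMr//; lra.
rewrite ler_pdivrMr// mulrAC ler_pdivlMr//.
have h1 := ler_wpM2l m0 TK; have h2 : m * d <= d by rewrite ler_piMl.
have := ler_wpM2l (ltW K0) (lerD md h2); lra.
Qed.

Variables h t : R -> R.
Hypothesis hW : in_W h t.
Variable Kz : R * R -> R[i] -> R[i].
Hypothesis hK : is_reproducing_kernel h Kz.


Local Notation c := (@kc R h).
Local Notation Kd p := (complex.Re (Kz p (p2c p))).

Lemma enorm_cnorm2 (p q : R * R) : enorm (q - p) ^+ 2 = cnorm2 (p2c p - p2c q).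
Proof. by rewrite cnorm2E cabsB. Qed.

Lemma enorm_diff (p q : R * R) : `|enorm p - enorm q| <= enorm (q - p).
Proof.
have -> : enorm (q - p) = cabs (p2c q - p2c p) by [].
rewrite ler_distl !enormE; apply/andP; split.
  by have := cabsD (p2c q - p2c p) (p2c p); rewrite subrK => h1; clear - h1 hW hK; lra.
by have := cabsD (p2c p - p2c q) (p2c q); rewrite subrK (cabsB (p2c p)) => h1; clear - h1 hW hK; lra.
Qed.

Lemma t_growth : exists2 K : R, 1 <= K & (forall p z, disk p -> disk z ->
    radial t p <= K * (radial t z + enorm (p - z))) /\
  forall a b, 0 <= a < 1 -> 0 <= b < 1 -> t a <= K * (t b + `|a - b|).
Proof.
have [K K1 gr] := tau_growth hW; exists K => //; split=> // a b /andP[a0 a1] /andP[b0 b1].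
have da : disk (a, 0 : R) by apply: disk_axis; rewrite ger0_norm.
have db : disk (b, 0 : R) by apply: disk_axis; rewrite ger0_norm.
have -> : `|a - b| = enorm ((a, 0) - (b, 0)).
  by rewrite -enorm_axis; congr enorm; rewrite [RHS](_ : _ = (a - b, 0 - 0))// subr0.
by have := gr _ _ da db; rewrite /radial !enorm_axis (ger0_norm a0) (ger0_norm b0).
Qed.

Lemma rsum_at (r : R) N : 0 <= r < 1 -> rsum c N (r ^+ 2) <= Kd (r, 0).
Proof.
move=> /andP[r0 r1]; have dr : disk (r, 0 : R) by apply: disk_axis; rewrite ger0_norm.
have := rsum_le hW hK N dr; congr (rsum _ _ _ <= _).
by rewrite cnorm2E -enormE enorm_axis real_normK ?num_real.
Qed.

Lemma skw_lower_near : exists2 k : R, 0 < k & exists2 w : R, 1 / 2 <= w < 1 &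
  forall p q, disk p -> disk q -> w <= enorm p * enorm q ->
  k * Num.min 1 (enorm (q - p) / radial t p) <= skw_dist h Kz p q.
Proof.
have [k0 k01 [w w1 low]] := gram_lower hW; have [K K1 [_ gr]] := t_growth.
have K0 : 0 < 2 * K by clear - K1 hW hK; lra.
(* The 4 is a factor 2 from [min_combine] and one from [gram_combine]; [min_growth] gives
   [(2 * K) ^ 2] and [skw_ge] the last halving. *)
pose k := k0 / 4 / (2 * K) ^+ 2 / 2.
have kp : 0 < k by rewrite !divr_gt0 ?exprn_gt0//; case/andP: k01.
exists (Num.sqrt k); first by rewrite sqrtr_gt0.
exists w => // p q dp dq wxy; set d := enorm (q - p); set x := enorm p in wxy *; set y := enorm q in wxy *.
have x1 : x < 1 by []. have y1 : y < 1 by [].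
have x0 : 0 <= x by exact: sqrtr_ge0. have y0 : 0 <= y by exact: sqrtr_ge0.
have d0 : 0 <= d by exact: sqrtr_ge0.
have xy0 : 0 < x * y by apply: lt_le_trans wxy; clear - w1 hW hK; lra.
have xp : 0 < x by rewrite lt_neqAle x0 andbT eq_sym; apply/eqP => e; rewrite e mul0r ltxx in xy0.
have yp : 0 < y by rewrite lt_neqAle y0 andbT eq_sym; apply/eqP => e; rewrite e mulr0 ltxx in xy0.
have u1 : x * y < 1 by rewrite mulr_ilt1.
have un : (x * y)%:C%C != 0 :> R[i] by rewrite fmorph_eq0 gt_eqF.
pose z := (p2c p)^* * p2c q / (x * y)%:C%C : R[i].
have zE : (x * y)%:C%C * z = (p2c p)^* * p2c q by rewrite /z mulrC divfK.
have z1 : cabs z = 1.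
  have := congr1 cabs zE; rewrite !cabsM cabs_conj cabs_real gtr0_norm//.
  rewrite -[cabs (p2c p)]/x -[cabs (p2c q)]/y => e; apply: (mulfI (lt0r_neq0 xy0)).
  by rewrite e mulr1.
have [N0 hN] := low x y z (introT andP (conj xp x1)) (introT andP (conj yp y1)) wxy z1.
set T := t (Num.sqrt (x * y)) in hN.
have sq1 : 0 <= Num.sqrt (x * y) < 1.
  by rewrite sqrtr_ge0 -[ltRHS]sqrtr1 ltr_sqrt.
have T0 : 0 < T by exact: (t_gt0 hW).
have tp : 0 < radial t p by apply: (t_gt0 hW); rewrite x0.
have xyd : `|x - y| <= d by exact: enorm_diff.
(* The geometric mean lies between [x] and [y], so tau there can be compared with tau at [p]. *)
have sx : `|Num.sqrt (x * y) - x| <= `|x - y|.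
  have [yx|xy] := leP y x.
    have h1 : y <= Num.sqrt (x * y) by rewrite -{1}[y](ger0_norm y0) -sqrtr_sqr ler_wsqrtr// expr2 ler_wpM2r.
    have h2 : Num.sqrt (x * y) <= x by rewrite -[leRHS](ger0_norm x0) -sqrtr_sqr ler_wsqrtr// expr2 ler_wpM2l.
    by rewrite distrC !ger0_norm ?subr_ge0// lerD2l lerN2.
  have h1 : x <= Num.sqrt (x * y) by rewrite -{1}[x](ger0_norm x0) -sqrtr_sqr ler_wsqrtr// expr2 ler_wpM2l// ltW.
  have h2 : Num.sqrt (x * y) <= y by rewrite -[leRHS](ger0_norm y0) -sqrtr_sqr ler_wsqrtr// expr2 ler_wpM2r// ltW.
  by rewrite (distrC x) !ger0_norm ?subr_ge0// ?(ltW xy)// lerD2r.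
have Tgr : T <= K * (radial t p + d).
  apply: le_trans (gr _ _ sq1 (introT andP (conj x0 x1))) _.
  rewrite ler_pM2l; last by clear - K1 hW hK; lra.
  by rewrite lerD2l; exact: le_trans sx xyd.
have mg := min_growth d0 tp T0 K1 Tgr.
(* The distance is split into the change of modulus and the change of argument, the two quantities
   of [gram_lower]. *)
have dz : d <= `|x - y| + cabs (z - 1).
  have e : d = cabs ((p2c p)^* * (p2c q - p2c p)) / x.
    by rewrite cabsM cabs_conj mulrAC divff ?mul1r// gt_eqF.
  rewrite e ler_pdivrMr// mulrBr -zE.
  have -> : (p2c p)^* * p2c p = (x * x)%:C%C by rewrite mulrC -cnorm2_conj cnorm2E expr2.
  have -> : (x * y)%:C%C * z - (x * x)%:C%C = (x * y)%:C%C * (z - 1) + (x * (y - x))%:C%C :> R[i].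
    by rewrite mulrBr mulr1 mulrBr rmorphB/= addrA subrK.
  apply: le_trans (cabsD _ _) _; rewrite cabsM !cabs_real (gtr0_norm xy0) normrM (gtr0_norm xp) (distrC y).
  have -> : (`|x - y| + cabs (z - 1)) * x = x * `|x - y| + x * cabs (z - 1) by ring.
  by rewrite addrC lerD2l -mulrA ler_pM2l// ler_piMl ?cabs_ge0// ltW.
have a0 : 0 <= `|x - y| / T by rewrite divr_ge0// ltW.
have b0 : 0 <= cabs (z - 1) / T by rewrite divr_ge0 ?cabs_ge0// ltW.
have dT : 0 <= d / T <= `|x - y| / T + cabs (z - 1) / T.
  by rewrite divr_ge0 ?(ltW T0)//= -mulrDl ler_pM2r// invr_gt0.
have mc := min_combine a0 b0 dT k01.
set m := Num.min 1 (d / radial t p) in mg *.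
have m0 : 0 <= m by rewrite le_min ler01 divr_ge0// ltW.
rewrite (sqrt_scale (ltW kp) m0).
have l0 : 0 <= 2 * k * m ^+ 2 by rewrite mulr_ge0 ?sqr_ge0// mulr_ge0// ltW.
apply: (skw_ge hW hK dp dq l0); apply: (gram_limit_ge hW hK (N0 := N0) dp dq) => // N NN; have [g1 g2] := hN N NN.
have cx : cnorm2 (p2c p) = x ^+ 2 by rewrite cnorm2E. have cy : cnorm2 (p2c q) = y ^+ 2 by rewrite cnorm2E.
rewrite cx cy -zE.
set A := rsum c N (x ^+ 2) * _ in g1 *; set X := rsum c N (x * y) ^+ 2 in g1 g2.
have A0 : 0 <= A by rewrite mulr_ge0 ?(rsum_ge0 hW) ?sqr_ge0.
have X0 : 0 <= X by exact: sqr_ge0.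
have ka0 : 0 <= k0 * ((x - y) / T) ^+ 2 by rewrite mulr_ge0 ?sqr_ge0//; case/andP: k01 => /ltW.
have mb1 : Num.min 1 ((cabs (z - 1) / T) ^+ 2) <= 1 by rewrite ge_min lexx.
have mb0 : 0 <= Num.min 1 ((cabs (z - 1) / T) ^+ 2) by rewrite le_min ler01 sqr_ge0.
have kb : 0 <= k0 * Num.min 1 ((cabs (z - 1) / T) ^+ 2) <= 1.
  by case/andP: k01 => kk0 kk1; rewrite mulr_ge0 ?(ltW kk0)//= mulr_ile1// ltW.
apply: le_trans (gram_combine A0 X0 ka0 kb g1 g2); rewrite ler_wpM2r//.
rewrite ler_pdivlMr//; have e1 : (`|x - y| / T) ^+ 2 = ((x - y) / T) ^+ 2.
  by rewrite !exprMn real_normK ?num_real.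
rewrite e1 in mc; apply: le_trans mc.
have h1 : (m / (2 * K)) ^+ 2 <= Num.min 1 (d / T) ^+ 2.
  by rewrite lerXn2r// nnegrE ?divr_ge0 ?(ltW K0)// le_min ler01 divr_ge0// ltW.
have -> : 2 * k * m ^+ 2 * 2 = k0 / 2 * (m / (2 * K)) ^+ 2.
  by rewrite /k; field; rewrite gt_eqF//; clear - K1 hW hK; lra.
by rewrite ler_wpM2l// divr_ge0//; case/andP: k01 => /ltW.
Qed.

(** Either [|p|] stays away from 1 and tau is bounded below at [p], or [|p|] is close to 1, which
    forces [|q| < sqrt w] and keeps the two points apart. *)
Lemma dist_lower_far (w : R) : 0 < w < 1 -> exists2 k : R, 0 < k & forall p q, disk p -> disk q ->
  enorm p * enorm q < w -> k * Num.min 1 (enorm (q - p) / radial t p) <= enorm (q - p).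
Proof.
move=> /andP[w0 w1]; pose s := Num.sqrt w; have s0 : 0 < s by rewrite sqrtr_gt0.
have s1 : s < 1 by rewrite -[ltRHS]sqrtr1 ltr_sqrt.
have ss : s * s = w by rewrite -expr2 sqr_sqrtr// ltW.
have r1 : 0 <= (1 + s) / 2 < 1 by clear - s0 s1 hW hK; lra.
have [[m M] /= m0 hm] := t_bounds hW r1.
pose g := (1 - s) / 2; have g0 : 0 < g by rewrite /g; clear - s1 hW hK; lra.
exists (Num.min m g); first by rewrite lt_min m0.
move=> p q dp dq xy; set d := enorm (q - p); set x := enorm p in xy *; set y := enorm q in xy *.
have x0 : 0 <= x by exact: sqrtr_ge0. have y0 : 0 <= y by exact: sqrtr_ge0.
have d0 : 0 <= d by exact: sqrtr_ge0.
have tp : 0 < radial t p by apply: (t_gt0 hW); rewrite x0.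
have mn0 : 0 <= Num.min m g by rewrite le_min !ltW.
have n0 : 0 <= Num.min 1 (d / radial t p) by rewrite le_min ler01 divr_ge0// ltW.
have [xr|xr] := leP x ((1 + s) / 2).
  have /andP[mt _] : m <= radial t p <= M by apply: hm; rewrite x0.
  apply: (@le_trans _ _ (m * (d / radial t p))).
    by apply: ler_pM => //; [rewrite ge_min lexx|rewrite ge_min lexx orbT].
  by rewrite mulrCA ler_piMr// ler_pdivrMr// mul1r.
apply: (@le_trans _ _ (g * 1)).
  by apply: ler_pM => //; [rewrite ge_min lexx orbT|rewrite ge_min lexx].
have xs : s <= x by clear - xr s1 hW hK; lra.
have ys : y < s.
  rewrite ltNge; apply/negP => sy; move: xy; rewrite ltNge -ss; apply/negP; rewrite negbK.
  by apply: ler_pM => //; exact: ltW.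
have := enorm_diff p q; rewrite -/x -/y -/d mulr1; have := ler_norm (x - y).
by rewrite /g; move=> h1 h2; clear - h1 h2 xr ys hW hK; lra.
Qed.

Lemma csum_le N (z : R[i]) (r : R) : cabs z <= r -> cnorm2 (csum c N z) <= rsum c N r ^+ 2.
Proof.
move=> zr; have r0 : 0 <= r by apply: le_trans zr; exact: cabs_ge0.
rewrite cnorm2E lerXn2r// ?nnegrE ?cabs_ge0 ?(rsum_ge0 hW)//.
apply: le_trans (ler_cabs_sum _ _ _) _; apply: ler_sum => k _.
have ck := ltW (kc_gt0 hW k).
by rewrite cabsM cabs_real ger0_norm// cabsX ler_wpM2l// lerXn2r// nnegrE cabs_ge0.
Qed.

(** Only the indices 0 and 1 of Lagrange's double sum are kept. *)
Lemma gram_two N (z w : R[i]) : (2 <= N)%N ->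
  c 0 * c 1 * cnorm2 (z - w) <= rsum c N (cnorm2 z) * rsum c N (cnorm2 w) - cnorm2 (csum c N (z^* * w)).
Proof.
move=> N2; rewrite -(ler_pM2l (ltr0Sn R 1)) lagrange_id.
have c0 n := ltW (kc_gt0 hW n).
have F0 n m : 0 <= c n * c m * cnorm2 (z ^+ n * w ^+ m - z ^+ m * w ^+ n).
  by rewrite mulr_ge0 ?cnorm2_ge0// mulr_ge0.
apply: le_trans (block_sum1 (a := 0) (M := 2)
  (G := fun n => \sum_(m < N) c n * c m * cnorm2 (z ^+ n * w ^+ m - z ^+ m * w ^+ n)) _ N2); last first.
  by move=> n; exact: sumr_ge0.
apply: (@le_trans _ _ (\sum_(i < 2) \sum_(j < 2) c i * c j * cnorm2 (z ^+ i * w ^+ j - z ^+ j * w ^+ i))); last first.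
  apply: ler_sum => i _; exact: (block_sum1 (a := 0) (M := 2)
    (G := fun m => c i * c m * cnorm2 (z ^+ i * w ^+ m - z ^+ m * w ^+ i)) (F0 i) N2).
rewrite !big_ord_recl !big_ord0/= /bump/= !expr0 !expr1 !mul1r !mulr1 !subrr.
have -> : cnorm2 (w - z) = cnorm2 (z - w) by rewrite !cnorm2E cabsB.
have -> : cnorm2 (0 : R[i]) = 0 by rewrite cnorm2E cabs0 expr0n.
have := mulr_ge0 (mulr_ge0 (c0 0%N) (c0 0%N)) (ler0n R 0).
rewrite [c 1 * c 0]mulrC; lra.
Qed.

Lemma skw_lower : exists2 k : R, 0 < k & forall p q, disk p -> disk q ->
  k * Num.min 1 (enorm (q - p) / radial t p) <= skw_dist h Kz p q.
Proof.
have [k1 k10 [w w1 near]] := skw_lower_near.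
have w01 : 0 < w < 1 by clear - w1 hW hK; lra.
have [k2 k20 far] := dist_lower_far w01.
pose s := Num.sqrt w; have s0 : 0 <= s by exact: sqrtr_ge0.
have s1 : s < 1 by rewrite -[ltRHS]sqrtr1 ltr_sqrt//; case/andP: w01.
have sw : s ^+ 2 = w by rewrite sqr_sqrtr// ltW//; case/andP: w01.
pose G := Kd (s, 0); have G0 N : rsum c N w <= G by rewrite -sw; apply: rsum_at; rewrite s0.
pose e1 := c 0 * c 1; have e10 : 0 < e1 by rewrite mulr_gt0 ?(kc_gt0 hW).
(* Away from the boundary the off-diagonal term is at most [G ^ 2], and [e1 * d ^ 2 <= 4 * e1] since
   the disk has diameter 2; [far_combine] adds the two bounds. *)
pose D := G ^+ 2 + 4 * e1; have D0 : 0 < D by rewrite ltr_wpDl ?sqr_ge0// mulr_gt0.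
pose k3 := e1 / D / 2; have k30 : 0 < k3 by apply: divr_gt0 => //; exact: divr_gt0.
exists (Num.min k1 (Num.sqrt k3 * k2)); first by rewrite lt_min k10 mulr_gt0// sqrtr_gt0.
move=> p q dp dq; set m := Num.min 1 _.
have m0 : 0 <= m.
  rewrite le_min ler01 divr_ge0 ?sqrtr_ge0// ltW//; apply: (t_gt0 hW).
  by rewrite sqrtr_ge0; exact: dp.
have [wxy|xyw] := leP w (enorm p * enorm q).
  by apply: le_trans (near p q dp dq wxy); rewrite ler_wpM2r// ge_min lexx.
apply: (@le_trans _ _ (Num.sqrt k3 * k2 * m)); first by rewrite ler_wpM2r// ge_min lexx orbT.
rewrite -mulrA; apply: le_trans (ler_wpM2l (sqrtr_ge0 _) (far p q dp dq xyw)) _.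
set d := enorm (q - p); have d0 : 0 <= d by exact: sqrtr_ge0.
rewrite (sqrt_scale (ltW k30) d0).
have l0 : 0 <= 2 * k3 * d ^+ 2 by rewrite mulr_ge0 ?sqr_ge0// mulr_ge0// ltW.
apply: (skw_ge hW hK dp dq l0); apply: (gram_limit_ge hW hK (N0 := 2) dp dq) => // N NN.
have two := gram_two (p2c p) (p2c q) NN; rewrite -enorm_cnorm2 -/d -/e1 in two.
set A := rsum c N _ * _ in two *; set Y := cnorm2 (csum _ _ _) in two *.
have Y0 : 0 <= Y by exact: cnorm2_ge0.
have YG : Y <= G ^+ 2.
  have hz : cabs ((p2c p)^* * p2c q) <= w by rewrite cabsM cabs_conj ltW.
  apply: le_trans (csum_le N hz) _; rewrite lerXn2r// ?nnegrE ?G0//.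
    by apply: (rsum_ge0 hW); rewrite -sw sqr_ge0.
  by apply: le_trans (G0 0%N); rewrite /rsum big_ord0.
have d2 : d ^+ 2 <= 4.
  have : d <= 2.
    apply: le_trans (_ : _ <= enorm q + enorm p) _.
      by rewrite !enormE; have := cabsD (p2c q) (- p2c p); rewrite cabsN.
    have p1 : enorm p < 1 by []. have q1 : enorm q < 1 by [].
    by clear - p1 q1 hW hK; lra.
  by move=> h1; rewrite -[4]/(2 * 2)%:R natrM expr2; apply: ler_pM.
have ed : e1 * d ^+ 2 <= 4 * e1 by rewrite mulrC ler_pM2r.
have -> : 2 * k3 * d ^+ 2 * A = e1 * d ^+ 2 * A / D by rewrite /k3; field; rewrite gt_eqF.
rewrite ler_pdivrMr// /D.
have ed0 : 0 <= e1 * d ^+ 2 by rewrite mulr_ge0 ?sqr_ge0// ltW.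
by apply: far_combine => //; rewrite ed0.
Qed.

(** This compares the centres of the weights at the two radii. Between them tau is at least
    [tau p / (2 K)], so [mm] has slope of order [tau ^ -2], over a length at most
    [2 * d <= tau / K]. *)
Lemma mm_diff (cl K x y d tau : R) : 1 <= cl -> 1 <= K -> 0 < x < 1 -> 0 < y < 1 -> `|x - y| <= d -> 0 < tau ->
  d <= tau / (2 * K) -> tau = t x ->
  (forall u, 0 <= u < 1 -> (cl * t (Num.sqrt u) ^+ 2)^-1 <= lapl h u / 2 <= cl / t (Num.sqrt u) ^+ 2) ->
  (forall a b, 0 <= a < 1 -> 0 <= b < 1 -> t a <= K * (t b + `|a - b|)) ->
  tau * `|mm h (x ^+ 2) - mm h (y ^+ 2)| <= 4 * cl * K ^+ 2.
Proof.
move=> cl1 K1 xi yi xyd tau0 dtau tE lb gr.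
have K0 : 0 < 2 * K by clear - K1 hW hK; lra.
have d0 : 0 <= d by apply: le_trans xyd.
have dK : K * d <= tau / 2.
  rewrite ler_pdivlMr// in dtau; clear - dtau hW hK; lra.
have sq (a : R) : 0 < a < 1 -> 0 < a ^+ 2 < 1 by move=> /andP[a0 a1]; rewrite exprn_gt0//= expr_lt1// ltW.
have main u v : 0 < u -> u < v -> v < 1 -> (forall xi, u < xi < v -> `|x - Num.sqrt xi| <= d) ->
    v - u <= 2 * d -> tau * `|mm h v - mm h u| <= 4 * cl * K ^+ 2.
  move=> u0 uv v1 hxi vu; have [z /andP[z1 z2] ->] := mm_mvt hW u0 uv v1.
  have zi : 0 <= z < 1 by rewrite ltW ?(lt_trans u0 z1)//= (lt_trans z2 v1).
  have /andP[_ l2] := lb z zi.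
  have sz : 0 <= Num.sqrt z < 1 by rewrite sqrtr_ge0 -[ltRHS]sqrtr1 ltr_sqrt//; case/andP: zi.
  have s0 := t_gt0 hW sz; have xi' : 0 <= x < 1 by case/andP: xi => /ltW -> ->.
  have g1 := gr _ _ xi' sz; rewrite -tE in g1.
  have g2 : tau <= 2 * K * t (Num.sqrt z).
    have h1 := hxi z (introT andP (conj z1 z2)).
    have h2 : K * `|x - Num.sqrt z| <= K * d by rewrite ler_pM2l//; clear - K1 hW hK; lra.
    by rewrite mulrDr in g1; rewrite -mulrA; clear - g1 h2 dK hW hK; lra.
  set s := t (Num.sqrt z) in l2 s0 g2.
  have l0 := lapl_gt0 hW zi.
  rewrite normrM (@ger0_norm _ (lapl h z / 2)) ?divr_ge0 ?(ltW l0)// (@ger0_norm _ (v - u)); last by rewrite subr_ge0 ltW.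
  have vu0 : 0 <= v - u by rewrite subr_ge0 ltW.
  apply: (@le_trans _ _ (tau * (cl / s ^+ 2 * (2 * d)))).
    by rewrite ler_pM2l//; apply: ler_pM => //; rewrite divr_ge0 ?(ltW l0).
  have s2 : 0 < s ^+ 2 by rewrite exprn_gt0.
  have -> : tau * (cl / s ^+ 2 * (2 * d)) = (2 * cl * (tau * d)) / s ^+ 2 by field; rewrite gt_eqF.
  rewrite ler_pdivrMr//.
  have h3 : tau * (2 * (K * d)) <= tau * tau by rewrite ler_pM2l//; clear - dK hW hK; lra.
  have h4 : tau * tau <= (2 * K * s) * (2 * K * s) by apply: ler_pM => //; exact: ltW.
  have h5 : tau * d <= 2 * K * s ^+ 2 * K.
    have Kp : 0 < K by clear - K1 hW hK; lra.
    rewrite -(ler_pM2l Kp) -(ler_pM2l (ltr0Sn R 1)).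
    have -> : 2 * (K * (tau * d)) = tau * (2 * (K * d)) by ring.
    apply: le_trans (le_trans h3 h4) _; have -> : 2 * (K * (2 * K * s ^+ 2 * K)) = (2 * K * s) * (2 * K * s) * K by ring.
    by rewrite ler_peMr// mulr_ge0// !mulr_ge0// ltW.
  have cl0 : 0 <= 2 * cl by clear - cl1 hW hK; lra.
  have h6 := ler_wpM2l cl0 h5; apply: le_trans h6 _; rewrite le_eqVlt; apply/orP; left; apply/eqP; ring.
have sqr_sub (a b : R) : 0 < a < 1 -> 0 < b < 1 -> a < b -> b ^+ 2 - a ^+ 2 <= 2 * (b - a).
  move=> /andP[a0 a1] /andP[b0 b1] ab; have h1 : 0 <= (b - a) * (2 - a - b) by rewrite mulr_ge0//; clear - ab a1 b1 hW hK; lra.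
  by rewrite !expr2; clear - h1 hW hK; lra.
have sb (a b z : R) : 0 < a -> 0 < b -> a ^+ 2 < z < b ^+ 2 -> a <= Num.sqrt z <= b.
  move=> a0 b0 /andP[z1 z2]; apply/andP; split.
    by rewrite -[leLHS](gtr0_norm a0) -sqrtr_sqr ler_wsqrtr// ltW.
  by rewrite -[leRHS](gtr0_norm b0) -sqrtr_sqr ler_wsqrtr// ltW.
have /andP[x0 x1] := xi; have /andP[y0 y1] := yi.
have /andP[xx0 xx1] := sq _ xi; have /andP[yy0 yy1] := sq _ yi.
have [xy|yx|->] := ltgtP x y; last by rewrite subrr normr0 mulr0 mulr_ge0 ?sqr_ge0//; clear - cl1 hW hK; lra.
  have xyd' : y - x <= d by rewrite distrC ger0_norm ?subr_ge0 ?(ltW xy)// in xyd.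
  rewrite distrC; apply: main => //.
  - by rewrite ltr_pXn2r// ?nnegrE ltW.
  - move=> z /(sb _ _ _ x0 y0)/andP[z1 z2]; rewrite distrC ger0_norm ?subr_ge0//; clear - z2 xyd' hW hK; lra.
  - by apply: le_trans (sqr_sub _ _ xi yi xy) _; rewrite ler_pM2l.
have xyd' : x - y <= d by rewrite ger0_norm ?subr_ge0 ?(ltW yx)// in xyd.
apply: main => //.
- by rewrite ltr_pXn2r// ?nnegrE ltW.
- move=> z /(sb _ _ _ y0 x0)/andP[z1 z2]; rewrite ger0_norm ?subr_ge0//; clear - z1 xyd' hW hK; lra.
- by apply: le_trans (sqr_sub _ _ yi xi yx) _; rewrite ler_pM2l.
Qed.

(** [gram_upper] takes the larger modulus first; the symmetry of the Gram determinant covers both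
    orders. *)
Lemma gram_upper_sym N (z w : R[i]) (r : R) : 0 <= r -> r <= cabs z -> r <= cabs w ->
  r ^+ 2 * (rsum c N (cnorm2 z) * rsum c N (cnorm2 w) - cnorm2 (csum c N (z^* * w))) <=
  cnorm2 (z - w) * \sum_(n < N) \sum_(m < N) kw h (cabs z ^+ 2) n * kw h (cabs w ^+ 2) m * (n%:R - m%:R) ^+ 2.
Proof.
move=> r0 rz rw; have c0 n := ltW (kc_gt0 hW n).
have g0 := gram_ge0 hW N z w.
have sqle (a : R) : r <= a -> r ^+ 2 <= a ^+ 2 by move=> ra; rewrite lerXn2r// nnegrE// (le_trans r0).
have [wz|/ltW zw] := leP (cabs w) (cabs z).
  apply: le_trans (ler_wpM2r g0 (sqle _ rz)) _.
  apply: le_trans (gram_upper N c0 (lexx _) (lexx _) wz) _.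
  rewrite ler_wpM2l ?cnorm2_ge0//; apply: ler_sum => n _; apply: ler_sum => m _.
  by rewrite le_eqVlt; apply/orP; left; apply/eqP; rewrite /kw /kc; ring.
apply: le_trans (ler_wpM2r g0 (sqle _ rw)) _.
have := gram_upper N c0 (lexx _) (lexx _) zw; rewrite gram_sym [rsum c N (cnorm2 w) * _]mulrC => h1.
apply: le_trans h1 _; have -> : cnorm2 (w - z) = cnorm2 (z - w) by rewrite !cnorm2E cabsB.
rewrite ler_wpM2l ?cnorm2_ge0// exchange_big/=; apply: ler_sum => n _; apply: ler_sum => m _.
by rewrite le_eqVlt; apply/orP; left; apply/eqP; rewrite /kw /kc; ring.
Qed.


Lemma skw_upper : exists2 C : R, 1 <= C & forall p q, disk p -> disk q ->
  skw_dist h Kz p q <= C * Num.min 1 (enorm (q - p) / radial t p).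
Proof.
have [C C1 [w w1 sp]] := kernel_spread hW; have [K K1 [grp gr]] := t_growth.
have [cl cl1 lb] := lapl_bounds hW.
have K0 : 0 < 2 * K by clear - K1 hW hK; lra.
pose s := Num.sqrt w; have w0 : 0 < w by clear - w1 hW hK; lra.
have s0 : 0 < s by rewrite sqrtr_gt0.
have s1 : s < 1 by rewrite -[ltRHS]sqrtr1 ltr_sqrt//; case/andP: w1.
have sw : s ^+ 2 = w by rewrite sqr_sqrtr// ltW.
pose rho := (1 + s) / 2; have rh : s < rho < 1 by rewrite /rho; clear - s0 s1 hW hK; lra.
have rho0 : 0 < rho by case/andP: rh => /(lt_trans s0).
have rho2 : w <= rho ^+ 2 < 1.
  by rewrite -sw lerXn2r ?nnegrE ?(ltW s0) ?(ltW rho0)//= ?expr_lt1 ?(ltW rho0)//; case/andP: rh => // /ltW.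
pose G := Kd (rho, 0); have G0 N : rsum c N (rho ^+ 2) <= G.
  by apply: rsum_at; rewrite (ltW rho0); case/andP: rh.
pose tr := t rho; have tr0 : 0 < tr by apply: (t_gt0 hW); rewrite (ltW rho0); case/andP: rh.
pose TM := K * (t 0 + 1).
have t00 : 0 < t 0 by apply: (t_gt0 hW); rewrite lexx ltr01.
have TM0 : 0 < TM by rewrite mulr_gt0//; [clear - K1 hW hK; lra|clear - t00 hW hK; lra].
have tTM p : disk p -> radial t p <= TM.
  move=> dp; have e0 : 0 <= enorm p by exact: sqrtr_ge0.
  have e1 : enorm p < 1 by [].
  apply: le_trans (gr _ _ (introT andP (conj e0 e1)) (introT andP (conj (lexx 0) ltr01))) _.
  by rewrite subr0 ger0_norm// /TM ler_pM2l; [rewrite lerD2l ltW|clear - K1 hW hK; lra].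
pose g := rho - s; have g0 : 0 < g by rewrite subr_gt0; case/andP: rh.
(* [6 = 3 * 2]: 3 from [moment_split] and 2 from [w >= 1 / 2]. The summands are the second moment at
   the first radius, the squared distance of the centres, and the second moment at the other radius
   after comparing the two values of tau. *)
pose B1 := 6 * (C + (4 * cl * K ^+ 2) ^+ 2 + C * (2 * K) ^+ 2).
(* Both second moments are taken at the radius [rho], which gives 6; [rho ^ 2 >= 1 / 2] doubles it,
   and [c 0 ^ 2] bounds the diagonal product from below. *)
pose B2 := 12 * C * G ^+ 2 / (tr ^+ 2 * c 0 ^+ 2).
have C0 : 0 < C by clear - C1 hW hK; lra.
have B10 : 0 <= B1.
  by rewrite mulr_ge0// !addr_ge0 ?sqr_ge0 ?(ltW C0)// mulr_ge0 ?sqr_ge0// ltW.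
have c0p := kc_gt0 hW 0.
have B20 : 0 <= B2.
  by apply: divr_ge0; apply: mulr_ge0; rewrite ?sqr_ge0// mulr_ge0// ltW.
have sB1 := sqrtr_ge0 B1; have sB2 := sqrtr_ge0 B2.
(* One summand for each case: points farther apart than [tau / (2 * K)], both near the boundary,
   both within [rho], and one within [s] while the other is beyond [rho]. *)
pose F := 1 + 2 * K + Num.sqrt B1 + Num.sqrt B2 * TM + TM / g.
have f1 : 0 <= Num.sqrt B2 * TM by rewrite mulr_ge0// ltW.
have f2 : 0 <= TM / g by rewrite divr_ge0// ltW.
exists F; first by rewrite /F; clear - K0 sB1 f1 f2 hW hK; lra.
move=> p q dp dq; set d := enorm (q - p); set tau := radial t p; set x := enorm p; set y := enorm q.
have x0 : 0 <= x by exact: sqrtr_ge0. have y0 : 0 <= y by exact: sqrtr_ge0.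
have x1 : x < 1 by []. have y1 : y < 1 by [].
have d0 : 0 <= d by exact: sqrtr_ge0.
have tau0 : 0 < tau by apply: (t_gt0 hW); rewrite x0.
have le1 := skw_le1 hW hK dp dq.
have [dt|dt] := leP d (tau / (2 * K)); last first.
  apply: le_trans le1 _; apply: (@le_trans _ _ (2 * K * Num.min 1 (d / tau))).
    rewrite -ler_pdivrMl// mulr1 le_min; apply/andP; split.
      by rewrite invf_le1//; clear - K1 hW hK; lra.
    by rewrite ler_pdivlMr// mulrC ltW.
  rewrite ler_wpM2r//; first by rewrite le_min ler01 divr_ge0// ltW.
  by rewrite /F; clear - sB1 f1 f2 hW hK; lra.
have dt1 : d / tau <= 1.
  rewrite ler_pdivrMr// mul1r; apply: le_trans dt _; rewrite ler_pdivrMr// ler_peMr ?(ltW tau0)//.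
  by clear - K1 hW hK; lra.
rewrite (min_r dt1); have dtau0 : 0 <= d / tau by rewrite divr_ge0// ltW.
have cx : cnorm2 (p2c p) = x ^+ 2 by rewrite cnorm2E. have cy : cnorm2 (p2c q) = y ^+ 2 by rewrite cnorm2E.
have ed := enorm_cnorm2 p q; rewrite -/d in ed.
have scale (B : R) : 0 <= B -> Num.sqrt (B * (d / tau) ^+ 2) = Num.sqrt B * (d / tau).
  by move=> b0; rewrite sqrtrM// sqrtr_sqr ger0_norm.
have kwE N (u : R) : \sum_(k < N) kw h u k = rsum c N u by apply: eq_bigr => k _; rewrite mulrC.
have kw0 (u : R) n : 0 <= u -> 0 <= kw h u n.
  by move=> u0; rewrite divr_ge0 ?exprn_ge0// ltW// (mnorm_gt0 hW).
have [/andP[wx wy]|small] := boolP ((w <= x ^+ 2) && (w <= y ^+ 2)).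
  have xs : s <= x by rewrite -(ger0_norm x0) -sqrtr_sqr ler_wsqrtr.
  have ys : s <= y by rewrite -(ger0_norm y0) -sqrtr_sqr ler_wsqrtr.
  have xp : 0 < x by exact: lt_le_trans s0 xs. have yp : 0 < y by exact: lt_le_trans s0 ys.
  have xx1 : x ^+ 2 < 1 by rewrite expr_lt1.
  have yy1 : y ^+ 2 < 1 by rewrite expr_lt1.
  have [_ [nx [npx [_ _ _ mx]]]] := sp _ (introT andP (conj wx xx1)).
  have [_ [ny [npy [_ _ _ my]]]] := sp _ (introT andP (conj wy yy1)).
  have sx : Num.sqrt (x ^+ 2) = x by rewrite sqrtr_sqr ger0_norm.
  have sy : Num.sqrt (y ^+ 2) = y by rewrite sqrtr_sqr ger0_norm.
  rewrite sx in mx; rewrite sy in my.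
  have tq0 : 0 < t y by apply: (t_gt0 hW); rewrite y0.
  have ttq : tau <= 2 * K * t y.
    have g1 := grp p q dp dq; have e : enorm (p - q) = d by rewrite /d !enormE; exact: (cabsB (p2c p) (p2c q)).
    rewrite e -/tau in g1; rewrite ler_pdivlMr// in dt.
    by move: g1; rewrite mulrDr -[radial t q]/(t y) => g1; clear - g1 dt hW hK; lra.
  have md := mm_diff cl1 K1 (introT andP (conj xp x1)) (introT andP (conj yp y1)) (enorm_diff p q) tau0 dt erefl lb gr.
  apply: (@le_trans _ _ (Num.sqrt B1 * (d / tau))); last first.
    by rewrite ler_wpM2r// /F; clear - K0 f1 f2 hW hK; lra.
  rewrite -scale//; apply: (skw_le hW hK dp dq); apply: (gram_limit_le hW hK (N0 := maxn npx npy) dp dq) => // N.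
  rewrite geq_max => /andP[Nx Ny]; rewrite cx cy.
  have up := @gram_upper_sym N (p2c p) (p2c q) s (ltW s0) xs ys.
  rewrite cx cy -ed sw -[cabs (p2c p)]/x -[cabs (p2c q)]/y in up.
  have Gr := gram_ge0 hW N (p2c p) (p2c q); rewrite cx cy in Gr.
  have mo := moment_split N (mm h (x ^+ 2)) (mm h (y ^+ 2)) (fun n => kw0 _ n (sqr_ge0 x)) (fun n => kw0 _ n (sqr_ge0 y)).
  have Mx := mx N Nx; have My := my N Ny; rewrite !kwE in Mx My mo.
  set A := rsum c N (x ^+ 2) in up Gr Mx My mo *; set B := rsum c N (y ^+ 2) in up Gr Mx My mo *.
  have A0 : 0 <= A by apply: (rsum_ge0 hW); exact: sqr_ge0.
  have B0 : 0 <= B by apply: (rsum_ge0 hW); exact: sqr_ge0.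
  have AB0 : 0 <= A * B by rewrite mulr_ge0.
  set Y := cnorm2 (csum _ _ _) in up Gr *.
  set V := (X in _ <= d ^+ 2 * X) in up; set Vx := (X in _ * X <= _) in Mx; set Vy := (X in _ * X <= _) in My.
  set D := mm h (x ^+ 2) - mm h (y ^+ 2) in md mo.
  have {}mo : V <= 3 * (Vx * B + D ^+ 2 * (A * B) + A * Vy) := mo.
  have tau2 : 0 < tau ^+ 2 by rewrite exprn_gt0.
  have v1 : tau ^+ 2 * (Vx * B) <= C * (A * B) by rewrite !mulrA ler_wpM2r.
  have v2 : tau ^+ 2 * (D ^+ 2 * (A * B)) <= (4 * cl * K ^+ 2) ^+ 2 * (A * B).
    rewrite mulrA ler_wpM2r// -(real_normK (num_real D)) -exprMn lerXn2r// nnegrE.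
      by rewrite mulr_ge0// ltW.
    by rewrite mulr_ge0 ?sqr_ge0//; clear - cl1 hW hK; lra.
  have v3 : tau ^+ 2 * (A * Vy) <= C * (2 * K) ^+ 2 * (A * B).
    have Vy0 : 0 <= Vy by apply: sumr_ge0 => m _; rewrite mulr_ge0 ?sqr_ge0// kw0// sqr_ge0.
    have h1 : tau ^+ 2 <= (2 * K) ^+ 2 * t y ^+ 2.
      by rewrite -exprMn lerXn2r// nnegrE ?(ltW tau0)// mulr_ge0 ?(ltW K0)// ltW.
    have h2 := ler_wpM2r (mulr_ge0 A0 Vy0) h1; apply: le_trans h2 _.
    have -> : (2 * K) ^+ 2 * t y ^+ 2 * (A * Vy) = (2 * K) ^+ 2 * A * (t y ^+ 2 * Vy) by ring.
    have -> : C * (2 * K) ^+ 2 * (A * B) = (2 * K) ^+ 2 * A * (C * B) by ring.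
    by rewrite ler_wpM2l// mulr_ge0 ?sqr_ge0.
  have v4 : tau ^+ 2 * V <= B1 / 2 * (A * B).
    apply: le_trans (ler_wpM2l (ltW tau2) mo) _.
    have -> : tau ^+ 2 * (3 * (Vx * B + D ^+ 2 * (A * B) + A * Vy)) =
      3 * (tau ^+ 2 * (Vx * B) + tau ^+ 2 * (D ^+ 2 * (A * B)) + tau ^+ 2 * (A * Vy)) by ring.
    have -> : B1 / 2 * (A * B) = 3 * (C * (A * B) + (4 * cl * K ^+ 2) ^+ 2 * (A * B) + C * (2 * K) ^+ 2 * (A * B)).
      by rewrite /B1; field.
    by rewrite ler_pM2l// !lerD.
  have h5 : w * (A * B - Y) * tau ^+ 2 <= d ^+ 2 * (B1 / 2 * (A * B)).
    apply: le_trans (ler_wpM2r (ltW tau2) up) _.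
    have -> : d ^+ 2 * V * tau ^+ 2 = d ^+ 2 * (tau ^+ 2 * V) by ring.
    by rewrite ler_wpM2l ?sqr_ge0.
  have h6 : (A * B - Y) * tau ^+ 2 / 2 <= w * (A * B - Y) * tau ^+ 2.
    have p0 : 0 <= (A * B - Y) * tau ^+ 2 by rewrite mulr_ge0// ltW.
    have -> : w * (A * B - Y) * tau ^+ 2 = w * ((A * B - Y) * tau ^+ 2) by ring.
    by apply: half_le => //; case/andP: w1.
  have -> : B1 * (d / tau) ^+ 2 * (A * B) = 2 * (d ^+ 2 * (B1 / 2 * (A * B))) / tau ^+ 2.
    by field; rewrite gt_eqF.
  rewrite ler_pdivlMr//; clear - h5 h6 hW hK; lra.
have msmall : (x < s) || (y < s).
  have lt (a : R) : 0 <= a -> ~~ (w <= a ^+ 2) -> a < s.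
    move=> a0; rewrite -ltNge => h1; rewrite ltNge; apply/negP => sa; move: h1; rewrite ltNge -sw.
    by rewrite lerXn2r// nnegrE// ltW.
  by move: small; rewrite negb_and => /orP[/(lt _ x0)->|/(lt _ y0)->]; rewrite ?orbT.
have dTM : d <= TM * (d / tau).
  by rewrite mulrCA ler_peMr// ler_pdivlMr// mul1r tTM.
(* Both points may be majorised by the common radius [rho], where the weights are fixed; the exact
   scale of tau is immaterial because tau is bounded on the disk. *)
have [/andP[xr yr]|big] := boolP ((x <= rho) && (y <= rho)).
  have [_ [nx [npx [_ _ _ mx]]]] := sp _ rho2.
  have sr : Num.sqrt (rho ^+ 2) = rho by rewrite sqrtr_sqr gtr0_norm.
  rewrite sr -/tr in mx.
  apply: (@le_trans _ _ (Num.sqrt B2 * d)); last first.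
    apply: (@le_trans _ _ (Num.sqrt B2 * TM * (d / tau))); first by rewrite -mulrA ler_wpM2l.
    by rewrite ler_wpM2r// /F; clear - K0 sB1 f2 hW hK; lra.
  have -> : Num.sqrt B2 * d = Num.sqrt (B2 * d ^+ 2) by rewrite [RHS]sqrtrM// sqrtr_sqr ger0_norm.
  apply: (skw_le hW hK dp dq); apply: (gram_limit_le hW hK (N0 := maxn npx 1) dp dq) => // N.
  rewrite geq_max => /andP[Nx N1]; rewrite cx cy.
  have c0n n := ltW (kc_gt0 hW n).
  have up := @gram_upper _ c N (p2c p) (p2c q) rho rho c0n xr yr (lexx _); rewrite cx cy -ed in up.
  have Gr := gram_ge0 hW N (p2c p) (p2c q); rewrite cx cy in Gr.
  have kr0 n := kw0 (rho ^+ 2) n (sqr_ge0 rho).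
  have mo := moment_split N (mm h (rho ^+ 2)) (mm h (rho ^+ 2)) kr0 kr0.
  have Mx := mx N Nx; rewrite subrr expr0n/= mul0r addr0 !kwE in Mx mo.
  have EV : \sum_(n < N) \sum_(m < N) c n * c m * (n%:R - m%:R) ^+ 2 * ((rho ^+ 2) ^+ n * (rho ^+ 2) ^+ m) =
      \sum_(n < N) \sum_(m < N) kw h (rho ^+ 2) n * kw h (rho ^+ 2) m * (n%:R - m%:R) ^+ 2.
    by apply: eq_bigr => n _; apply: eq_bigr => m _; rewrite /kw /kc; ring.
  rewrite EV in up.
  set S := rsum c N (rho ^+ 2) in Mx mo *; have SG : S <= G by exact: G0.
  have S0 : 0 <= S by apply: (rsum_ge0 hW); exact: sqr_ge0.
  set A := rsum c N (x ^+ 2) in up Gr *; set B := rsum c N (y ^+ 2) in up Gr *.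
  set Y := cnorm2 (csum _ _ _) in up Gr *.
  set V := \sum_(n < N) \sum_(m < N) _ in up mo; set Vx := \sum_(n < N) kw h (rho ^+ 2) n * _ in Mx mo.
  have low (u : R) : 0 <= u -> c 0 <= rsum c N u.
    move=> u0; apply: le_trans (rsum_mono hW u0 N1); by rewrite /rsum big_ord1 expr0 mulr1.
  have cAB : c 0 ^+ 2 <= A * B by rewrite expr2; apply: ler_pM; rewrite ?(ltW c0p)// low// sqr_ge0.
  have tr2 : 0 < tr ^+ 2 by rewrite exprn_gt0.
  have v4 : tr ^+ 2 * V <= 6 * C * G ^+ 2.
    apply: le_trans (ler_wpM2l (ltW tr2) mo) _.
    have -> : tr ^+ 2 * (3 * (Vx * S + S * Vx)) = 6 * S * (tr ^+ 2 * Vx) by ring.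
    apply: (@le_trans _ _ (6 * S * (C * S))); first by rewrite ler_wpM2l// mulr_ge0.
    have -> : 6 * S * (C * S) = 6 * C * S ^+ 2 by ring.
    by rewrite ler_wpM2l ?mulr_ge0 ?(ltW C0)// lerXn2r// nnegrE// (le_trans S0).
  have h5 : rho ^+ 2 * (A * B - Y) * tr ^+ 2 <= d ^+ 2 * (6 * C * G ^+ 2).
    apply: le_trans (ler_wpM2r (ltW tr2) up) _.
    have -> : d ^+ 2 * V * tr ^+ 2 = d ^+ 2 * (tr ^+ 2 * V) by ring.
    by rewrite ler_wpM2l ?sqr_ge0.
  have h6 : (A * B - Y) * tr ^+ 2 / 2 <= rho ^+ 2 * (A * B - Y) * tr ^+ 2.
    have p0 : 0 <= (A * B - Y) * tr ^+ 2 by rewrite mulr_ge0// ltW.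
    have -> : rho ^+ 2 * (A * B - Y) * tr ^+ 2 = rho ^+ 2 * ((A * B - Y) * tr ^+ 2) by ring.
    by apply: half_le => //; case/andP: rho2 => wr _; apply: le_trans wr; case/andP: w1.
  have c2 : 0 < c 0 ^+ 2 by rewrite exprn_gt0.
  apply: (@le_trans _ _ (B2 * d ^+ 2 * c 0 ^+ 2)); last first.
    by rewrite ler_wpM2l// mulr_ge0// sqr_ge0.
  have -> : B2 * d ^+ 2 * c 0 ^+ 2 = 2 * (d ^+ 2 * (6 * C * G ^+ 2)) / tr ^+ 2.
    by rewrite /B2; field; rewrite !gt_eqF.
  rewrite ler_pdivlMr//; clear - h5 h6 hW hK; lra.
(* One point is within [s] and one beyond [rho], so the distance is at least the gap [rho - s]. *)
have gd : g <= d.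
  have h1 := enorm_diff p q; rewrite -/d -/x -/y ler_distl in h1; case/andP: h1 => h1 h2.
  have : (rho < x) || (rho < y) by move: big; rewrite negb_and -!ltNge.
  case/andP: rh => sr _; rewrite /g; case/orP: msmall => m1 /orP[] m2; clear - h1 h2 m1 m2 sr d0 hW hK; lra.
apply: le_trans le1 _; apply: (@le_trans _ _ (TM / g * (d / tau))).
  by rewrite mulrAC ler_pdivlMr// mul1r; apply: le_trans gd dTM.
by rewrite ler_wpM2r// /F; clear - K0 sB1 f1 hW hK; lra.
Qed.

End Comparison.

(** * Equivalence of the two distances *)

(** Since [expR v >= 1 + v], one has [1 - expR (- v) >= v / (1 + v)]; here [v = k * m <= k]. *)
Lemma one_sub_expRN_ge (R : realType) (k m D : R) : 0 < k -> 0 <= m <= 1 -> k * m <= D ->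
  k / (1 + k) * m <= 1 - expR (- D).
Proof.
move=> k0 /andP[m0 m1] kD; have v0 : 0 <= k * m by rewrite mulr_ge0// ltW.
have h1 : expR (- D) <= (1 + k * m)^-1.
  apply: (@le_trans _ _ (expR (- (k * m)))); first by rewrite ler_expR lerN2.
  by rewrite expRN lef_pV2 ?posrE ?expR_gt0 ?expR_ge1Dx//; lra.
apply: (@le_trans _ _ (1 - (1 + k * m)^-1)); last by lra.
have p1 : 0 < 1 + k * m by lra.
have p2 : 0 < 1 + k by lra.
have -> : 1 - (1 + k * m)^-1 = k * m / (1 + k * m) by field; rewrite gt_eqF.
rewrite mulrAC ler_wpM2l// lef_pV2 ?posrE// lerD2l ler_piMr//; exact: ltW.
Qed.

Theorem theorem2p3 (R : realType) (h t : R -> R)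
  (hW : in_W h t) (Kz : R * R -> R[i] -> R[i])
  (hK : is_reproducing_kernel h Kz) :
  exists C : R, 1 <= C /\
    forall z w : R * R, disk z -> disk w ->
      C^-1 * rho_tau t z w <= skw_dist h Kz z w /\
      skw_dist h Kz z w <= C * rho_tau t z w.
Proof.
have [k1 k10 slo] := skw_lower hW hK; have [C1 C11 sup] := skw_upper hW hK.
have [k2 k20 dlo] := d_tau_lower hW; have [C2 C21 dup] := d_tau_upper hW.
pose k3 := k2 / (1 + k2); have k30 : 0 < k3 by rewrite divr_gt0//; lra.
have q1 : 0 <= C2 / k1 by rewrite divr_ge0 ?(ltW k10)//; lra.
have q2 : 0 <= C1 / k3 by rewrite divr_ge0 ?(ltW k30)//; lra.
pose C := 1 + C2 / k1 + C1 / k3; have C0 : 1 <= C by rewrite /C; lra.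
exists C; split=> // z w dz dw.
set m := Num.min 1 (enorm (w - z) / radial t z); have tz := radial_t_gt0 hW dz.
have n0 : 0 <= enorm (w - z) by exact: sqrtr_ge0.
have m0 : 0 <= m by rewrite le_min ler01 divr_ge0// ltW.
have m1 : m <= 1 by rewrite ge_min lexx.
have rlo : k3 * m <= rho_tau t z w.
  by apply: one_sub_expRN_ge => //; [rewrite m0|exact: dlo].
have C20 : 0 < C2 by lra.
have rup : rho_tau t z w <= C2 * m.
  have [dt|dt] := leP (enorm (w - z)) (radial t z / C2).
    have d1 : enorm (w - z) / radial t z <= 1.
      rewrite ler_pdivrMr// mul1r; apply: le_trans dt _.
      by rewrite ler_pdivrMr// ler_peMr// ltW.
    have -> : m = enorm (w - z) / radial t z by exact: min_r.
    apply: le_trans (dup z w dz dw dt); rewrite /rho_tau.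
    by have := expR_ge1Dx (- d_tau t z w); lra.
  (* Beyond [tau / C2] the trivial bound [rho_tau <= 1] is enough, because then [C2 * m >= 1]. *)
  apply: (@le_trans _ _ 1); first by rewrite /rho_tau; have := expR_ge0 (- d_tau t z w); lra.
  rewrite -ler_pdivrMl// mulr1 le_min invf_le1// C21/=.
  by rewrite ler_pdivlMr// mulrC ltW.
have s1 := slo z w dz dw; have s2 := sup z w dz dw; rewrite -/m in s1 s2.
have Cp : 0 < C by lra.
split.
  rewrite mulrC ler_pdivrMr//; apply: le_trans rup _.
  apply: (@le_trans _ _ (skw_dist h Kz z w * (C2 / k1))).
    rewrite mulrA ler_pdivlMr//; have -> : C2 * m * k1 = k1 * m * C2 by ring.
    by rewrite ler_pM2r.
  rewrite ler_wpM2l ?sqrtr_ge0// /C; lra.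
apply: le_trans s2 _; apply: (@le_trans _ _ (C1 / k3 * rho_tau t z w)).
  by rewrite mulrAC -mulrA ler_wpM2l//; [lra|rewrite ler_pdivlMr// mulrC].
by rewrite ler_wpM2r//; [apply: le_trans rlo; rewrite mulr_ge0// ltW|rewrite /C; lra].
Qed.
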